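(* Let $f:S\to S$ be a generalized pseudo-Anosov homeomorphism and let $n\ge n(f)$. Then there exists a finite but nonempty set of orbits (under $f$) of primitive Markov partitions of $f$ of order $n$.
   Context: **Pseudo-Anosov maps.** A surface $S$ is a smooth closed oriented 2-manifold. A generalized pseudo-Anosov homeomorphism $f:S\to S$ is an orientation-preserving homeomorphism for which there are $\lambda>1$ and two $f$-invariant transverse measured singular foliations $(\mathcal{F}^s,\mu^s)$ (stable) and $(\mathcal{F}^u,\mu^u)$ (unstable), possibly with 1-prong singularities (spines), with $f_*\mu^s=\lambda\mu^s$, $f_*\mu^u=\lambda^{-1}\mu^u$; the convention is that $f$ stretches unstable arcs (measured by $\mu^s$) by $\lambda$ and contracts stable arcs (measured by $\mu^u$) by $\lambda^{-1}$. $\mathbf{Sing}(f)$ is the set of singularities of the foliations; if there are none (torus case), $\mathbf{Sing}(f)$ denotes a fixed nonempty finite $f$-invariant family of periodic points. $\mathcal{F}^{s}(p),\mathcal{F}^u(p)$ (also $F^s_p$, $F^u_p$) are the leaves through $p$ (for a singularity, including all its prongs); $\mathcal{F}^{s,u}(\mathbf{Sing}(f))$ is the union of these over $p\in\mathbf{Sing}(f)$. A stable (unstable) separatrix $F^s(p)$ ($F^u(p)$) of $p\in\mathbf{Sing}(f)$ is a connected component of $\mathcal{F}^s(p)\setminus\{p\}$ ($\mathcal{F}^u(p)\setminus\{p\}$); for $x$ on it, $[p,x]^s$ ($[p,x]^u$) is the arc from $p$ to $x$ in the leaf. A stable (unstable) interval is an arc in a stable (unstable) leaf. **First intersection points.**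 A point $x\notin\mathbf{Sing}(f)$ is a first intersection point of $f$ if there are $p,q\in\mathbf{Sing}(f)$, a stable separatrix $F^s(p)$ and an unstable separatrix $F^u(q)$ with $x\in F^s(p)\cap F^u(q)$ and $(p,x]^s\cap(q,x]^u=\{x\}$. **Rectangles.** For an open connected nonempty $r\subset S$ and $x\in r$, let $I_x$ (resp. $J_x$) be the closure of the connected component of $F^s_x\cap r$ (resp. $F^u_x\cap r$) containing $x$. The set $r$ is trivially bi-foliated if for all $x,y\in r$, $I_x$ and $J_y$ are homeomorphic to closed intervals and $I_x\cap J_y$ is a single point, lying in $r$. A rectangle $R$ is the closure of a trivially bi-foliated set. A parametrization of $R$ is a continuous map $\rho:[0,1]^2\to S$ with image $R$, restricting to an orientation-preserving homeomorphism from $(0,1)^2$ onto the interior $\overset{o}{R}:=\rho((0,1)^2)$, mapping each horizontal (vertical) segment homeomorphically onto an arc of a single stable (unstable) leaf, called a horizontal (vertical) leaf of $R$. $\partial^sR=\rho([0,1]\times\{0,1\})$, $\partial^uR=\rho(\{0,1\}\times[0,1])$; the two arcs of $\partial^uR$ are the $u$-boundary components. $R$ is embedded if $\rho$ is a homeomorphism onto its image. **Adapted graphs.** An $s$-graph adapted to $f$ is a finite family $\delta^s=\{I_i\}$ of nondegenerate compact stable intervals such that, with $\cup\delta^s:=\bigcup_iI_i$: $f(\cup\delta^s)\subset\cup\delta^s$; each $I_i$ lies in $\mathcal{F}^s(p)$ for some $p\in\mathbf{Sing}(f)$; for every $p\in\mathbf{Sing}(f)$ and every stable separatrix of $p$ some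 $I_i$ lies in that separatrix (together with $p$) and has $p$ as an endpoint; endpoints of each $I_i$ lie in $\mathcal{F}^u(\mathbf{Sing}(f))$. A $u$-graph adapted to $f$ is defined exchanging $s,u$ and $f,f^{-1}$. **Rails and compatibility.** The regular part $\overset{o}{\delta^s}$ is $\cup\delta^s$ minus all endpoints of its intervals. A regular $u$-rail of $\delta^s$ is an unstable interval with interior disjoint from $\cup\delta^s$ and endpoints in $\overset{o}{\delta^s}$. An extreme $u$-rail of $\delta^s$ is an unstable segment $J$ with at least one endpoint not in $\overset{o}{\delta^s}$ for which there is an embedded rectangle $R$ with $\partial^sR\subset\cup\delta^s$, $J$ a $u$-boundary component of $R$, and every other vertical leaf of $R$ a regular $u$-rail. $s$-rails of $\delta^u$ are defined by exchanging $s$ and $u$. $\delta^s$ and $\delta^u$ are compatible if endpoints of intervals of $\delta^s$ lie in $\cup\delta^u$, endpoints of intervals of $\delta^u$ lie in $\cup\delta^s$, extreme $u$-rails of $\delta^s$ are contained in $\cup\delta^u$, and extreme $s$-rails of $\delta^u$ are contained in $\cup\delta^s$. **Primitive partitions.** Let $z\in F^s(p)\cap F^u(q)$ be a first intersection point. Put $J^u(z)=[q,z]^u$ and $\mathcal{J}^u(z)=\bigcup_{i\ge0}f^{-i}(J^u(z))$, a finite union of compact arcs, $f^{-1}$-invariant. Let $\delta^s(z)$ be the family of all stable segments with one endpoint in $\mathbf{Sing}(f)$, the other in $\mathcal{J}^u(z)$, and interior disjoint from $\mathcal{J}^u(z)$; it is an $s$-graph adapted to $f$. Let $\delta^u(z)$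 be the family of all unstable segments with one endpoint in $\mathbf{Sing}(f)$, the other in $\cup\delta^s(z)$, and interior disjoint from $\cup\delta^s(z)$; it is a $u$-graph adapted to $f$. The compatibility coefficient $n(z)$ is the least natural number such that $\delta^s(z)$ and $f^n(\delta^u(z))$ are compatible for all $n\ge n(z)$. For $n\ge n(z)$, the primitive Markov partition $\mathcal{R}(z,n)$ generated by $z$ of order $n$ is the family of closures of the connected components of $S\setminus(\cup\delta^s(z)\cup\bigcup f^n(\delta^u(z)))$; it is a Markov partition for $f$. The compatibility order is $n(f)=\max\{n(z):z\text{ a first intersection point of }f\}$ (the maximum exists). For $n\ge n(f)$, the set of primitive Markov partitions of $f$ of order $n$ is $\mathcal{M}(f,n)=\{\mathcal{R}(z,n):z\text{ a first intersection point of }f\}$. The orbit of $\mathcal{R}\in\mathcal{M}(f,n)$ is $\{f^m(\mathcal{R})\}_{m\in\mathbb{Z}}$ where $f^m(\mathcal{R})=\{f^m(R):R\in\mathcal{R}\}$ (for $\mathcal{R}=\mathcal{R}(z,n)$ one has $f^m(\mathcal{R}(z,n))=\mathcal{R}(f^m(z),n)$). *)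

(* Defs.v *)
(* R : realType is the real line and R * R the plane. *)
From HB Require Import structures.
From mathcomp Require Import all_boot all_order all_algebra.
From mathcomp Require Import complex.
From mathcomp Require Import all_classical all_reals all_analysis.

Set Implicit Arguments.
Unset Strict Implicit.
Unset Printing Implicit Defensive.

Import Order.TTheory GRing.Theory Num.Theory.
Import numFieldNormedType.Exports.

Local Open Scope classical_set_scope.
Local Open Scope ring_scope.

Definition uitv (R : realType) : set R := `[0, 1].
Arguments uitv R : clear implicits.
Definition usquare (R : realType) : set (R * R) := uitv R `*` uitv R.
Definition osquare (R : realType) : set (R * R) := `]0, 1[ `*` `]0, 1[.
Arguments usquare R : clear implicits.
Arguments osquare R : clear implicits.

Section Topology.
Context {R : realType}.
Implicit Types T U : topologicalType.

Definition homeomorphism T (f : T -> T) : Prop :=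
  exists g : T -> T,
    [/\ continuous f, continuous g, cancel f g & cancel g f].

(* f restricts to a homeomorphism from A onto f @` A *)
Definition embeds T U (A : set T) (f : T -> U) : Prop :=
  exists g : U -> T,
    [/\ {within A, continuous f}, {within f @` A, continuous g} &
        forall x, A x -> g (f x) = x].

(* A is an arc (a homeomorphic image of [0, 1]) with endpoints a and b *)
Definition is_arc T (A : set T) (a b : T) : Prop :=
  exists g : R -> T,
    [/\ embeds (uitv R) g, g 0 = a, g 1 = b & A = g @` uitv R].

Definition arc_ends T (A : set T) : set T := [set a | exists b, is_arc A a b].

Definition path_component T (A : set T) (x : T) : set T :=
  [set y | exists g : R -> T,
    [/\ {within uitv R, continuous g}, g 0 = x, g 1 = y &
        g @` uitv R `<=` A]].

End Topology.

Section Plane.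
Context {R : realType}.

Fixpoint classC (k : nat) (U : set (R * R)) (g : R * R -> R) : Prop :=
  {in U, continuous g} /\
  if k is k'.+1 then
    [/\ forall a, U a ->
          derivable g a ((1, 0) : R * R) /\ derivable g a ((0, 1) : R * R),
        classC k' U ('D_((1, 0) : R * R) g) &
        classC k' U ('D_((0, 1) : R * R) g)]
  else True.

Definition smooth (U : set (R * R)) (h : R * R -> R * R) : Prop :=
  forall k, classC k U (fun a => (h a).1) /\ classC k U (fun a => (h a).2).

Definition jacobian_det (h : R * R -> R * R) (a : R * R) : R :=
  'D_((1, 0) : R * R) (fun b => (h b).1) a *
    'D_((0, 1) : R * R) (fun b => (h b).2) a -
  'D_((0, 1) : R * R) (fun b => (h b).1) a *
    'D_((1, 0) : R * R) (fun b => (h b).2) a.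

(* g : [0, 1] -> R * R is a loop with winding number 1 around the origin:
   theta is a continuous determination of its argument. *)
Definition winds_once (g : R -> R * R) : Prop :=
  exists theta : R -> R,
    [/\ {within uitv R, continuous theta},
        forall t, uitv R t ->
          exists2 r, 0 < r & g t = (r * cos (theta t), r * sin (theta t)) &
        theta 1 - theta 0 = 2 * pi].

(* h has local degree 1 at a; for a homeomorphism between planar domains, not
   assumed differentiable, this is what preserving the orientation means. *)
Definition sense_preserving_at (h : R * R -> R * R) (a : R * R) : Prop :=
  exists2 r0, 0 < r0 &
    forall r, 0 < r < r0 ->
      winds_once (fun t : R =>
        h (a.1 + r * cos (2 * pi * t), a.2 + r * sin (2 * pi * t)) - h a).

Definition disc : set (R * R) := [set z | z.1 ^+ 2 + z.2 ^+ 2 < 1].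

Definition modulus (z : R * R) : R := Num.sqrt (z.1 ^+ 2 + z.2 ^+ 2).

Definition repow (k : nat) (z : R * R) : R :=
  complex.Re ((z.1 +i* z.2)%C ^+ k).

(* Away from 0 let w = z ^ (k / 2), defined up to sign.  Then hlevel k z is
   2 (Im w) ^ 2 and vlevel k z is 2 (Re w) ^ 2: the components of their level
   sets in the disc are the plaques of the horizontal and of the vertical
   foliation with one k-prong singularity at 0.  For k = 2 these are the
   horizontal and the vertical chords. *)
Definition hlevel (k : nat) (z : R * R) : R := modulus z ^+ k - repow k z.
Definition vlevel (k : nat) (z : R * R) : R := modulus z ^+ k + repow k z.

Definition model_plaque (lev : R * R -> R) (z : R * R) : set (R * R) :=
  path_component (R := R) (disc `&` [set w | lev w = lev z]) z.

End Plane.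

Section Surfaces.
Variable R : realType.

Record chart (T : topologicalType) := Chart {
  cdom : set T;
  cmap : T -> R * R;
  cinv : R * R -> T;
  cdom_open : open cdom;
  cimg_open : open (cmap @` cdom);
  cmap_cont : {within cdom, continuous cmap};
  cinv_cont : {within cmap @` cdom, continuous cinv};
  cmapK : forall x, cdom x -> cinv (cmap x) = x }.

(* A smooth closed oriented surface.  Second countability is implied by
   compactness and the existence of charts. *)
Record surface := Surface {
  carrier :> topologicalType;
  atlas : set (chart carrier);
  surf_hausdorff : hausdorff_space carrier;
  surf_compact : compact [set: carrier];
  atlas_cover : forall x : carrier, exists2 c, atlas c & cdom c x;
  atlas_smooth : forall c d, atlas c -> atlas d ->
    smooth (cmap c @` (cdom c `&` cdom d)) (cmap d \o cinv c);
  atlas_oriented : forall c d x, atlas c -> atlas d -> cdom c x -> cdom d x ->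
    0 < jacobian_det (cmap d \o cinv c) (cmap c x) }.

Variable S : surface.

Definition orientation_preserving (f : S -> S) : Prop :=
  forall c d x, atlas c -> atlas d -> cdom c x -> cdom d (f x) ->
    sense_preserving_at (cmap d \o f \o cinv c) (cmap c x).

(* c is a chart onto the unit disc, centred at x, sending the plaques of the
   partition leaf to the components of the level sets of lev.  Connected
   components of subsets of a leaf are taken in the topology of the leaf, that
   is, as path components: separatrices are dense, so that a leaf minus a
   singularity is connected for the topology induced by S. *)
Definition foliated_chart (leaf : S -> set S) (lev : R * R -> R)
    (c : chart S) (x : S) : Prop :=
  [/\ cdom c x, cmap c x = 0, cmap c @` cdom c = disc &
      forall y, cdom c y ->
        cmap c @` path_component (R := R) (leaf y `&` cdom c) y =
        model_plaque lev (cmap c y)].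

(* A singular foliation: a partition into path-connected leaves which near x
   is the k-prong model, k = prongs x.  The number k is determined by the
   leaves; 1-prongs are allowed.  The leaf through a singularity contains all
   of its prongs.  Singularities are isolated, hence finite in number. *)
Record foliation := Foliation {
  leaf : S -> set S;
  prongs : S -> nat;
  leaf_refl : forall x, leaf x x;
  leaf_eq : forall x y, leaf x y -> leaf y = leaf x;
  leaf_connected : forall x, leaf x `<=` path_component (R := R) (leaf x) x;
  prongs_gt0 : forall x, (0 < prongs x)%N;
  leaf_chart : forall x, exists c,
    foliated_chart leaf (hlevel (prongs x)) c x }.

Definition singular (F : foliation) : set S := [set x | prongs F x <> 2%N].

(* g parametrizes an arc transverse to F: near every parameter t the vertical
   coordinate of g in a regular chart, constant along plaques, is injective
   (equivalently strictly monotone). *)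
Definition transverse_arc (F : foliation) (g : R -> S) : Prop :=
  embeds (uitv R) g /\
  forall t, uitv R t ->
    exists2 c, foliated_chart (leaf F) (hlevel 2) c (g t) &
    exists2 e, 0 < e &
      (forall s, uitv R s -> `|s - t| < e -> cdom c (g s)) /\
      (forall s s', uitv R s -> uitv R s' -> `|s - t| < e -> `|s' - t| < e ->
        (cmap c (g s)).2 = (cmap c (g s')).2 -> s = s').

(* Borel subsets of transverse arcs *)
Definition transverse_set (F : foliation) (A : set S) : Prop :=
  exists g (B : set (measurableTypeR R)),
    [/\ transverse_arc F g, measurable B, B `<=` uitv R & A = g @` B].

(* mu induces on every transverse arc a finite Borel measure without atoms and
   of full support, invariant under homotopy along the leaves. *)
Record measured_foliation := MeasuredFoliation {
  mfol :> foliation;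
  mu : set S -> \bar R;
  mu_measure : forall g, transverse_arc mfol g ->
    exists m : {measure set (measurableTypeR R) -> \bar R},
      [/\ forall B, measurable B -> B `<=` uitv R -> mu (g @` B) = m B,
          (m (uitv R) < +oo)%E,
          forall t : R, uitv R t -> m [set t] = 0%E &
          forall a b : R, 0 <= a -> a < b -> b <= 1 ->
            (0 < m `]a, b[%classic)%E];
  mu_holonomy : forall H : R * R -> S,
    {within usquare R, continuous H} ->
    (forall s, uitv R s -> transverse_arc mfol (fun t => H (s, t))) ->
    (forall s t, uitv R s -> uitv R t -> leaf mfol (H (0, t)) (H (s, t))) ->
    mu ((fun t => H (0, t)) @` uitv R) = mu ((fun t => H (1, t)) @` uitv R) }.

(* Same singularities, and common charts in which F is horizontal and G is
   vertical; the vertical k-prong model is the horizontal one rotated by the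
   angle pi / k. *)
Definition transverse (F G : foliation) : Prop :=
  forall x, prongs F x = prongs G x /\
    exists2 c, foliated_chart (leaf F) (hlevel (prongs F x)) c x &
               foliated_chart (leaf G) (vlevel (prongs G x)) c x.

(* Generalized pseudo-Anosov structure of f.  The map stretches unstable arcs,
   measured by the transverse measure of the stable foliation, by the factor
   dilatation.  The set Sing is the set of singularities or, if there are none,
   a chosen family of periodic points. *)
Record pseudo_anosov (f : S -> S) := PseudoAnosov {
  dilatation : R;
  stab : measured_foliation;
  unst : measured_foliation;
  Sing : set S;
  pa_homeo : homeomorphism f;
  pa_orientation : orientation_preserving f;
  pa_dilatation : 1 < dilatation;
  pa_transverse : transverse stab unst;
  pa_stab_invariant : forall x, f @` leaf stab x = leaf stab (f x);
  pa_unst_invariant : forall x, f @` leaf unst x = leaf unst (f x);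
  pa_stab_scaling : forall A, transverse_set stab A ->
    mu stab (f @` A) = (dilatation%:E * mu stab A)%E;
  pa_unst_scaling : forall A, transverse_set unst A ->
    mu unst (f @` A) = (dilatation^-1%:E * mu unst A)%E;
  pa_Sing : singular stab `|` singular unst !=set0 ->
    Sing = singular stab `|` singular unst;
  pa_Sing_marked : singular stab `|` singular unst = set0 ->
    [/\ finite_set Sing, Sing !=set0, f @` Sing = Sing &
        forall p, Sing p -> exists2 m, (0 < m)%N & iter m f p = p] }.

Definition interval_of (F : foliation) (J : set S) (a b : S) : Prop :=
  is_arc (R := R) J a b /\ exists x, J `<=` leaf F x.

(* The arc from p to x in the leaf of p.  It is written as the union of all
   such arcs; there is at most one, as leaves of pseudo-Anosov foliations
   contain no closed curve. *)
Definition seg (F : foliation) (p x : S) : set S :=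
  \bigcup_(J in [set J | is_arc (R := R) J p x /\ J `<=` leaf F p]) J.

Definition separatrix (F : foliation) (p : S) (L : set S) : Prop :=
  exists2 y, (leaf F p `\ p) y & L = path_component (R := R) (leaf F p `\ p) y.

Definition regular_part (d : set (set S)) : set S :=
  \bigcup_(I in d) I `\` \bigcup_(I in d) arc_ends (R := R) I.

Definition regular_rail (F : foliation) (d : set (set S)) (J : set S) : Prop :=
  exists a b,
    [/\ interval_of F J a b, regular_part d a, regular_part d b &
        (J `\` [set a; b]) `&` \bigcup_(I in d) I = set0].

(* The roles of the sides of a rectangle in the definition of extreme u-rails
   and s-rails: across i (i in [0, 1]) are the leaves parallel to the rail and
   along 0, along 1 are the two sides that must lie on the graph. *)
Definition extreme_position (F : foliation) (d : set (set S)) (J : set S)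
    (across along : R -> set S) : Prop :=
  along 0 `|` along 1 `<=` \bigcup_(I in d) I /\
  exists i : R,
    [/\ i = 0 \/ i = 1, J = across i &
        forall t, uitv R t -> t <> i -> regular_rail F d (across t)].

Definition singular_end (F : foliation) (d : set (set S)) (J : set S) : Prop :=
  exists a b, interval_of F J a b /\ ~ (regular_part d a /\ regular_part d b).

Definition hleaf (rho : R * R -> S) (t : R) : set S :=
  (fun s => rho (s, t)) @` uitv R.
Definition vleaf (rho : R * R -> S) (s : R) : set S :=
  (fun t => rho (s, t)) @` uitv R.

Section PseudoAnosov.
Variables (f : S -> S) (P : pseudo_anosov f).
Notation Fs := (stab P).
Notation Fu := (unst P).

Definition first_intersection (x : S) : Prop :=
  ~ Sing P x /\
  exists p q L M,
    [/\ Sing P p /\ Sing P q, separatrix Fs p L, separatrix Fu q M,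
        L x /\ M x &
        (seg Fs p x `\ p) `&` (seg Fu q x `\ q) = [set x]].

Definition rect_I (r : set S) (x : S) : set S :=
  closure (path_component (R := R) (leaf Fs x `&` r) x).
Definition rect_J (r : set S) (x : S) : set S :=
  closure (path_component (R := R) (leaf Fu x `&` r) x).

Definition trivially_bifoliated (r : set S) : Prop :=
  [/\ open r, connected r & r !=set0] /\
  forall x y, r x -> r y ->
    [/\ exists a b, is_arc (R := R) (rect_I r x) a b,
        exists a b, is_arc (R := R) (rect_J r y) a b &
        exists2 z, r z & rect_I r x `&` rect_J r y = [set z]].

Definition rectangle (X : set S) : Prop :=
  exists2 r, trivially_bifoliated r & X = closure r.

Definition parametrizes (rho : R * R -> S) (X : set S) : Prop :=
  [/\ {within usquare R, continuous rho},
      rho @` usquare R = X,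
      embeds (osquare R) rho /\
      (forall a c, osquare R a -> atlas c -> cdom c (rho a) ->
        sense_preserving_at (cmap c \o rho) a),
      (forall t, uitv R t ->
        embeds (uitv R) (fun s : R => rho (s, t)) /\
        exists x, hleaf rho t `<=` leaf Fs x) &
      (forall s, uitv R s ->
        embeds (uitv R) (fun t : R => rho (s, t)) /\
        exists x, vleaf rho s `<=` leaf Fu x)].

Definition embedded_rectangle (rho : R * R -> S) (X : set S) : Prop :=
  [/\ rectangle X, parametrizes rho X & embeds (usquare R) rho].

Definition extreme_urail (d : set (set S)) (J : set S) : Prop :=
  singular_end Fu d J /\
  exists rho X, embedded_rectangle rho X /\
    extreme_position Fu d J (vleaf rho) (hleaf rho).

Definition extreme_srail (d : set (set S)) (J : set S) : Prop :=
  singular_end Fs d J /\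
  exists rho X, embedded_rectangle rho X /\
    extreme_position Fs d J (hleaf rho) (vleaf rho).

Definition compatible (ds du : set (set S)) : Prop :=
  [/\ forall I, ds I -> arc_ends (R := R) I `<=` \bigcup_(J in du) J,
      forall J, du J -> arc_ends (R := R) J `<=` \bigcup_(I in ds) I,
      forall J, extreme_urail ds J -> J `<=` \bigcup_(J' in du) J' &
      forall I, extreme_srail du I -> I `<=` \bigcup_(I' in ds) I'].

(* the arcs in leaves of F issued from Sing and stopped at X *)
Definition stopped_segments (F : foliation) (X : set S) : set (set S) :=
  [set A | exists p y,
    [/\ Sing P p, X y, is_arc (R := R) A p y, A `<=` leaf F p &
        (A `\` [set p; y]) `&` X = set0]].

(* For a first intersection point z there is only one q in Sing whose unstable
   leaf contains z, so that the first union is [q, z]^u. *)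
Definition Ju (z : S) : set S := \bigcup_(q in Sing P) seg Fu q z.

Definition calJu (z : S) : set S := \bigcup_(i : nat) (iter i f @^-1` Ju z).

Definition delta_s (z : S) : set (set S) := stopped_segments Fs (calJu z).

Definition delta_u (z : S) : set (set S) :=
  stopped_segments Fu (\bigcup_(I in delta_s z) I).

Definition iterate_image (n : nat) (d : set (set S)) : set (set S) :=
  [set iter n f @` J | J in d].

Definition is_least (Q : set nat) (k : nat) : Prop :=
  Q k /\ forall m, Q m -> (k <= m)%N.
Definition is_greatest (Q : set nat) (k : nat) : Prop :=
  Q k /\ forall m, Q m -> (m <= k)%N.

(* xget 0 Q is the element of Q when Q is a singleton, and 0 when Q is empty;
   the minimum and the maximum below do exist. *)
Definition compat_coeff (z : S) : nat :=
  xget 0%N (is_least [set k | forall n, (k <= n)%N ->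
                      compatible (delta_s z) (iterate_image n (delta_u z))]).

Definition compat_order : nat :=
  xget 0%N (is_greatest [set compat_coeff z | z in first_intersection]).

Definition primitive_partition (z : S) (n : nat) : set (set S) :=
  let A := ~` (\bigcup_(I in delta_s z) I `|`
               \bigcup_(J in iterate_image n (delta_u z)) J) in
  [set closure (connected_component A x) | x in A].

Definition primitive_partitions (n : nat) : set (set (set S)) :=
  [set primitive_partition z n | z in first_intersection].

End PseudoAnosov.

(* f^m(X); for m < 0 it is the preimage of X under f^|m|. *)
Definition image_iter (f : S -> S) (m : int) (X : set S) : set S :=
  match m with
  | Posz k => iter k f @` X
  | Negz k => iter k.+1 f @^-1` X
  end.

Definition partition_orbit (f : S -> S) (Q : set (set S)) : set (set (set S)) :=
  [set [set image_iter f m X | X in Q] | m in [set: int]].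

End Surfaces.

(* Main.v *)
(* Parametrize the separatrices of f by transverse measure.  A separatrix of finite
   length would end at a singularity, but f multiplies its length by a constant
   k < 1 and there are finitely many separatrices, so all of them are infinite rays.
   Such a ray accumulates somewhere, hence crosses a small box twice.  Slide the
   vertical segment between the two crossings horizontally, the first crossing moving
   back along the ray.  It reaches the origin of the ray in finite time, so there is a
   first time when the segment meets a singularity q'; its other end, which is on the
   ray at every time, is then in the vertical leaf of q'.
   So a stable and an unstable separatrix g, h meet, and a meeting
   point which is minimal in both parameters is a first intersection point.
   Some power of f preserves both g and h and acts on the parameters by
   (t, r) |-> (K t, r / K).  Fix an intersection (t0, r0).  Up to this action a
   first intersection point has K t0 < t <= t0, and then the intersection
   (K t0, r0 / K) forces r < r0 / K; compact arcs of transverse leaves meet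
   finitely often, so there are finitely many orbits of first intersection points.
   Since z determines the partition equivariantly, the corollary follows. *)

Require Import Defs.
From HB Require Import structures.
From mathcomp Require Import all_boot all_order all_algebra.
From mathcomp Require Import complex.
From mathcomp Require Import all_classical all_reals all_analysis.
From mathcomp Require Import ring lra.

Set Implicit Arguments.
Unset Strict Implicit.
Unset Printing Implicit Defensive.

Import Order.TTheory GRing.Theory Num.Theory.
Import numFieldNormedType.Exports.

Local Open Scope classical_set_scope.
Local Open Scope ring_scope.

(* [lra] slows down with each hypothesis of the context, used or not, so it is tried
   first on the hypotheses sharing a variable with the goal.  It fails when the context
   is shorter than the list of the section variables, hence the padding by [tt]. *)
Ltac related H :=
  match goal with x : ?X |- ?G =>
    lazymatch X with realType => fail | surface _ => fail | _ => idtac end;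
    lazymatch G with context [x] => idtac end;
    lazymatch type of H with context [x] => idtac end
  end.

Ltac keep_for_lra H :=
  lazymatch type of H with
  | is_true _ => idtac
  | @eq (Topological.sort _) _ _ => fail
  | _ = _ => idtac
  | _ /\ _ => idtac
  | _ \/ _ => idtac
  end.

Ltac clear_unless keep :=
  repeat match goal with H : ?T |- _ =>
    lazymatch type of T with Prop => idtac end;
    tryif keep H then fail else clear H
  end.

Ltac clra :=
  do 20 pose proof tt; clear_unless keep_for_lra;
  lazymatch goal with
  | |- is_true (?x <= ?x) => exact: lexx
  | |- False => lra
  | _ => first [solve [clear_unless related; lra] | lra]
  end.

(** * Continuity along sets and path components *)

(** Everything is proved for a pair of transverse foliations [F] and [G], of which only [G] has to
    be measured, and is applied twice: to ([stab], [unst]) with [f], and to ([unst], [stab]) with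
    the inverse of [f]. In both cases the map contracts the [G]-measure of arcs of [F] by the
    inverse of the dilatation. The measure is what makes leaves tractable: two boxes whose
    horizontal coordinate is [G]-measure differ by (u, v) -> (c + u, eta v) or (c - u, eta v), so
    unit speed paths continue uniquely, coincide up to direction as soon as they meet, and move in
    parallel. Leaves are given as bare sets and may cross a chart along many plaques, so local
    statements are about paths. A singularity is surrounded by half-boxes, one for each prong; for a
    single prong the two halves of the bottom edge of the half-box are the same arc. The delicate
    moment is the one when the sliding segment touches a singularity: nearby lines then enter
    different sectors, and all of them must be shown to be in the vertical leaf of the singularity
    at that same moment. *)

Section Con.
Context {R : realType} {T : topologicalType}.
Implicit Types (I J : set R) (f g : R -> T) (t : R).

(** Continuity at [t] along [I], with explicit radii: the ends of an interval need no subspace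
    topology, and [I] can be shrunk by inclusion. *)
Definition con I f t := forall U, nbhs (f t) U ->
  exists2 d : R, 0 < d & forall s, I s -> `|s - t| < d -> U (f s).

Lemma con_within I f :
  {within I, continuous f} <-> forall t, I t -> con I f t.
Proof.
split.
  move=> /subspace_continuousP cf t It U nU.
  have := cf t It U nU.
  rewrite /nbhs /= /within /= => /nbhs_ballP[d /= d0 Hd].
  exists d => // s Is sd; apply: (Hd s) => //.
  by rewrite /ball /= distrC.
move=> cf; apply/subspace_continuousP => t It U nU.
have [d d0 Hd] := cf t It U nU.
apply/nbhs_ballP; exists d => //= s; rewrite /ball /= distrC => sd Is.
exact: Hd.
Qed.

Lemma con_for I f t : {for t, continuous f} -> con I f t.
Proof.
move=> cf U nU; have := cf U nU => /nbhs_ballP[d /= d0 Hd].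
exists d => // s _ sd; apply: (Hd s); by rewrite /ball /= distrC.
Qed.

Lemma for_con I f t (e : R) : 0 < e -> (forall s, `|s - t| < e -> I s) -> con I f t ->
  {for t, continuous f}.
Proof.
move=> e0 He cf U nU; have [d d0 Hd] := cf U nU.
apply/nbhs_ballP; exists (Num.min d e) => /=; first by rewrite lt_min d0.
move=> s; rewrite /ball /= distrC lt_min => /andP[sd se].
by apply: Hd => //; apply: He.
Qed.

Lemma con_sub I J f t : J `<=` I -> con I f t -> con J f t.
Proof.
move=> JI cf U nU; have [d d0 Hd] := cf U nU; exists d => // s Js.
by apply: Hd; apply: JI.
Qed.

Lemma con_eq I f g t (e : R) : 0 < e -> I t ->
  (forall s, I s -> `|s - t| < e -> f s = g s) -> con I f t -> con I g t.
Proof.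
move=> e0 It fg cf U.
rewrite -fg ?subrr ?normr0// => nU; have [d d0 Hd] := cf U nU.
exists (Num.min d e); first by rewrite lt_min d0.
move=> s Is; rewrite lt_min => /andP[sd se]; rewrite -fg//; exact: Hd.
Qed.

Lemma con_uniq I f g t : hausdorff_space T -> con I f t -> con I g t ->
  (forall d, 0 < d -> exists2 s, I s & `|s - t| < d /\ f s = g s) -> f t = g t.
Proof.
move=> hT cf cg H; apply: hT => A B /cf[d1 d10 H1] /cg[d2 d20 H2].
have [|s Is [sd fgs]] := H (Num.min d1 d2); first by rewrite lt_min d10.
move: sd; rewrite lt_min => /andP[s1 s2].
by exists (f s); split; [exact: H1|rewrite fgs; exact: H2].
Qed.

End Con.

Lemma con_comp {R : realType} (T U : topologicalType) (I : set R) (f : R -> T)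
    (h : T -> U) t :
  con I f t -> {for f t, continuous h} -> con I (h \o f) t.
Proof. by move=> cf cg V nV; apply: (cf (h @^-1` V)); exact: cg. Qed.

Section ConReal.
Context {R : realType}.

Lemma conP (I : set R) (f : R -> R) (t : R) : con I f t <->
  forall e, 0 < e -> exists2 d : R, 0 < d & forall s, I s -> `|s - t| < d -> `|f s - f t| < e.
Proof.
split=> [cf e e0|H U /nbhs_ballP[e /= e0 He]].
  have [d d0 Hd] := cf _ (nbhsx_ballx (f t) e e0).
  by exists d => // s Is sd; have := Hd s Is sd; rewrite /ball /= distrC.
have [d d0 Hd] := H e e0; exists d => // s Is sd; apply: He.
by rewrite /ball /= distrC; exact: Hd.
Qed.

Lemma con_compR (T : topologicalType) (I J : set R) (h : R -> R) (f : R -> T) t :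
  (forall s, J s -> I (h s)) -> con J h t -> con I f (h t) -> con J (f \o h) t.
Proof.
move=> JI /conP ch cf U /cf[d d0 Hd].
have [e e0 He] := ch d d0; exists e => // s Js se.
by apply: Hd; [exact: JI|exact: He].
Qed.

Lemma con_affine (I : set R) (a b t : R) : con I (fun s => a + b * s) t.
Proof.
apply: con_for; apply: cvgD; first exact: cvg_cst.
by apply: cvgM; [exact: cvg_cst|exact: cvg_id].
Qed.

(** Continuous induction. The supremum of the [t] with [P] on all of [a, t] satisfies [P] by the
    last hypothesis, and the step to the right then forces it to be [b]. Uniqueness, prolongation
    and sliding of paths all proceed in this way. *)
Lemma real_ind (a b : R) (P : R -> Prop) : a <= b -> P a ->
  (forall t, a <= t -> t < b -> P t ->
     exists2 d : R, 0 < d & forall s, t < s -> s < t + d -> s <= b -> P s) ->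
  (forall t, a < t -> t <= b -> (forall s, a <= s -> s < t -> P s) -> P t) ->
  forall t, a <= t -> t <= b -> P t.
Proof.
move=> ab Pa Pr Pl.
pose E := [set t | a <= t <= b /\ forall s, a <= s -> s <= t -> P s].
have Ea : E a by split; rewrite ?lexx//= => s h1 h2; rewrite (@le_anti _ _ s a)// h1 h2.
have hE : has_sup E by split; [exists a|exists b => t [/andP[]]].
set u := sup E.
have au : a <= u by apply: ub_le_sup => //; exact: hE.2.
have ub : u <= b by apply: ge_sup => //; [exists a|move=> t [/andP[]]].
have lt_u s : a <= s -> s < u -> P s.
  move=> as_ /(sup_gt hE.1)[t [/andP[at_ tb] Pt] st].
  by apply: Pt => //; exact: ltW.
have Pu : P u.
  move: au; rewrite le_eqVlt => /orP[/eqP <-//|au].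
  exact: Pl.
suff ub' : u = b.
  move=> t at_; rewrite -ub' le_eqVlt => /orP[/eqP->//|]; exact: lt_u.
apply/eqP; rewrite eq_le ub leNgt; apply/negP => ltub.
have [d d0 Hd] := Pr u au ltub Pu.
pose v := Num.min (u + d / 2) b.
have uv : u < v by rewrite lt_min ltub andbT ltrDl divr_gt0.
suff Ev : E v by have := ub_le_sup hE.2 Ev; rewrite leNgt uv.
split; first by rewrite (le_trans au (ltW uv)) ge_min lexx orbT.
move=> s as_; rewrite le_min => /andP[s1 s2].
case: (ltrgtP s u) => [|us|->//]; first exact: lt_u.
apply: Hd => //; apply: le_lt_trans s1 _.
by rewrite ltrD2l ltr_pdivrMr// ltr_pMr// ltr1n.
Qed.

(** Connectedness of [a, b], in a form where the target has no topology. With booleans as values, a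
    property that is open and closed along a path is constant on it. *)
Lemma locally_constant (U : Type) (a b : R) (f : R -> U) : a <= b ->
  (forall t, a <= t <= b -> exists2 d : R, 0 < d &
     forall s, a <= s <= b -> `|s - t| < d -> f s = f t) -> f b = f a.
Proof.
move=> ab H.
apply: (@real_ind a b (fun t => f t = f a)) => //.
  move=> t at_ tb ft; have [|d d0 Hd] := H t; first by rewrite at_ ltW.
  exists d => // s ts sd sb; rewrite Hd//; first by rewrite sb (le_trans at_ (ltW ts)).
  by rewrite ger0_norm ?subr_ge0 ?ltW// ltrBlDl.
move=> t at_ tb Hs; have [|d d0 Hd] := H t; first by rewrite tb ltW.
have [s] : exists s, [/\ a <= s, s < t & t - d < s].
  exists (Num.max a (t - d / 2)); split; first by rewrite le_max lexx.
    by rewrite gt_max at_ /= ltrBlDr ltrDl divr_gt0.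
  by rewrite lt_max ltrD2l ltrN2 ltr_pdivrMr// ltr_pMr// ltr1n orbT.
case=> as_ st tds; rewrite -(Hs s as_ st); apply/esym/Hd.
  by rewrite as_ (le_trans (ltW st)).
by rewrite ltr0_norm ?subr_lt0// opprB ltrBlDr addrC -ltrBlDr.
Qed.

(** The level functions of the 2-prong model see only the square of a coordinate; when the square is
    not 0, continuity excludes a change of sign. *)
Lemma con_sqr_constant (a b c : R) (f : R -> R) : a <= b ->
  (forall t, a <= t <= b -> con `[a, b] f t) ->
  (forall t, a <= t <= b -> f t ^+ 2 = c) -> f b = f a.
Proof.
move=> ab cf f2; apply: locally_constant => // t tab.
have [c0|c0] := eqVneq c 0.
  exists 1 => // s sab _; have := f2 _ sab; have := f2 _ tab; rewrite c0.
  by move=> /eqP; rewrite sqrf_eq0 => /eqP -> /eqP; rewrite sqrf_eq0 => /eqP ->.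
have ft0 : f t != 0 by apply: contra_neq c0 => ft0; rewrite -(f2 t tab) ft0 expr0n.
have /conP/(_ `|f t|) := cf t tab.
rewrite normr_gt0 => /(_ ft0)[d d0 Hd]; exists d => // s sab sd.
have /eqP := f2 s sab; rewrite -(f2 t tab) eqf_sqr => /orP[/eqP//|/eqP fs].
have := Hd s; rewrite /= in_itv /= => /(_ sab sd); rewrite fs -opprD normrN -mulr2n normrMn.
by rewrite mulr2n -subr_gt0 opprD addrA subrr sub0r oppr_gt0 ltNge normr_ge0.
Qed.

End ConReal.

Section Paths.
Context {R : realType} {T : topologicalType}.
Implicit Types (A B : set T) (x y z : T).

Local Notation pc A x := (@path_component R T A x).

Lemma uitvE (t : R) : uitv R t <-> 0 <= t <= 1.
Proof. by rewrite /uitv /= in_itv. Qed.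

Lemma pcP A x y : pc A x y <-> exists g : R -> T,
  [/\ forall t, 0 <= t <= 1 -> con `[0, 1] g t, g 0 = x, g 1 = y &
      forall t, 0 <= t <= 1 -> A (g t)].
Proof.
split=> -[g [cg g0 g1 Ag]]; exists g; split => //.
- by move=> t t01; move/con_within : cg; apply; rewrite uitvE.
- by move=> t t01; apply: Ag; exists t => //; rewrite uitvE.
- by apply/con_within => t; rewrite uitvE; apply: cg.
- by move=> _ [t /uitvE t01 <-]; apply: Ag.
Qed.

Lemma pcI A (g : R -> T) (a b : R) : a <= b ->
  (forall t, a <= t <= b -> con `[a, b] g t) ->
  (forall t, a <= t <= b -> A (g t)) -> pc A (g a) (g b).
Proof.
move=> ab cg Ag; apply/pcP.
have H t : 0 <= t <= 1 -> a <= a + (b - a) * t <= b.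
  move=> /andP[t0 t1]; rewrite lerDl mulr_ge0 ?subr_ge0//=.
  by rewrite -lerBrDl ler_piMr ?subr_ge0.
exists (g \o (fun t => a + (b - a) * t)); split => /=.
- move=> t t01; apply: (@con_compR _ _ `[a, b]).
  + by move=> s /=; rewrite !in_itv /=; apply: H.
  + exact: con_affine.
  + by apply: cg; exact: H.
- by rewrite mulr0 addr0.
- by rewrite mulr1 addrC subrK.
- by move=> t t01; apply: Ag; apply: H.
Qed.

Lemma pc_sym A x y : pc A x y -> pc A y x.
Proof.
move=> /pcP[g [cg <- <- Ag]]; apply/pcP.
have H (t : R) : 0 <= t <= 1 -> 0 <= 1 + (-1) * t <= 1.
  by move=> /andP[t0 t1]; rewrite mulN1r subr_ge0 t1 gerBl.
exists (g \o (fun t => 1 + (-1) * t)); split => /=.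
- move=> t t01; apply: (@con_compR _ _ `[0, 1]).
  + by move=> s /=; rewrite !in_itv /=; apply: H.
  + exact: con_affine.
  + by apply: cg; exact: H.
- by rewrite mulr0 addr0.
- by rewrite mulr1 subrr.
- by move=> t t01; apply: Ag; apply: H.
Qed.

Lemma pc_sub A B x : A `<=` B -> pc A x `<=` pc B x.
Proof.
by move=> AB y /pcP[g [cg g0 g1 Ag]]; apply/pcP; exists g; split => // t /Ag /AB.
Qed.

Lemma pc_mem A x y : pc A x y -> A x /\ A y.
Proof.
by move=> /pcP[g [cg <- <- Ag]]; split; apply: Ag; rewrite ?lexx ?ler01.
Qed.

Lemma pc_pc A x y : pc A x y -> pc (pc A x) x y.
Proof.
move=> /pcP[g [cg g0 g1 Ag]]; apply/pcP; exists g; split => // t /andP[t0 t1].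
rewrite -g0; apply: pcI => // s /andP[s0 st].
  apply: (@con_sub _ _ `[0, 1]); last by apply: cg; rewrite s0 (le_trans st).
  by move=> r /=; rewrite !in_itv /= => /andP[-> /le_trans]; apply.
by apply: Ag; rewrite s0 (le_trans st).
Qed.

(** Compactness: the image of [a, b] minus a ball around t is closed and misses f t. The inverse
    takes the default value [a] off the image. *)
Lemma con_inj_inverse (a b : R) (f : R -> T) : hausdorff_space T ->
  (forall t, a <= t <= b -> con `[a, b] f t) ->
  (forall s t, a <= s <= b -> a <= t <= b -> f s = f t -> s = t) ->
  exists g : T -> R, {within f @` `[a, b], continuous g} /\
     forall t, a <= t <= b -> g (f t) = t.
Proof.
move=> hT cf fi.
pose g y := xget a [set t | a <= t <= b /\ f t = y].
have gK t : a <= t <= b -> g (f t) = t.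
  move=> tab; rewrite /g; case: xgetP => [s _ [sab fst]|/(_ t)]; first exact: fi.
  by case.
exists g; split => //; apply/subspace_continuousP => _ [t /= tab <-].
rewrite in_itv /= in tab.
move=> U; rewrite /= /from_subspace gK// => /nbhs_ballP[e /= e0 He].
pose K := `[a, b] `&` ~` (ball t e).
have cK : compact K.
  apply: (@subclosed_compact _ _ `[a, b]); last by move=> s [].
    apply: closedI; first exact: itv_closed.
    by apply: open_closedC; exact: ball_open.
  exact: segment_compact.
have cfK : closed (f @` K).
  apply: compact_closed => //; apply: continuous_compact => //.
  apply/con_within => s Ks; apply: (@con_sub _ _ `[a, b]); first by move=> r [].
  by apply: cf; case: Ks; rewrite /= in_itv.
have nf : ~ (f @` K) (f t).
  move=> [s [/=]]; rewrite in_itv /= => sab nts /fi st; apply: nts.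
  by rewrite st//; exact: ballxx.
have : nbhs (f t) (~` (f @` K)) by apply: open_nbhs_nbhs; split; [exact: closed_openC|].
rewrite /= /nbhs /= /within /=; apply: filterS => y ny [s /= sab fs].
rewrite in_itv /= in sab; rewrite -fs gK//; apply: He.
by apply: contrapT => nb; apply: ny; exists s => //; split.
Qed.

Lemma embeds_uitv (f : R -> T) : hausdorff_space T ->
  (forall t, 0 <= t <= 1 -> con `[0, 1] f t) ->
  (forall s t, 0 <= s <= 1 -> 0 <= t <= 1 -> f s = f t -> s = t) ->
  embeds (uitv R) f.
Proof.
move=> hT cf fi; have [g [cg gK]] := con_inj_inverse hT cf fi.
exists g; split => //.
  by apply/con_within => t; rewrite uitvE; apply: cf.
Qed.

Lemma seq_cluster (x : nat -> T) : compact [set: T] ->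
  exists z, forall U, nbhs z U -> forall N, exists2 n, (N <= n)%N & U (x n).
Proof.
move=> cT.
have [|z [_ cz]] := cT (x @ \oo) _ _; first exact: filterT.
exists z => U nU N.
have [|_ [[n Nn <-] Uy]] := cz [set x n | n in [set n | (N <= n)%N]] U _ nU.
  by exists N => // n Nn; exists n.
by exists n.
Qed.

Lemma left_cluster (f : R -> T) (b : R) : compact [set: T] ->
  exists z, forall U, nbhs z U -> forall d, 0 < d -> exists2 t, b - d < t < b & U (f t).
Proof.
move=> cT.
have [|z [_ cz]] := cT (f @ b^'-) _ _; first exact: filterT.
exists z => U nU d d0.
have [] := cz [set f t | t in [set t | b - d < t < b]] U _ nU.
  suff : \forall t \near b^'-, b - d < t < b by apply: filterS => t tb; exists t.
  near=> t; apply/andP; split; near: t; last exact: nbhs_left_lt.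
  by apply: nbhs_left_gt; rewrite ltrBlDr ltrDl.
by move=> y [[t tb <-] Uy]; exists t.
Unshelve. all: by end_near. Qed.

(** In a compact space a unique cluster point is a limit: otherwise the parameters sent outside the
    interior of [U] generate a proper filter, whose image clusters at a point other than [q]. *)
Lemma left_cvg (f : R -> T) (b : R) (q : T) : hausdorff_space T -> compact [set: T] ->
  (forall z, (forall U, nbhs z U -> forall d, 0 < d ->
     exists2 t, b - d < t < b & U (f t)) -> z = q) ->
  forall U, nbhs q U -> exists2 d : R, 0 < d & forall t, b - d < t < b -> U (f t).
Proof.
move=> hT cT H U nU.
apply: contrapT => nd.
pose V := ~` (U°).
have cV : compact V.
  apply: (@subclosed_compact _ _ setT) => //; apply: open_closedC.
  exact: open_interior.
have Hd (d : R) : 0 < d -> exists2 t, b - d < t < b & V (f t).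
  move=> d0; apply: contrapT => nt; apply: nd; exists d => // t td.
  apply: contrapT => nU'; apply: nt; exists t => // /interior_subset; exact: nU'.
pose F := within [set t | V (f t)] (b^'-).
have PF : ProperFilter F.
  split; last exact: within_filter.
  move=> F0; have [d /= d0 Hb] : nbhs b (fun t => t < b -> V (f t) -> False) by exact: F0.
  have [t /andP[tb1 tb2] Vt] := Hd d d0.
  by apply: (Hb t) => //=; rewrite ger0_norm; clra.
have [|z [Vz cz]] := cV (f @ F) _ _.
  suff : \forall t \near b^'-, V (f t) -> V (f t) by [].
  by near=> t.
have zq : z = q.
  apply: H => W nW d d0.
  have [] := cz [set f t | t in [set t | b - d < t < b]] W _ nW; last first.
    by move=> y [[t tb <-] Uy]; exists t.
  suff : \forall t \near b^'-, b - d < t < b.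
    by apply: filterS => t tb _; exists t.
  near=> t; apply/andP; split; near: t; last exact: nbhs_left_lt.
  by apply: nbhs_left_gt; rewrite ltrBlDr ltrDl.
by apply: Vz; rewrite zq.
Unshelve. all: by end_near. Qed.

End Paths.

(** * The local model of a singular foliation *)

Section ContReal.
Context {R : realType} {T : topologicalType}.
Implicit Types (f g : T -> R) (x : T).

Lemma cont_add f g x : {for x, continuous f} -> {for x, continuous g} ->
  {for x, continuous (fun y => f y + g y)}.
Proof. by move=> cf cg; apply: cvgD. Qed.

Lemma cont_sub f g x : {for x, continuous f} -> {for x, continuous g} ->
  {for x, continuous (fun y => f y - g y)}.
Proof. by move=> cf cg; apply: cvgB. Qed.

Lemma cont_mul f g x : {for x, continuous f} -> {for x, continuous g} ->
  {for x, continuous (fun y => f y * g y)}.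
Proof. by move=> cf cg; apply: cvgM. Qed.

Lemma cont_exp f n x : {for x, continuous f} ->
  {for x, continuous (fun y => f y ^+ n)}.
Proof.
move=> cf; apply: (@continuous_comp _ _ _ f (fun y => y ^+ n)) => //.
exact: exprn_continuous.
Qed.

Lemma cont_div f g x : g x != 0 -> {for x, continuous f} -> {for x, continuous g} ->
  {for x, continuous (fun y => f y / g y)}.
Proof. by move=> gx cf cg; apply: cvgM => //; apply: cvgV. Qed.

Lemma cont_comp (h : R -> R) f x : {for x, continuous f} -> {for f x, continuous h} ->
  {for x, continuous (fun y => h (f y))}.
Proof. exact: continuous_comp. Qed.

Lemma cont_cst (c : R) x : {for x, continuous (fun=> c)}.
Proof. exact: cvg_cst. Qed.

Lemma cont_pair f g x : {for x, continuous f} -> {for x, continuous g} ->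
  {for x, continuous (fun y => (f y, g y))}.
Proof. by move=> cf cg; exact: (cvg_pair cf cg). Qed.

Lemma cont_near f g x : (\forall y \near x, f y = g y) -> {for x, continuous f} ->
  {for x, continuous g}.
Proof.
move=> fg cf U /=; rewrite -(nbhs_singleton fg) => /cf.
by apply: filterS2 fg => y /= ->.
Qed.

End ContReal.

Lemma cont_fst {R : realType} (w : R * R) : {for w, continuous fst}.
Proof. exact: cvg_fst. Qed.
Lemma cont_snd {R : realType} (w : R * R) : {for w, continuous snd}.
Proof. exact: cvg_snd. Qed.

Section Model.
Context {R : realType}.
Implicit Types (z w : R * R) (k j : nat).

Definition cpx z : R[i] := (z.1 +i* z.2)%C.
Definition impow k z : R := complex.Im (cpx z ^+ k).

Lemma repowE k z : repow k z = complex.Re (cpx z ^+ k). Proof. by []. Qed.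

Lemma powS k z : repow k.+1 z = z.1 * repow k z - z.2 * impow k z /\
  impow k.+1 z = z.1 * impow k z + z.2 * repow k z.
Proof.
rewrite !repowE /impow exprS /cpx; case: (_ ^+ k) => a b /=; split => //.
Qed.

Lemma repow0 z : repow 0 z = 1. Proof. by []. Qed.
Lemma impow0 z : impow 0 z = 0. Proof. by []. Qed.

Lemma pow_cont k z : {for z, continuous (repow (R := R) k)} /\ {for z, continuous (impow k)}.
Proof.
elim: k => [|k [IH1 IH2]]; first by split; apply: cont_cst.
split.
  apply: (@cont_near _ _ (fun z => z.1 * repow k z - z.2 * impow k z)).
    by near=> y; rewrite (powS k y).1.
  apply: cont_sub.
    by apply: (cont_mul (f := fst) (g := repow k)) IH1; exact: cont_fst.
  by apply: (cont_mul (f := snd) (g := impow k)) IH2; exact: cont_snd.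
apply: (@cont_near _ _ (fun z => z.1 * impow k z + z.2 * repow k z)).
  by near=> y; rewrite (powS k y).2.
apply: cont_add.
  by apply: (cont_mul (f := fst) (g := impow k)) IH2; exact: cont_fst.
by apply: (cont_mul (f := snd) (g := repow k)) IH1; exact: cont_snd.
Unshelve. all: by end_near. Qed.

Lemma modulus_cont z : {for z, continuous (@modulus R)}.
Proof.
apply: (cont_comp (h := Num.sqrt)); last exact: sqrt_continuous.
by apply: cont_add; apply: cont_exp; [exact: cont_fst|exact: cont_snd].
Qed.

Lemma hlevel_cont k z : {for z, continuous (@hlevel R k)}.
Proof.
apply: cont_sub; last exact: (pow_cont k z).1.
by apply: cont_exp; exact: modulus_cont.
Qed.

Lemma vlevel_cont k z : {for z, continuous (@vlevel R k)}.
Proof.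
apply: cont_add; last exact: (pow_cont k z).1.
by apply: cont_exp; exact: modulus_cont.
Qed.

Lemma sqr_modulus z : modulus z ^+ 2 = z.1 ^+ 2 + z.2 ^+ 2.
Proof. by rewrite sqr_sqrtr// addr_ge0// sqr_ge0. Qed.

Lemma modulus_ge0 z : 0 <= modulus z. Proof. exact: sqrtr_ge0. Qed.

Lemma modulus_eq0 z : modulus z = 0 -> z = 0.
Proof.
move=> z0; have := sqr_modulus z; rewrite z0 expr0n /= => /esym/eqP.
rewrite paddr_eq0 ?sqr_ge0// !sqrf_eq0 => /andP[/eqP z1 /eqP z2].
by case: z z1 z2 {z0} => a b /= -> ->.
Qed.

Lemma modulus0 : modulus (0 : R * R) = 0.
Proof. by rewrite /modulus /= expr0n /= addr0 sqrtr0. Qed.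

Lemma discE z : disc z <-> modulus z < 1.
Proof.
rewrite /disc /= -sqr_modulus; have m0 := modulus_ge0 z.
by rewrite expr_lt1.
Qed.

Lemma de_moivre k (r t : R) :
  repow k (r * cos t, r * sin t) = r ^+ k * cos (t *+ k) /\
  impow k (r * cos t, r * sin t) = r ^+ k * sin (t *+ k).
Proof.
elim: k => [|k [IH1 IH2]].
  by rewrite repow0 impow0 !mulr0n cos0 sin0 !mulr1 mulr0.
have [-> ->] := powS k (r * cos t, r * sin t).
by rewrite /= IH1 IH2 mulrS cosD sinD exprS; split; ring.
Qed.

Lemma hlevel2 z : hlevel 2 z = 2 * z.2 ^+ 2.
Proof.
rewrite /hlevel sqr_modulus; have [-> _] := powS 1 z; have [-> ->] := powS 0 z.
by rewrite repow0 impow0; ring.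
Qed.

Lemma vlevel2 z : vlevel 2 z = 2 * z.1 ^+ 2.
Proof.
rewrite /vlevel sqr_modulus; have [-> _] := powS 1 z; have [-> ->] := powS 0 z.
by rewrite repow0 impow0; ring.
Qed.

Lemma hvlevel k z : hlevel k z + vlevel k z = 2 * modulus z ^+ k.
Proof. by rewrite /hlevel /vlevel; ring. Qed.

(* w = z ^ (k / 2) on a sector: w ranges over the upper half plane, which is cut
   out of the sector j of the k-prong model *)
Definition ang w : R := pi / 2 - 2 * atan (w.1 / (modulus w + w.2)).

Definition psi k j w : R * R :=
  (modulus w `^ (2 / k%:R) * cos ((2 * ang w + 2 * pi * j%:R) / k%:R),
   modulus w `^ (2 / k%:R) * sin ((2 * ang w + 2 * pi * j%:R) / k%:R)).

Lemma modulus_polar (r t : R) : 0 <= r -> modulus (r * cos t, r * sin t) = r.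
Proof.
move=> r0; rewrite /modulus /= !exprMn -mulrDr cos2Dsin2 mulr1.
by rewrite sqrtr_sqr ger0_norm.
Qed.

Lemma polar w : 0 <= w.2 ->
  exists2 t, 0 <= t <= pi & w = (modulus w * cos t, modulus w * sin t).
Proof.
move=> w2; have [w0|w0] := eqVneq (modulus w) 0.
  exists 0; first by rewrite lexx pi_ge0.
  by rewrite w0 !mul0r; exact: modulus_eq0.
have m0 : 0 < modulus w by rewrite lt_neqAle eq_sym w0 modulus_ge0.
have m2 := sqr_modulus w.
have w21 : (w.1 / modulus w) ^+ 2 + (w.2 / modulus w) ^+ 2 = 1.
  by rewrite !expr_div_n -mulrDl -m2 divff// expf_neq0.
have H : -1 <= w.1 / modulus w <= 1.
  rewrite -ler_norml -(@expr_le1 _ 2)// real_normK ?num_real// -w21 lerDl.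
  exact: sqr_ge0.
exists (acos (w.1 / modulus w)); first by rewrite acos_ge0// acos_lepi.
rewrite acosK ?in_itv//= sin_acos// (_ : 1 - _ = (w.2 / modulus w) ^+ 2); last first.
  by rewrite -w21 addrAC subrr add0r.
rewrite sqrtr_sqr ger0_norm ?divr_ge0 ?(ltW m0)//.
by rewrite ![_ * (_ / _)]mulrC !divfK//; case: w {w2 w0 m0 m2 w21 H}.
Qed.

Lemma ang_polar (r t : R) : 0 < r -> 0 <= t <= pi -> ang (r * cos t, r * sin t) = t.
Proof.
move=> r0 /andP[t0 tp]; rewrite /ang modulus_polar ?ltW//=.
(* Half-angle formula: if t = pi/2 - 2s then cos t / (1 + sin t) = tan s. Thus one [atan] gives the
   argument on the whole closed upper half plane, without cases. *)
pose s := (pi / 2 - t) / 2.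
have ts : t = pi / 2 - s *+ 2 by rewrite /s -mulr_natr; field.
have ct : cos t = (cos s * sin s) *+ 2 by rewrite ts cosB cos_pihalf sin_pihalf mul0r mul1r add0r sin_mulr2n.
have st : sin t = cos s ^+ 2 *+ 2 - 1 by rewrite ts sinB cos_pihalf sin_pihalf mul0r mul1r subr0 cos_mulr2n.
have hs : s \in `](- (pi / 2)), (pi / 2)[.
  by have := @pi_gt0 R; rewrite in_itv /= /s; clra.
have cs : 0 < cos s by apply: cos_gt0_pihalf; rewrite in_itv /= in hs.
have -> : r * cos t / (r + r * sin t) = tan s.
  rewrite ct st /tan; move: (cos s) (sin s) cs => c d c0.
  rewrite (_ : r + _ = 2 * r * (c * c)); last by rewrite mulr2n; ring.
  rewrite (_ : r * _ = 2 * r * (c * d)); last by rewrite mulr2n; ring.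
  by rewrite -mulf_div divff ?mul1r -?mulf_div ?divff ?mul1r// ?mulf_neq0// ?gt_eqF.
by rewrite tanK// /s; field.
Qed.

Lemma psi_polar k j (r t : R) : 0 < r -> 0 <= t <= pi ->
  psi k j (r * cos t, r * sin t) =
  (r `^ (2 / k%:R) * cos ((2 * t + 2 * pi * j%:R) / k%:R),
   r `^ (2 / k%:R) * sin ((2 * t + 2 * pi * j%:R) / k%:R)).
Proof. by move=> r0 tp; rewrite /psi ang_polar// modulus_polar// ltW. Qed.

Lemma modulus_psi k j w : modulus (psi k j w) = modulus w `^ (2 / k%:R).
Proof. by rewrite modulus_polar// powR_ge0. Qed.

Lemma psi0 k j : (0 < k)%N -> psi k j 0 = 0.
Proof.
move=> k0; rewrite /psi modulus0 powR0 ?mul0r//.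
by rewrite mulf_neq0// invr_neq0// pnatr_eq0 -lt0n.
Qed.

Lemma sin_natpi n (t : R) : sin (t + 2 * pi * n%:R) = sin t /\ cos (t + 2 * pi * n%:R) = cos t.
Proof.
rewrite (_ : 2 * pi * n%:R = pi *+ 2 *+ n); last by rewrite mulr_natr mulr_natl.
by rewrite (periodicn (@sinD2pi R)) (periodicn (@cosD2pi R)).
Qed.

(** The equations express z ^ k = w ^ 2 for z = [psi k j w]. Hence both level functions of the
    k-prong model become twice the square of a coordinate of w. *)
Lemma psi_pow k j w : (0 < k)%N -> 0 <= w.2 ->
  [/\ modulus (psi k j w) ^+ k = modulus w ^+ 2,
      repow k (psi k j w) = w.1 ^+ 2 - w.2 ^+ 2 &
      impow k (psi k j w) = 2 * w.1 * w.2].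
Proof.
move=> k0 w2.
have kR : (k%:R : R) != 0 by rewrite pnatr_eq0 -lt0n.
have rk (r : R) : 0 <= r -> (r `^ (2 / k%:R)) ^+ k = r ^+ 2.
  by move=> r0; rewrite -powR_mulrn ?powR_ge0// -powRrM divfK// powR_mulrn.
split; first by rewrite modulus_psi rk// modulus_ge0.
all: have [w0|w0] := eqVneq (modulus w) 0.
- rewrite (modulus_eq0 w0) psi0//= subrr; case: k k0 {kR rk} => // k _.
  by have [-> _] := powS k 0; rewrite /= !mul0r subrr.
- have [t tp wt] := polar w2.
  have m0 : 0 < modulus w by rewrite lt_neqAle eq_sym w0 modulus_ge0.
  rewrite {1}wt psi_polar// (de_moivre _ _ _).1 rk ?ltW//.
  rewrite -[_ *+ k]mulr_natr divfK// (sin_natpi _ _).2 [2 * t]mulr_natl cos_mulr2n.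
  rewrite [w.1](congr1 fst wt) [w.2](congr1 snd wt) /=.
  rewrite -(cos2Dsin2 t) mulr2n; ring.
- rewrite (modulus_eq0 w0) psi0//= !mulr0; case: k k0 {kR rk} => // k _.
  by have [_ ->] := powS k 0; rewrite /= !mul0r addr0.
- have [t tp wt] := polar w2.
  have m0 : 0 < modulus w by rewrite lt_neqAle eq_sym w0 modulus_ge0.
  rewrite {1}wt psi_polar// (de_moivre _ _ _).2 rk ?ltW//.
  rewrite -[_ *+ k]mulr_natr divfK// (sin_natpi _ _).1 [2 * t]mulr_natl sin_mulr2n.
  rewrite [w.1](congr1 fst wt) [w.2](congr1 snd wt) /= mulr2n; ring.
Qed.

Lemma hlevel_psi k j w : (0 < k)%N -> 0 <= w.2 -> hlevel k (psi k j w) = 2 * w.2 ^+ 2.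
Proof.
move=> k0 w2; rewrite /hlevel; have [-> -> _] := psi_pow j k0 w2.
by rewrite sqr_modulus; ring.
Qed.

Lemma vlevel_psi k j w : (0 < k)%N -> 0 <= w.2 -> vlevel k (psi k j w) = 2 * w.1 ^+ 2.
Proof.
move=> k0 w2; rewrite /vlevel; have [-> -> _] := psi_pow j k0 w2.
by rewrite sqr_modulus; ring.
Qed.

Lemma powR_cont (s r : R) : 0 < s -> 0 <= r ->
  con [set x | 0 <= x] (fun x : R => x `^ s) r.
Proof.
move=> s0; rewrite le_eqVlt => /orP[/eqP <-|r0].
  apply/conP => e e0; exists (e `^ (s^-1)); first exact: powR_gt0.
  move=> x /= x0; rewrite powR0 ?gt_eqF// !subr0 !ger0_norm ?powR_ge0// => xe.
  rewrite -[ltRHS](powRr1 (ltW e0)) -(@mulVf _ s) ?gt_eqF// powRrM.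
  by apply: gt0_ltr_powR; rewrite ?nnegrE ?powR_ge0.
apply: con_for; apply: (@cont_near _ _ (fun x => expR (s * ln x))).
  near=> x; have x0 : 0 < x by near: x; exact: lt_nbhsr.
  by rewrite /powR gt_eqF.
apply: (cont_comp (h := @expR R)); last exact: continuous_expR.
by apply: cont_mul; [exact: cont_cst|exact: continuous_ln].
Unshelve. all: by end_near. Qed.

Lemma cont_powR_modulus (s : R) w : 0 < s ->
  {for w, continuous (fun w => modulus w `^ s)}.
Proof.
move=> s0 U nU; have [d d0 Hd] := powR_cont s0 (modulus_ge0 w) nU.
have := modulus_cont (nbhsx_ballx (modulus w) d d0); rewrite /= /nbhs /=.
apply: filterS => y; rewrite /ball /= distrC => yd; apply: Hd => //.
exact: modulus_ge0.
Qed.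

(** At 0 the angle has no limit, but both coordinates are bounded by |w| ^ (2 / k). Elsewhere in the
    closed half plane the denominator |w| + w.2 in [ang] is positive. *)
Lemma psi_cont k j w : (0 < k)%N -> 0 <= w.2 -> {for w, continuous (psi k j)}.
Proof.
move=> k0 w2; have s0 : 0 < 2 / k%:R :> R by rewrite divr_gt0// ltr0n.
have [w0|w0] := eqVneq (modulus w) 0.
  have w0' := modulus_eq0 w0; subst w.
  have H (h : R * R -> R) : (forall w, `|h w| <= modulus w `^ (2 / k%:R)) ->
      {for (0 : R * R), continuous h}.
    move=> hle; have h0 : h 0 = 0.
      apply/eqP; rewrite -normr_le0 (le_trans (hle 0))// modulus0 powR0//.
      by rewrite gt_eqF.
    have := cont_powR_modulus (w := 0) s0.
    move=> /cvgrPdist_lt H; apply/cvgrPdist_lt => e e0; rewrite h0.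
    have := H e e0; apply: filterS => y; rewrite modulus0 powR0 ?gt_eqF//.
    rewrite !sub0r !normrN; apply: le_lt_trans; rewrite (le_trans (hle y))//.
    exact: ler_norm.
  apply: cont_pair; apply: H => w; rewrite normrM ger0_norm ?powR_ge0//.
    by rewrite ler_piMr ?powR_ge0// cos_max.
  by rewrite ler_piMr ?powR_ge0// sin_max.
have m0 : 0 < modulus w by rewrite lt_neqAle eq_sym w0 modulus_ge0.
have ca : {for w, continuous (fun w => (2 * ang w + 2 * pi * j%:R) / k%:R)}.
  apply: cont_mul; last exact: cont_cst.
  apply: cont_add; last exact: cont_cst.
  apply: cont_mul; first exact: cont_cst.
  apply: cont_sub; first exact: cont_cst.
  apply: cont_mul; first exact: cont_cst.
  apply: (cont_comp (h := @atan R)); last exact: continuous_atan.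
  apply: cont_div; first by rewrite gt_eqF// ltr_wpDr.
    exact: cont_fst.
  by apply: cont_add; [exact: modulus_cont|exact: cont_snd].
apply: cont_pair; apply: cont_mul; try exact: cont_powR_modulus.
  by apply: (cont_comp (h := @cos R)) => //; exact: continuous_cos.
by apply: (cont_comp (h := @sin R)) => //; exact: continuous_sin.
Qed.

(** The levels determine w.2, and w.1 up to sign; Im (w ^ 2) = 2 w.1 w.2 gives the sign off the
    axis. On the axis a sign condition is needed: for k = 1 its two halves have the same image. *)
Lemma psi_inj k j w w' : (0 < k)%N -> 0 <= w.2 -> 0 <= w'.2 ->
  0 < w.2 \/ 0 <= w.1 /\ 0 <= w'.1 ->
  psi k j w = psi k j w' -> w = w'.
Proof.
move=> k0 w2 w2' H E.
have h := hlevel_psi j k0 w2; have v := vlevel_psi j k0 w2.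
have [_ _ i] := psi_pow j k0 w2; have [_ _] := psi_pow j k0 w2'.
have := hlevel_psi j k0 w2'; have := vlevel_psi j k0 w2'.
rewrite -E h v i.
move: w w' w2 w2' H {E h v i} => [a b] [a' b'] /= b0 b0' H va hb.
have bb : b = b'.
  by apply/eqP; rewrite -(eqrXn2 (n := 2))//; apply/eqP; clra.
subst b' => ab; congr (_, _); case: H => [b1|[a0 a0']].
  by apply: (@mulIf _ b); rewrite ?gt_eqF//; clra.
by apply/eqP; rewrite -(eqrXn2 (n := 2))//; apply/eqP; clra.
Qed.

Lemma psi_inj_fst k j (a a' b : R) : (0 < k)%N -> 0 < b ->
  psi k j (a, b) = psi k j (a', b) -> a = a'.
Proof.
move=> k0 b0 E.
by have [] := psi_inj (w := (a, b)) (w' := (a', b)) k0 (ltW b0) (ltW b0) (or_introl b0) E.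
Qed.

Lemma psi_inj_axis k j (a a' : R) : (0 < k)%N -> 0 <= a -> 0 <= a' ->
  psi k j (a, 0) = psi k j (a', 0) -> a = a'.
Proof.
move=> k0 a0 a0' E.
by have [] := psi_inj (w := (a, 0)) (w' := (a', 0)) k0 (lexx 0) (lexx 0) (or_intror (conj a0 a0')) E.
Qed.

Lemma polar_full z : exists t : R, z = (modulus z * cos t, modulus z * sin t).
Proof.
have [z2|z2] := leP 0 z.2; first by have [t _ zt] := polar z2; exists t.
have [|t _ zt] := @polar (- z); first by rewrite /= oppr_ge0 ltW.
exists (t + pi); rewrite cosDpi sinDpi.
have mN : modulus (- z) = modulus z by rewrite /modulus /= !sqrrN.
rewrite mN in zt; rewrite !mulrN; move: zt; case: z {z2 mN} => a b [<- <-].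
by rewrite !opprK.
Qed.

(** On the edge w.2 = 0 of a sector only the half w.1 >= 0 is kept, since the other half is the
    first edge of the next sector. *)
Lemma psi_surj k z : (0 < k)%N -> exists j w,
  [/\ (j < k)%N, 0 < w.2 \/ w.2 = 0 /\ 0 <= w.1 & psi k j w = z].
Proof.
move=> k0.
have kR : (0 : R) < k%:R by rewrite ltr0n.
have s0 : 0 < 2 / k%:R :> R by rewrite divr_gt0.
have [z0|z0] := eqVneq (modulus z) 0.
  exists 0%N, 0; split => //; first by right; rewrite /= lexx.
  by rewrite psi0// (modulus_eq0 z0).
have m0 : 0 < modulus z by rewrite lt_neqAle eq_sym z0 modulus_ge0.
have [t zt] := polar_full z.
(* The angle t has to be (2 p + 2 pi j) / k modulo 2 pi. The integer part [n] of k t / (2 pi) gives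
   j modulo k, and p is half of what remains of k t. *)
pose q := k%:R * t / (2 * pi).
have pi0 := @pi_gt0 R.
pose n := Num.floor q.
have /andP[n1 n2] : n%:~R <= q < (n + 1)%:~R by rewrite floor_itv.
pose j := `|(n %% k)%Z|%N; pose p := (k%:R * t - 2 * pi * n%:~R) / 2.
have jE : (j%:Z = n %% k)%Z by rewrite /j gez0_abs// modz_ge0// eqz_nat -lt0n.
have nE : n%:~R = j%:R + k%:R * (n %/ k)%Z%:~R :> R.
  rewrite {1}(divz_eq n k) -jE intrD intrM addrC; congr (_ + _); exact: mulrC.
have qE : k%:R * t = 2 * pi * q by rewrite /q; field; clra.
have p0 : 0 <= p by rewrite /p qE -mulrBr divr_ge0// mulr_ge0 ?subr_ge0//; clra.
have pp : p < pi.
  rewrite intrD /= in n2.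
  have : pi * (q - n%:~R) < pi * 1 by rewrite ltr_pM2l//; clra.
  by rewrite /p qE; clra.
pose r := modulus z `^ (k%:R / 2).
have r0 : 0 < r by rewrite powR_gt0.
exists j, (r * cos p, r * sin p); split.
- by rewrite -ltz_nat jE ltz_pmod// ltz_nat.
- move: p0; rewrite /= le_eqVlt => /orP[/eqP<-|p0].
    by right; rewrite sin0 cos0 mulr0 mulr1; split => //; exact: ltW.
  by left; rewrite mulr_gt0// sin_gt0_pi// p0.
- rewrite psi_polar ?p0 ?(ltW pp)// -powRrM (_ : k%:R / 2 * _ = 1); last by field; rewrite gt_eqF.
  rewrite powRr1 ?ltW//.
  have E : t = (2 * p + 2 * pi * j%:R) / k%:R + 2 * pi * (n %/ k)%Z%:~R.
    by rewrite /p nE; field; rewrite gt_eqF.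
  have per (m : int) (x : R) : sin (x + 2 * pi * m%:~R) = sin x /\ cos (x + 2 * pi * m%:~R) = cos x.
    case: m => m; first exact: sin_natpi.
    have [s c] := sin_natpi m.+1 (x + 2 * pi * (Negz m)%:~R).
    by rewrite -s -c NegzE mulrNz mulrN subrK.
  by rewrite [RHS]zt E (per _ _).1 (per _ _).2.
Qed.

Lemma disc_psi k j w : (0 < k)%N -> modulus w < 1 -> disc (psi k j w).
Proof.
move=> k0 w1; apply/discE; rewrite modulus_psi.
have p1 : 1 `^ (2 / k%:R) = 1 :> R by rewrite powR1.
rewrite -[ltRHS]p1; apply: gt0_ltr_powR; rewrite ?nnegrE ?modulus_ge0//.
by rewrite divr_gt0// ltr0n.
Qed.

Lemma modulus_axis (t : R) : 0 <= t -> modulus (t, 0 : R) = t.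
Proof. by move=> t0; rewrite /modulus /= expr0n /= addr0 sqrtr_sqr ger0_norm. Qed.

End Model.

(** * Prongs of a chart *)

Lemma infinite_inj T (A : set T) : infinite_set A ->
  exists f : nat -> T, (forall n, A (f n)) /\ injective f.
Proof.
elim/Ppointed: T => T in A *.
  by rewrite emptyE => /(_ (finite_set0 _)).
move=> /infiniteP/ppcard_leP[f].
exists f; split => [n|m n]; first exact: (@funS _ _ _ _ f).
by move=> fmn; apply: (@inj _ _ _ f); rewrite ?inE.
Qed.

(** An injective sequence in [A] would cluster at a point each of whose neighbourhoods contains two
    of its terms. Singularities and intersections of arcs are both counted in this way. *)
Lemma finite_discrete {T : topologicalType} (A : set T) : compact [set: T] ->
  (forall z : T, exists2 U : set T, nbhs z U & forall a b, A a -> A b -> U a -> U b -> a = b) ->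
  finite_set A.
Proof.
move=> cT H; apply: contrapT => /infinite_inj[f [Af fi]].
have [z cz] := seq_cluster f cT.
have [U nU HU] := H z.
have [n _ Un] := cz U nU 0%N; have [m nm Um] := cz U nU n.+1.
have /fi nm' : f n = f m by apply: HU.
by rewrite nm' ltnn in nm.
Qed.

(** Serves to choose one radius for all the sectors of a singularity. *)
Lemma finite_radius {R : realType} (P : nat -> R -> Prop) n (t : R) :
  (forall i, (i < n)%N -> exists2 e : R, 0 < e & forall s, `|s - t| < e -> P i s) ->
  exists2 e : R, 0 < e & forall s, `|s - t| < e -> forall i, (i < n)%N -> P i s.
Proof.
elim: n => [_|n IH H]; first by exists 1.
have [e e0 He] := IH (fun i ni => H i (ltnW ni)).
have [e' e'0 He'] := H n (ltnSn n).
exists (Num.min e e'); first by rewrite lt_min e0.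
move=> s; rewrite lt_min => /andP[se se'] i.
by rewrite ltnS leq_eqVlt => /orP[/eqP->|]; [exact: He'|exact: He].
Qed.

(** * Rotations of the model and comparison of its sectors *)

Section Rot.
Context {R : realType}.
Implicit Types (z w : R * R).

Definition rot (t : R) z : R * R := (z.1 * cos t - z.2 * sin t, z.1 * sin t + z.2 * cos t).

Lemma rotK t : cancel (rot t) (rot (- t)).
Proof.
move=> [a b]; rewrite /rot /= cosN sinN; have := cos2Dsin2 t => H.
by congr (_, _); [rewrite -[RHS]mulr1 -H|rewrite -[RHS]mulr1 -H]; ring.
Qed.

Lemma rotNK t : cancel (rot (- t)) (rot t).
Proof. by move=> z; rewrite -{1}(opprK t) rotK. Qed.

Lemma rot_cont t z : {for z, continuous (rot t)}.
Proof.
apply: cont_pair.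
  apply: cont_sub.
    by apply: (cont_mul (f := fst)); [exact: cont_fst|exact: cont_cst].
  by apply: (cont_mul (f := snd)); [exact: cont_snd|exact: cont_cst].
apply: cont_add.
  by apply: (cont_mul (f := fst)); [exact: cont_fst|exact: cont_cst].
by apply: (cont_mul (f := snd)); [exact: cont_snd|exact: cont_cst].
Qed.

Lemma rot_polar t (r s : R) : rot t (r * cos s, r * sin s) = (r * cos (s + t), r * sin (s + t)).
Proof. by rewrite /rot /= cosD sinD; congr (_, _); ring. Qed.

Lemma rot0 t : rot t 0 = 0.
Proof. by rewrite /rot /= !mul0r subrr addr0. Qed.

Lemma modulus_rot t z : modulus (rot t z) = modulus z.
Proof.
have [s zs] := polar_full z; rewrite {1}zs rot_polar modulus_polar//.
exact: modulus_ge0.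
Qed.

Lemma disc_rot t z : disc (rot t z) <-> disc z.
Proof. by rewrite !discE modulus_rot. Qed.

(** A turn by pi / k multiplies z ^ k by -1, which exchanges the horizontal and the vertical
    model. *)
Lemma repow_rot k z : (0 < k)%N -> repow k (rot (pi / k%:R) z) = - repow k z.
Proof.
move=> k0; have [s zs] := polar_full z; rewrite zs rot_polar !(de_moivre _ _ _).1.
rewrite (_ : (s + _) *+ k = s *+ k + pi); last first.
  by rewrite mulrnDl -[X in _ + X]mulr_natr divfK// pnatr_eq0 -lt0n.
by rewrite cosDpi mulrN.
Qed.

Lemma hlevel_rot k z : (0 < k)%N -> hlevel k (rot (pi / k%:R) z) = vlevel k z.
Proof. by move=> k0; rewrite /hlevel /vlevel repow_rot// modulus_rot opprK. Qed.

Lemma vlevel_rot k z : (0 < k)%N -> vlevel k (rot (pi / k%:R) z) = hlevel k z.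
Proof. by move=> k0; rewrite /hlevel /vlevel repow_rot// modulus_rot. Qed.

Lemma plaque_rot (lev lev' : R * R -> R) t z w :
  (forall z, lev' (rot t z) = lev z) ->
  model_plaque lev z w -> model_plaque lev' (rot t z) (rot t w).
Proof.
move=> H /pcP[g [cg <- <- gl]]; apply/pcP; exists (rot t \o g); split => //.
  by move=> s s01; apply: con_comp; [exact: cg|exact: rot_cont].
by move=> s s01 /=; have [gd ge] := gl s s01; split => /=; [apply/disc_rot|rewrite !H].
Qed.

Lemma psiE k j w :
  psi k j w = rot (2 * pi * j%:R / k%:R) (psi k 0 w).
Proof.
rewrite /psi rot_polar.
by have -> : (2 * ang w + 2 * pi * j%:R) / k%:R =
  (2 * ang w + 2 * pi * 0%:R) / k%:R + 2 * pi * j%:R / k%:R by rewrite mulr0 addr0 mulrDl.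
Qed.

(** The sectors are rotated copies of the sector 0, and a rotation is determined by the image of one
    nonzero vector. *)
Lemma psi_eq k i j w w' : (0 < k)%N -> modulus w != 0 -> psi k i w = psi k j w ->
  psi k i w' = psi k j w'.
Proof.
move=> k0 w0; rewrite ![psi k i _]psiE ![psi k j _]psiE; set z := psi k 0 w.
set a := 2 * pi * i%:R / k%:R; set b := 2 * pi * j%:R / k%:R.
have z0 : modulus z != 0 by rewrite modulus_psi powR_eq0 negb_and w0.
have z2 : z.1 ^+ 2 + z.2 ^+ 2 != 0 by rewrite -sqr_modulus expf_neq0.
move: z z0 z2 => [x y] /= _ n0; rewrite /rot /= => -[e1 e2].
have c : (x ^+ 2 + y ^+ 2) * cos a = (x ^+ 2 + y ^+ 2) * cos b.
  have -> : (x ^+ 2 + y ^+ 2) * cos a = x * (x * cos a - y * sin a) + y * (x * sin a + y * cos a) by ring.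
  by rewrite e1 e2; ring.
have s : (x ^+ 2 + y ^+ 2) * sin a = (x ^+ 2 + y ^+ 2) * sin b.
  have -> : (x ^+ 2 + y ^+ 2) * sin a = x * (x * sin a + y * cos a) - y * (x * cos a - y * sin a) by ring.
  by rewrite e1 e2; ring.
by rewrite (mulfI n0 c) (mulfI n0 s).
Qed.

Lemma psi_neq k i j w : (i < j)%N -> (j < k)%N -> modulus w != 0 -> psi k i w <> psi k j w.
Proof.
move=> ij jk w0 E; have k0 : (0 < k)%N by apply: leq_ltn_trans jk.
have := psi_eq (1, 0) k0 w0 E.
rewrite (_ : (1, 0) = (1 * cos 0, 1 * sin 0)); last by rewrite cos0 sin0 mulr1 mulr0.
rewrite !psi_polar ?ltr01 ?lexx ?pi_ge0// powR1 !mul1r mulr0 !add0r => -[c s].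
(* Half the angle between the two sectors: it lies in ]0, pi[, where cos (2 x) = 1 is impossible. *)
pose x := pi * (j - i)%:R / k%:R : R.
have kR : (0 : R) < k%:R by rewrite ltr0n.
have x0 : 0 < x < pi.
  rewrite /x divr_gt0 ?mulr_gt0 ?pi_gt0 ?ltr0n ?subn_gt0//=.
  by rewrite ltr_pdivrMr// ltr_pM2l ?pi_gt0// ltr_nat (leq_ltn_trans _ jk)// leq_subr.
have := sin_gt0_pi x0.
have : cos (x *+ 2) = 1.
  rewrite (_ : x *+ 2 = 2 * pi * j%:R / k%:R - 2 * pi * i%:R / k%:R); last first.
    by rewrite /x natrB 1?ltnW// mulr2n; ring.
  by rewrite cosB -c -s -!expr2 cos2Dsin2.
rewrite cos_mulr2n cos2sin2 => H s0; have : sin x ^+ 2 = 0 by move: H; rewrite mulr2n; clra.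
by move=> /eqP; rewrite sqrf_eq0 gt_eqF.
Qed.

End Rot.

Global Opaque psi impow modulus repow.

(** * Foliated charts of the surface *)

Section Charts.
Context {R : realType} {S : surface R}.
Implicit Types (c : chart R S) (x y : S) (lf : S -> set S) (lev : R * R -> R).

Lemma cmap_for c y : cdom c y -> {for y, continuous (cmap c)}.
Proof.
move=> cy; have := @cmap_cont _ _ c; rewrite continuous_open_subspace; last exact: cdom_open.
by apply; rewrite inE.
Qed.

Lemma fc_disc lf lev c x w : foliated_chart lf lev c x -> disc w ->
  cdom c (cinv c w) /\ cmap c (cinv c w) = w.
Proof.
by move=> [_ _ <- _] [y cy <-]; rewrite cmapK.
Qed.

Lemma fc_cdom lf lev c x y : foliated_chart lf lev c x -> cdom c y -> disc (cmap c y).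
Proof. by move=> [_ _ <- _] cy; exists y. Qed.

Lemma cinv_for lf lev c x w : foliated_chart lf lev c x -> disc w ->
  {for w, continuous (cinv c)}.
Proof.
move=> [_ _ E _] dw; have := @cinv_cont _ _ c; rewrite continuous_open_subspace; last exact: cimg_open.
by apply; rewrite inE E.
Qed.

Lemma fc_plaque lf lev c x y y' : foliated_chart lf lev c x ->
  path_component (R := R) (lf y `&` cdom c) y y' ->
  model_plaque lev (cmap c y) (cmap c y').
Proof.
move=> [_ _ _ H] yy'; have [[_ cy] _] := pc_mem yy'.
by rewrite -(H y cy); exists y'.
Qed.

Lemma fc_lev lf lev c x y y' : foliated_chart lf lev c x ->
  path_component (R := R) (lf y `&` cdom c) y y' ->
  lev (cmap c y') = lev (cmap c y).
Proof. by move=> fc p; have [_ []] := pc_mem (fc_plaque fc p). Qed.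

Lemma fc_leaf lf lev c x w w' : foliated_chart lf lev c x ->
  model_plaque lev w w' ->
  path_component (R := R) (lf (cinv c w) `&` cdom c) (cinv c w) (cinv c w').
Proof.
move=> fc ww'; have [[dw _] [dw' _]] := pc_mem ww'.
have [cy my] := fc_disc fc dw; have [cy' my'] := fc_disc fc dw'.
have [_ _ _ H] := fc; have := H _ cy; rewrite my => E.
have : model_plaque lev w w' by [].
rewrite -E => -[y'' p E']; rewrite -E' cmapK//.
by have [_ []] := pc_mem p.
Qed.

(** With t = pi / k the new chart shows as horizontal the foliation that was vertical and
    conversely. This is how results for [F] are transferred to [G]. *)
Lemma rotchart (t : R) c x lf lev : foliated_chart lf lev c x ->
  exists c' : chart R S, [/\ cdom c' = cdom c, cmap c' = rot t \o cmap c &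
    forall lf lev lev', (forall z, lev' (rot t z) = lev z) ->
      foliated_chart lf lev c x -> foliated_chart lf lev' c' x].
Proof.
move=> fc.
have im : (rot t \o cmap c) @` cdom c = disc.
  have [_ _ E _] := fc; rewrite -image_comp E; apply/seteqP; split.
    by move=> _ [w dw <-]; apply/disc_rot.
  by move=> w dw; exists (rot (- t) w); [apply/disc_rot|rewrite rotNK].
have op : open ((rot t \o cmap c) @` cdom c).
  by have [_ _ E _] := fc; rewrite im -E; exact: cimg_open.
have c1 : {within cdom c, continuous (rot t \o cmap c)}.
  rewrite continuous_open_subspace; last exact: cdom_open.
  move=> y; rewrite inE => cy; apply: continuous_comp; first exact: cmap_for.
  exact: rot_cont.
have c2 : {within (rot t \o cmap c) @` cdom c, continuous (cinv c \o rot (- t))}.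
  rewrite continuous_open_subspace// => y; rewrite inE im => dy.
  apply: continuous_comp; first exact: rot_cont.
  by apply: (cinv_for fc); apply/disc_rot.
have c3 y : cdom c y -> (cinv c \o rot (- t)) ((rot t \o cmap c) y) = y.
  by move=> cy; rewrite /= rotK cmapK.
exists (Chart (cdom_open c) op c1 c2 c3); split => // lf' lev' lev'' H fc'.
have [cx x0 E Hp] := fc'; split => //=; first by rewrite x0 rot0.
move=> y cy; rewrite -image_comp Hp//.
apply/seteqP; split => w.
  by move=> [w' p <-]; exact: plaque_rot.
move=> p; exists (rot (- t) w); last by rewrite rotNK.
rewrite -(rotK t (cmap c y)); apply: (plaque_rot (lev := lev'')) p => z.
by rewrite -{2}(rotNK t z) H.
Qed.

Lemma transverse_sym (F G : foliation S) : transverse F G -> transverse G F.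
Proof.
move=> tr x; have [E [c f1 f2]] := tr x; split => //.
have k0 := prongs_gt0 F x.
have [c' [_ _ H]] := rotchart (pi / (prongs F x)%:R) f1.
exists c'.
  by apply: (H _ _ _ _ f2) => z; rewrite -E hlevel_rot.
by apply: (H _ _ _ _ f1) => z; rewrite vlevel_rot.
Qed.

(* the sector j of a k-prong chart, parametrized by w in the upper half plane *)
Definition sector c k j w : S := cinv c (psi k j w).

(** * Points off the horizontal prongs of a chart have two prongs *)

Section ProngCount.
Variables (lf : S -> set S) (c d : chart R S) (x y : S) (k l : nat) (b : R).
Hypothesis (k0 : (0 < k)%N) (l0 : (0 < l)%N).
Hypothesis (fc : foliated_chart lf (hlevel k) c x) (cy : cdom c y).
Hypothesis (fd : foliated_chart lf (hlevel l) d y) (b0 : 0 < b) (b2 : hlevel k (cmap c y) = 2 * b ^+ 2).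

(** On the part of a sector at level 2 b ^ 2 > 0 the quantity Im (z ^ k) / (2 b) is a coordinate.
    Parts in different sectors are disjoint, so a path in the plaque stays in its sector. *)
Lemma regular_plaque : exists j a, [/\ (j < k)%N,
  modulus (a, b) < 1, cmap c y = psi k j (a, b) &
  forall y', path_component (R := R) (lf y `&` cdom c) y y' ->
    exists a', [/\ modulus (a', b) < 1, cmap c y' = psi k j (a', b) &
      a' = impow k (cmap c y') / (2 * b)]].
Proof.
have key z : disc z -> hlevel k z = 2 * b ^+ 2 -> exists i, [/\ (i < k)%N,
    z = psi k i (impow k z / (2 * b), b) & modulus (impow k z / (2 * b), b) < 1].
  move=> dz hz; have [i [w [ik w2 E]]] := psi_surj z k0.
  have w20 : 0 <= w.2 by case: w2 => [/ltW//|[->]].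
  have wb : w.2 = b.
    apply/eqP; rewrite -(eqrXn2 (n := 2))// ?(ltW b0)//; apply/eqP.
    by have := hlevel_psi i k0 w20; rewrite E hz => /mulfI ->.
  have [M _ I] := psi_pow i k0 w20.
  have wa : w.1 = impow k z / (2 * b).
    by rewrite -E I wb; field; rewrite gt_eqF.
  exists i; rewrite -wa -wb -surjective_pairing; split => //.
  rewrite -(@expr_lt1 _ 2)// ?modulus_ge0// -M E expr_lt1 ?modulus_ge0//.
  exact/discE.
have [j [jk E m1]] := key _ (fc_cdom fc cy) b2.
exists j, (impow k (cmap c y) / (2 * b)); split => // y' p.
have [dy' hy'] := (pc_mem (fc_plaque fc p)).2.
rewrite b2 in hy'.
exists (impow k (cmap c y') / (2 * b)).
suff E' : cmap c y' = psi k j (impow k (cmap c y') / (2 * b), b).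
  by have [i [_ E'' m]] := key _ dy' hy'; split; [exact: m|exact: E'|].
have /pcP[g [cg g0 g1 Ag]] := fc_plaque fc p.
pose a t := impow k (g t) / (2 * b).
(* Locally constant: not being in a given sector is an open condition along the path, and near a
   time in sector [j] only sectors that contain the point at that time remain, which by [psi_eq]
   coincide with [j]. *)
pose phi t := `[<g t = psi k j (a t, b)>].
suff : phi 1 = phi 0.
  by rewrite /phi /a g0 g1 -E => H; apply/asboolP; rewrite H; apply/asboolP.
apply: locally_constant => // t t01.
have ca (t0 : R) : 0 <= t0 <= 1 -> con `[0, 1] (fun t => (a t, b)) t0.
  move=> t01'; apply: (con_comp (f := g) (h := fun z => (impow k z / (2 * b), b))).
    exact: cg.
  apply: cont_pair; last exact: cont_cst.
  by apply: cont_mul; [exact: (pow_cont k (g t0)).2|exact: cont_cst].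
have cp i (t0 : R) : 0 <= t0 <= 1 -> con `[0, 1] (fun t => psi k i (a t, b)) t0.
  move=> t01'; apply: (con_comp (f := fun t => (a t, b)) (h := psi k i)).
    exact: ca.
  by apply: psi_cont => //=; exact: ltW.
have hR : hausdorff_space (R * R)%type.
  exact: norm_hausdorff.
have neq i (t0 : R) : 0 <= t0 <= 1 -> g t0 <> psi k i (a t0, b) ->
    exists2 e : R, 0 < e & forall s, 0 <= s <= 1 -> `|s - t0| < e -> g s <> psi k i (a s, b).
  move=> t01' ne; apply: contrapT => nex; apply: ne.
  apply: (con_uniq (I := `[0, 1]) (t := t0) (f := g) (g := fun t => psi k i (a t, b)) hR).
  - exact: cg.
  - exact: cp.
  - move=> e e0; apply: contrapT => ns; apply: nex; exists e => // s s01 se gs.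
    by apply: ns; exists s => //=; rewrite in_itv.
have [gt|gt] := pselect (g t = psi k j (a t, b)); last first.
  have [e e0 He] := neq j t t01 gt.
  exists e; first exact: e0.
  move=> s s01 se; have -> : phi t = false by exact: asboolF.
  by apply: asboolF; exact: He.
have [|e e0 He] := @finite_radius _
    (fun i s => 0 <= s <= 1 -> g s = psi k i (a s, b) -> g s = psi k j (a s, b)) k t.
  move=> i ik; have [gn|gn] := pselect (g t = psi k i (a t, b)); last first.
    have [e' e'0 He'] := neq i t t01 gn; exists e'; first exact: e'0.
    by move=> s se' s01 gs; exfalso; exact: (He' s s01 se' gs).
  exists 1; first exact: ltr01.
  move=> s _ _ gs; rewrite gs; apply: (psi_eq (w := (a t, b))); first exact: k0.
    by apply/eqP => /modulus_eq0 [_ b00]; move: b0; rewrite b00 ltxx.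
  by rewrite -gn -gt.
exists e; first exact: e0.
move=> s s01 se; have -> : phi t = true by exact: asboolT.
apply: asboolT.
have [dg hg] := Ag s s01.
rewrite /= b2 in hg.
have [i [ik gi _]] := key _ dg hg.
exact: (He s se i ik s01 gi).
Qed.

Lemma psi_axis_neq i j (t t' : R) : (i < j)%N -> (j < l)%N -> 0 < t -> 0 < t' ->
  psi l i (t, 0) <> psi l j (t', 0).
Proof.
move=> ij jl t0 t'0 E.
have := vlevel_psi j l0 (w := (t', 0)) (lexx _); rewrite -E vlevel_psi//= => v.
have tt : t = t'.
  by apply/eqP; rewrite -(eqrXn2 (n := 2))// ?ltW//; apply/eqP; clra.
subst t'; apply: (psi_neq ij jl _ E); apply/eqP => /modulus_eq0 [tt].
by rewrite tt ltxx in t0.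
Qed.

(** Reads a prong of the chart [d] at [y] inside the plaque of [c] through [y]. Counting prongs
    becomes a question on curves in an interval that start at [a]. *)
Lemma prong_coordinate j a : (j < k)%N -> modulus (a, b) < 1 ->
  cmap c y = psi k j (a, b) ->
  (forall y', path_component (R := R) (lf y `&` cdom c) y y' ->
    exists a', [/\ modulus (a', b) < 1, cmap c y' = psi k j (a', b) &
      a' = impow k (cmap c y') / (2 * b)]) ->
  forall i, (i < l)%N -> exists (th : R -> R) (e : R), [/\ 0 < e < 1,
    th 0 = a, forall t, 0 <= t <= e -> con `[0, e] th t &
    forall t, 0 <= t <= e -> modulus (th t, b) < 1 /\
       sector d l i (t, 0) = sector c k j (th t, b)].
Proof.
move=> jk m1 E H i il.
have cs t : 0 <= t < 1 -> {for t, continuous (fun t : R => sector d l i (t, 0))}.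
  move=> /andP[t0 t1].
  apply: (@continuous_comp _ _ _ (fun t : R => psi l i (t, 0)) (cinv d)).
    apply: (@continuous_comp _ _ _ (fun t : R => (t, 0)) (psi l i)); last exact: psi_cont.
    by apply: (cont_pair (f := id)); [exact: cvg_id|exact: cont_cst].
  by apply: (cinv_for fd); apply: disc_psi => //; rewrite modulus_axis.
have s0 : sector d l i (0, 0) = y.
  rewrite /sector (_ : (0, 0) = 0)// psi0//.
  by have [dy <- _ _] := fd; rewrite cmapK.
have s_in t : 0 <= t < 1 -> cdom d (sector d l i (t, 0)).
  move=> /andP[t0 t1]; apply: (fc_disc fd _).1.
  by apply: disc_psi => //; rewrite modulus_axis.
have s_leaf t : 0 <= t < 1 -> lf y (sector d l i (t, 0)).
  move=> /andP[t0 t1].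
  have : model_plaque (hlevel l) (psi l i (0, 0)) (psi l i (t, 0)).
    apply: (pcI (g := fun t => psi l i (t, 0))) => // s /andP[s0' st].
      apply: con_for; apply: (@continuous_comp _ _ _ (fun t : R => (t, 0)) (psi l i)).
        by apply: (cont_pair (f := id)); [exact: cvg_id|exact: cont_cst].
      exact: psi_cont.
    split => /=; last by rewrite !hlevel_psi.
    by apply: disc_psi => //; rewrite modulus_axis// (le_lt_trans st).
  move=> p; have [_ []] := pc_mem (fc_leaf fd p).
  by rewrite -/(sector d l i (0, 0)) s0.
have [e e0 He] : exists2 e : R, 0 < e & forall t, `|t| < e -> cdom c (sector d l i (t, 0)).
  have := cs 0; rewrite lexx ltr01 => /(_ isT) /(_ (cdom c)) /=.
  rewrite s0 => /(_ (open_nbhs_nbhs (conj (cdom_open c) cy))).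
  move=> /nbhs_ballP[e /= e0 He]; exists e => // t te; apply: He.
  by rewrite /ball /= sub0r normrN.
pose e' := Num.min (e / 2) (1 / 2).
have e'0 : 0 < e' by rewrite lt_min !divr_gt0.
have e'1 : e' < 1 by rewrite gt_min (_ : 1 / 2 < 1) ?orbT//; clra.
have e'e : e' < e by rewrite gt_min (_ : e / 2 < e) ?orTb//; clra.
pose th t := impow k (cmap c (sector d l i (t, 0))) / (2 * b).
have cth t : 0 <= t <= e' -> {for t, continuous th}.
  move=> /andP[t0 t1]; apply: cont_mul; last exact: cont_cst.
  apply: (@continuous_comp _ _ _ (fun t : R => cmap c (sector d l i (t, 0))) (impow k)).
    apply: (@continuous_comp _ _ _ (fun t : R => sector d l i (t, 0)) (cmap c)).
      by apply: cs; rewrite t0 (le_lt_trans t1).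
    by apply: cmap_for; apply: He; rewrite ger0_norm// (le_lt_trans t1).
  exact: (pow_cont k _).2.
exists th, e'; split.
- by rewrite e'0.
- rewrite /th s0 E.
  by have [_ _ ->] := psi_pow j k0 (w := (a, b)) (ltW b0); rewrite /=; field; rewrite gt_eqF.
- by move=> t te; apply: con_for; exact: cth.
- move=> t /andP[t0 t1].
  have [|a' [m' E' a'E]] := H (sector d l i (t, 0)).
    rewrite [X in path_component _ X](esym s0).
    apply: (pcI (g := fun t => sector d l i (t, 0))) => // s /andP[s0' st].
      by apply: con_for; apply: cs; rewrite s0' (le_lt_trans st)// (le_lt_trans t1).
    split; first by apply: s_leaf; rewrite s0' (le_lt_trans st)// (le_lt_trans t1).
    by apply: He; rewrite ger0_norm// (le_lt_trans st)// (le_lt_trans t1).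
  have -> : th t = a' by rewrite /th -a'E.
  split => //; rewrite [RHS]/sector -E' cmapK//; apply: He.
  by rewrite ger0_norm// (le_lt_trans t1).
Qed.

(** A change of side would give, by the intermediate value theorem, a second parameter with value
    0. *)
Lemma sign_injective (th : R -> R) (e : R) : 0 < e -> th 0 = 0 ->
  (forall t, 0 <= t <= e -> con `[0, e] th t) ->
  (forall s t, 0 <= s <= e -> 0 <= t <= e -> th s = th t -> s = t) ->
  (forall t, 0 < t <= e -> 0 < th t) \/ (forall t, 0 < t <= e -> th t < 0).
Proof.
move=> e0 th0 cth thi.
have thn (t : R) : 0 < t <= e -> th t != 0.
  move=> /andP[t0 te]; apply/eqP => tht.
  have : t = 0 by apply: thi; rewrite ?lexx ?(ltW t0) ?(ltW e0)//= th0 tht.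
  by move=> t0'; rewrite t0' ltxx in t0.
have key s t : 0 < s <= e -> 0 < t <= e -> 0 < th s -> th t < 0 -> False.
  move=> /andP[s0 se] /andP[t0 te] ths tht.
  have W u v : 0 < u -> 0 < v -> u <= e -> v <= e -> u <= v ->
      Num.min (th u) (th v) <= 0 <= Num.max (th u) (th v) -> False.
    move=> u0 v0 ue ve uv H.
    have [|w] := @IVT _ th u v 0 uv _ H.
      apply/con_within => w; rewrite /= in_itv /= => /andP[uw wv].
      apply: (@con_sub _ _ `[0, e]).
        by move=> r /=; rewrite !in_itv /= => /andP[r1 r2]; apply/andP; split; clra.
      by apply: cth; clra.
    rewrite in_itv /= => /andP[uw wv] /eqP; apply/negP.
    by apply: thn; clra.
  have [st|ts] := leP s t.
    by apply: (W s t) => //; rewrite ge_min le_max (ltW tht) (ltW ths) orbT.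
  by apply: (W t s) => //; rewrite ?(ltW ts)// ge_min le_max (ltW tht) (ltW ths) orbT.
have [H|H] := pselect (forall t, 0 < t <= e -> 0 < th t); first by left.
right => t te; rewrite ltNge le_eqVlt negb_or eq_sym thn//=.
apply/negP => tht; apply: H => s se; rewrite ltNge le_eqVlt negb_or thn//=.
by apply/negP => ths; apply: (key t s).
Qed.

(** Each prong leaves [a] injectively, hence on one side. Two prongs on the same side take a common
    value, although distinct prongs are disjoint; so there are at most two. If there is only one,
    all points of the plaque near [y] lie on it, on both sides of [a]. *)
Lemma two_prongs : l = 2%N.
Proof.
have [j [a [jk m1 E H]]] := regular_plaque.
have P := prong_coordinate jk m1 E H.
have P' i : (i < l)%N -> exists (th : R -> R) (e : R), [/\ 0 < e < 1,
  th 0 = a, (forall t, 0 <= t <= e -> con `[0, e] th t) &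
    (forall t, 0 <= t <= e -> modulus (th t, b) < 1 /\
       sector d l i (t, 0) = sector c k j (th t, b)) /\
    (forall s t, 0 <= s <= e -> 0 <= t <= e -> th s = th t -> s = t)].
  move=> il; have [th [e [e01 th0 cth Eth]]] := P i il.
  exists th, e; split => //; split => // s t se te st.
  have /andP[e0 e1] := e01.
  have [s0 s1] : 0 <= s /\ s < 1 by split; clra.
  have [t0 t1] : 0 <= t /\ t < 1 by split; clra.
  have : psi l i (s, 0) = psi l i (t, 0).
    have [ms mt] : modulus (s, 0 : R) < 1 /\ modulus (t, 0 : R) < 1 by rewrite !modulus_axis.
    rewrite -(fc_disc fd (disc_psi i l0 ms)).2 -(fc_disc fd (disc_psi i l0 mt)).2.
    have [_ Es] := Eth s se; have [_ Et] := Eth t te.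
    by rewrite -/(sector d l i (s, 0)) -/(sector d l i (t, 0)) Es Et st.
  exact: psi_inj_axis.
have share i i' (th th' : R -> R) (e e' : R) : (i < i')%N -> (i' < l)%N ->
    0 < e < 1 -> 0 < e' < 1 ->
    (forall t, 0 <= t <= e -> modulus (th t, b) < 1 /\ sector d l i (t, 0) = sector c k j (th t, b)) ->
    (forall t, 0 <= t <= e' -> modulus (th' t, b) < 1 /\ sector d l i' (t, 0) = sector c k j (th' t, b)) ->
    forall t t', 0 < t <= e -> 0 < t' <= e' -> th t = th' t' -> False.
  move=> ii' i'l e01 e01' Eth Eth' t t' te te' tt.
  have [t0 t1] : 0 < t /\ t < 1 by split; clra.
  have [t'0 t'1] : 0 < t' /\ t' < 1 by split; clra.
  apply: (psi_axis_neq ii' i'l t0 t'0).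
  have [ms mt] : modulus (t, 0 : R) < 1 /\ modulus (t', 0 : R) < 1 by rewrite !modulus_axis// ltW.
  rewrite -(fc_disc fd (disc_psi i l0 ms)).2 -(fc_disc fd (disc_psi i' l0 mt)).2.
  have [|_ Et] := Eth t; first by clra.
  have [|_ Et'] := Eth' t'; first by clra.
  by rewrite -/(sector d l i (t, 0)) -/(sector d l i' (t', 0)) Et Et' tt.
have sgn (th : R -> R) (e : R) : 0 < e < 1 -> th 0 = a ->
    (forall t, 0 <= t <= e -> con `[0, e] th t) ->
    (forall s t, 0 <= s <= e -> 0 <= t <= e -> th s = th t -> s = t) ->
    (forall t, 0 < t <= e -> 0 < th t - a) \/ (forall t, 0 < t <= e -> th t - a < 0).
  move=> /andP[e0 _] th0 cth thi; apply: sign_injective => //.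
  - by rewrite th0 subrr.
  - move=> t te; apply/conP => f f0.
    have /conP/(_ f f0)[r r0 Hr] := cth t te.
    by exists r => // s se sr; rewrite opprB addrA subrK; exact: Hr.
  - by move=> s t se te /addIr; exact: thi.
have l1 : l != 1%N.
  apply/eqP => l1; have l1' : (0 < l)%N by rewrite l1.
  have [th [e [e01 th0 cth [Eth thi]]]] := P' _ l1'.
  have /andP[e0 e1] := e01.
  have crv : {for (0 : R), continuous (fun s : R => (a + s, b))}.
    apply: cont_pair; last exact: cont_cst.
    by apply: cont_add; [exact: cont_cst|exact: cvg_id].
  have a0 : (a + 0, b) = (a, b) by rewrite addr0.
  have small : \forall s \near (0 : R), modulus (a + s, b) < 1 /\
      (cdom d (sector c k j (a + s, b)) /\
       vlevel l (cmap d (sector c k j (a + s, b))) < 2 * e ^+ 2).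
    have N1 : \forall s \near (0 : R), modulus (a + s, b) < 1.
      have : {for (0 : R), continuous (fun s : R => modulus (a + s, b))}.
        apply: (@continuous_comp _ _ _ (fun s : R => (a + s, b)) modulus); first exact: crv.
        exact: modulus_cont.
      move=> /(_ [set x | x < 1]); apply; rewrite /= a0.
      by apply: open_nbhs_nbhs; split => //; exact: open_lt.
    have cy' : sector c k j (a, b) = y by rewrite /sector -E cmapK.
    have csec : {for (0 : R), continuous (fun s : R => sector c k j (a + s, b))}.
      apply: (@continuous_comp _ _ _ (fun s : R => psi k j (a + s, b)) (cinv c)).
        apply: (@continuous_comp _ _ _ (fun s : R => (a + s, b)) (psi k j)) => //.
        by apply: psi_cont => //=; exact: ltW.
      by apply: (cinv_for fc); rewrite a0; apply: disc_psi.
    have [dy d0 _ _] := fd.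
    have N2 : \forall s \near (0 : R), cdom d (sector c k j (a + s, b)).
      have := csec (cdom d); apply; rewrite /= a0 cy'.
      by apply: open_nbhs_nbhs; split => //; exact: cdom_open.
    have N3 : \forall s \near (0 : R), vlevel l (cmap d (sector c k j (a + s, b))) < 2 * e ^+ 2.
      have : {for (0 : R), continuous (fun s : R => vlevel l (cmap d (sector c k j (a + s, b))))}.
        apply: (@continuous_comp _ _ _ (fun s : R => cmap d (sector c k j (a + s, b))) (vlevel l)).
          apply: (@continuous_comp _ _ _ (fun s : R => sector c k j (a + s, b)) (cmap d)) => //.
          by apply: cmap_for; rewrite a0 cy'.
        exact: vlevel_cont.
      move=> /(_ [set x | x < 2 * e ^+ 2]); apply; rewrite /= a0 cy' d0.
      apply: open_nbhs_nbhs; split; first exact: open_lt.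
      have -> : (0 : R * R) = psi l 0 (0, 0) by rewrite (_ : (0, 0) = 0)// psi0.
      by rewrite /= vlevel_psi//= expr0n /= mulr0 mulr_gt0// exprn_gt0.
    by near=> s; split; [near: s|split; near: s].
  have [r r0 Hr] : exists2 r : R, 0 < r & forall s, `|s| < r -> modulus (a + s, b) < 1 /\
      (cdom d (sector c k j (a + s, b)) /\
       vlevel l (cmap d (sector c k j (a + s, b))) < 2 * e ^+ 2).
    have [r /= r0 Hr] := small; exists r => // s sr; apply: Hr => /=.
    by rewrite sub0r normrN.
  (* The plaque near [y] stays in the chart [d] at level 0, hence on its only prong; the bound on
     [vlevel] keeps the parameter on that prong at most [e]. *)
  have hit s : `|s| < r -> exists2 t, 0 <= t <= e & th t = a + s.
    move=> sr; have [ms [cs vs]] := Hr s sr.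
    have pth : path_component (R := R) (lf y `&` cdom d) y (sector c k j (a + s, b)).
      have y0 : y = sector c k j (a + 0 * s, b) by rewrite mul0r addr0 /sector -E cmapK.
      rewrite [X in path_component _ X]y0 -[s in X in path_component _ _ X]mul1r.
      have Hs (t : R) : 0 <= t <= 1 -> `|t * s| < r.
        move=> /andP[t0 t1]; rewrite normrM ger0_norm//.
        by apply: le_lt_trans sr; rewrite ler_piMl.
      apply: (pcI (g := fun t => sector c k j (a + t * s, b))) => // t t01.
        apply: con_for.
        apply: (@continuous_comp _ _ _ (fun t : R => psi k j (a + t * s, b)) (cinv c)).
          apply: (@continuous_comp _ _ _ (fun t : R => (a + t * s, b)) (psi k j)).
            apply: cont_pair; last exact: cont_cst.
            apply: cont_add; first exact: cont_cst.
            by apply: (cont_mul (f := id)); [exact: cvg_id|exact: cont_cst].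
          by apply: psi_cont => //=; exact: ltW.
        by apply: (cinv_for fc); apply: disc_psi => //; have [] := Hr _ (Hs t t01).
      split; last by have [_ []] := Hr _ (Hs t t01).
      have Q : model_plaque (hlevel k) (psi k j (a + 0 * s, b)) (psi k j (a + t * s, b)).
        have /andP[t0 t1] := t01.
        apply: (pcI (g := fun t => psi k j (a + t * s, b))) => // u /andP[u0 ut].
          apply: con_for.
          apply: (@continuous_comp _ _ _ (fun t : R => (a + t * s, b)) (psi k j)).
            apply: cont_pair; last exact: cont_cst.
            apply: cont_add; first exact: cont_cst.
            by apply: (cont_mul (f := id)); [exact: cvg_id|exact: cont_cst].
          by apply: psi_cont => //=; exact: ltW.
        split; last by rewrite /= !hlevel_psi//= ltW.
        apply: disc_psi => //; have [] := Hr (u * s) => //; apply: Hs.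
        by rewrite u0 (le_trans ut).
      have [_ [+ _]] := pc_mem (fc_leaf fc Q).
      by rewrite -/(sector c k j (a + 0 * s, b)) -y0.
    have hz : hlevel l (cmap d (sector c k j (a + s, b))) = 0.
      have := fc_lev fd pth; have [_ -> _ _] := fd => ->.
      have -> : (0 : R * R) = psi l 0 (0, 0) by rewrite (_ : (0, 0) = 0)// psi0.
      by rewrite hlevel_psi//= expr0n /= mulr0.
    have [i [[u v] [il uv Ew]]] := psi_surj (cmap d (sector c k j (a + s, b))) l0.
    have i0 : i = 0%N by move: il; rewrite l1 ltnS leqn0 => /eqP.
    subst i.
    have v0 : 0 <= v by case: uv => [/ltW|/= [->]].
    have vE : v = 0.
      by have := hlevel_psi 0%N l0 (w := (u, v)) v0; rewrite Ew hz /= => /esym/eqP; rewrite mulf_eq0 pnatr_eq0 /= sqrf_eq0 => /eqP.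
    subst v; case: uv => /= [|[_ u0]]; first by rewrite ltxx.
    have ue : u <= e.
      have := vlevel_psi 0%N l0 (w := (u, 0)) (lexx 0); rewrite Ew /= => uE.
      rewrite uE ltr_pM2l// in vs.
      by rewrite -(ler_pXn2r (n := 2)) ?nnegrE ?(ltW e0)//; exact: ltW.
    exists u; first by rewrite u0.
    have := Eth u; rewrite u0 ue => /(_ isT)[w1].
    rewrite /sector Ew -/(sector c k j (a + s, b)) cmapK// => /(congr1 (cmap c)).
    rewrite /sector (fc_disc fc (disc_psi j k0 w1)).2 (fc_disc fc (disc_psi j k0 ms)).2.
    by move=> /(psi_inj_fst k0 b0).
  have [r1 r2] : `|r / 2| < r /\ `|- (r / 2)| < r.
    by rewrite normrN gtr0_norm ?divr_gt0//; split; clra.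
  have [t te thE] := hit _ r1; have [t' te' thE'] := hit _ r2.
  have [] := sgn th e e01 th0 cth thi.
    move=> H'; have := H' t'; rewrite thE'.
    have : t' != 0 by apply/eqP => t'0; move: thE'; rewrite t'0 th0; clra.
    move=> t'0; have : 0 < t' by clra.
    clra.
  move=> H'; have := H' t; rewrite thE.
  have : t != 0 by apply/eqP => t'0; move: thE; rewrite t'0 th0; clra.
  move=> t'0; have : 0 < t by clra.
  clra.
have meet (th th' : R -> R) (e e' : R) : 0 < e -> 0 < e' -> th 0 = a -> th' 0 = a ->
    (forall t, 0 <= t <= e -> con `[0, e] th t) ->
    (forall t, 0 <= t <= e' -> con `[0, e'] th' t) ->
    (0 < th e - a /\ 0 < th' e' - a) \/ (th e - a < 0 /\ th' e' - a < 0) ->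
    exists t t', [/\ 0 < t <= e, 0 < t' <= e' & th t = th' t'].
  move=> e0 e'0 th0 th'0 cth cth' Hs.
  have IV (h : R -> R) (f v : R) : 0 < f -> h 0 = a -> (forall t, 0 <= t <= f -> con `[0, f] h t) ->
      v != a -> Num.min a (h f) <= v <= Num.max a (h f) -> exists2 t, 0 < t <= f & h t = v.
    move=> f0 h0 ch va Hv.
    have [||t] := @IVT _ h 0 f v (ltW f0) _; rewrite ?h0//.
      by apply/con_within => t; rewrite /= in_itv /=; exact: ch.
    rewrite in_itv /= => /andP[t0 tf] ht; exists t => //.
    rewrite tf andbT lt_neqAle t0 andbT; apply/eqP => t0'.
    by move: va; rewrite -ht -t0' h0 eqxx.
  case: Hs => -[h1 h2].
    pose v := Num.min (th e) (th' e').
    have va : a < v by rewrite lt_min; apply/andP; split; clra.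
    have [||t te tv] := IV th e v e0 th0 cth; first by rewrite gt_eqF.
      by apply/andP; split; [rewrite ge_min (ltW va)|rewrite le_max /v !ge_min !lexx !orbT].
    have [||t' te' tv'] := IV th' e' v e'0 th'0 cth'; first by rewrite gt_eqF.
      by apply/andP; split; [rewrite ge_min (ltW va)|rewrite le_max /v !ge_min !lexx !orbT].
    by exists t, t'; split => //; rewrite tv.
  pose v := Num.max (th e) (th' e').
  have va : v < a by rewrite gt_max; apply/andP; split; clra.
  have [||t te tv] := IV th e v e0 th0 cth; first by rewrite lt_eqF.
    by apply/andP; split; [rewrite ge_min /v !le_max !lexx !orbT|rewrite le_max (ltW va)].
  have [||t' te' tv'] := IV th' e' v e'0 th'0 cth'; first by rewrite lt_eqF.
    by apply/andP; split; [rewrite ge_min /v !le_max !lexx !orbT|rewrite le_max (ltW va)].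
  by exists t, t'; split => //; rewrite tv.
(* Among three prongs two are on the same side of [a]. *)
have l3 : (l <= 2)%N.
  rewrite leqNgt; apply/negP => l3.
  have [th0 [e0 [e01 z0 c0 [E0 i0]]]] := P' 0%N (ltn_trans (isT : (0 < 2)%N) l3).
  have [th1 [e1 [e11 z1 c1 [E1 i1]]]] := P' 1%N (ltn_trans (isT : (1 < 2)%N) l3).
  have [th2 [e2 [e21 z2 c2 [E2 i2]]]] := P' 2%N l3.
  have pos (e : R) : 0 < e < 1 -> 0 < e /\ (0 < e <= e) by move=> /andP[-> _]; rewrite lexx.
  have [p0 p0'] := pos _ e01; have [p1 p1'] := pos _ e11; have [p2 p2'] := pos _ e21.
  have := share 0%N 1%N th0 th1 e0 e1 isT (ltn_trans (isT : (1 < 2)%N) l3) e01 e11 E0 E1.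
  have := share 0%N 2%N th0 th2 e0 e2 isT l3 e01 e21 E0 E2.
  have := share 1%N 2%N th1 th2 e1 e2 isT l3 e11 e21 E1 E2.
  move=> s12 s02 s01.
  have m01 := meet th0 th1 e0 e1 p0 p1 z0 z1 c0 c1.
  have m02 := meet th0 th2 e0 e2 p0 p2 z0 z2 c0 c2.
  have m12 := meet th1 th2 e1 e2 p1 p2 z1 z2 c1 c2.
  have no01 : ~ ((0 < th0 e0 - a /\ 0 < th1 e1 - a) \/ (th0 e0 - a < 0 /\ th1 e1 - a < 0)).
    by move=> /m01[t [t' [te te' tt]]]; exact: (s01 t t').
  have no02 : ~ ((0 < th0 e0 - a /\ 0 < th2 e2 - a) \/ (th0 e0 - a < 0 /\ th2 e2 - a < 0)).
    by move=> /m02[t [t' [te te' tt]]]; exact: (s02 t t').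
  have no12 : ~ ((0 < th1 e1 - a /\ 0 < th2 e2 - a) \/ (th1 e1 - a < 0 /\ th2 e2 - a < 0)).
    by move=> /m12[t [t' [te te' tt]]]; exact: (s12 t t').
  have := sgn th0 e0 e01 z0 c0 i0; have := sgn th1 e1 e11 z1 c1 i1.
  have := sgn th2 e2 e21 z2 c2 i2.
  by case=> [/(_ _ p2')|/(_ _ p2')] g2; case=> [/(_ _ p1')|/(_ _ p1')] g1; case=> [/(_ _ p0')|/(_ _ p0')] g0; tauto.
by case: l l1 l3 l0 => [|[|[|?]]].
Unshelve. all: by end_near. Qed.

End ProngCount.

Lemma prongs_hlevel (F : foliation S) c x y : foliated_chart (leaf F) (hlevel (prongs F x)) c x ->
  cdom c y -> 0 < hlevel (prongs F x) (cmap c y) -> prongs F y = 2%N.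
Proof.
move=> fc cy h0; have [d fd] := leaf_chart F y.
set h := hlevel _ _ in h0.
have b0 : 0 < Num.sqrt (h / 2) by rewrite sqrtr_gt0 divr_gt0.
apply: (two_prongs (prongs_gt0 F x) (prongs_gt0 F y) fc cy fd b0).
by rewrite sqr_sqrtr ?divr_ge0 ?ltW// mulrC divfK.
Qed.

(** The two levels add up to 2 |z| ^ k, so away from the centre one of them is positive: [y] is off
    the prongs of [F] or off those of [G], and [F] and [G] have the same number of prongs at [y]. *)
Lemma prongs_isolated (F G : foliation S) c x y : transverse F G ->
  foliated_chart (leaf F) (hlevel (prongs F x)) c x ->
  foliated_chart (leaf G) (vlevel (prongs F x)) c x ->
  cdom c y -> y <> x -> prongs F y = 2%N.
Proof.
move=> tr f1 f2 cy yx.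
have m0 : 0 < modulus (cmap c y).
  rewrite lt_neqAle modulus_ge0 andbT eq_sym; apply/eqP => /modulus_eq0 y0; apply: yx.
  by have [cx x0 _ _] := f1; rewrite -(cmapK cy) -(cmapK cx) y0 x0.
have hv := hvlevel (prongs F x) (cmap c y).
have hv0 : 0 < 2 * modulus (cmap c y) ^+ (prongs F x) by rewrite mulr_gt0// exprn_gt0.
have [h0|h0] := ltP 0 (hlevel (prongs F x) (cmap c y)).
  exact: (prongs_hlevel f1).
have [-> _] := tr y; have E := (tr x).1.
have [c' [cd cm H]] := rotchart (pi / (prongs F x)%:R) f1.
have f2' : foliated_chart (leaf G) (hlevel (prongs G x)) c' x.
  by apply: (H _ _ _ _ f2) => z; rewrite -E hlevel_rot// prongs_gt0.
apply: (prongs_hlevel f2'); first by rewrite cd.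
rewrite -E cm /= hlevel_rot ?prongs_gt0//; clra.
Qed.

Lemma finite_singular (F G : foliation S) : transverse F G -> finite_set (singular F).
Proof.
move=> tr; apply: finite_discrete; first exact: surf_compact.
move=> z; have [E [c f1 f2]] := tr z; rewrite -E in f2.
have [cz _ _ _] := f1.
exists (cdom c).
  by apply: open_nbhs_nbhs; split => //; exact: cdom_open.
have H a : singular F a -> cdom c a -> a = z.
  move=> Fa ca; apply: contrapT => az; apply: Fa; exact: (prongs_isolated tr f1 f2).
by move=> a b Fa Fb ca cb; rewrite (H a)// (H b).
Qed.

End Charts.

(** * Boxes and sectors *)

Lemma near_itv {R : realType} (i s t x : R) : - i < s - t -> s <= x <= t -> t - i <= x <= t + i.
Proof. clra. Qed.

Lemma near_itv2 {R : realType} (i s t x : R) : s - t < i -> t <= x <= s -> t - i <= x <= t + i.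
Proof. clra. Qed.

Lemma near_lt {R : realType} {T : topologicalType} (f : T -> R) a x :
  {for x, continuous f} -> f x < a -> \forall y \near x, f y < a.
Proof.
by move=> cf fx; apply: (cf [set z | z < a]); apply: open_nbhs_nbhs; split => //; exact: open_lt.
Qed.

Lemma near_norm_lt {R : realType} {T : topologicalType} (f : T -> R) a x :
  {for x, continuous f} -> `|f x| < a -> \forall y \near x, `|f y| < a.
Proof.
move=> cf fx; apply: near_lt => //; apply: (cont_comp (h := @Num.norm _ R)) => //.
exact: norm_continuous.
Qed.

Lemma nbhs_fst_lt {R : realType} (w : R * R) (r : R) : `|w.1| < r ->
  nbhs w [set z : R * R | `|z.1| < r].
Proof. exact: (near_norm_lt (@cont_fst R w)). Qed.

Lemma nbhs_snd_lt {R : realType} (w : R * R) (r : R) : `|w.2| < r ->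
  nbhs w [set z : R * R | `|z.2| < r].
Proof. exact: (near_norm_lt (@cont_snd R w)). Qed.

Lemma image_reparam {R : realType} (T : Type) (h : R -> T) (V D : R -> R) (e r u u' : R) :
  (forall u u', - e < u -> u < u' -> u' < e -> V u < V u') ->
  (forall a a', - r < a -> a < a' -> a' < r -> D a < D a') ->
  (forall u, `|u| < e -> `|V u| < r /\ D (V u) = u) ->
  (forall a, `|a| < r -> V (D a) = a) ->
  - e < u -> u < u' -> u' < e ->
  (fun s => h (V s)) @` `[u, u'] = h @` `[V u, V u'].
Proof.
move=> Vlt Dlt HV HD ue uu ue'.
have ul : `|u| < e by rewrite ltr_norml; clra.
have ul' : `|u'| < e by rewrite ltr_norml; clra.
have [+ DV] := HV _ ul; rewrite ltr_norml => Vr.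
have [+ DV'] := HV _ ul'; rewrite ltr_norml => Vr'.
apply/seteqP; split => _ [a /= + <-]; rewrite in_itv /= => /andP[h1 h2].
  exists (V a) => //; rewrite in_itv /=; apply/andP; split.
    by move: h1; rewrite le_eqVlt => /orP[/eqP->//|h1]; apply/ltW/Vlt; clra.
  by move: h2; rewrite le_eqVlt => /orP[/eqP->//|h2]; apply/ltW/Vlt; clra.
have ar : `|a| < r by rewrite ltr_norml; clra.
exists (D a); last by rewrite HD.
rewrite in_itv /= -{1}DV -DV'; apply/andP; split.
  by move: h1; rewrite le_eqVlt => /orP[/eqP->//|h1]; apply/ltW/Dlt; clra.
by move: h2; rewrite le_eqVlt => /orP[/eqP->//|h2]; apply/ltW/Dlt; clra.
Qed.

(** * Parametrizing an interval by a measure *)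

Section MeasureParam.
Context {R : realType} (m : {measure set (measurableTypeR R) -> \bar R}).
Hypothesis (mfin : (m (uitv R) < +oo)%E).
Hypothesis (m0 : forall t : R, uitv R t -> m [set t] = 0%E).
Hypothesis (mpos : forall a b : R, 0 <= a -> a < b -> b <= 1 -> (0 < m `]a, b[%classic)%E).

Let C (t : R) : R := fine (m `[0, t]%classic).

Lemma measure_sub_fin (A : set (measurableTypeR R)) : measurable A -> A `<=` uitv R ->
  m A \is a fin_num.
Proof.
move=> mA AI; rewrite ge0_fin_numE//; apply: le_lt_trans mfin.
by apply: le_measure; rewrite ?inE//; exact: measurable_itv.
Qed.

Lemma measure_itvcc (s t : R) : 0 <= s -> s <= t -> t <= 1 ->
  m `[s, t]%classic = (C t - C s)%:E.
Proof.
move=> s0 st t1.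
have f0s : m `[0, s]%classic \is a fin_num.
  apply: measure_sub_fin; first exact: measurable_itv.
  by move=> x /=; rewrite /uitv /= !in_itv /= => /andP[-> xs]; clra.
have f0t : m `[0, t]%classic \is a fin_num.
  apply: measure_sub_fin; first exact: measurable_itv.
  by move=> x /=; rewrite /uitv /= !in_itv /= => /andP[-> xs]; clra.
have E1 : m `[0, t]%classic = (m `[0%R, s]%classic + m `]s, t]%classic)%E.
  rewrite -measureU//; try exact: measurable_itv.
    by congr (m _); rewrite (@itv_bndbnd_setU _ _ _ (BRight s))// bnd_simp.
  apply/seteqP; split => x //=; rewrite !in_itv /= => -[/andP[_ xs] /andP[sx _]].
  by move: (lt_le_trans sx xs); rewrite ltxx.
have E2 : m `[s, t]%classic = m `]s, t]%classic.
  have -> : `[s, t]%classic = [set s] `|` `]s, t]%classic by rewrite setU1itv// bnd_simp.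
  have Ms : m [set s] = 0%E by apply: m0; apply/uitvE; clra.
  rewrite measureU; [|exact: measurable_set1|exact: measurable_itv|].
    by rewrite [X in (X + _)%E]Ms add0e.
  by apply/seteqP; split => x //= -[->]; rewrite in_itv /= ltxx.
have f2 : m `]s, t]%classic \is a fin_num.
  apply: measure_sub_fin; first exact: measurable_itv.
  by move=> x /=; rewrite /uitv /= !in_itv /= => /andP[h1 h2]; clra.
rewrite E2 /C E1 fineD// addrAC subrr add0r fineK//.
Qed.

Lemma cumul_lt (s t : R) : 0 <= s -> s < t -> t <= 1 -> C s < C t.
Proof.
move=> s0 st t1; rewrite -subr_gt0 -lte_fin -measure_itvcc ?(ltW st)//.
apply: lt_le_trans (mpos s0 st t1) _; apply: le_measure; rewrite ?inE; try exact: measurable_itv.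
by move=> x /=; rewrite !in_itv /= => /andP[/ltW-> /ltW->].
Qed.

(** The intervals [Fn n] shrink to {t}, so their measures tend to m {t} = 0, and they bound the
    oscillation of [C] near t. *)
Lemma cumul_cont (t : R) : 0 <= t <= 1 -> con `[0, 1] C t.
Proof.
move=> t01; apply/conP => e e0.
pose Fn (n : nat) : set (measurableTypeR R) := `[t - n.+1%:R^-1, t + n.+1%:R^-1] `&` `[0, 1].
have mF n : measurable (Fn n) by apply: measurableI; exact: measurable_itv.
have capF : \bigcap_n Fn n = [set t].
  apply/seteqP; split => [x Fx|x ->]; last first.
    move=> n _; split => /=; last by rewrite in_itv.
    have i0 : (0 : R) < n.+1%:R^-1 by rewrite invr_gt0 ltr0n.
    by rewrite in_itv /= gerBl lerDl (ltW i0).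
  apply/eqP; rewrite eq_le; apply/andP; split; apply/ler_addgt0Pr => d d0.
    have [n _ /= Hn] := near_infty_natSinv_lt (PosNum d0).
    have [+ _] := Fx n I; rewrite /= in_itv /= => /andP[_].
    by move=> h; apply: (le_trans h); rewrite lerD2l ltW//; exact: (Hn n (leqnn n)).
  have [n _ /= Hn] := near_infty_natSinv_lt (PosNum d0).
  have [+ _] := Fx n I; rewrite /= in_itv /= => /andP[+ _].
  rewrite lerBlDr => h; apply: (le_trans h); rewrite lerD2l ltW//; exact: (Hn n (leqnn n)).
have : m \o Fn @ \oo --> m (\bigcap_n Fn n).
  apply: nonincreasing_cvg_mu => //.
  - by rewrite -ge0_fin_numE//; apply: measure_sub_fin => // x [].
  - by rewrite capF.
  - move=> i j ij; rewrite subsetEset; apply: setSI => x /=; rewrite !in_itv /=.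
    have h : j.+1%:R^-1 <= i.+1%:R^-1 :> R by rewrite lef_pV2 ?posrE// ler_nat.
    move=> /andP[h1 h2]; apply/andP; split.
      by apply: le_trans h1; rewrite lerD2l lerN2.
    by apply: le_trans h2 _; rewrite lerD2l.
rewrite capF m0 ?uitvE// => /fine_cvgP[_] /cvgrPdist_lt/(_ e e0)[n _ Hn].
have := Hn n (leqnn n); rewrite /= sub0r normrN => mFn.
exists n.+1%:R^-1 => // s; rewrite /= in_itv /= => s01 sd.
have key (a b : R) : 0 <= a -> a <= b -> b <= 1 -> `[a, b]%classic `<=` Fn n -> C b - C a < e.
  move=> a0 ab b1 sub; rewrite -lte_fin -measure_itvcc//.
  apply: (@le_lt_trans _ _ (m (Fn n))).
    by apply: le_measure; rewrite ?inE//; exact: measurable_itv.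
  rewrite -(@fineK _ (m (Fn n))); last by apply: measure_sub_fin => // x [].
  by rewrite lte_fin (le_lt_trans _ mFn)// ler_norm.
have mono (a b : R) : 0 <= a -> a <= b -> b <= 1 -> C a <= C b.
  by move=> a0; rewrite le_eqVlt => /orP[/eqP->//|ab b1]; apply/ltW/cumul_lt.
move: sd; rewrite ltr_norml => /andP[sd1 sd2].
have [st|ts] := leP s t.
  rewrite ler0_norm ?opprB; last by rewrite subr_le0; apply: mono => //; clra.
  apply: key => //; try clra.
  have sub (x : R) : s <= x <= t -> Fn n x.
    move=> xst; split; rewrite /= in_itv /=; last clra.
    exact: (near_itv sd1).
  by move=> x /=; rewrite in_itv /=; exact: sub.
rewrite ger0_norm; last by rewrite subr_ge0; apply: mono => //; clra.
apply: key => //; try clra.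
have sub (x : R) : t <= x <= s -> Fn n x.
  move=> xst; split; rewrite /= in_itv /=; last clra.
  exact: (near_itv2 sd2).
by move=> x /=; rewrite in_itv /=; exact: sub.
Qed.

(** [D] is the distribution function of [m]: continuous as there are no atoms, strictly increasing
    by full support, hence a homeomorphism onto [0, T], with inverse [V]. *)
Lemma measure_param : exists (T : R) (V D : R -> R),
  [/\ 0 < T,
      forall t, 0 <= t <= T -> 0 <= V t <= 1 /\ D (V t) = t,
      forall a, 0 <= a <= 1 -> 0 <= D a <= T /\ V (D a) = a,
      (forall t, 0 <= t <= T -> con `[0, T] V t) /\ (forall a, 0 <= a <= 1 -> con `[0, 1] D a) &
      (forall a b, 0 <= a -> a < b -> b <= 1 -> D a < D b) /\
      (forall a b, 0 <= a -> a < b -> b <= 1 -> m `[a, b]%classic = (D b - D a)%:E)].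
Proof.
have C0 : C 0 = 0 by rewrite /C set_itv1 m0 ?uitvE ?lexx ?ler01.
have C1 : 0 < C 1 by rewrite -C0; apply: cumul_lt.
have mono (a b : R) : 0 <= a -> a <= b -> b <= 1 -> C a <= C b.
  by move=> a0; rewrite le_eqVlt => /orP[/eqP->//|ab b1]; apply/ltW/cumul_lt.
have surj t : 0 <= t <= C 1 -> exists a, 0 <= a <= 1 /\ C a = t.
  move=> t1; have [||a] := @IVT _ C 0 1 t ler01.
  - by apply/con_within => a; rewrite /= in_itv /=; exact: cumul_cont.
  - by rewrite C0 ge_min le_max; case/andP: t1 => -> ->; rewrite orbT.
  - by rewrite in_itv /= => a01 Ca; exists a.
pose V t := xget 0 [set a | 0 <= a <= 1 /\ C a = t].
have VP t : 0 <= t <= C 1 -> 0 <= V t <= 1 /\ C (V t) = t.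
  by move=> /surj[a Ha]; rewrite /V; case: xgetP => [b _ []//|/(_ a)].
have inj a b : 0 <= a <= 1 -> 0 <= b <= 1 -> C a = C b -> a = b.
  move=> /andP[a0 a1] /andP[b0 b1] ab; case: (ltrgtP a b) => // h.
    by have := cumul_lt a0 h b1; rewrite ab ltxx.
  by have := cumul_lt b0 h a1; rewrite ab ltxx.
have VK a : 0 <= a <= 1 -> V (C a) = a.
  move=> a01; have /andP[a0 a1] := a01.
  have [|h1 h2] := VP (C a); first by rewrite -{1}C0 !mono.
  exact: inj.
exists (C 1), V, C; split => //.
- by move=> a /andP[a0 a1]; rewrite VK ?a0// -{1}C0 !mono.
- split; last exact: cumul_cont.
  move=> t t1.
  suff : {within `[C 0, C 1], continuous V}.
    by rewrite C0 => /con_within; apply; rewrite /= in_itv.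
  apply: (@segment_can_le_continuous _ 0 1 C V) => //.
    by apply/con_within => a; rewrite /= in_itv /=; exact: cumul_cont.
- split; first exact: cumul_lt.
  by move=> a b a0 ab b1; rewrite measure_itvcc// ltW.
Qed.

End MeasureParam.

(** * Boxes at regular points and half-boxes at singular points, normalized by the measure *)

Section Boxes.
Context {R : realType} {S : surface R} (F : foliation S) (G : measured_foliation S).
Hypothesis tr : transverse F G.
Variable Sg : set S.
Hypothesis finSg : finite_set Sg.
Hypothesis regular : forall x, ~ Sg x -> prongs F x = 2%N.
Implicit Types (c : chart R S) (x y : S).

Lemma leaf_sym (H : foliation S) x y : leaf H x y -> leaf H y x.
Proof. by move=> xy; rewrite (leaf_eq xy); exact: leaf_refl. Qed.

Lemma leaf_trans (H : foliation S) x y z : leaf H x y -> leaf H y z -> leaf H x z.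
Proof. by move=> xy yz; rewrite -(leaf_eq xy). Qed.

Lemma nbhs_regular x : ~ Sg x -> nbhs x (~` Sg).
Proof.
move=> nx; apply: open_nbhs_nbhs; split => //; apply: closed_openC.
by apply: compact_closed; [exact: surf_hausdorff|exact: finite_compact].
Qed.

Lemma fc_snd lf c x y y' : foliated_chart lf (hlevel 2) c x ->
  path_component (R := R) (lf y `&` cdom c) y y' -> (cmap c y').2 = (cmap c y).2.
Proof.
move=> fc p; have /pcP[g [cg g0 g1 Ag]] := fc_plaque fc p.
rewrite -g0 -g1; apply: (con_sqr_constant (f := fun t => (g t).2) (c := (cmap c y).2 ^+ 2)) => //.
  move=> t t01; apply: (@con_comp R _ _ `[0, 1] g snd t); first exact: cg.
  exact: cont_snd.
by move=> t /Ag[_ /=]; rewrite !hlevel2 => /mulfI ->.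
Qed.

Lemma fc_fst lf c x y y' : foliated_chart lf (vlevel 2) c x ->
  path_component (R := R) (lf y `&` cdom c) y y' -> (cmap c y').1 = (cmap c y).1.
Proof.
move=> fc p; have /pcP[g [cg g0 g1 Ag]] := fc_plaque fc p.
rewrite -g0 -g1; apply: (con_sqr_constant (f := fun t => (g t).1) (c := (cmap c y).1 ^+ 2)) => //.
  move=> t t01; apply: (@con_comp R _ _ `[0, 1] g fst t); first exact: cg.
  exact: cont_fst.
by move=> t /Ag[_ /=]; rewrite !vlevel2 => /mulfI ->.
Qed.

Definition harc (a b : R) (g : R -> S) : Prop :=
  [/\ a < b, forall t, a <= t <= b -> con `[a, b] g t,
      forall s t, a <= s <= b -> a <= t <= b -> g s = g t -> s = t,
      forall t, a <= t <= b -> leaf F (g a) (g t) &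
      forall t, a <= t <= b -> ~ Sg (g t)].

Lemma regular_chart x : ~ Sg x -> exists c,
  foliated_chart (leaf F) (hlevel 2) c x /\ foliated_chart (leaf G) (vlevel 2) c x.
Proof.
by move=> /regular p2; have [E [c f1 f2]] := tr x; exists c; move: f1 f2; rewrite -E p2.
Qed.

(** Turn the chart by a right angle, so that [G] is horizontal. Two nearby points of the arc with
    the same coordinate transverse to [G] also lie on one plaque of [F], so both coordinates agree
    and the points are equal. *)
Lemma harc_transverse g : harc 0 1 g -> transverse_arc G g.
Proof.
move=> [_ cg gi gl gr]; split.
  by apply: embeds_uitv => //; exact: surf_hausdorff.
move=> t /uitvE t01.
have [c [f1 f2]] := regular_chart (gr t t01).
have [c' [cd cm H]] := rotchart (pi / 2%:R) f1.
have f2' : foliated_chart (leaf G) (hlevel 2) c' (g t).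
  by apply: (H _ _ _ _ f2) => z; rewrite hlevel_rot.
exists c' => //.
have [cx _ _ _] := f1.
have [e e0 He] := cg t t01 (cdom c) (open_nbhs_nbhs (conj (cdom_open c) cx)).
exists e => //; rewrite cd; split.
  by move=> s su; apply: He.
move=> s s' /uitvE s01 /uitvE s01' se se' E.
wlog ss : s s' s01 s01' se se' E / s <= s'.
  move=> W; have [|/ltW] := leP s s'; first exact: W.
  by move=> h; apply/esym/W.
have cs : cdom c (g s) by apply: He.
have cs' : cdom c (g s') by apply: He.
have p : path_component (R := R) (leaf F (g s) `&` cdom c) (g s) (g s').
  apply: pcI => // r /andP[r1 r2].
    apply: (@con_sub _ _ `[0, 1]); last by apply: cg; clra.
    by move=> q /=; rewrite !in_itv /=; clra.
  split; last first.
    apply: He; first by rewrite /= in_itv /=; clra.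
    by move: se se'; rewrite !ltr_norml; clra.
  by apply: (@leaf_trans _ _ (g 0)); [apply: leaf_sym|]; apply: gl; clra.
apply: gi => //; rewrite -(cmapK cs) -(cmapK cs').
have E2 := fc_snd f1 p.
move: E; rewrite cm /= /rot /= cos_pihalf sin_pihalf !mulr1 !mulr0 !addr0 => E1.
by congr (cinv c _); rewrite [LHS]surjective_pairing [RHS]surjective_pairing E1 E2.
Qed.

Lemma image_affine (T : Type) (g : R -> T) (a b s t : R) : a < b -> s <= t ->
  g @` `[a + (b - a) * s, a + (b - a) * t] = (g \o (fun r => a + (b - a) * r)) @` `[s, t].
Proof.
move=> ab st; have d0 : 0 < b - a by rewrite subr_gt0.
apply/seteqP; split => [_ [r /= + <-]|_ [r /= + <-]]; rewrite in_itv /= => /andP[r1 r2].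
  exists ((r - a) / (b - a)); last by congr g; field; rewrite gt_eqF.
  rewrite in_itv /= ler_pdivlMr// ler_pdivrMr//; clra.
exists (a + (b - a) * r) => //; rewrite in_itv /= !lerD2l !ler_pM2l//.
by rewrite r1.
Qed.

Lemma harc_affine a b g : harc a b g -> harc 0 1 (g \o (fun r => a + (b - a) * r)).
Proof.
move=> [ab cg gi gl gr]; have d0 : 0 < b - a by rewrite subr_gt0.
have H (t : R) : 0 <= t <= 1 -> a <= a + (b - a) * t <= b.
  move=> /andP[t0 t1]; rewrite lerDl mulr_ge0 ?(ltW d0)//=.
  by rewrite -lerBrDl ler_piMr ?(ltW d0).
split => //.
- move=> t t01; apply: (@con_compR _ _ `[a, b]).
  + by move=> s /=; rewrite !in_itv /=; apply: H.
  + exact: con_affine.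
  + by apply: cg; exact: H.
- move=> s t s01 t01 /= E.
  have := gi _ _ (H s s01) (H t t01) E => /addrI/mulfI; apply; by rewrite gt_eqF.
- by move=> t t01 /=; rewrite mulr0 addr0; apply: gl; exact: H.
- by move=> t t01 /=; apply: gr; exact: H.
Qed.

Lemma arc_param a b g : harc a b g -> exists (T : R) (V D : R -> R),
  [/\ 0 < T,
      forall t, 0 <= t <= T -> a <= V t <= b /\ D (V t) = t,
      forall r, a <= r <= b -> 0 <= D r <= T /\ V (D r) = r,
      (forall t, 0 <= t <= T -> con `[0, T] V t) /\ (forall r, a <= r <= b -> con `[a, b] D r) &
      (forall r s, a <= r -> r < s -> s <= b -> D r < D s) /\
      (forall r s, a <= r -> r < s -> s <= b -> mu G (g @` `[r, s]) = (D s - D r)%:E)].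
Proof.
move=> hg; have [ab cg gi gl gr] := hg; have d0 : 0 < b - a by rewrite subr_gt0.
have [m [mE mfin m0 mpos]] := mu_measure (harc_transverse (harc_affine hg)).
have [T [V [D [T0 HV HD [cV cD] [Dlt mD]]]]] := measure_param mfin m0 mpos.
pose A r := (r - a) / (b - a).
have AE r : a + (b - a) * A r = r by rewrite /A; field; rewrite gt_eqF.
have A01 r : a <= r <= b -> 0 <= A r <= 1.
  by move=> ?; rewrite /A ler_pdivlMr// ler_pdivrMr//; clra.
have Alt r s : r < s -> A r < A s by move=> rs; rewrite ltr_pM2r ?invr_gt0// ltrD2r.
have AK r : A (a + (b - a) * r) = r by rewrite /A; field; rewrite gt_eqF.
exists T, (fun t => a + (b - a) * V t), (fun r => D (A r)); split => //.
- move=> t t01; have [/andP[h1 h2] h3] := HV t t01; rewrite AK; split => //.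
  rewrite lerDl mulr_ge0 ?(ltW d0)//=.
  by rewrite -lerBrDl ler_piMr ?(ltW d0).
- by move=> r rab; have [h1 h2] := HD (A r) (A01 r rab); rewrite h2 AE.
- split.
    move=> t t01; apply: (@con_compR _ _ setT `[0, T] V (fun r => a + (b - a) * r)) => //.
      exact: cV.
    exact: con_affine.
  move=> r rab; apply: (@con_compR _ _ `[0, 1] `[a, b] A D).
  + by move=> s /=; rewrite !in_itv /=; exact: A01.
  + apply: (@con_eq _ _ _ (fun r => - a / (b - a) + (b - a)^-1 * r) _ _ 1) => //.
    * by move=> s _ _; rewrite /A; field; rewrite gt_eqF.
    * exact: con_affine.
  + by apply: cD; exact: A01.
- split.
    move=> r s ar rs sb; have /andP[r0 r1] := A01 r ltac:(clra).
    have /andP[s0 s1] := A01 s ltac:(clra).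
    by apply: Dlt => //; exact: Alt.
  move=> r s ar rs sb; have /andP[r0 r1] := A01 r ltac:(clra).
  have /andP[s0 s1] := A01 s ltac:(clra).
  rewrite -{1}(AE r) -{1}(AE s) image_affine ?ltW ?Alt//.
  rewrite mE; [|exact: measurable_itv|].
    by rewrite mD// Alt.
  by move=> x /=; rewrite /uitv /= !in_itv /= => /andP[h1 h2]; clra.
Qed.

(** The measure counted from the middle of the arc. The radius [e] is the smaller of the measures of
    the two halves; on open intervals continuity along a set becomes plain continuity. *)
Lemma arc_center (r : R) g : 0 < r -> harc (- r) r g -> exists (e : R) (V D : R -> R),
  [/\ 0 < e, V 0 = 0,
      forall u, `|u| < e -> [/\ `|V u| < r, D (V u) = u & {for u, continuous V}],
      forall a, `|a| < r -> V (D a) = a /\ {for a, continuous D} &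
      (forall u u', - e < u -> u < u' -> u' < e -> V u < V u') /\
      ((forall a a', - r < a -> a < a' -> a' < r -> D a < D a') /\
       (forall a a', - r < a -> a < a' -> a' < r -> mu G (g @` `[a, a']) = (D a' - D a)%:E))].
Proof.
move=> r0 hg; have [T [V [D [T0 HV HD [cV cD] [Dlt mD]]]]] := arc_param hg.
have [/andP[h1 h2] _] := HD (- r) ltac:(clra).
have [/andP[h3 h4] _] := HD r ltac:(clra).
have l1 := Dlt (- r) 0 (lexx _) ltac:(clra) ltac:(clra).
have l2 := Dlt 0 r ltac:(clra) ltac:(clra) (lexx _).
pose e := Num.min (D 0) (T - D 0).
have e0 : 0 < e by rewrite lt_min; clra.
have eD : e <= D 0 by rewrite ge_min lexx.
have eT : e <= T - D 0 by rewrite ge_min lexx orbT.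
have [V0a V0b] := HV 0 ltac:(clra); have [VTa VTb] := HV T ltac:(clra).
have Vin t : 0 < t < T -> - r < V t < r.
  move=> tT; have [V1 V2] := HV t ltac:(clra).
  apply/andP; split; rewrite lt_neqAle; apply/andP; split.
  - apply/eqP => E; rewrite -E in V2.
    have [h|h] : - r = V 0 \/ - r < V 0.
      by move: V0a => /andP[+ _]; rewrite le_eqVlt => /orP[/eqP->|]; [left|right].
      by rewrite -h in V0b; clra.
    by have := Dlt (- r) (V 0) (lexx _) h ltac:(clra); clra.
  - by case/andP: V1.
  - apply/eqP => E; rewrite E in V2.
    have [h|h] : V T = r \/ V T < r.
      by move: VTa => /andP[_]; rewrite le_eqVlt => /orP[/eqP->|]; [left|right].
      by rewrite h in VTb; clra.
    by have := Dlt (V T) r ltac:(clra) h (lexx _); clra.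
  - by case/andP: V1.
have itv0 (a b t : R) : a < t < b -> 0 < Num.min (t - a) (b - t) by rewrite lt_min; clra.
exists e, (fun u => V (u + D 0)), (fun a => D a - D 0); split => //.
- by rewrite add0r; have [] := HD 0 ltac:(clra).
- move=> u; rewrite ltr_norml => ue.
  have ut : 0 < u + D 0 < T by clra.
  have [V1 V2] := HV (u + D 0) ltac:(clra).
  split; first by rewrite ltr_norml; exact: Vin.
    by rewrite V2 addrK.
  apply: (@continuous_comp _ _ _ (fun u => u + D 0) V).
    by apply: cont_add; [exact: cvg_id|exact: cont_cst].
  apply: (for_con (I := `[0, T]) (e := Num.min (u + D 0 - 0) (T - (u + D 0)))).
  + exact: itv0.
  + by move=> s; rewrite lt_min ltr_norml => /andP[s1]; rewrite ltr_norml /= in_itv /=; clra.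
  + by apply: cV; clra.
- move=> a; rewrite ltr_norml => ar; split; first by rewrite subrK; have [] := HD a ltac:(clra).
  apply: cont_sub; last exact: cont_cst.
  apply: (for_con (I := `[- r, r]) (e := Num.min (a - (- r)) (r - a))).
  + exact: itv0.
  + by move=> s; rewrite lt_min ltr_norml => /andP[s1]; rewrite ltr_norml /= in_itv /=; clra.
  + by apply: cD; clra.
- split; last split.
  + move=> u u' ue uu ue'; rewrite ltNge le_eqVlt; apply/negP => /orP[/eqP E|E].
      have [_ D1] := HV (u + D 0) ltac:(clra); have [_ D2] := HV (u' + D 0) ltac:(clra).
      by rewrite E in D2; clra.
    have [V1 D1] := HV (u + D 0) ltac:(clra); have [V2 D2] := HV (u' + D 0) ltac:(clra).
    by have := Dlt (V (u' + D 0)) (V (u + D 0)) ltac:(clra) E ltac:(clra); clra.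
  + by move=> a a' ra aa ar; have := Dlt a a' ltac:(clra) aa ltac:(clra); clra.
  + by move=> a a' ra aa ar; rewrite mD//; [congr (_%:E); ring|clra|clra].
Qed.

(** [mu_holonomy] on a rectangle of base [a, a'] between the heights v and v', where v' may be below
    v. In the unit square of [mu_holonomy] the moving parameter comes first, so the coordinates are
    exchanged. *)
Lemma holonomy (P : R * R -> S) (a a' v v' : R) : a < a' ->
  (forall r s, a <= r <= a' -> 0 <= s <= 1 -> {for (r, v + (v' - v) * s), continuous P}) ->
  (forall s, 0 <= s <= 1 -> harc a a' (fun r => P (r, v + (v' - v) * s))) ->
  (forall r s, a <= r <= a' -> 0 <= s <= 1 -> leaf G (P (r, v)) (P (r, v + (v' - v) * s))) ->
  mu G ((fun r => P (r, v)) @` `[a, a']) = mu G ((fun r => P (r, v')) @` `[a, a']).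
Proof.
move=> aa cP hP lP.
have d0 : 0 < a' - a by rewrite subr_gt0.
have H (t : R) : 0 <= t <= 1 -> a <= a + (a' - a) * t <= a'.
  move=> /andP[t0 t1]; rewrite lerDl mulr_ge0 ?(ltW d0)//=.
  by rewrite -lerBrDl ler_piMr ?(ltW d0).
pose h (w : R * R) : R * R := (a + (a' - a) * w.2, v + (v' - v) * w.1).
pose Q (w : R * R) := P (h w).
have ch w : {for w, continuous h}.
  apply: cont_pair; apply: cont_add; try exact: cont_cst.
    by apply: (cont_mul (g := snd)); [exact: cont_cst|exact: cont_snd].
  by apply: (cont_mul (g := fst)); [exact: cont_cst|exact: cont_fst].
have E s : (fun r => P (r, v + (v' - v) * s)) @` `[a, a'] = (fun t => Q (s, t)) @` uitv R.
  have := @image_affine _ (fun r => P (r, v + (v' - v) * s)) a a' 0 1 aa ler01.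
  by rewrite mulr0 addr0 mulr1 addrC subrK.
have := E 0; rewrite mulr0 addr0 => ->.
have := E 1; rewrite mulr1 (addrC v) subrK => ->.
apply: (mu_holonomy (H := Q)).
- rewrite continuous_subspace_in => -[s t]; rewrite inE => -[/uitvE /= s01 /uitvE /= t01].
  apply: continuous_subspaceT_for; first by split; apply/uitvE.
  apply: continuous_comp; first exact: ch.
  by apply: cP => //; exact: H.
- by move=> s /uitvE s01; exact: (harc_transverse (harc_affine (hP s s01))).
- move=> s t /uitvE s01 /uitvE t01; rewrite /Q /h /= mulr0 addr0.
  by apply: lP => //; exact: H.
Qed.

Definition sq (e : R) (w : R * R) := `|w.1| < e /\ `|w.2| < e.

(** Only the first coordinate is normalized, by [box_mu]; the second one is an arbitrary coordinate
    across [F], which need not carry a measure. Since a leaf can cross the box along many plaques,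
    [box_pathF] and [box_pathG] concern paths that stay in the box. *)
Record isbox (x : S) (e : R) (B : R * R -> S) (I : S -> R * R) : Prop := IsBox {
  box_gt0 : 0 < e;
  box_center : B (0, 0) = x;
  box_cont : forall w, sq e w -> {for w, continuous B};
  box_K : forall w, sq e w -> I (B w) = w;
  box_open : forall w, sq e w -> \forall y \near B w, sq e (I y) /\ B (I y) = y;
  box_Icont : forall w, sq e w -> {for B w, continuous I};
  box_F : forall u u' v, sq e (u, v) -> sq e (u', v) -> leaf F (B (u, v)) (B (u', v));
  box_G : forall u v v', sq e (u, v) -> sq e (u, v') -> leaf G (B (u, v)) (B (u, v'));
  box_reg : forall w, sq e w -> ~ Sg (B w);
  box_pathF : forall (g : R -> S) (a b : R), a <= b ->
    (forall t, a <= t <= b -> con `[a, b] g t) ->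
    (forall t, a <= t <= b -> leaf F (g a) (g t)) ->
    (forall t, a <= t <= b -> exists2 w, sq e w & g t = B w) ->
    (I (g b)).2 = (I (g a)).2;
  box_pathG : forall (g : R -> S) (a b : R), a <= b ->
    (forall t, a <= t <= b -> con `[a, b] g t) ->
    (forall t, a <= t <= b -> leaf G (g a) (g t)) ->
    (forall t, a <= t <= b -> exists2 w, sq e w & g t = B w) ->
    (I (g b)).1 = (I (g a)).1;
  box_mu : forall u u' v : R, - e < u -> u < u' -> u' < e -> `|v| < e ->
    mu G ((fun r => B (r, v)) @` `[u, u']) = (u' - u)%:E }.

(* the half-box of a prong: u = 0 is the leaf of G at the vertex, and the two halves
   u < 0 and u > 0 of v = 0 may be the same prong, hence the hypothesis of [sec_inj] *)
Record issector (q : S) (N : set S) (hl vl : S -> R) (e A : R) (B : R * R -> S) (ph : R -> R) : Prop := IsSector {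
  sec_gt0 : 0 < e /\ 0 < A;
  sec_vertex : B (0, 0) = q;
  sec_cont : forall u v, `|u| < e -> 0 <= v <= A -> {for (u, v), continuous B};
  sec_inj : forall u u' v, `|u| < e -> `|u'| < e -> 0 <= v <= A -> 0 < v \/ 0 <= u /\ 0 <= u' \/ u <= 0 /\ u' <= 0 ->
     B (u, v) = B (u', v) -> u = u';
  sec_F : forall u u' v, `|u| < e -> `|u'| < e -> 0 <= v <= A -> leaf F (B (u, v)) (B (u', v));
  sec_G : forall u v, `|u| < e -> 0 <= v <= A -> leaf G (B (u, 0)) (B (u, v));
  sec_reg : forall u v, `|u| < e -> 0 <= v <= A -> 0 < v \/ u != 0 -> ~ Sg (B (u, v));
  sec_mu : forall u u' v : R, - e < u -> u < u' -> u' < e -> 0 <= v <= A ->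
    0 < v \/ 0 < u \/ u' < 0 ->
    mu G ((fun r => B (r, v)) @` `[u, u']) = (u' - u)%:E;
  sec_N : forall u v, `|u| < e -> 0 <= v <= A -> N (B (u, v));
  sec_hl : forall u v, `|u| < e -> 0 <= v <= A -> hl (B (u, v)) = 2 * v ^+ 2;
  sec_vl : forall u v, `|u| < e -> 0 <= v <= A -> vl (B (u, v)) = 2 * ph u ^+ 2;
  sec_ph0 : ph 0 = 0;
  sec_ph : forall u u', - e < u -> u < u' -> u' < e -> ph u < ph u' }.

(** A neighbourhood of [q] made of k half-boxes. The levels [hl] and [vl] come from one chart around
    [q] and do not refer to a sector, so they can be followed along a path that changes sector. In
    [prong_cover] the condition 0 < v or 0 <= u leaves out the second half of each edge, which
    belongs to the next sector. *)
Record isprong (q : S) (N : set S) (hl vl : S -> R) (k : nat) (e : nat -> R) (A : R)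
    (B : nat -> R * R -> S) (ph : nat -> R -> R) : Prop := IsProng {
  prong_gt0 : (0 < k)%N;
  prong_open : open N;
  prong_hl : forall y, N y -> {for y, continuous hl};
  prong_vl : forall y, N y -> {for y, continuous vl};
  prong_pathF : forall (g : R -> S) (a b : R), a <= b ->
    (forall t, a <= t <= b -> con `[a, b] g t) ->
    (forall t, a <= t <= b -> leaf F (g a) (g t)) ->
    (forall t, a <= t <= b -> N (g t)) -> hl (g b) = hl (g a);
  prong_pathG : forall (g : R -> S) (a b : R), a <= b ->
    (forall t, a <= t <= b -> con `[a, b] g t) ->
    (forall t, a <= t <= b -> leaf G (g a) (g t)) ->
    (forall t, a <= t <= b -> N (g t)) -> vl (g b) = vl (g a);
  prong_sector : forall j, (j < k)%N -> issector q N hl vl (e j) A (B j) (ph j);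
  prong_cover : \forall y \near q, exists j u v, [/\ (j < k)%N, `|u| < e j, 0 <= v <= A,
    0 < v \/ 0 <= u & y = B j (u, v)] }.

Lemma path_component_leaf (H : foliation S) (A : set S) (g : R -> S) (a b : R) : a <= b ->
  (forall t, a <= t <= b -> con `[a, b] g t) ->
  (forall t, a <= t <= b -> leaf H (g a) (g t)) ->
  (forall t, a <= t <= b -> A (g t)) ->
  path_component (R := R) (leaf H (g a) `&` A) (g a) (g b).
Proof. by move=> ab cg lg Ag; apply: pcI => // t tab; split; [exact: lg|exact: Ag]. Qed.

(** The horizontal coordinate of a foliated chart is replaced by the [G]-measure along the line v =
    0. Holonomy along the leaves of [G] shows that it measures the other horizontal lines as
    well. *)
Lemma exists_box x : ~ Sg x -> exists e B I, isbox x e B I.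
Proof.
move=> nx; have [c [f1 f2]] := regular_chart nx.
have [cx x0 _ _] := f1.
have d0 : disc (0 : R * R) by apply/discE; rewrite modulus0 ltr01.
have x0' : cinv c 0 = x by rewrite -x0 cmapK.
have [r r0 Hr] : exists2 r : R, 0 < r & forall w, `|w.1| <= r -> `|w.2| <= r ->
    disc w /\ ~ Sg (cinv c w).
  have : \forall w \near (0 : R * R), disc w /\ ~ Sg (cinv c w).
    near=> w; split; near: w.
      have [_ _ <- _] := f1; apply: open_nbhs_nbhs; split; first exact: cimg_open.
      by exists x.
    have : nbhs (cinv c 0) (~` Sg) by rewrite x0'; exact: nbhs_regular.
    by move=> /(cinv_for f1 d0).
  move=> /nbhs_ballP[r /= r0 Hr]; exists (r / 2); first by rewrite divr_gt0.
  move=> w w1 w2; apply: Hr; split; rewrite /ball /= sub0r normrN; clra.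
have hl w w' : (forall t, 0 <= t <= 1 -> `|w.1 + (w'.1 - w.1) * t| <= r) ->
    `|w.2| <= r -> w'.2 = w.2 -> leaf F (cinv c w) (cinv c w').
  move=> Hw w2 E2.
  have Q : model_plaque (hlevel 2) w w'.
    pose g (t : R) : R * R := (w.1 + (w'.1 - w.1) * t, w.2).
    have <- : g 0 = w by rewrite /g mulr0 addr0; case: (w).
    have <- : g 1 = w' by rewrite /g mulr1 addrC subrK -E2; case: (w').
    apply: pcI => // t t01.
      apply: con_for; apply: cont_pair; last exact: cont_cst.
      apply: cont_add; first exact: cont_cst.
      by apply: (cont_mul (g := id)); [exact: cont_cst|exact: cvg_id].
    by split; [have [] := Hr (g t) (Hw t t01) w2|rewrite /= !hlevel2].
  by have [_ []] := pc_mem (fc_leaf f1 Q).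
have vl w w' : (forall t, 0 <= t <= 1 -> `|w.2 + (w'.2 - w.2) * t| <= r) ->
    `|w.1| <= r -> w'.1 = w.1 -> leaf G (cinv c w) (cinv c w').
  move=> Hw w2 E2.
  have Q : model_plaque (vlevel 2) w w'.
    pose g (t : R) : R * R := (w.1, w.2 + (w'.2 - w.2) * t).
    have <- : g 0 = w by rewrite /g mulr0 addr0; case: (w).
    have <- : g 1 = w' by rewrite /g mulr1 [w.2 + _]addrC subrK -E2; case: (w').
    apply: pcI => // t t01.
      apply: con_for; apply: cont_pair; first exact: cont_cst.
      apply: cont_add; first exact: cont_cst.
      by apply: (cont_mul (g := id)); [exact: cont_cst|exact: cvg_id].
    by split; [have [] := Hr (g t) w2 (Hw t t01)|rewrite /= !vlevel2].
  by have [_ []] := pc_mem (fc_leaf f2 Q).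
have seg (a b t : R) : `|a| <= r -> `|b| <= r -> 0 <= t <= 1 -> `|a + (b - a) * t| <= r.
  move=> ar br t01; rewrite ler_norml; move: ar br; rewrite !ler_norml; nra.
have cP w : `|w.1| <= r -> `|w.2| <= r -> {for w, continuous (cinv c)}.
  by move=> w1 w2; apply: (cinv_for f1); have [] := Hr w w1 w2.
have iP w w' : `|w.1| <= r -> `|w.2| <= r -> `|w'.1| <= r -> `|w'.2| <= r ->
    cinv c w = cinv c w' -> w = w'.
  move=> w1 w2 w1' w2' E; have [dw _] := Hr w w1 w2; have [dw' _] := Hr w' w1' w2'.
  by rewrite -(fc_disc f1 dw).2 E (fc_disc f1 dw').2.
have harcP (a b v : R) : - r <= a -> a < b -> b <= r -> `|v| <= r ->
    harc a b (fun u => cinv c (u, v)).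
  move=> ra ab br vr.
  have N (t : R) : a <= t <= b -> `|t| <= r by rewrite ler_norml; clra.
  split => //.
  - move=> t tab; apply: con_for.
    apply: (@continuous_comp _ _ _ (fun t : R => (t, v)) (cinv c)).
      by apply: (cont_pair (f := id)); [exact: cvg_id|exact: cont_cst].
    by apply: cP => //=; exact: N.
  - by move=> s t /N sr /N tr' E; have [] := iP (s, v) (t, v) sr vr tr' vr E.
  - move=> t /N tr'; apply: hl => //= s s01; apply: seg => //; apply: N.
    by rewrite lexx ltW.
  - by move=> t /N tr'; have [] := Hr (t, v) tr' vr.
have rr : - r < r by clra.
have r00 : `|0 : R| <= r by rewrite normr0 ltW.
have [e [V [D [e0 V0 HV HD [Vlt mD]]]]] := arc_center r0 (harcP _ _ 0 (lexx _) rr (lexx _) r00).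
pose e' := Num.min e r.
have e'0 : 0 < e' by rewrite lt_min e0.
have e'e : e' <= e by rewrite ge_min lexx.
have e'r : e' <= r by rewrite ge_min lexx orbT.
have sqP w : sq e' w -> [/\ `|w.1| < e, `|w.2| <= r & `|V w.1| <= r].
  move=> [w1 w2]; have w1' : `|w.1| < e by clra.
  by have [Vr _ _] := HV _ w1'; split => //; clra.
have cB w : sq e' w -> {for w, continuous (fun w => (V w.1, w.2))}.
  move=> /sqP[w1 w2 w3]; apply: cont_pair; last exact: cont_snd.
  apply: (@continuous_comp _ _ _ fst V); first exact: cont_fst.
  by have [] := HV _ w1.
exists e', (fun w => cinv c (V w.1, w.2)), (fun y => (D (cmap c y).1, (cmap c y).2)); split.
- exact: e'0.
- by rewrite /= V0.
- move=> w sw; have [w1 w2 w3] := sqP w sw.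
  apply: (@continuous_comp _ _ _ (fun w => (V w.1, w.2)) (cinv c)); first exact: cB.
  exact: cP.
- move=> w sw; have [w1 w2 w3] := sqP w sw; have [dw _] := Hr (V w.1, w.2) w3 w2.
  by rewrite (fc_disc f1 dw).2 /=; have [_ -> _] := HV _ w1; case: (w).
- move=> w sw; have [w1 w2 w3] := sqP w sw; have [dw _] := Hr (V w.1, w.2) w3 w2.
  have [cw mw] := fc_disc f1 dw.
  have [Vr DV cV] := HV _ w1; have [_ cD] := HD _ Vr.
  have cm (W : set (R * R)) : nbhs (V w.1, w.2) W ->
      \forall y \near cinv c (V w.1, w.2), W (cmap c y).
    by rewrite -{1}mw => /(cmap_for cw).
  have N1 : \forall y \near cinv c (V w.1, w.2), cdom c y.
    by apply: open_nbhs_nbhs; split => //; exact: cdom_open.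
  have N2 : \forall y \near cinv c (V w.1, w.2), `|(cmap c y).1| < r.
    exact: (cm _ (nbhs_fst_lt (w := (V w.1, w.2)) Vr)).
  have N3 : \forall y \near cinv c (V w.1, w.2), `|(cmap c y).2| < e'.
    by have [_ h2] := sw; exact: (cm _ (nbhs_snd_lt (w := (V w.1, w.2)) h2)).
  have N4 : \forall y \near cinv c (V w.1, w.2), `|D (cmap c y).1| < e'.
    have /(_ [set z | `|D z.1| < e']) := cm; apply.
    apply: (near_norm_lt (f := fun z : R * R => D z.1)).
      by apply: (@continuous_comp _ _ _ fst D); [exact: cont_fst|].
    by rewrite /= DV; have [] := sw.
  near=> y; have cy : cdom c y by near: y.
  have y1 : `|(cmap c y).1| < r by near: y.
  split; first by split; rewrite /=; near: y.
  rewrite /=; have [-> _] := HD _ y1.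
  by rewrite -surjective_pairing cmapK.
- move=> w sw; have [w1 w2 w3] := sqP w sw; have [dw _] := Hr (V w.1, w.2) w3 w2.
  have [cw mw] := fc_disc f1 dw.
  have [Vr DV cV] := HV _ w1; have [_ cD] := HD _ Vr.
  apply: cont_pair.
    apply: (@continuous_comp _ _ _ (fun y => (cmap c y).1) D).
      by apply: (@continuous_comp _ _ _ (cmap c) fst); [exact: cmap_for|exact: cont_fst].
    by rewrite mw.
  by apply: (@continuous_comp _ _ _ (cmap c) snd); [exact: cmap_for|exact: cont_snd].
- move=> u u' v su su'; have [u1 u2 u3] := sqP _ su; have [u1' u2' u3'] := sqP _ su'.
  by apply: hl => //= t t01; exact: seg.
- move=> u v v' su su'; have [u1 u2 u3] := sqP _ su; have [u1' u2' u3'] := sqP _ su'.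
  by apply: vl => //= t t01; exact: seg.
- by move=> w sw; have [w1 w2 w3] := sqP w sw; have [] := Hr (V w.1, w.2) w3 w2.
- move=> g a b ab cg lg Hg /=.
  apply: (fc_snd f1); apply: path_component_leaf => // t tab.
  have [w sw ->] := Hg t tab; have [w1 w2 w3] := sqP w sw.
  by have [dw _] := Hr (V w.1, w.2) w3 w2; have [] := fc_disc f1 dw.
- move=> g a b ab cg lg Hg /=; congr (D _).
  apply: (fc_fst f2); apply: path_component_leaf => // t tab.
  have [w sw ->] := Hg t tab; have [w1 w2 w3] := sqP w sw.
  by have [dw _] := Hr (V w.1, w.2) w3 w2; have [] := fc_disc f1 dw.
- move=> u u' v ue uu ue' ve /=.
  have ve' : `|v| <= r by clra.
  have ul : `|u| < e by rewrite ltr_norml; clra.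
  have ul' : `|u'| < e by rewrite ltr_norml; clra.
  have [+ DV _] := HV _ ul; rewrite ltr_norml => Vr.
  have [+ DV' _] := HV _ ul'; rewrite ltr_norml => Vr'.
  have VV : V u < V u' by apply: Vlt; clra.
  have -> : (fun r0 : R => cinv c (V r0, v)) @` `[u, u'] = (fun a => cinv c (a, v)) @` `[V u, V u'].
    apply: (image_reparam (fun a => cinv c (a, v)) Vlt mD.1 _ _ _ uu).
    - by move=> z /HV[].
    - by move=> z /HD[].
    - by apply: le_lt_trans ue; rewrite lerN2.
    - exact: lt_le_trans ue' e'e.
  have sv s : 0 <= s <= 1 -> `|v + (0 - v) * s| <= r by move=> s01; apply: seg.
  rewrite (@holonomy (cinv c) (V u) (V u') v 0 VV).
  + by rewrite mD.2 ?DV ?DV'//; clra.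
  + move=> a s ha hs; apply: cP => /=; last exact: sv.
    by rewrite ler_norml; clra.
  + by move=> s hs; apply: harcP => //; [clra|clra|exact: sv].
  + move=> a s ha hs; apply: vl => //=; last by rewrite ler_norml; clra.
    move=> t t01; have sv' := sv s hs; exact: seg.
Unshelve. all: by end_near. Qed.

(** The edge v = 0 passes through the singularity and is no transverse arc for the measure. So each
    sector is normalized along its top v = A, and holonomy carries the measure down; on the edge
    itself this works for segments avoiding u = 0. *)
Lemma exists_prong q : Sg q -> exists N hl vl e A B ph,
  isprong q N hl vl (prongs F q) e A B ph.
Proof.
move=> sq_; have [pE [c f1 f2]] := tr q; rewrite -pE in f2.
set k := prongs F q in f1 f2 *.
have k0 : (0 < k)%N by exact: prongs_gt0.
have kR : (0 : R) < k%:R by rewrite ltr0n.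
have [cq q0 im _] := f1.
have d0 : disc (0 : R * R) by apply/discE; rewrite modulus0 ltr01.
have q0' : cinv c 0 = q by rewrite -q0 cmapK.
have [r0 [r00 r01] Hr0] : exists2 r0 : R, 0 < r0 /\ r0 < 1 &
    forall z, modulus z < r0 -> z != 0 -> ~ Sg (cinv c z).
  have : nbhs (cinv c 0) (~` (Sg `\ q)).
    rewrite q0'; apply: open_nbhs_nbhs; split; last by move=> [_]; apply.
    apply: closed_openC; apply: compact_closed; first exact: surf_hausdorff.
    by apply: finite_compact; apply: sub_finite_set finSg => x [].
  move=> /(cinv_for f1 d0)/nbhs_ballP[r /= rp Hr].
  exists (Num.min r (1 / 2)).
    by split; [rewrite lt_min rp; clra|rewrite gt_min; apply/orP; right; clra].
  move=> z; rewrite lt_min => /andP[zr z12] z0 Sz.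
  have m2 := sqr_modulus z; have m0 := modulus_ge0 z.
  have ab (x : R) : x ^+ 2 <= modulus z ^+ 2 -> `|x| < r.
    move=> h; apply: le_lt_trans zr; rewrite -(ler_pXn2r (n := 2)) ?nnegrE//.
    by rewrite real_normK ?num_real.
  apply: (Hr z); last first.
    split => // zq; move: z0; rewrite -q0 -zq (fc_disc f1 _).2 ?eqxx//.
    by apply/discE; clra.
  split; rewrite /ball /= sub0r normrN; apply: ab; rewrite m2.
    by rewrite lerDl sqr_ge0.
  by rewrite lerDr sqr_ge0.
(* The radius in the w plane that corresponds to r0, because |psi k j w| = |w| ^ (2 / k). With A =
   rho / 2 the points |w.1| <= A, |w.2| <= A have modulus less than rho. *)
pose rho := r0 `^ (k%:R / 2).
have rho0 : 0 < rho by exact: powR_gt0.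
have s0 : 0 < 2 / k%:R :> R by rewrite divr_gt0.
have s0' : 0 < k%:R / 2 :> R by rewrite divr_gt0.
have rhoE : rho `^ (2 / k%:R) = r0.
  by rewrite -powRrM (_ : k%:R / 2 * _ = 1) ?powRr1 ?ltW//; field; rewrite gt_eqF.
pose A := rho / 2.
have A0 : 0 < A by rewrite divr_gt0.
have mw (w : R * R) : `|w.1| <= A -> `|w.2| <= A -> modulus w < rho.
  move=> w1 w2; rewrite -(ltr_pXn2r (n := 2)) ?nnegrE ?modulus_ge0 ?ltW// sqr_modulus.
  have h1 : w.1 ^+ 2 <= A ^+ 2 by rewrite -real_normK ?num_real// ler_pXn2r ?nnegrE// ltW.
  have h2 : w.2 ^+ 2 <= A ^+ 2 by rewrite -real_normK ?num_real// ler_pXn2r ?nnegrE// ltW.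
  have : A ^+ 2 = rho ^+ 2 / 4 by rewrite /A; field.
  have : 0 < rho ^+ 2 by rewrite exprn_gt0.
  clra.
have mpsi j w : modulus w < rho -> modulus (psi k j w) < r0.
  by move=> wr; rewrite modulus_psi -rhoE; apply: gt0_ltr_powR; rewrite ?nnegrE ?modulus_ge0 ?ltW.
have psi_n0 j w : modulus w != 0 -> psi k j w != 0.
  move=> w0; apply/eqP => E; have := modulus_psi k j w; rewrite E modulus0 => /esym/eqP.
  by rewrite powR_eq0 (negbTE w0).
have dpsi j w : `|w.1| <= A -> 0 <= w.2 <= A -> disc (psi k j w).
  move=> w1 /andP[w2 w2']; apply/discE; apply: lt_trans r01; apply: mpsi; apply: mw => //.
  by rewrite ger0_norm.
have cP j w : `|w.1| <= A -> 0 <= w.2 <= A -> {for w, continuous (sector c k j)}.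
  move=> w1 w2; apply: (@continuous_comp _ _ _ (psi k j) (cinv c)).
    by apply: psi_cont => //; case/andP: w2.
  by apply: (cinv_for f1); exact: dpsi.
have cS j w : `|w.1| <= A -> 0 <= w.2 <= A -> cdom c (sector c k j w) /\ cmap c (sector c k j w) = psi k j w.
  by move=> w1 w2; apply: (fc_disc f1); exact: dpsi.
have seg (a b t : R) : `|a| <= A -> `|b| <= A -> 0 <= t <= 1 -> `|a + (b - a) * t| <= A.
  move=> ar br t01; rewrite ler_norml; move: ar br; rewrite !ler_norml; nra.
have lP (H : foliation S) (lev : nat -> R * R -> R) j w w' : foliated_chart (leaf H) (lev k) c q ->
    (forall t, 0 <= t <= 1 -> lev k (psi k j (w.1 + (w'.1 - w.1) * t, w.2 + (w'.2 - w.2) * t)) = lev k (psi k j w)) ->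
    `|w.1| <= A -> 0 <= w.2 <= A -> `|w'.1| <= A -> 0 <= w'.2 <= A ->
    leaf H (sector c k j w) (sector c k j w').
  move=> fH Hl w1 w2 w1' w2'.
  have segb (t : R) : 0 <= t <= 1 -> 0 <= w.2 + (w'.2 - w.2) * t <= A by move=> t01; nra.
  have Q : model_plaque (lev k) (psi k j w) (psi k j w').
    pose g (t : R) := psi k j (w.1 + (w'.1 - w.1) * t, w.2 + (w'.2 - w.2) * t).
    have <- : g 0 = psi k j w by rewrite /g !mulr0 !addr0 -surjective_pairing.
    have <- : g 1 = psi k j w' by rewrite /g !mulr1 ![_ + (_ - _)]addrC !subrK -surjective_pairing.
    apply: pcI => // t t01.
      apply: con_for; apply: (@continuous_comp _ _ _ (fun t : R => (w.1 + (w'.1 - w.1) * t, w.2 + (w'.2 - w.2) * t)) (psi k j)).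
        by apply: cont_pair; (apply: cont_add; first exact: cont_cst);
          (apply: (cont_mul (g := id)); [exact: cont_cst|exact: cvg_id]).
      by apply: psi_cont => //=; have /andP[] := segb t t01.
    split; first by apply: dpsi; [exact: seg|exact: segb].
    by rewrite /= /g !Hl ?lexx ?ler01.
  by have [_ []] := pc_mem (fc_leaf fH Q).
have hP j (u u' v : R) : `|u| <= A -> `|u'| <= A -> 0 <= v <= A ->
    leaf F (sector c k j (u, v)) (sector c k j (u', v)).
  move=> u1 u2 v1; apply: (lP F (@hlevel R)) => //= t t01.
  have v0 : 0 <= v by case/andP: v1.
  by rewrite subrr mul0r addr0 !hlevel_psi.
have vP j (u v v' : R) : `|u| <= A -> 0 <= v <= A -> 0 <= v' <= A ->
    leaf G (sector c k j (u, v)) (sector c k j (u, v')).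
  move=> u1 v1 v2; apply: (lP G (@vlevel R)) => //= t t01.
  have v0 : 0 <= v by case/andP: v1.
  by rewrite subrr mul0r addr0 !vlevel_psi//=; nra.
have rP j (u v : R) : `|u| <= A -> 0 <= v <= A -> 0 < v \/ u != 0 -> ~ Sg (sector c k j (u, v)).
  move=> u1 v1 uv; have v0 : 0 <= v by case/andP: v1.
  have m0 : modulus (u, v) != 0.
    apply/eqP => /modulus_eq0[u0 vv0]; move: uv; by rewrite u0 vv0 eqxx ltxx; case.
  apply: Hr0; last exact: psi_n0.
  by apply: mpsi; apply: mw => //=; rewrite ger0_norm//; case/andP: v1.
have iP j (u u' v : R) : `|u| <= A -> `|u'| <= A -> 0 <= v <= A ->
    0 < v \/ 0 <= u /\ 0 <= u' \/ u <= 0 /\ u' <= 0 ->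
    sector c k j (u, v) = sector c k j (u', v) -> u = u'.
  move=> u1 u2 v1 H E; have v0 : 0 <= v by case/andP: v1.
  have E' : psi k j (u, v) = psi k j (u', v).
    by rewrite -(cS j (u, v) u1 v1).2 -(cS j (u', v) u2 v1).2 E.
  case: H => [v0'|H]; first exact: psi_inj_fst E'.
  have vl1 := @vlevel_psi _ k j (u, v) k0 v0; have vl2 := @vlevel_psi _ k j (u', v) k0 v0.
  rewrite E' vl2 /= in vl1.
  have : (u - u') * (u + u') = 0 by clra.
  move=> /eqP; rewrite mulf_eq0 => /orP[/eqP|/eqP]; first by clra.
  case: H; clra.
have harcP j (a b v : R) : - A <= a -> a < b -> b <= A -> 0 <= v <= A -> 0 < v \/ 0 < a \/ b < 0 ->
    harc a b (fun u => sector c k j (u, v)).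
  move=> ra ab br vr H.
  have N (t : R) : a <= t <= b -> `|t| <= A by rewrite ler_norml; clra.
  have N' (t : R) : a <= t <= b -> 0 < v \/ t != 0.
    move=> tab; case: H => [|H]; [by left|right; apply/eqP => t0].
    by rewrite t0 in tab; case: H; clra.
  split => //.
  - move=> t tab; apply: con_for.
    apply: (@continuous_comp _ _ _ (fun t : R => (t, v)) (sector c k j)).
      by apply: (cont_pair (f := id)); [exact: cvg_id|exact: cont_cst].
    by apply: cP => //=; exact: N.
  - move=> s t sab tab; apply: iP => //; [exact: N|exact: N|].
    case: H => [|[H|H]]; [by left|right; left; clra|right; right; clra].
  - by move=> t /N tr'; apply: hP => //; apply: N; rewrite lexx ltW.
  - by move=> t tab; apply: rP => //; [exact: N|exact: N'].
have AA : - A < A by clra.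
have AIn : 0 <= A <= A by rewrite lexx ltW.
pose Q (x : R * (R -> R) * (R -> R)) j := let: (e, V, D) := x in
  [/\ 0 < e, V 0 = 0,
      forall u, `|u| < e -> [/\ `|V u| < A, D (V u) = u & {for u, continuous V}],
      forall a, `|a| < A -> V (D a) = a /\ {for a, continuous D} &
      (forall u u', - e < u -> u < u' -> u' < e -> V u < V u') /\
      ((forall a a', - A < a -> a < a' -> a' < A -> D a < D a') /\
       (forall a a', - A < a -> a < a' -> a' < A ->
         mu G ((fun u => sector c k j (u, A)) @` `[a, a']) = (D a' - D a)%:E))].
have /choice[X HX] : forall j : nat, exists x : R * (R -> R) * (R -> R), Q x j.
  move=> j; have [e [V [D H]]] := arc_center A0 (harcP j (- A) A A (lexx _) AA (lexx _) AIn (or_introl A0)).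
  by exists (e, V, D).
pose e j := (X j).1.1; pose V j := (X j).1.2; pose D j := (X j).2.
have HQ j : [/\ 0 < e j, V j 0 = 0,
      forall u, `|u| < e j -> [/\ `|V j u| < A, D j (V j u) = u & {for u, continuous (V j)}],
      forall a, `|a| < A -> V j (D j a) = a /\ {for a, continuous (D j)} &
      (forall u u', - e j < u -> u < u' -> u' < e j -> V j u < V j u') /\
      ((forall a a', - A < a -> a < a' -> a' < A -> D j a < D j a') /\
       (forall a a', - A < a -> a < a' -> a' < A ->
         mu G ((fun u => sector c k j (u, A)) @` `[a, a']) = (D j a' - D j a)%:E))].
  by have := HX j; rewrite /e /V /D; case: (X j) => [[]].
pose N := [set y | cdom c y /\ modulus (cmap c y) < r0].
exists N, (fun y => hlevel k (cmap c y)), (fun y => vlevel k (cmap c y)), e, A,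
  (fun j w => sector c k j (V j w.1, w.2)), V.
have NB j w : `|w.1| <= A -> 0 <= w.2 <= A -> N (sector c k j w).
  move=> w1 w2; have [h1 h2] := cS j w w1 w2; split => //.
  by rewrite h2; apply: mpsi; apply: mw => //; rewrite ger0_norm; case/andP: w2.
split.
- exact: k0.
- rewrite openE => y [cy my]; rewrite /interior.
  have h1 : \forall y' \near y, cdom c y'.
    by apply: open_nbhs_nbhs; split => //; exact: cdom_open.
  have h2 : \forall y' \near y, modulus (cmap c y') < r0.
    have := @continuous_comp _ _ _ (cmap c) (@modulus R) y (cmap_for cy) (@modulus_cont _ _).
    by move=> /near_lt; apply.
  by near=> y'; split; near: y'.
- move=> y [cy _]; apply: (@continuous_comp _ _ _ (cmap c) (@hlevel R k)); first exact: cmap_for.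
  exact: hlevel_cont.
- move=> y [cy _]; apply: (@continuous_comp _ _ _ (cmap c) (@vlevel R k)); first exact: cmap_for.
  exact: vlevel_cont.
- move=> g a b ab cg lg Ng; apply: (fc_lev f1).
  by apply: path_component_leaf => // t /Ng[].
- move=> g a b ab cg lg Ng; apply: (fc_lev f2).
  by apply: path_component_leaf => // t /Ng[].
- move=> j jk; have [e0 V0 HV HD [Vlt [Dlt mD]]] := HQ j.
  have HV' u : `|u| < e j -> `|V j u| <= A by move=> /HV[/ltW].
  have Vle u u' : - e j < u -> u <= u' -> u' < e j -> V j u <= V j u'.
    by move=> h1; rewrite le_eqVlt => /orP[/eqP->//|h2 h3]; apply/ltW/Vlt.
  have Vs u : `|u| < e j -> (0 <= u -> 0 <= V j u) /\ (u <= 0 -> V j u <= 0).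
    rewrite ltr_norml => ue; rewrite -V0; split => h; apply: Vle => //; clra.
  have V_inj u u' : `|u| < e j -> `|u'| < e j -> V j u = V j u' -> u = u'.
    by move=> /HV[_ h1 _] /HV[_ h2 _] E; rewrite -h1 -h2 E.
  split.
  + by split.
  + by rewrite /= V0 /sector (_ : (0, 0) = 0)// psi0.
  + move=> u v ue v1; have [h1 h2 h3] := HV u ue.
    apply: (@continuous_comp _ _ _ (fun w : R * R => (V j w.1, w.2)) (sector c k j)).
      apply: cont_pair; last exact: cont_snd.
      by apply: (@continuous_comp _ _ _ fst (V j)); [exact: cont_fst|exact: h3].
    by apply: cP => //=; exact: HV'.
  + move=> u u' v ue ue' v1 H /= E; apply: V_inj => //.
    apply: iP E => //; [exact: HV'|exact: HV'|].
    have [a1 a2] := Vs u ue; have [b1 b2] := Vs u' ue'.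
    by case: H => [|[[h1 h2]|[h1 h2]]]; [left|right; left; auto|right; right; auto].
  + by move=> u u' v ue ue' v1; apply: hP => //; exact: HV'.
  + by move=> u v ue v1; apply: vP => //; [exact: HV'|rewrite lexx ltW].
  + move=> u v ue v1 H; apply: rP => //; first exact: HV'.
    case: H => [|u0]; [by left|right; apply: contra_neq u0].
    move=> E; apply: V_inj => //; first by rewrite normr0.
    by rewrite V0; exact: E.
  + move=> u u' v ue uu ue' v1 H /=.
    have ul : `|u| < e j by rewrite ltr_norml; clra.
    have ul' : `|u'| < e j by rewrite ltr_norml; clra.
    have [+ DV _] := HV _ ul; rewrite ltr_norml => Vr.
    have [+ DV' _] := HV _ ul'; rewrite ltr_norml => Vr'.
    have VV : V j u < V j u' by exact: Vlt.
    have -> : (fun r => sector c k j (V j r, v)) @` `[u, u'] =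
        (fun a => sector c k j (a, v)) @` `[V j u, V j u'].
      apply: (image_reparam (fun a => sector c k j (a, v)) Vlt Dlt) ue uu ue'.
      - by move=> z /HV[].
      - by move=> z /HD[].
    have HH : 0 < v \/ 0 < V j u \/ V j u' < 0.
      case: H => [|[u0|u0]]; [by left|right; left|right; right].
        by rewrite -V0; apply: Vlt; clra.
      by rewrite -V0; apply: Vlt; clra.
    have sv s : 0 <= s <= 1 -> 0 <= v + (A - v) * s <= A by move=> s01; nra.
    have sv' s : 0 <= s <= 1 -> 0 < v -> 0 < v + (A - v) * s by move=> s01 v0; nra.
    have mv a : V j u <= a <= V j u' -> `|a| <= A by rewrite ler_norml; clra.
    rewrite (@holonomy (sector c k j) (V j u) (V j u') v A VV).
    * by rewrite mD ?DV ?DV'//; clra.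
    * by move=> a s ha hs; apply: cP => /=; [exact: mv|exact: sv].
    * move=> s hs; apply: harcP => //; [clra|clra|exact: sv|].
      by case: HH => [v0|]; [left; exact: sv'|right].
    * by move=> a s ha hs; apply: vP; [exact: mv| |exact: sv].
  + by move=> u v ue v1; apply: NB => //=; exact: HV'.
  + move=> u v ue v1; rewrite (cS _ _ _ _).2 //=; last exact: HV'.
    by rewrite hlevel_psi//=; case/andP: v1.
  + move=> u v ue v1; rewrite (cS _ _ _ _).2 //=; last exact: HV'.
    by rewrite vlevel_psi//=; case/andP: v1.
  + exact: V0.
  + exact: Vlt.
(* A common range of the unnormalized first coordinate that every [D j] sends into the domain of its
   sector. *)
- have [eta eta0 Heta] : exists2 eta : R, 0 < eta & forall s, `|s - 0| < eta ->
      forall j, (j < k)%N -> `|D j s| < e j /\ `|s| < A.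
    apply: finite_radius => j jk; have [e0 V0 HV HD _] := HQ j.
    have [_ /cvgrPdist_lt/(_ _ e0)] := HD 0 ltac:(by rewrite normr0).
    have D00 : D j 0 = 0 by have [|_ + _] := HV 0; rewrite ?normr0// V0.
    move=> /nbhs_ballP[d /= d0' Hd]; exists (Num.min d A); first by rewrite lt_min d0'.
    move=> s; rewrite lt_min subr0 => /andP[sd sA]; split => //.
    have := Hd s; rewrite /ball /= sub0r normrN => /(_ sd).
    by rewrite D00 sub0r normrN.
  have et0 : 0 < Num.min eta A by rewrite lt_min eta0.
  pose et := Num.min eta A.
  have etp : 0 < et `^ (2 / k%:R) by exact: powR_gt0.
  have h1 : \forall y \near q, cdom c y.
    by apply: open_nbhs_nbhs; split => //; exact: cdom_open.
  have h2 : \forall y \near q, modulus (cmap c y) < et `^ (2 / k%:R).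
    have := @continuous_comp _ _ _ (cmap c) (@modulus R) q (cmap_for cq) (@modulus_cont _ _).
    by move=> /near_lt; apply; rewrite /= q0 modulus0.
  near=> y; have cy : cdom c y by near: y.
  have my : modulus (cmap c y) < et `^ (2 / k%:R) by near: y.
  have [j [[a b] [jk ab E]]] := psi_surj (cmap c y) k0.
  rewrite -E modulus_psi in my.
  have mab : modulus (a, b) < et.
    rewrite ltNge; apply/negP => h; move: my; rewrite ltNge => /negP; apply.
    by apply: ge0_ler_powR; rewrite ?nnegrE ?modulus_ge0 ?(ltW et0)// ltW.
  have m2 := sqr_modulus (a, b); have mm0 := modulus_ge0 (a, b).
  have lem (x : R) : x ^+ 2 <= modulus (a, b) ^+ 2 -> `|x| < et.
    move=> h; apply: le_lt_trans mab; rewrite -(ler_pXn2r (n := 2)) ?nnegrE//.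
    by rewrite real_normK ?num_real.
  have a1 : `|a| < et by apply: lem; rewrite m2 /= lerDl sqr_ge0.
  have b1 : `|b| < et by apply: lem; rewrite m2 /= lerDr sqr_ge0.
  have b0 : 0 <= b by case: ab => [/ltW//|/= [->]].
  have [|Da aA] := Heta a _ j jk; first by rewrite subr0; move: a1; rewrite lt_min => /andP[].
  have [e0 V0 HV HD [Vlt [Dlt _]]] := HQ j.
  have [VD _] := HD a aA.
  exists j, (D j a), b; split => //.
  + rewrite b0 /=; move: b1; rewrite ger0_norm// lt_min => /andP[_ /ltW]//.
  + case: ab => [|[_ /= a0]]; [by left|right].
    have D00 : D j 0 = 0 by have [|_ + _] := HV 0; rewrite ?normr0// V0.
    rewrite -D00; move: a0; rewrite le_eqVlt => /orP[/eqP->//|a0].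
    by apply/ltW/Dlt; move: aA; rewrite ?ltr_norml; clra.
  + by rewrite /= VD /sector E cmapK.
Unshelve. all: by end_near. Qed.

End Boxes.

(** * Unit speed paths in leaves *)

Definition sgn1 {R : realType} (s : R) := s = 1 \/ s = - 1.

Lemma sgn1M {R : realType} (s t : R) : sgn1 s -> sgn1 t -> sgn1 (s * t).
Proof. by move=> [->|->] [->|->]; [left|right|right|left]; ring. Qed.

Lemma sgn1V {R : realType} (s : R) : sgn1 s -> s * s = 1.
Proof. by move=> [->|->]; ring. Qed.

Lemma sgn1_neq0 {R : realType} (s : R) : sgn1 s -> s != 0.
Proof. by move=> [->|->]; rewrite ?oppr_eq0 oner_neq0. Qed.

Lemma norm_sgn1 {R : realType} (s t : R) : sgn1 s -> `|s * t| = `|t|.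
Proof. by move=> [->|->]; rewrite ?mul1r ?mulN1r ?normrN. Qed.

(** On a line a point is determined by its distances to xi 0 and xi (d/2). Comparing squares
    linearizes the problem and avoids a discussion of the order of the three points. *)
Lemma isometry_affine {R : realType} (xi : R -> R) (c d : R) : 0 < c -> 0 < d ->
  (forall s t, `|s| < d -> `|t| < d -> s < t -> `|xi t - xi s| = c * (t - s)) ->
  exists2 sg, sgn1 sg & forall s, `|s| < d -> xi s = xi 0 + sg * c * s.
Proof.
move=> c0 d0 H.
have d2 : `|d / 2| < d by rewrite gtr0_norm ?divr_gt0//; clra.
have z0 : `|0 : R| < d by rewrite normr0.
have H' s t : `|s| < d -> `|t| < d -> (xi t - xi s) ^+ 2 = c ^+ 2 * (t - s) ^+ 2.
  move=> sd td; case: (ltrgtP s t) => [st|ts|->]; last by rewrite !subrr; ring.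
    by rewrite -real_normK ?num_real// H//; ring.
  by rewrite -(sqrrN (xi t - xi s)) opprB -real_normK ?num_real// H//; ring.
pose A := xi (d / 2) - xi 0.
have A2 : A ^+ 2 = (c * (d / 2)) ^+ 2 by rewrite H'//; ring.
have [sg sg1 AE] : exists2 sg, sgn1 sg & A = sg * c * (d / 2).
  move/eqP: A2; rewrite eqf_sqr => /orP[/eqP AE|/eqP AE].
    by exists 1; [left|rewrite AE; ring].
  by exists (- 1); [right|rewrite AE; ring].
exists sg => // s sd.
have e1 := H' 0 s z0 sd; have e2 := H' (d / 2) s d2 sd.
have X1 : xi s - xi (d / 2) = (xi s - xi 0) - A by rewrite /A; ring.
rewrite X1 in e2; set X := xi s - xi 0 in e1 e2.
have k : X * A = (sg * c * s) * A.
  rewrite [in RHS]AE; have s2 := sgn1V sg1.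
  have -> : sg * c * s * (sg * c * (d / 2)) = (sg * sg) * (c ^+ 2 * s * (d / 2)) by ring.
  rewrite s2 mul1r subr0 in e1 *.
  have : 2 * (X * A) = X ^+ 2 + A ^+ 2 - (X - A) ^+ 2 by ring.
  by rewrite e1 e2 A2 => E; apply: (@mulfI _ 2) => //; rewrite E; ring.
have A0 : A != 0.
  by rewrite AE !mulf_neq0 ?(gt_eqF c0) ?(gt_eqF d0)//; exact: sgn1_neq0.
by have := mulIf A0 k; rewrite /X; clra.
Qed.

Section Geodesics.
Context {R : realType} {S : surface R} (F : foliation S) (G : measured_foliation S).
Variable Sg : set S.
Local Notation isbox := (isbox F G Sg).
Implicit Types (x y : S) (t u v : R).

Lemma box_path_F x e B I (g : R -> S) (a b : R) : isbox x e B I ->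
  (forall t, a < t < b -> {for t, continuous g}) ->
  (forall s t, a < s < b -> a < t < b -> leaf F (g s) (g t)) ->
  (forall t, a < t < b -> sq e (I (g t)) /\ B (I (g t)) = g t) ->
  forall s t, a < s < b -> a < t < b -> (I (g s)).2 = (I (g t)).2.
Proof.
move=> bx cg lg Hg.
have key s t : a < s < b -> a < t < b -> s <= t -> (I (g t)).2 = (I (g s)).2.
  move=> sab tab st; apply: (box_pathF bx) => //.
  - by move=> r rst; apply: con_for; apply: cg; clra.
  - by move=> r rst; apply: lg; clra.
  - move=> r rst; have [|h1 h2] := Hg r; first clra.
    by exists (I (g r)).
by move=> s t sab tab; have [st|/ltW ts] := leP s t; [rewrite (key s t)|rewrite (key t s)].
Qed.

Lemma box_path_G x e B I (g : R -> S) (a b : R) : isbox x e B I ->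
  (forall t, a < t < b -> {for t, continuous g}) ->
  (forall s t, a < s < b -> a < t < b -> leaf G (g s) (g t)) ->
  (forall t, a < t < b -> sq e (I (g t)) /\ B (I (g t)) = g t) ->
  forall s t, a < s < b -> a < t < b -> (I (g s)).1 = (I (g t)).1.
Proof.
move=> bx cg lg Hg.
have key s t : a < s < b -> a < t < b -> s <= t -> (I (g t)).1 = (I (g s)).1.
  move=> sab tab st; apply: (box_pathG bx) => //.
  - by move=> r rst; apply: con_for; apply: cg; clra.
  - by move=> r rst; apply: lg; clra.
  - move=> r rst; have [|h1 h2] := Hg r; first clra.
    by exists (I (g r)).
by move=> s t sab tab; have [st|/ltW ts] := leP s t; [rewrite (key s t)|rewrite (key t s)].
Qed.

(** The first coordinate of [th] in the box is continuous and injective, so it maps [s, t] onto the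
    interval between its end values, whose length is the measure of the arc. Hence it is affine of
    slope c or -c. The case c = 1 gives changes of boxes, the case c = k the action of the
    homeomorphism. *)
Lemma constant_speed x e B I w (th : R -> S) (c d : R) : isbox x e B I -> sq e w ->
  0 < c -> 0 < d -> th 0 = B w ->
  (forall s, `|s| < d -> {for s, continuous th}) ->
  (forall s t, `|s| < d -> `|t| < d -> th s = th t -> s = t) ->
  (forall s t, `|s| < d -> `|t| < d -> leaf F (th s) (th t)) ->
  (forall s t, `|s| < d -> `|t| < d -> s < t -> mu G (th @` `[s, t]) = (c * (t - s))%:E) ->
  exists d' sg, [/\ 0 < d', sgn1 sg & forall s, `|s| < d' ->
    [/\ `|s| < d, sq e (w.1 + sg * c * s, w.2) & th s = B (w.1 + sg * c * s, w.2)]].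
Proof.
move=> bx sw c0 d0 th0 cth ith lth mth.
have [d1 [d10 d1d Hd1]] : exists d1 : R, [/\ 0 < d1, d1 <= d & forall s, `|s| < d1 ->
    sq e (I (th s)) /\ B (I (th s)) = th s].
  have z0 : `|0 : R| < d by rewrite normr0.
  have := cth 0 z0 _; rewrite th0 => /(_ _ (box_open bx sw)) /nbhs_ballP[r /= r0 Hr].
  exists (Num.min r d); split; [by rewrite lt_min r0|by rewrite ge_min lexx orbT|].
  move=> s; rewrite lt_min => /andP[sr _]; apply: Hr.
  by rewrite /ball /= sub0r normrN.
pose xi s := (I (th s)).1.
have z0 : - d1 < (0 : R) < d1 by clra.
have lt1 s : - d1 < s < d1 -> `|s| < d by rewrite ltr_norml; clra.
have I2 s : `|s| < d1 -> (I (th s)).2 = w.2.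
  rewrite ltr_norml => sd.
  rewrite (@box_path_F x e B I th (- d1) d1 bx _ _ _ s 0)//.
  - by rewrite th0 (box_K bx sw).
  - by move=> t /lt1; exact: cth.
  - by move=> r t /lt1 rd /lt1 td; exact: lth.
  - by move=> t td; apply: Hd1; rewrite ltr_norml.
have thE s : `|s| < d1 -> th s = B (xi s, w.2).
  by move=> sd; rewrite -(I2 s sd) /xi -surjective_pairing (Hd1 s sd).2.
have sqE s : `|s| < d1 -> sq e (xi s, w.2).
  by move=> sd; rewrite -(I2 s sd) /xi -surjective_pairing; exact: (Hd1 s sd).1.
have xi0 : xi 0 = w.1 by rewrite /xi th0 (box_K bx sw).
have cxi s : `|s| < d1 -> {for s, continuous xi}.
  move=> sd; apply: (@continuous_comp _ _ _ (fun s => I (th s)) fst); last exact: cont_fst.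
  apply: (@continuous_comp _ _ _ th I); first by apply: cth; clra.
  by rewrite -(Hd1 s sd).2; apply: (box_Icont bx); exact: (Hd1 s sd).1.
have ixi s t : `|s| < d1 -> `|t| < d1 -> xi s = xi t -> s = t.
  move=> sd td E; apply: ith; [clra|clra|].
  by rewrite !thE// E.
have iso s t : `|s| < d1 -> `|t| < d1 -> s < t -> `|xi t - xi s| = c * (t - s).
  move=> sd td st.
  have st1 r : s <= r <= t -> `|r| < d1 by move: sd td; rewrite !ltr_norml; clra.
  have E : xi @` `[s, t] = `[Num.min (xi s) (xi t), Num.max (xi s) (xi t)]%classic.
    apply: continuous_inj_image_segment; first exact: ltW.
      by apply/con_within => r; rewrite /= in_itv /= => /st1/cxi/con_for.
    by move=> r r'; rewrite !in_itv /= => /st1 h1 /st1 h2; exact: ixi.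
  have im : th @` `[s, t] = (fun u => B (u, w.2)) @` `[Num.min (xi s) (xi t), Num.max (xi s) (xi t)].
    rewrite -E image_comp; apply/seteqP; split => _ [r /= + <-]; rewrite in_itv /= => rst.
      by exists r; rewrite ?in_itv//= -thE//; exact: st1.
    by exists r; rewrite ?in_itv//= -thE//; exact: st1.
  have := mth s t ltac:(clra) ltac:(clra) st; rewrite im.
  have [h1 h2] := sqE s sd; have [h3 h4] := sqE t td; rewrite /= in h1 h2 h3 h4.
  have ne : xi s <> xi t by move=> /(ixi _ _ sd td); clra.
  move: h1 h3; rewrite !ltr_norml => h1 h3.
  case: (ltrgtP (xi s) (xi t)) => // lt.
    by rewrite (box_mu bx)//; [move=> [] | clra | clra].
  by rewrite (box_mu bx)//; [move=> [] | clra | clra].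
have [sg sg1 Hsg] := isometry_affine c0 d10 iso.
exists d1, sg; split => // s sd; rewrite -xi0 -Hsg//.
by split; [clra|exact: sqE|exact: thE].
Qed.

Lemma image_shift (T : Type) (g : R -> T) (a s t : R) :
  (fun r => g (a + r)) @` `[s, t] = g @` `[a + s, a + t].
Proof.
apply/seteqP; split => _ [r /= + <-]; rewrite in_itv /= => /andP[h1 h2].
  by exists (a + r) => //; rewrite in_itv /= !lerD2l h1.
exists (r - a); last by rewrite addrC subrK.
by rewrite in_itv /=; apply/andP; split; clra.
Qed.

Lemma box_shift x e B I w : isbox x e B I -> sq e w -> exists d : R, [/\ 0 < d,
  forall r v, `|r| < d -> `|v| < d -> sq e (w.1 + r, w.2 + v),
  forall s, `|s| < d -> {for s, continuous (fun r => B (w.1 + r, w.2))},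
  forall s t, `|s| < d -> `|t| < d -> B (w.1 + s, w.2) = B (w.1 + t, w.2) -> s = t &
  (forall s t, `|s| < d -> `|t| < d -> leaf F (B (w.1 + s, w.2)) (B (w.1 + t, w.2))) /\
  (forall s t, `|s| < d -> `|t| < d -> s < t ->
    mu G ((fun r => B (w.1 + r, w.2)) @` `[s, t]) = (1 * (t - s))%:E)].
Proof.
move=> bx [w1 w2].
pose d := Num.min (e - `|w.1|) (e - `|w.2|).
have d0 : 0 < d by rewrite lt_min !subr_gt0 w1.
have sqd r v : `|r| < d -> `|v| < d -> sq e (w.1 + r, w.2 + v).
  rewrite !lt_min => /andP[r1 _] /andP[_ v2]; split => /=.
    by apply: le_lt_trans (ler_normD _ _) _; clra.
  by apply: le_lt_trans (ler_normD _ _) _; clra.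
have sqd0 r : `|r| < d -> sq e (w.1 + r, w.2).
  by move=> rd; rewrite -(addr0 w.2); apply: sqd => //; rewrite normr0.
exists d; split => //.
- move=> s sd; apply: (@continuous_comp _ _ _ (fun r => (w.1 + r, w.2)) B).
    apply: cont_pair; last exact: cont_cst.
    by apply: cont_add; [exact: cont_cst|exact: cvg_id].
  by apply: (box_cont bx); exact: sqd0.
- move=> s t /sqd0 h1 /sqd0 h2 E; have := box_K bx h1; rewrite E (box_K bx h2) => -[].
  by move/addrI.
- split; first by move=> s t /sqd0 h1 /sqd0 h2; apply: (box_F bx).
  move=> s t /sqd0[+ _] /sqd0[+ _] st /=; rewrite !ltr_norml => /= h1 h2.
  rewrite (image_shift (fun r => B (r, w.2))) (box_mu bx)//; [congr (_%:E); ring|clra|clra|clra].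
Qed.

(** On the horizontal line through [w] this is [constant_speed]. Leaves of [G] keep the first
    coordinate of both boxes, so the same sign and shift hold at every height. *)
Lemma box_transition x e B I w x' e' B' I' w' : isbox x e B I -> sq e w ->
  isbox x' e' B' I' -> sq e' w' -> B w = B' w' ->
  exists (d sg : R) (eta : R -> R), [/\ 0 < d, sgn1 sg, eta 0 = w'.2,
    (forall v, `|v| < d -> {for v, continuous eta}) /\
    (forall v v', `|v| < d -> `|v'| < d -> eta v = eta v' -> v = v') &
    forall r v, `|r| < d -> `|v| < d ->
      [/\ sq e (w.1 + r, w.2 + v), sq e' (w'.1 + sg * r, eta v) &
          B (w.1 + r, w.2 + v) = B' (w'.1 + sg * r, eta v)]].
Proof.
move=> bx sw bx' sw' E.
have [d1 [d10 sq1 c1 i1 [l1 m1]]] := box_shift bx sw.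
have E0 : B (w.1 + 0, w.2) = B' w' by rewrite addr0 -surjective_pairing.
have [d2 [sg [d20 sg1 H2]]] := constant_speed bx' sw' ltr01 d10 E0 c1 i1 l1 m1.
have shc (a : R * R) : {for a, continuous (fun z : R * R => (w.1 + z.1, w.2 + z.2))}.
  apply: cont_pair; apply: cont_add; try exact: cont_cst; [exact: cont_fst|exact: cont_snd].
have [d3 [d30 Hd3]] : exists d3 : R, 0 < d3 /\ forall r v, `|r| < d3 -> `|v| < d3 ->
    [/\ `|r| < d1, `|v| < d1, sq e' (I' (B (w.1 + r, w.2 + v))) &
        B' (I' (B (w.1 + r, w.2 + v))) = B (w.1 + r, w.2 + v)].
  have cB : {for (0, 0) : R * R, continuous (fun z : R * R => B (w.1 + z.1, w.2 + z.2))}.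
    apply: (@continuous_comp _ _ _ (fun z : R * R => (w.1 + z.1, w.2 + z.2)) B); first exact: shc.
    by apply: (box_cont bx); apply: sq1; rewrite normr0.
  have E1 : B (w.1 + 0, w.2 + 0) = B' w' by rewrite !addr0 -surjective_pairing.
  have := cB (fun y => sq e' (I' y) /\ B' (I' y) = y); rewrite /= E1 => /(_ (box_open bx' sw')).
  move=> /nbhs_ballP[r /= r0 Hr].
  exists (Num.min r d1); split; first by rewrite lt_min r0.
  move=> s v; rewrite !lt_min => /andP[sr sd] /andP[vr vd].
  have [] := Hr (s, v) => //.
  by split; rewrite /ball /= sub0r normrN.
pose d := Num.min d2 d3.
have d0 : 0 < d by rewrite lt_min d20.
have zd : `|0 : R| < d by rewrite normr0.
have dd2 (r : R) : `|r| < d -> `|r| < d2 by rewrite lt_min => /andP[].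
have dd3 (r : R) : `|r| < d -> `|r| < d3 by rewrite lt_min => /andP[].
pose Q (r v : R) := I' (B (w.1 + r, w.2 + v)).
have H3 r v : `|r| < d -> `|v| < d -> sq e' (Q r v) /\ B' (Q r v) = B (w.1 + r, w.2 + v).
  by move=> /dd3 rd /dd3 vd; have [] := Hd3 r v rd vd.
have sqw r v : `|r| < d -> `|v| < d -> sq e (w.1 + r, w.2 + v).
  by move=> /dd3 rd /dd3 vd; have [h1 h2 _ _] := Hd3 r v rd vd; exact: sq1.
have Qc r v : `|r| < d -> `|v| < d -> {for (r, v), continuous (fun z : R * R => B (w.1 + z.1, w.2 + z.2))}.
  move=> rd vd; apply: (@continuous_comp _ _ _ (fun z : R * R => (w.1 + z.1, w.2 + z.2)) B); first exact: shc.
  by apply: (box_cont bx); exact: sqw.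
have Q2 r v : `|r| < d -> `|v| < d -> (Q r v).2 = (Q 0 v).2.
  move=> rd vd.
  apply: (@box_path_F x' e' B' I' (fun r => B (w.1 + r, w.2 + v)) (- d) d bx' _ _ _ r 0).
  - move=> t; rewrite -ltr_norml => td.
    apply: (@continuous_comp _ _ _ (fun t : R => (t, v)) (fun z : R * R => B (w.1 + z.1, w.2 + z.2))).
      by apply: (cont_pair (f := id)); [exact: cvg_id|exact: cont_cst].
    exact: Qc.
  - by move=> s t; rewrite -!ltr_norml => sd td; apply: (box_F bx); exact: sqw.
  - by move=> t; rewrite -ltr_norml => td; exact: H3.
  - by rewrite -ltr_norml.
  - by rewrite -ltr_norml.
have Q1 r v : `|r| < d -> `|v| < d -> (Q r v).1 = (Q r 0).1.
  move=> rd vd.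
  apply: (@box_path_G x' e' B' I' (fun v => B (w.1 + r, w.2 + v)) (- d) d bx' _ _ _ v 0).
  - move=> t; rewrite -ltr_norml => td.
    apply: (@continuous_comp _ _ _ (fun t : R => (r, t)) (fun z : R * R => B (w.1 + z.1, w.2 + z.2))).
      by apply: (cont_pair (g := id)); [exact: cont_cst|exact: cvg_id].
    exact: Qc.
  - by move=> s t; rewrite -!ltr_norml => sd td; apply: (box_G bx); exact: sqw.
  - by move=> t; rewrite -ltr_norml => td; exact: H3.
  - by rewrite -ltr_norml.
  - by rewrite -ltr_norml.
have Q10 r : `|r| < d -> (Q r 0).1 = w'.1 + sg * r.
  move=> rd; have [_ h1 h2] := H2 r (dd2 r rd).
  by rewrite /Q addr0 h2 (box_K bx' h1) mulr1.
have QE r v : `|r| < d -> `|v| < d -> Q r v = (w'.1 + sg * r, (Q 0 v).2).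
  by move=> rd vd; rewrite [LHS]surjective_pairing Q1// Q10// Q2.
have i0 v v' : `|v| < d -> `|v'| < d -> (Q 0 v).2 = (Q 0 v').2 -> v = v'.
  move=> vd vd' E2; have QQ : Q 0 v = Q 0 v' by rewrite (QE 0 v zd vd) (QE 0 v' zd vd') E2.
  have := (H3 0 v zd vd).2; rewrite QQ (H3 0 v' zd vd').2 => E3.
  have := box_K bx (sqw 0 v zd vd); rewrite -E3 (box_K bx (sqw 0 v' zd vd')) => -[].
  by move/addrI.
exists d, sg, (fun v => (Q 0 v).2); split; [exact: d0|exact: sg1| | |].
- by rewrite /Q !addr0 -surjective_pairing E (box_K bx' sw').
- split; last exact: i0.
  move=> v vd.
  apply: (@continuous_comp _ _ _ (fun v => Q 0 v) snd); last exact: cont_snd.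
  apply: (@continuous_comp _ _ _ (fun v => B (w.1 + 0, w.2 + v)) I').
    apply: (@continuous_comp _ _ _ (fun t : R => (0, t)) (fun z : R * R => B (w.1 + z.1, w.2 + z.2))).
      by apply: (cont_pair (g := id)); [exact: cont_cst|exact: cvg_id].
    exact: Qc.
  by rewrite -(H3 0 v zd vd).2; apply: (box_Icont bx'); exact: (H3 0 v zd vd).1.
- move=> r v rd vd; have [h1 h2] := H3 r v rd vd.
  by rewrite -(QE r v rd vd) h2; split => //; exact: sqw.
Qed.

Variables (be : S -> R) (B : S -> R * R -> S) (bi : S -> S -> R * R).
Hypothesis bP : forall x, ~ Sg x -> isbox x (be x) (B x) (bi x).

(** Unit speed paths in leaves of [F]: near each time the path runs along the axis of the box
    centred at its position, in the direction [sg]. Only times in [I] are tested, so at an end of an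
    interval the condition is one-sided. *)
Definition geo (I : set R) (g : R -> S) : Prop := forall t, I t -> ~ Sg (g t) /\
  exists d sg, [/\ 0 < d, sgn1 sg & forall s, I s -> `|s - t| < d ->
    `|s - t| < be (g t) /\ g s = B (g t) (sg * (s - t), 0)].

Lemma sq0 (e : R) : 0 < e -> sq e (0, 0).
Proof. by move=> e0; split; rewrite /= normr0. Qed.

Lemma sq_axis (e a : R) : `|a| < e -> sq e (a, 0).
Proof. by move=> ae; split => //=; rewrite normr0 (le_lt_trans _ ae). Qed.

Lemma geo_reg I g t : geo I g -> I t -> ~ Sg (g t).
Proof. by move=> gI /gI[]. Qed.

Lemma geo_sub (I J : set R) g : J `<=` I -> geo I g -> geo J g.
Proof.
move=> JI gI t Jt; have [n [d [sg [d0 sg1 H]]]] := gI t (JI t Jt); split => //.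
by exists d, sg; split => // s Js; apply: H; exact: JI.
Qed.

Lemma geo_eq (I : set R) g g' : (forall t, I t -> g t = g' t) -> geo I g -> geo I g'.
Proof.
move=> E gI t It; rewrite -E//; have [n [d [sg [d0 sg1 H]]]] := gI t It; split => //.
by exists d, sg; split => // s Is sd; rewrite -E//; exact: H.
Qed.

Lemma geo_local (I : set R) g : (forall t, I t -> exists2 d : R, 0 < d &
    geo [set s | I s /\ `|s - t| < d] g) -> geo I g.
Proof.
move=> H t It; have [e e0 gI] := H t It.
have [|n [d [sg [d0 sg1 K]]]] := gI t; first by split => //; rewrite subrr normr0.
split => //; exists (Num.min d e), sg; split => //; first by rewrite lt_min d0.
by move=> s Is; rewrite lt_min => /andP[sd se]; apply: K.
Qed.

Lemma geo_con I g t : geo I g -> I t -> con I g t.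
Proof.
move=> gI It; have [n [d [sg [d0 sg1 H]]]] := gI t It.
move=> U nU; have bx := bP n.
have c0 : con setT (fun s => B (g t) (sg * (s - t), 0)) t.
  apply: con_for; apply: (@continuous_comp _ _ _ (fun s : R => (sg * (s - t), 0)) (B (g t))).
    apply: cont_pair; last exact: cont_cst.
    apply: cont_mul; first exact: cont_cst.
    by apply: cont_sub; [exact: cvg_id|exact: cont_cst].
  by apply: (box_cont bx); rewrite subrr mulr0; apply: sq0; exact: (box_gt0 bx).
have := c0 U; rewrite subrr mulr0 (box_center bx) => /(_ nU)[e e0 He].
exists (Num.min d e); first by rewrite lt_min d0.
move=> s Is; rewrite lt_min => /andP[sd se].
by have [_ ->] := H s Is sd; apply: He.
Qed.

Lemma geo_affine I g (c sg : R) : sgn1 sg -> geo I g ->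
  geo [set t | I (c + sg * t)] (fun t => g (c + sg * t)).
Proof.
move=> sg1 gI t /= It; have [n [d [sg' [d0 sg1' H]]]] := gI _ It; split => //.
exists d, (sg' * sg); split => //; first exact: sgn1M.
move=> s /= Is sd.
have E : c + sg * s - (c + sg * t) = sg * (s - t) by ring.
have [|h1 h2] := H _ Is; first by rewrite E norm_sgn1.
by rewrite -(norm_sgn1 (s - t) sg1) -E; split => //; rewrite h2 E mulrA.
Qed.

(** Frees [geo] from the particular box centred at the point: by [box_transition] the path is a
    horizontal line in every box that contains it. *)
Lemma geo_box I g t x e b bi' w : geo I g -> I t -> isbox x e b bi' -> sq e w -> g t = b w ->
  exists d sg, [/\ 0 < d, sgn1 sg & forall s, I s -> `|s - t| < d ->
    sq e (w.1 + sg * (s - t), w.2) /\ g s = b (w.1 + sg * (s - t), w.2)].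
Proof.
move=> gI It bx sw E; have [n [d [sg [d0 sg1 H]]]] := gI t It.
have bt := bP n; have bt0 := sq0 (box_gt0 bt).
have E' : B (g t) (0, 0) = b w by rewrite (box_center bt).
have [d1 [sg' [eta [d10 sg1' eta0 _ K]]]] := box_transition bt bt0 bx sw E'.
exists (Num.min d d1), (sg' * sg); split => //; [by rewrite lt_min d0|exact: sgn1M|].
move=> s Is; rewrite lt_min => /andP[sd sd1].
have [_ ->] := H s Is sd.
have [||_] := K (sg * (s - t)) 0; first by rewrite norm_sgn1.
  by rewrite normr0.
by rewrite /= !add0r eta0 mulrA.
Qed.

Lemma box_geo x e b bi' (u0 v sg : R) : isbox x e b bi' -> sgn1 sg ->
  geo [set t | sq e (u0 + sg * t, v)] (fun t => b (u0 + sg * t, v)).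
Proof.
move=> bx sg1 t /= It; have n := box_reg bx It; split => //.
have bt := bP n; have bt0 := sq0 (box_gt0 bt).
have E' : b (u0 + sg * t, v) = B (b (u0 + sg * t, v)) (0, 0) by rewrite (box_center bt).
have [d1 [sg' [eta [d10 sg1' eta0 _ K]]]] := box_transition bx It bt bt0 E'.
exists d1, (sg' * sg); split => //; first exact: sgn1M.
move=> s Is sd.
have [||h1] := K (sg * (s - t)) 0; first by rewrite norm_sgn1.
  by rewrite normr0.
rewrite /= eta0 addr0 add0r !mulrA (_ : u0 + sg * t + sg * (s - t) = u0 + sg * s); last by ring.
move=> [+ _] ->; rewrite /= norm_sgn1 //; exact: sgn1M.
Qed.

(** Continuous induction: at a limit time the positions agree by continuity, and the directions
    agree because a single earlier point, seen in the box at the limit, decides the sign. *)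
Lemma geo_uniq (a b : R) g g' : geo `[a, b] g -> geo `[a, b] g' ->
  (exists2 d : R, 0 < d & forall s, a <= s <= b -> s < a + d -> g s = g' s) ->
  forall s, a <= s <= b -> g s = g' s.
Proof.
move=> gI gI' [d d0 Hd].
have [ab|ba] := leP a b; last by move=> s sab; exfalso; clra.
have itv (s : R) : a <= s <= b -> `[a, b]%classic s by rewrite /= in_itv.
suff : forall t, a <= t -> t <= b ->
    exists2 d : R, 0 < d & forall s, a <= s <= b -> s < t + d -> g s = g' s.
  move=> K s sab; have [h1 h2] := andP sab; have [e e0 He] := K s h1 h2.
  by apply: He => //; rewrite ltrDl.
apply: real_ind => //.
- by exists d.
- move=> t at_ tb [e e0 He]; exists e => // s ts ste sb.
  exists (t + e - s); first by rewrite subr_gt0.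
  by move=> r rab re; apply: He => //; move: re; rewrite addrC subrK.
- move=> t at_ tb H.
  have lt_t s : a <= s -> s < t -> g s = g' s.
    move=> as_ st; have [e e0 He] := H s as_ st; apply: He; last by rewrite ltrDl.
    by rewrite as_ (le_trans (ltW st)).
  have tab : a <= t <= b by rewrite tb ltW.
  have mid e : 0 < e -> exists s, [/\ a <= s, s < t & `|s - t| < e].
    move=> e0; exists (Num.max a (t - e / 2)); split.
    - by rewrite le_max lexx.
    - by rewrite gt_max at_ /= ltrBlDr ltrDl divr_gt0.
    - rewrite ltr0_norm ?subr_lt0 ?gt_max ?at_ /= ?ltrBlDr ?ltrDl ?divr_gt0//.
      rewrite opprB ltrBlDr -ltrBlDl lt_max; apply/orP; right; clra.
  have Et : g t = g' t.
    apply: (con_uniq (I := `[a, b])); first exact: surf_hausdorff.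
    - by apply: geo_con gI _; exact: itv.
    - by apply: geo_con gI' _; exact: itv.
    - move=> e e0; have [s [as_ st se]] := mid e e0; exists s.
        by apply: itv; rewrite as_ (le_trans (ltW st)).
      by split => //; exact: lt_t.
  have [n [d1 [sg [d10 sg1 H1]]]] := gI t (itv t tab).
  have [_ [d2 [sg' [d20 sg1' H2]]]] := gI' t (itv t tab).
  rewrite -Et in H2.
  pose e := Num.min d1 d2.
  have e0 : 0 < e by rewrite lt_min d10.
  have [s [as_ st se]] := mid e e0.
  have sab : a <= s <= b by rewrite as_ (le_trans (ltW st)).
  move: se; rewrite lt_min => /andP[sd1 sd2].
  have [s1 E1] := H1 s (itv s sab) sd1; have [s2 E2] := H2 s (itv s sab) sd2.
  have bt := bP n.
  have Esg : sg = sg'.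
    have := box_K bt (sq_axis (a := sg * (s - t)) _); rewrite norm_sgn1// => /(_ s1).
    rewrite -E1 (lt_t s as_ st) E2 (box_K bt); last by apply: sq_axis; rewrite norm_sgn1.
    by move=> [] /mulIf -> //; rewrite subr_eq0 lt_eqF.
  exists e => // r rab rte.
  have [rt|tr] := ltP r t; first by apply: lt_t => //; case/andP: rab.
  have re : `|r - t| < e by rewrite ger0_norm ?subr_ge0// ltrBlDl.
  move: re; rewrite lt_min => /andP[re1 re2].
  have [_ ->] := H1 r (itv r rab) re1; have [_ ->] := H2 r (itv r rab) re2.
  by rewrite Esg.
Qed.

Lemma geo_uniq_left (a b : R) g g' : geo `[a, b] g -> geo `[a, b] g' ->
  (exists2 d : R, 0 < d & forall s, a <= s <= b -> b - d < s -> g s = g' s) ->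
  forall s, a <= s <= b -> g s = g' s.
Proof.
move=> gI gI' [d d0 Hd] s sab.
have m1 : sgn1 (-1 : R) by right.
have sub : `[- b, - a] `<=` [set t : R | `[a, b]%classic (0 + -1 * t)].
  by move=> t /=; rewrite !in_itv /=; clra.
have h1 := geo_sub sub (geo_affine (c := 0) m1 gI).
have h2 := geo_sub sub (geo_affine (c := 0) m1 gI').
have := geo_uniq h1 h2 _ (s := - s).
rewrite /= (_ : 0 + -1 * - s = s); last by ring.
apply; last by clra.
by exists d => // r rab rb; apply: Hd; clra.
Qed.

Lemma geo_line I g t0 x e b bi' w : geo I g -> I t0 -> isbox x e b bi' -> sq e w -> g t0 = b w ->
  exists2 sg, sgn1 sg & forall s,
    (forall r, t0 <= r <= s \/ s <= r <= t0 -> I r /\ `|w.1 + sg * (r - t0)| < e) ->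
    g s = b (w.1 + sg * (s - t0), w.2).
Proof.
move=> gI It bx sw E; have [d [sg [d0 sg1 H]]] := geo_box gI It bx sw E.
exists sg => // s Hs.
have sqr r : t0 <= r <= s \/ s <= r <= t0 -> sq e (w.1 - sg * t0 + sg * r, w.2).
  move=> /Hs[_ h]; split => /=; last by case: sw.
  by rewrite (_ : _ + _ = w.1 + sg * (r - t0))//; ring.
have bg := box_geo (u0 := w.1 - sg * t0) (v := w.2) bx sg1.
rewrite (_ : w.1 + _ = w.1 - sg * t0 + sg * s); last by ring.
have [st|ts] := leP t0 s.
  apply: (@geo_uniq t0 s g (fun r => b (w.1 - sg * t0 + sg * r, w.2))).
  - by apply: geo_sub gI => r /=; rewrite in_itv /= => rs; have [] := Hs r (or_introl rs).
  - by apply: geo_sub bg => r /=; rewrite in_itv /= => rs; apply: sqr; left.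
  - exists d => // r rs rd; have [|_ ->] := H r (Hs r (or_introl rs)).1; last by congr (b (_, _)); ring.
    by rewrite ger0_norm; clra.
  - by rewrite lexx st.
apply: (@geo_uniq_left s t0 g (fun r => b (w.1 - sg * t0 + sg * r, w.2))).
- by apply: geo_sub gI => r /=; rewrite in_itv /= => rs; have [] := Hs r (or_intror rs).
- by apply: geo_sub bg => r /=; rewrite in_itv /= => rs; apply: sqr; right.
- exists d => // r rs rd; have [|_ ->] := H r (Hs r (or_intror rs)).1; last by congr (b (_, _)); ring.
  by rewrite ler0_norm; clra.
- by rewrite lexx ltW.
Qed.

Lemma geo_extend (t : R) g : 0 < t -> geo `[0, t] g -> exists (d : R) g',
  [/\ 0 < d, geo `[0, t + d] g' & forall s, s <= t -> g' s = g s].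
Proof.
move=> t0 gI.
have It : `[0, t]%classic t by rewrite /= in_itv /= lexx ltW.
have [n [d [sg [d0 sg1 H]]]] := gI t It.
have bt := bP n; have e0 := box_gt0 bt.
pose g' s := if s <= t then g s else B (g t) (0 - sg * t + sg * s, 0).
have g'E s : 0 <= s -> `|s - t| < d -> g' s = B (g t) (0 - sg * t + sg * s, 0).
  move=> s0 sd; rewrite /g'; case: leP => // st.
  have [|_ ->//] := H s _ sd; first by rewrite /= in_itv /= s0.
  by congr (B _ (_, _)); ring.
have bg := box_geo (u0 := 0 - sg * t) (v := 0) bt sg1.
have sqB s : `|s - t| < be (g t) -> sq (be (g t)) (0 - sg * t + sg * s, 0).
  move=> h; apply: sq_axis; rewrite (_ : _ + _ = sg * (s - t)) ?norm_sgn1//; ring.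
exists (be (g t) / 2), g'; split; [by rewrite divr_gt0| |by move=> s st; rewrite /g' st].
apply: geo_local => s /=; rewrite in_itv /= => /andP[s0 st].
have [h|h] := ltP s t.
  exists (t - s); first by rewrite subr_gt0.
  apply: (geo_eq (g := g)).
    by move=> r [_]; rewrite ltr_norml => /andP[_ rt]; rewrite /g' ifT//; clra.
  apply: geo_sub gI => r [] /=; rewrite !in_itv /= ltr_norml; clra.
have lineP (J : set R) : (forall r, J r -> `|r - t| < be (g t)) ->
    (forall r, J r -> g' r = B (g t) (0 - sg * t + sg * r, 0)) -> geo J g'.
  move=> J1 J2; apply: (geo_eq (g := fun s => B (g t) (0 - sg * t + sg * s, 0))).
    by move=> r Jr; rewrite J2.
  by apply: geo_sub bg => r Jr /=; apply: sqB; exact: J1.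
case: (ltrgtP s t) h => // [ts _|-> _].
  exists (s - t); first by rewrite subr_gt0.
  apply: lineP => r [] /=; rewrite in_itv /= ltr_norml => /andP[r0 rt] rs.
    by rewrite ger0_norm; clra.
  by rewrite /g' leNgt ifF//; apply/negbTE; rewrite negbK; clra.
exists (Num.min d (be (g t))); first by rewrite lt_min d0.
apply: lineP => r [] /=; rewrite in_itv /= lt_min => /andP[r0 rt] /andP[rd rb] //.
exact: g'E.
Qed.

Definition tends (g : R -> S) (t : R) (q : S) := forall U, nbhs q U ->
  exists2 d : R, 0 < d & forall s, t - d < s < t -> U (g s).

Hypothesis finSg : finite_set Sg.

Lemma closed_Sg (A : set S) : A `<=` Sg -> closed A.
Proof.
move=> AS; apply: compact_closed; first exact: surf_hausdorff.
by apply: finite_compact; exact: sub_finite_set finSg.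
Qed.

(** If some cluster point at time t is regular, the path enters the middle half of the box there
    with less than half of its radius left to run, so a line of the box prolongs it to t. Otherwise
    all cluster points are in the finite set [Sg], and it remains to exclude that there are two. *)
Lemma geo_end (t : R) g : 0 < t -> geo `[0, t[ g ->
  (exists2 g', geo `[0, t] g' & forall s, 0 <= s < t -> g' s = g s) \/
  (exists2 q, Sg q & tends g t q).
Proof.
move=> t0 gI.
pose clus (z : S) := forall U, nbhs z U -> forall d, 0 < d -> exists2 s, t - d < s < t & U (g s).
have hS : hausdorff_space S := @surf_hausdorff _ S.
have cS : compact [set: S] := @surf_compact _ S.
have [[z [cz nz]]|allS] := pselect (exists z, clus z /\ ~ Sg z).
  left; have bz := bP nz; have e0 := box_gt0 bz.
  have sq00 := sq0 e0.
  pose U y := sq (be z) (bi z y) /\ B z (bi z y) = y /\ `|(bi z y).1| < be z / 2.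
  have nU : nbhs z U.
    have N1 := box_open bz sq00; rewrite (box_center bz) in N1.
    have N2 : \forall y \near z, `|(bi z y).1| < be z / 2.
      apply: (near_norm_lt (f := fun y => (bi z y).1)).
        apply: (@continuous_comp _ _ _ (bi z) fst); last exact: cont_fst.
        by have := box_Icont bz sq00; rewrite (box_center bz).
      by rewrite -{2}(box_center bz) (box_K bz)//= normr0 divr_gt0.
    near=> y; split; first by have [] := near N1 y.
    by split; [have [] := near N1 y|near: y].
  have d0 : 0 < Num.min (be z / 2) t by rewrite lt_min divr_gt0.
  have [t1 /andP[t1a t1b] [sw [Ew w1]]] := cz U nU _ d0.
  set w := bi z (g t1) in sw Ew w1.
  have t10 : 0 <= t1 by have : Num.min (be z / 2) t <= t by [rewrite ge_min lexx orbT]; clra.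
  have t1e : t - be z / 2 < t1 by have : Num.min (be z / 2) t <= be z / 2 by [rewrite ge_min lexx]; clra.
  have It1 : `[0, t[%classic t1 by rewrite /= in_itv /= t10.
  have [sg sg1 Hs] := geo_line gI It1 bz sw (esym Ew).
  have sqB s : t1 <= s <= t -> sq (be z) (w.1 - sg * t1 + sg * s, w.2).
    move=> st; split => /=; last by case: sw.
    rewrite (_ : _ + _ = w.1 + sg * (s - t1)); last by ring.
    apply: le_lt_trans (ler_normD _ _) _; rewrite norm_sgn1// (ger0_norm (x := s - t1)); clra.
  have lineE s : t1 <= s < t -> g s = B z (w.1 - sg * t1 + sg * s, w.2).
    move=> st; rewrite Hs; first by congr (B z (_, _)); ring.
    move=> r rs; split; first by rewrite /= in_itv /=; clra.
    have [|h _] := sqB r; first clra.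
    by move: h; rewrite /= (_ : _ + _ = w.1 + sg * (r - t1))//; ring.
  pose g' s := if s < t then g s else B z (w.1 - sg * t1 + sg * s, w.2).
  exists g'; last by move=> s /andP[_ st]; rewrite /g' st.
  apply: geo_local => s /=; rewrite in_itv /= => /andP[s0 st].
  have [h|h] := ltP s t.
    exists (t - s); first by rewrite subr_gt0.
    apply: (geo_eq (g := g)).
      by move=> r [_]; rewrite ltr_norml => /andP[_ rt]; rewrite /g' ifT//; clra.
    apply: geo_sub gI => r [] /=; rewrite !in_itv /= ltr_norml; clra.
  exists (t - t1); first by rewrite subr_gt0.
  apply: (geo_eq (g := fun s => B z (w.1 - sg * t1 + sg * s, w.2))).
    move=> r [/=]; rewrite in_itv /= ltr_norml => /andP[r0 rt] rs.
    by rewrite /g'; case: ifP => // rt'; rewrite lineE//; clra.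
  apply: geo_sub (box_geo (u0 := w.1 - sg * t1) (v := w.2) bz sg1) => r [/=].
  by rewrite in_itv /= ltr_norml => rt rs; apply: sqB; clra.
right.
have {}allS z : clus z -> Sg z.
  by move=> cz; apply: contrapT => nz; apply: allS; exists z.
have [q cq] := left_cluster g t cS.
have Sq := allS q cq; exists q => //.
apply: left_cvg => // z' cz'; apply: contrapT => zq.
(* the path would cross infinitely often the boundary of a neighbourhood of q *)
have clO : closed (Sg `\ q) by apply: closed_Sg => x [].
have nq : nbhs q (~` (Sg `\ q)).
  by apply: open_nbhs_nbhs; split; [exact: closed_openC|move=> [_]; apply].
have [V [nV cV VO]] : exists V, [/\ nbhs q V, closed V & V `<=` ~` (Sg `\ q)].
  have [V nV VO] := compact_regular (x := q) hS cS filterT nq.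
  exists (closure V); split => //; last exact: closed_closure.
  by apply: filterS nV; exact: subset_closure.
have cross d : 0 < d -> exists2 s, t - d < s < t & V (g s) /\ ~ (V°)%classic (g s).
  move=> d0; pose d' := Num.min d t.
  have d'0 : 0 < d' by rewrite lt_min d0.
  have d't : d' <= t by rewrite ge_min lexx orbT.
  have d'd : d' <= d by rewrite ge_min lexx.
  have nI : nbhs q (V°)%classic by exact: nbhs_interior.
  have [s1 s1t Vs1] := cq _ nI d' d'0.
  have nz' : nbhs z' (~` V).
    apply: open_nbhs_nbhs; split; first exact: closed_openC.
    by move=> /VO; apply; split; [exact: allS|].
  have [s2 s2t Vs2] := cz' _ nz' d' d'0.
  apply: contrapT => nc.
  have Hc s : t - d' < s < t -> V (g s) -> (V°)%classic (g s).
    move=> st Vs; apply: contrapT => ni; apply: nc; exists s => //; clra.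
  have lc a b : t - d' < a -> a <= b -> b < t -> `[<V (g b)>] = `[<V (g a)>].
    move=> ta ab bt; apply: (locally_constant (f := fun s => `[<V (g s)>])) => // s sab.
    have Is : `[0, t[%classic s by rewrite /= in_itv /=; clra.
    have [Vs|nVs] := pselect (V (g s)).
      have /(_ _ (open_nbhs_nbhs (conj (open_interior V) (Hc s ltac:(clra) Vs))))[e e0 He] := geo_con gI Is.
      exists e => // r rab re; rewrite (asboolT Vs) asboolT//.
      by apply: interior_subset; apply: He; rewrite /= ?in_itv /=; clra.
    have /(_ _ (open_nbhs_nbhs (conj (closed_openC cV) nVs)))[e e0 He] := geo_con gI Is.
    exists e => // r rab re; rewrite (asboolF nVs) asboolF//.
    by apply: He; rewrite /= ?in_itv /=; clra.
  have V1 : V (g s1) by exact: interior_subset.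
  have [h|h] := leP s1 s2.
    by have := lc s1 s2 ltac:(clra) h ltac:(clra); rewrite (asboolT V1) (asboolF Vs2).
  by have := lc s2 s1 ltac:(clra) (ltW h) ltac:(clra); rewrite (asboolT V1) (asboolF Vs2).
(* Such crossings accumulate at a point of [V] outside its interior. It is a cluster point of the
   path, hence in [Sg]; but the only point of [Sg] in [V] is [q], which is interior. *)
have /choice[sn Hsn] : forall n : nat, exists s : R, t - n.+1%:R^-1 < s < t /\ (V (g s) /\ ~ (V°)%classic (g s)).
  move=> n; have n0 : (0 : R) < n.+1%:R^-1 by rewrite invr_gt0.
  by have [s st Vs] := cross _ n0; exists s.
have [y cy] := seq_cluster (g \o sn) cS.
have Vy : V y.
  apply: contrapT => nVy.
  have [n _ /=] := cy _ (open_nbhs_nbhs (conj (closed_openC cV) nVy)) 0%N.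
  by apply; have [_ []] := Hsn n.
have niy : ~ (V°)%classic y.
  move=> iy; have [n _ /=] := cy _ (open_nbhs_nbhs (conj (open_interior V) iy)) 0%N.
  by have [_ []] := Hsn n.
have Sy : Sg y.
  apply: allS => U nU d d0.
  have [N _ HN] := near_infty_natSinv_lt (PosNum d0).
  have [n Nn Un] := cy U nU N; exists (sn n) => //.
  have nd : n.+1%:R^-1 < d := HN n Nn; have [/andP[h ht] _] := Hsn n.
  by rewrite ht andbT; apply: le_lt_trans h; rewrite lerD2l lerN2 ltW.
have yq : y = q by apply: contrapT => yq; apply: (VO y Vy).
by apply: niy; rewrite yq.
Unshelve. all: by end_near. Qed.

Lemma geo_glue (t : R) (d0 : R) (g0 : R -> S) : 0 < t -> 0 < d0 ->
  (forall s, 0 < s -> s < t -> exists2 g, geo `[0, s] g &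
     forall r, 0 <= r < d0 -> r <= s -> g r = g0 r) ->
  exists2 g, geo `[0, t[ g & forall r, 0 <= r < d0 -> r < t -> g r = g0 r.
Proof.
move=> t0 d00 H.
have /choice[Ga HG] : forall s, exists g, 0 < s -> s < t ->
    geo `[0, s] g /\ forall r, 0 <= r < d0 -> r <= s -> g r = g0 r.
  move=> s; have [[s0 st]|ns] := pselect (0 < s /\ s < t); last by exists g0 => s0 st; case: ns.
  by have [g h1 h2] := H s s0 st; exists g.
have agree s s' r : 0 < s -> s <= s' -> s' < t -> 0 <= r <= s -> Ga s r = Ga s' r.
  move=> s0 ss st rs; have [h1 h2] := HG s s0 ltac:(clra); have [h3 h4] := HG s' ltac:(clra) st.
  apply: (@geo_uniq 0 s) => //.
    by apply: geo_sub h3 => x /=; rewrite !in_itv /=; clra.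
  by exists d0 => // x xs xd; rewrite (h2 x) 1?(h4 x)//; clra.
(* The value at s is read from the path on [0, m s] with s < m s < t, whose domain contains a
   neighbourhood of s. *)
pose m s := (s + t) / 2.
have mP s : 0 <= s < t -> [/\ 0 < m s, s < m s & m s < t] by rewrite /m; split; clra.
have gE s r : 0 <= r -> r <= s -> 0 < s -> s < t -> Ga (m r) r = Ga s r.
  move=> r0 rs s0 st; have [|h1 h2 h3] := mP r; first clra.
  by have [h|/ltW h] := leP (m r) s; [apply: agree|apply/esym/agree]; clra.
exists (fun s => Ga (m s) s).
  apply: geo_local => s /=; rewrite in_itv /= => st; have [h1 h2 h3] := mP s st.
  exists (m s - s); first by rewrite subr_gt0.
  have [gm _] := HG (m s) h1 h3.
  apply: (geo_eq (g := Ga (m s))).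
    move=> r [/=]; rewrite in_itv /= ltr_norml => rt rs.
    by rewrite (gE (m s) r)//; clra.
  by apply: geo_sub gm => r [/=]; rewrite !in_itv /= ltr_norml; clra.
move=> r rd rt; have [|h1 h2 h3] := mP r; first clra.
by have [_ H'] := HG (m r) h1 h3; apply: H'; clra.
Qed.

(** Together with [hits] below: the continuation of the germ of [g0] at time 0. Agreement with [g0]
    is asked only on an arbitrarily short initial piece; the rest follows by uniqueness. *)
Definition reach (g0 : R -> S) (t : R) (g : R -> S) := geo `[0, t] g /\
  exists2 d : R, 0 < d & forall r, 0 <= r < d -> r <= t -> g r = g0 r.

Definition hits (g0 : R -> S) (t : R) (q : S) := exists g, [/\ geo `[0, t[ g, tends g t q &
  exists2 d : R, 0 < d & forall r, 0 <= r < d -> r < t -> g r = g0 r].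

(** Prolongation is open to the right by [geo_extend]; at a limit time the pieces are glued, and
    [geo_end] leaves convergence to a point of [Sg] as the only obstruction. *)
Lemma reach_or_hits (g0 : R -> S) (d : R) (t : R) : 0 < d -> geo `[0, d[ g0 -> 0 < t ->
  (exists g, reach g0 t g) \/ (exists t' q, [/\ 0 < t', t' <= t, Sg q & hits g0 t' q]).
Proof.
move=> d0 gI t0.
have [?|nh] := pselect (exists t' q, [/\ 0 < t', t' <= t, Sg q & hits g0 t' q]); first by right.
left.
pose e := Num.min (d / 2) t.
have e0 : 0 < e by rewrite lt_min t0 divr_gt0.
have ed : e <= d / 2 by rewrite ge_min lexx.
have et : e <= t by rewrite ge_min lexx orbT.
have rW s g : 0 < s -> reach g0 s g -> forall r, 0 <= r < d -> r <= s -> g r = g0 r.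
  move=> s0 [h1 [d1 d10 h2]] r rd rs.
  apply: (@geo_uniq 0 r) => //.
  - by apply: geo_sub h1 => x /=; rewrite !in_itv /=; clra.
  - by apply: geo_sub gI => x /=; rewrite !in_itv /=; clra.
  - by exists d1 => // x xr xd; apply: h2; clra.
  - clra.
suff : exists g, reach g0 t g by [].
apply: (real_ind (a := e) (b := t) (P := fun s => exists g, reach g0 s g)) => //.
- exists g0; split; first by apply: geo_sub gI => x /=; rewrite !in_itv /=; clra.
  by exists d.
- move=> s es st [g [h1 [d1 d10 h2]]].
  have [|d2 [g' [d20 h3 h4]]] := geo_extend _ h1; first clra.
  exists d2 => // s' ss' sd st'; exists g'; split.
    by apply: geo_sub h3 => x /=; rewrite !in_itv /=; clra.
  exists (Num.min d1 s); first by rewrite lt_min d10; clra.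
  by move=> r; rewrite lt_min => /andP[r0 /andP[rd rs]] rt; rewrite h4 ?h2//; clra.
- move=> s es st H; have s0 : 0 < s by clra.
  have [|g h1 h2] := @geo_glue s d g0 s0 d0.
    move=> r r0 rs; have [er|re] := leP e r.
      have [g Hg] := H r er rs; exists g; first by case: Hg.
      exact: rW.
    exists g0 => //.
    by apply: geo_sub gI => x /=; rewrite !in_itv /=; clra.
  have [[g' h3 h4]|[q Sq tq]] := geo_end s0 h1.
    exists g'; split => //.
    exists (Num.min d s); first by rewrite lt_min d0.
    by move=> r; rewrite lt_min => /andP[r0 /andP[rd rs]] rt; rewrite h4 ?h2//; clra.
  exfalso; apply: nh; exists s, q; split => //; exists g; split => //.
  by exists d.
Qed.

End Geodesics.

(** * Germs of prongs and the action of the homeomorphism *)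

Section Tends.
Context {R : realType} {T : topologicalType}.
Hypothesis hT : hausdorff_space T.
Implicit Types (g : R -> T) (x y : T).

Definition tends0 g x := forall U, nbhs x U ->
  exists2 d : R, 0 < d & forall s, 0 < s < d -> U (g s).

Lemma tends0_eq g g' x (d : R) : 0 < d -> (forall s, 0 < s < d -> g s = g' s) ->
  tends0 g x -> tends0 g' x.
Proof.
move=> d0 E gx U nU; have [e e0 H] := gx U nU.
exists (Num.min d e); first by rewrite lt_min d0.
by move=> s; rewrite lt_min => /andP[s0 /andP[sd se]]; rewrite -E ?s0//; apply: H; rewrite s0.
Qed.

Lemma tends0_con (I : set R) g (t sg d : R) : sg = 1 \/ sg = -1 -> 0 < d ->
  (forall r, 0 < r < d -> I (t + sg * r)) -> con I g t ->
  tends0 (fun r => g (t + sg * r)) (g t).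
Proof.
move=> sg1 d0 Id gt U nU; have [e e0 H] := gt U nU.
exists (Num.min d e); first by rewrite lt_min d0.
move=> s; rewrite lt_min => /andP[s0 /andP[sd se]]; apply: H; first by apply: Id; rewrite s0.
by case: sg1 => ->; rewrite addrAC subrr add0r ?mul1r ?mulN1r ?normrN gtr0_norm.
Qed.

Lemma tends0_for g (t sg : R) : sg = 1 \/ sg = -1 -> {for t, continuous g} ->
  tends0 (fun r => g (t + sg * r)) (g t).
Proof. by move=> sg1 gt; apply: (tends0_con (I := setT) (d := 1)) => //; exact: con_for. Qed.

Lemma tends0_uniq g x y : tends0 g x -> tends0 g y -> x = y.
Proof.
move=> gx gy; apply: hT => A B nA nB.
have [d d0 H] := gx A nA; have [e e0 K] := gy B nB.
pose m := Num.min d e / 2.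
have m0 : 0 < Num.min d e by rewrite lt_min d0.
have md : Num.min d e <= d by rewrite ge_min lexx.
have me : Num.min d e <= e by rewrite ge_min lexx orbT.
by exists (g m); split; [apply: H|apply: K]; rewrite /m; clra.
Qed.

Lemma tends0_scale g x (c : R) : 0 < c -> tends0 g x -> tends0 (fun r => g (c * r)) x.
Proof.
move=> c0 gx U nU; have [d d0 H] := gx U nU.
exists (d / c); first by rewrite divr_gt0.
by move=> s /andP[s0 sd]; apply: H; rewrite mulr_gt0//= mulrC -ltr_pdivlMr.
Qed.

End Tends.

Lemma tends0_comp {R : realType} (T U : topologicalType) (h : T -> U) (g : R -> T) x :
  {for x, continuous h} -> tends0 g x -> tends0 (h \o g) (h x).
Proof. by move=> hx gx V nV; exact: gx (hx V nV). Qed.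

Section Prongs.
Context {R : realType} {S : surface R} (F : foliation S) (G : measured_foliation S).
Variable Sg : set S.
Hypothesis finSg : finite_set Sg.
Local Notation isbox := (isbox F G Sg).
Local Notation isprong := (isprong F G Sg).
Variables (be : S -> R) (B : S -> R * R -> S) (bi : S -> S -> R * R).
Hypothesis bP : forall x, ~ Sg x -> isbox x (be x) (B x) (bi x).
Variables (N : S -> set S) (hl vl : S -> S -> R) (e : S -> nat -> R) (A : S -> R)
  (C : S -> nat -> R * R -> S) (ph : S -> nat -> R -> R).
Hypothesis cP : forall q, Sg q ->
  isprong q (N q) (hl q) (vl q) (prongs F q) (e q) (A q) (C q) (ph q).
Local Notation geo := (geo Sg be B).
Local Notation reach := (reach Sg be B).
Local Notation hits := (hits Sg be B).
Implicit Types (q x y : S) (g h : R -> S).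

Let hS : hausdorff_space S := @surf_hausdorff _ S.
Let cS : compact [set: S] := @surf_compact _ S.

(** At the common point both paths run along the axis of the same box; uniqueness, forwards and
    backwards, carries the agreement over the common domain. *)
Lemma geo_meet (I I' : set R) g g' (t0 t1 : R) : geo I g -> geo I' g' -> I t0 -> I' t1 ->
  g t0 = g' t1 -> exists2 sg, sgn1 sg & forall s,
    (forall r, 0 <= r <= s \/ s <= r <= 0 -> I (t0 + r) /\ I' (t1 + sg * r)) ->
    g (t0 + s) = g' (t1 + sg * s).
Proof.
move=> gI gI' It It' E.
have [n [d [sg [d0 sg1 H]]]] := gI t0 It; have [_ [d' [sg' [d0' sg1' H']]]] := gI' t1 It'.
have s1 : sgn1 (sg * sg') by exact: sgn1M.
have p1 : sgn1 (1 : R) by left.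
exists (sg * sg') => // s K.
have h1 := geo_affine (c := t0) p1 gI; have h2 := geo_affine (c := t1) s1 gI'.
have near0 r : (I (t0 + r) /\ I' (t1 + sg * sg' * r)) -> `|r| < Num.min d d' ->
    g (t0 + 1 * r) = g' (t1 + sg * sg' * r).
  move=> [i1 i2]; rewrite lt_min => /andP[rd rd'].
  have [|_] := H (t0 + r) i1; first by rewrite addrAC subrr add0r.
  rewrite mul1r => ->.
  have [|_ ->] := H' (t1 + sg * sg' * r) i2.
    by rewrite addrAC subrr add0r norm_sgn1.
  rewrite E; congr (B _ (_, _)); have := sgn1V sg1'.
  move=> E2; transitivity (sg' * sg' * (sg * r)); last by ring.
  by rewrite E2; ring.
have m0 : 0 < Num.min d d' by rewrite lt_min d0.
have sub1 a b : (forall r, a <= r <= b -> I (t0 + r) /\ I' (t1 + sg * sg' * r)) ->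
    (`[a, b] `<=` [set t | I (t0 + 1 * t)]) /\ (`[a, b] `<=` [set t | I' (t1 + sg * sg' * t)]).
  by move=> L; split => r /=; rewrite in_itv /= => /L[]; rewrite ?mul1r.
have Es : g (t0 + s) = (fun r => g (t0 + 1 * r)) s by rewrite mul1r.
rewrite Es; have [s0|s0] := leP 0 s.
  have [c1 c2] := sub1 0 s (fun r rs => K r (or_introl rs)).
  apply: (geo_uniq bP (geo_sub c1 h1) (geo_sub c2 h2)); last by rewrite s0 lexx.
  exists (Num.min d d') => // r rs; rewrite add0r => rd.
  by apply: near0; [exact: K r (or_introl rs)|rewrite ger0_norm//; case/andP: rs].
have [c1 c2] := sub1 s 0 (fun r rs => K r (or_intror rs)).
apply: (geo_uniq_left bP (geo_sub c1 h1) (geo_sub c2 h2)); last by rewrite (ltW s0) lexx.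
exists (Num.min d d') => // r rs; rewrite sub0r => rd.
apply: near0; [exact: K r (or_intror rs)|rewrite ler0_norm; clra].
Qed.

Lemma geo_leaf (I : set R) g (a b : R) : geo I g -> a <= b -> (forall t, a <= t <= b -> I t) ->
  leaf F (g a) (g b).
Proof.
move=> gI ab HI.
suff -> : leaf F (g a) = leaf F (g b) by exact: leaf_refl.
apply/esym; apply: (locally_constant (f := fun t => leaf F (g t))) => // t tab.
have [n [d [sg [d0 sg1 H]]]] := gI t (HI t tab); exists d => // s sab sd.
have [sb ->] := H s (HI s sab) sd; have bx := bP n.
rewrite -{2}(box_center bx); apply: leaf_eq; apply: (box_F bx); first exact: sq0 (box_gt0 bx).
by apply: sq_axis; rewrite norm_sgn1.
Qed.

(** Recognizes a unit speed path from measures alone; needed for the lines of a sector, which is not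
    a box. *)
Lemma speed_geo (a b : R) g : (forall t, a < t < b -> ~ Sg (g t)) ->
  (forall t, a < t < b -> {for t, continuous g}) ->
  (forall s t, a < s < b -> a < t < b -> g s = g t -> s = t) ->
  (forall s t, a < s < b -> a < t < b -> leaf F (g s) (g t)) ->
  (forall s t, a < s -> s < t -> t < b -> mu G (g @` `[s, t]) = (t - s)%:E) ->
  geo `]a, b[ g.
Proof.
move=> rg cg ig lg mg t /=; rewrite in_itv /= => tab; split; first exact: rg.
have bx := bP (rg t tab); have sq00 := sq0 (box_gt0 bx).
pose d := Num.min (t - a) (b - t).
have d0 : 0 < d by rewrite lt_min !subr_gt0.
have in_ab s : `|s| < d -> a < t + s < b.
  by rewrite lt_min !ltr_norml => /andP[/andP[h1 h2] /andP[h3 h4]]; apply/andP; split; clra.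
have [|||||d' [sg [d'0 sg1 H]]] := constant_speed (th := fun s => g (t + s)) bx sq00 ltr01 d0.
- by rewrite addr0 (box_center bx).
- move=> s sd; apply: (@continuous_comp _ _ _ (fun s => t + s) g); last by apply: cg; exact: in_ab.
  by apply: cont_add; [exact: cont_cst|exact: cvg_id].
- by move=> r s rd sd /(ig _ _ (in_ab r rd) (in_ab s sd))/addrI.
- by move=> r s rd sd; apply: lg; exact: in_ab.
- move=> r s rd sd rs; rewrite image_shift mg; [by congr (_%:E); ring| | |].
  + by case/andP: (in_ab r rd).
  + by rewrite ltrD2l.
  + by case/andP: (in_ab s sd).
exists d', sg; split => // s _ /H[_ [/= h1 _]].
rewrite (addrC t) subrK => ->.
by move: h1; rewrite mulr1 !add0r norm_sgn1.
Qed.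

Lemma box_line x (v : R) : ~ Sg x -> `|v| < be x ->
  geo `]- be x, be x[ (fun u => B x (u, v)).
Proof.
move=> nx vb; have p1 : sgn1 (1 : R) by left.
apply: (geo_eq (g := fun t => B x (0 + 1 * t, v))).
  by move=> t _; rewrite mul1r add0r.
apply: geo_sub (box_geo bP (u0 := 0) (v := v) (bP nx) p1) => u /=; rewrite in_itv /= => ub.
by split => //=; rewrite add0r mul1r ltr_norml.
Qed.

Section AtVertex.
Variables (q : S) (Sq : Sg q).

Lemma sector_line j (v : R) : (j < prongs F q)%N -> 0 < v -> v <= A q ->
  geo `]- e q j, e q j[ (fun u => C q j (u, v)).
Proof.
move=> jk v0 vA; have sc := prong_sector (cP Sq) jk.
have vv : 0 <= v <= A q by rewrite ltW.
apply: speed_geo => [t|t|s t|s t|s t]; rewrite -?ltr_norml.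
- by move=> te; apply: (sec_reg sc) => //; left.
- move=> te; apply: (@continuous_comp _ _ _ (fun u : R => (u, v)) (C q j)).
    by apply: (cont_pair (f := id)); [exact: cvg_id|exact: cont_cst].
  exact: (sec_cont sc).
- by move=> se te; apply: (sec_inj sc) => //; left.
- by move=> se te; apply: (sec_F sc).
- by move=> se st te; apply: (sec_mu sc) => //; left.
Qed.

Lemma prong_line j : (j < prongs F q)%N -> geo `]0, e q j[ (fun u => C q j (u, 0)).
Proof.
move=> jk; have sc := prong_sector (cP Sq) jk; have [e0 A0] := sec_gt0 sc.
have vv : 0 <= (0 : R) <= A q by rewrite lexx ltW.
have ab t : 0 < t < e q j -> `|t| < e q j by move=> /andP[t0 te]; rewrite gtr0_norm.
apply: speed_geo => [t|t|s t|s t|s t].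
- by move=> te; apply: (sec_reg sc); [exact: ab|exact: vv|right; rewrite gt_eqF//; case/andP: te].
- move=> te; apply: (@continuous_comp _ _ _ (fun u : R => (u, 0 : R)) (C q j)).
    by apply: (cont_pair (f := id)); [exact: cvg_id|exact: cont_cst].
  by apply: (sec_cont sc); [exact: ab|exact: vv].
- move=> se te; apply: (sec_inj sc); [exact: ab|exact: ab|exact: vv|right; left].
  by move: se te => /andP[/ltW -> _] /andP[/ltW -> _].
- by move=> se te; apply: (sec_F sc); [exact: ab|exact: ab|exact: vv].
- move=> se st te; apply: (sec_mu sc) => //; [clra|by right; left].
Qed.

Lemma vertex_N : N q q.
Proof.
have sc := prong_sector (cP Sq) (prong_gt0 (cP Sq)); have [e0 A0] := sec_gt0 sc.
by rewrite -{2}(sec_vertex sc); apply: (sec_N sc); rewrite ?normr0// lexx ltW.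
Qed.

Lemma vertex_hl : hl q q = 0.
Proof.
have sc := prong_sector (cP Sq) (prong_gt0 (cP Sq)); have [e0 A0] := sec_gt0 sc.
rewrite -{2}(sec_vertex sc) (sec_hl sc) ?normr0//; [ring|by rewrite lexx ltW].
Qed.

Lemma vertex_vl : vl q q = 0.
Proof.
have sc := prong_sector (cP Sq) (prong_gt0 (cP Sq)); have [e0 A0] := sec_gt0 sc.
rewrite -{2}(sec_vertex sc) (sec_vl sc) ?normr0//; last by rewrite lexx ltW.
rewrite (sec_ph0 sc); ring.
Qed.

Lemma vertex_nbhs (m : R) : 0 < m -> \forall y \near q, N q y /\ `|vl q y| < m /\
  exists j u v, [/\ (j < prongs F q)%N, `|u| < e q j, 0 <= v <= A q,
    0 < v \/ 0 <= u & y = C q j (u, v)].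
Proof.
move=> m0.
have nN : nbhs q (N q) by apply: open_nbhs_nbhs; split; [exact: (prong_open (cP Sq))|exact: vertex_N].
have nv : \forall y \near q, `|vl q y| < m.
  apply: near_norm_lt; first by apply: (prong_vl (cP Sq)); exact: vertex_N.
  by rewrite vertex_vl normr0.
by near=> y; split; [near: y|split; near: y; [exact: nv|exact: (prong_cover (cP Sq))]].
Unshelve. all: by end_near. Qed.

Lemma sector_ph_pos j (u : R) : (j < prongs F q)%N -> 0 < u -> u < e q j -> 0 < ph q j u.
Proof.
move=> jk u0 ue; have sc := prong_sector (cP Sq) jk.
by rewrite -(sec_ph0 sc); apply: (sec_ph sc); clra.
Qed.

Lemma prong_tends j : (j < prongs F q)%N -> tends0 (fun u => C q j (u, 0)) q.
Proof.
move=> jk; have sc := prong_sector (cP Sq) jk; have [e0 A0] := sec_gt0 sc.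
have := tends0_for (g := fun u => C q j (u, 0)) (t := 0) (or_introl (erefl (1 : R))).
rewrite /= (sec_vertex sc) => H.
apply: (tends0_eq (d := 1) _ _ (H _)) => //; first by move=> s _; rewrite add0r mul1r.
apply: (@continuous_comp _ _ _ (fun u : R => (u, 0 : R)) (C q j)).
  by apply: (cont_pair (f := id)); [exact: cvg_id|exact: cont_cst].
by apply: (sec_cont sc); [rewrite normr0|rewrite lexx ltW].
Qed.

Definition germ j g := exists2 d : R, 0 < d & forall t, 0 < t < d -> g t = C q j (t, 0).

(** Along the path [hl] is constant and tends to its value 0 at [q], so the path runs on the edges v
    = 0. It agrees with a prong up to direction and shift; as both tend to the singular point [q] at
    time 0, the direction is outward and the shift is 0. *)
Lemma germ_exists (T : R) g : 0 < T -> geo `]0, T[ g -> tends0 g q ->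
  exists2 j, (j < prongs F q)%N & germ j g.
Proof.
move=> T0 gI gq.
(* By monotonicity of [ph], a value of [vl] below m forces u < e/2; as the time t1 is also less than
   e/2, the point u + t1 is still on the prong. *)
have [m m0 Hm] : exists2 m : R, 0 < m & forall j, (j < prongs F q)%N ->
    m < e q j / 2 /\ m < 2 * ph q j (e q j / 2) ^+ 2.
  have [j jk|m m0 Hm] := finite_radius (P := fun j s =>
      s < e q j / 2 /\ s < 2 * ph q j (e q j / 2) ^+ 2) (n := prongs F q) (t := 0).
    have [e0 _] := sec_gt0 (prong_sector (cP Sq) jk).
    have p0 : 0 < ph q j (e q j / 2) by apply: sector_ph_pos; rewrite ?divr_gt0//; clra.
    exists (Num.min (e q j / 2) (2 * ph q j (e q j / 2) ^+ 2)).
      by rewrite lt_min !divr_gt0//= mulr_gt0// exprn_gt0.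
    by move=> s; rewrite subr0 ltr_norml lt_min => /andP[_ /andP[]].
  exists (m / 2); first by rewrite divr_gt0.
  by move=> j jk; apply: Hm => //; rewrite subr0 gtr0_norm ?divr_gt0//; clra.
have [d0 d00 Hd0] := gq _ (vertex_nbhs m0).
pose d := Num.min d0 (Num.min T m).
have dd0 : d <= d0 by rewrite ge_min lexx.
have dT : d <= T by rewrite /d !ge_min lexx orbT.
have dm : d <= m by rewrite /d !ge_min lexx !orbT.
have dp : 0 < d by rewrite !lt_min d00 T0.
have Hd s : 0 < s < d -> N q (g s) /\ `|vl q (g s)| < m /\
    exists j u v, [/\ (j < prongs F q)%N, `|u| < e q j, 0 <= v <= A q,
      0 < v \/ 0 <= u & g s = C q j (u, v)] by move=> sd; apply: Hd0; clra.
have gc s : 0 < s < d -> con `]0, T[ g s.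
  by move=> sd; apply: (geo_con bP gI); rewrite /= in_itv /=; clra.
have hlc s t : 0 < s -> s <= t -> t < d -> hl q (g t) = hl q (g s).
  move=> s0 st td; apply: (prong_pathF (cP Sq)) => //.
  - move=> r rst; apply: (con_sub (I := `]0, T[)); last by apply: gc; clra.
    by move=> x /=; rewrite !in_itv /=; clra.
  - move=> r /andP[r1 r2]; apply: (geo_leaf gI) => // x xr; rewrite /= in_itv /=; clra.
  - by move=> r rst; have [|] := Hd r; first clra.
have hl0 s : 0 < s < d -> hl q (g s) = 0.
  move=> sd; apply: contrapT => /eqP ne.
  have : \forall y \near q, `|hl q y| < `|hl q (g s)|.
    apply: near_norm_lt; first by apply: (prong_hl (cP Sq)); exact: vertex_N.
    by rewrite vertex_hl normr0 normr_gt0.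
  move=> /gq[d1 d10 H1].
  pose r := Num.min d1 s / 2.
  have r1 : Num.min d1 s <= d1 by rewrite ge_min lexx.
  have r2 : Num.min d1 s <= s by rewrite ge_min lexx orbT.
  have r3 : 0 < Num.min d1 s by rewrite lt_min d10; case/andP: sd.
  have := H1 r ltac:(rewrite /r; clra).
  by rewrite -(hlc r s) ?ltxx//; rewrite /r; clra.
have rd : 0 < d / 2 < d by clra.
set t1 := d / 2 in rd.
have [_ [vt [j [u [v [jk ue vA vu E]]]]]] := Hd t1 rd.
have sc := prong_sector (cP Sq) jk; have [e0 A0] := sec_gt0 sc.
have [m1 m2] := Hm j jk.
have v0 : v = 0.
  have := hl0 t1 rd; rewrite E (sec_hl sc)// => /eqP.
  by rewrite mulf_eq0 pnatr_eq0 /= sqrf_eq0 => /eqP.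
subst v.
have It1 : `]0, T[%classic t1 by rewrite /= in_itv /=; clra.
have u0 : 0 < u.
  case: vu => [|]; first by rewrite ltxx.
  rewrite le_eqVlt => /orP[/eqP u0|//].
  by case: (geo_reg gI It1); rewrite E -u0 (sec_vertex sc).
have u2 : u < e q j / 2.
  rewrite ltNge; apply/negP => h; move: vt; rewrite E (sec_vl sc)// ltr_norml => /andP[_ vt].
  have : ph q j (e q j / 2) <= ph q j u.
    move: h; rewrite le_eqVlt => /orP[/eqP ->//|h]; apply: ltW; apply: (sec_ph sc) => //; first clra.
    by move: ue; rewrite gtr0_norm.
  have p0 : 0 < ph q j (e q j / 2) by apply: sector_ph_pos; rewrite ?divr_gt0//; clra.
  move=> h'; have : ph q j (e q j / 2) ^+ 2 <= ph q j u ^+ 2 by rewrite ler_pXn2r// nnegrE; clra.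
  clra.
have Iu : `]0, e q j[%classic u by rewrite /= in_itv /=; clra.
have Cfor (w : R) : 0 <= w < e q j -> {for w, continuous (fun u => C q j (u, 0))}.
  move=> we; apply: (@continuous_comp _ _ _ (fun u : R => (u, 0 : R)) (C q j)).
    by apply: (cont_pair (f := id)); [exact: cvg_id|exact: cont_cst].
  by apply: (sec_cont sc); [rewrite ger0_norm; clra|rewrite lexx ltW].
have Creg (w : R) : 0 < w < e q j -> ~ Sg (C q j (w, 0)).
  by move=> we; apply: (geo_reg (prong_line jk)); rewrite /= in_itv.
have [sg sg1 H] := geo_meet gI (prong_line jk) It1 Iu E.
(* With opposite directions, as the time decreases to 0 the path would tend to the regular point of
   parameter u + t1 and not to [q]. *)
case: sg1 => sgE; rewrite sgE in H; last first.
  exfalso; apply: (Creg (u + t1)); first clra.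
  suff <- : q = C q j (u + t1, 0) by [].
  apply: (tends0_uniq hS gq).
  have := tends0_for (or_intror (erefl (- 1 : R))) (Cfor (u + t1) ltac:(clra)).
  apply: (tends0_eq (d := t1)); first clra.
  move=> s st; have := H (s - t1); rewrite (addrC t1) subrK => ->; last first.
    by move=> r rs; rewrite /= !in_itv /=; clra.
  by congr (C q j (_, _)); ring.
have E1 s : 0 < s -> s <= t1 -> t1 - u < s -> g s = C q j (u - t1 + s, 0).
  move=> s0 st us; have := H (s - t1); rewrite (addrC t1) subrK => ->.
    by congr (C q j (_, _)); ring.
  by move=> r rs; rewrite /= !in_itv /=; clra.
have uT : t1 < T by clra.
have ueT : u < e q j by clra.
have t10 : 0 < t1 by clra.
clearbody t1 d.
clear m0 Hm m1 m2 d0 d00 Hd0 dd0 dm dT dp Hd gc hlc hl0 rd vt vu vA ue u2 T0 H sgE.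
(* If u < t1, the path would be at [q] at the positive time t1 - u; if u > t1, it would tend at time
   0 to the regular point of parameter u - t1. *)
case: (ltrgtP u t1) => ut.
- exfalso; have It : `]0, T[%classic (t1 - u) by rewrite /= in_itv /=; clra.
  apply: (geo_reg gI It); suff -> : g (t1 - u) = q by [].
  have L : tends0 (fun r => g (t1 - u + 1 * r)) (g (t1 - u)).
    apply: (tends0_con (I := `]0, T[) (d := u)) => //; first by left.
      by move=> r ru /=; rewrite in_itv /=; clra.
    by apply: (geo_con bP gI).
  apply: (tends0_uniq hS L); apply: tends0_eq (prong_tends jk); first exact: u0.
  move=> s su; rewrite E1; [congr (C q j (_, _)); ring|clra|clra|clra].
- exfalso; apply: (Creg (u - t1)); first clra.
  suff <- : q = C q j (u - t1, 0) by [].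
  apply: (tends0_uniq hS gq).
  have := tends0_for (or_introl (erefl (1 : R))) (Cfor (u - t1) ltac:(clra)).
  apply: (tends0_eq (d := t1)); first clra.
  by move=> s st; rewrite E1; [congr (C q j (_, _)); ring|clra|clra|clra].
- exists j => //; exists t1; first clra.
  by move=> t tt1; rewrite E1; [congr (C q j (_, _)); rewrite ut; ring|clra|clra|clra].
Qed.

End AtVertex.

End Prongs.

(** Orbits of multiplication by k on positive numbers are infinite. [A] will be the set of lengths
    of saddle connections. *)
Lemma finite_contracted {R : realType} (A : set R) (k : R) : 0 < k < 1 -> finite_set A ->
  (forall x, A x -> 0 < x /\ A (k * x)) -> A = set0.
Proof.
move=> /andP[k0 k1] finA H; apply: contrapT => /eqP/set0P[x Ax].
have pw n : 0 < k ^+ n * x /\ A (k ^+ n * x).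
  elim: n => [|n [h1 h2]]; first by rewrite expr0 mul1r; have [] := H x Ax.
  by have [h3 h4] := H _ h2; rewrite exprS -mulrA mulr_gt0.
have lt m n : (m < n)%N -> k ^+ n * x < k ^+ m * x.
  by move=> mn; rewrite ltr_pM2r ?(H x Ax).1// ltr_iXn2l.
have inj : injective (fun n => k ^+ n * x).
  by move=> m n E; case: (ltngtP m n) => // /lt; rewrite E ltxx.
apply: infinite_nat; apply: (sub_finite_set (B := (fun n => k ^+ n * x) @^-1` A)).
  by move=> n _; exact: (pw n).2.
by apply: finite_preimage finA => m n _ _; exact: inj.
Qed.

(** * No saddle connections; prongs continue for all time *)

Section Rays.
Context {R : realType} {S : surface R} (F : foliation S) (G : measured_foliation S).
Variable Sg : set S.
Hypothesis finSg : finite_set Sg.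
Local Notation isbox := (isbox F G Sg).
Local Notation isprong := (isprong F G Sg).
Variables (be : S -> R) (B : S -> R * R -> S) (bi : S -> S -> R * R).
Hypothesis bP : forall x, ~ Sg x -> isbox x (be x) (B x) (bi x).
Variables (N : S -> set S) (hl vl : S -> S -> R) (e : S -> nat -> R) (A : S -> R)
  (C : S -> nat -> R * R -> S) (ph : S -> nat -> R -> R).
Hypothesis cP : forall q, Sg q ->
  isprong q (N q) (hl q) (vl q) (prongs F q) (e q) (A q) (C q) (ph q).
Local Notation geo := (geo Sg be B).
Local Notation reach := (reach Sg be B).
Local Notation hits := (hits Sg be B).
Local Notation germ := (germ C).
Implicit Types (q x y : S) (g h : R -> S).

Let hS : hausdorff_space S := @surf_hausdorff _ S.
Let cS : compact [set: S] := @surf_compact _ S.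

Variables (f : S -> S) (k : R).
Hypotheses (f_cont : continuous f) (f_inj : injective f).
Hypothesis f_leaf : forall x y, leaf F x y -> leaf F (f x) (f y).
Hypothesis f_Sg : forall x, Sg (f x) <-> Sg x.
Hypothesis k01 : 0 < k < 1.
Hypothesis f_mu : forall (a b : R) g, harc F Sg a b g ->
  mu G (f @` (g @` `[a, b])) = (k%:E * mu G (g @` `[a, b]))%E.

(** In the box at the image point, the image of an axis has constant speed k; the change of time
    makes it 1. *)
Lemma geo_f (I : set R) g : geo I g -> geo [set t | I (t / k)] (fun t => f (g (t / k))).
Proof.
have k0 : 0 < k by case/andP: k01.
move=> gI t /= It; have [n [d [sg [d0 sg1 H]]]] := gI _ It.
set x := g (t / k) in n H *.
have nf : ~ Sg (f x) by move=> /f_Sg.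
split => //; have bx := bP n; have bf := bP nf.
have [b0 bf0] := (box_gt0 bx, box_gt0 bf).
have ax s : `|s| < be x -> sq (be x) (s, 0) by exact: sq_axis.
have [|||||d' [sg' [d'0 sg1' K]]] :=
    constant_speed (th := fun s => f (B x (s, 0))) bf (sq0 bf0) k0 b0.
- by rewrite (box_center bx) (box_center bf).
- move=> s sb; apply: (@continuous_comp _ _ _ (fun s => B x (s, 0)) f); last exact: f_cont.
  apply: (@continuous_comp _ _ _ (fun s : R => (s, 0 : R)) (B x)).
    by apply: (cont_pair (f := id)); [exact: cvg_id|exact: cont_cst].
  by apply: (box_cont bx); exact: ax.
- move=> s r sb rb /f_inj E; have := box_K bx (ax s sb).
  by rewrite E (box_K bx (ax r rb)) => -[].
- by move=> s r sb rb; apply: f_leaf; apply: (box_F bx); exact: ax.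
- move=> s r sb rb sr.
  have ab (u : R) : s <= u <= r -> `|u| < be x.
    by move: sb rb; rewrite !ltr_norml => /andP[s1 s2] /andP[r1 r2] /andP[u1 u2]; apply/andP; split; clra.
  have hA : harc F Sg s r (fun u => B x (u, 0)).
    split => //.
    + move=> u us; apply: con_for; apply: (@continuous_comp _ _ _ (fun s : R => (s, 0 : R)) (B x)).
        by apply: (cont_pair (f := id)); [exact: cvg_id|exact: cont_cst].
      by apply: (box_cont bx); apply: ax; exact: ab.
    + move=> u v us vs E; have := box_K bx (ax u (ab u us)).
      by rewrite E (box_K bx (ax v (ab v vs))) => -[].
    + by move=> u us; apply: (box_F bx); apply: ax => //; exact: ab.
    + by move=> u us; apply: (box_reg bx); apply: ax; exact: ab.
  have := f_mu hA; rewrite image_comp => ->.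
  move: sb rb; rewrite !ltr_norml => /andP[s1 s2] /andP[r1 r2].
  by rewrite (box_mu bx) ?normr0.
have kd0 : 0 < k * Num.min d d' by rewrite mulr_gt0// lt_min d0.
exists (k * Num.min d d'), (sg' * sg); split; [exact: kd0|exact: sgn1M|] => s /= Is.
have E : s / k - t / k = (s - t) / k by field; rewrite gt_eqF.
move=> sk; have : `|s / k - t / k| < Num.min d d'.
  by rewrite E normrM (gtr0_norm (x := k^-1)) ?invr_gt0// ltr_pdivrMr// mulrC.
rewrite lt_min => /andP[sd sd'].
have [h1 h2] := H _ Is sd.
have [|_ [/= h3 _] h4] := K (sg * (s / k - t / k)); first by rewrite norm_sgn1.
have E2 : (0 + sg' * k * (sg * (s / k - t / k)) : R) = sg' * sg * (s - t).
  by rewrite E; field; rewrite gt_eqF.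
rewrite E2 in h3 h4.
split; last by rewrite h2 h4.
by move: h3; rewrite norm_sgn1//; exact: sgn1M.
Qed.

Lemma geo_patch (I : set R) (a b : R) g h : a < b ->
  geo [set t | I t /\ t < b] g -> geo [set t | I t /\ a < t] h ->
  (forall t, I t -> a < t < b -> g t = h t) -> geo I (fun t => if t < b then g t else h t).
Proof.
move=> ab gI hI E; apply: geo_local => t It.
have [tb|bt] := ltP t b.
  exists (b - t); first by rewrite subr_gt0.
  apply: (geo_eq (g := g)).
    by move=> s [_]; rewrite ltr_norml => /andP[_ st]; rewrite ifT//; clra.
  by apply: geo_sub gI => s [Is]; rewrite ltr_norml => /andP[_ st]; split => //; clra.
exists (t - a); first by rewrite subr_gt0; clra.
apply: (geo_eq (g := h)).
  move=> s [Is]; rewrite ltr_norml => /andP[st _]; case: ifP => // sb.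
  by rewrite E//; apply/andP; split; [clra|].
by apply: geo_sub hI => s [Is]; rewrite ltr_norml => /andP[st _]; split => //; clra.
Qed.

Lemma tends_rev g (t : R) q : tends g t q <-> tends0 (fun r => g (t - r)) q.
Proof.
split => gq U nU; have [d d0 H] := gq U nU; exists d => // s sd.
  by apply: H; clra.
by rewrite (_ : s = t - (t - s)); [apply: H; clra|ring].
Qed.

(** A saddle connection of length T that leaves [q] along the prong [j]. The end is expressed by
    running the path backwards from time T. *)
Definition saddle q j (T : R) := exists g q', [/\ 0 < T, Sg q /\ (j < prongs F q)%N,
  geo `]0, T[ g, germ q j g & Sg q' /\ tends0 (fun r => g (T - r)) q'].

Lemma germ_tends q j g : Sg q -> (j < prongs F q)%N -> germ q j g -> tends0 g q.
Proof.
move=> Sq jk [d d0 H]; apply: tends0_eq d0 _ (prong_tends cP Sq jk).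
by move=> s sd; rewrite H.
Qed.

Lemma germ_uniq q j (T : R) g h : geo `]0, T[ g -> geo `]0, T[ h -> germ q j g -> germ q j h ->
  forall t, 0 < t < T -> g t = h t.
Proof.
move=> gI hI [d d0 gC] [d' d'0 hC] t tT.
pose a := Num.min t (Num.min d d') / 2.
have m0 : 0 < Num.min t (Num.min d d') by rewrite !lt_min d0 d'0; case/andP: tT => ->.
have m1 : Num.min t (Num.min d d') <= t by rewrite ge_min lexx.
have m2 : Num.min t (Num.min d d') <= d by rewrite !ge_min lexx !orbT.
have m3 : Num.min t (Num.min d d') <= d' by rewrite !ge_min lexx !orbT.
apply: (@geo_uniq _ _ F G Sg be B bi bP a t g h).
- by apply: geo_sub gI => s /=; rewrite /a !in_itv /=; clra.
- by apply: geo_sub hI => s /=; rewrite /a !in_itv /=; clra.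
- exists (Num.min t (Num.min d d') / 2); first clra.
  by move=> s; rewrite /a => s1 s2; rewrite gC ?hC//; clra.
- by rewrite /a; clra.
Qed.

(** The longer one would be regular at the time when the shorter one ends at a singularity. Thus
    there are at most as many lengths as prongs. *)
Lemma saddle_uniq q j (T T' : R) : saddle q j T -> saddle q j T' -> T = T'.
Proof.
suff H T1 T2 : T1 < T2 -> saddle q j T1 -> saddle q j T2 -> False.
  by move=> s s'; case: (ltrgtP T T') => // /H K; exfalso; apply: K.
move=> T12 [g [x [T10 _ gI gC [Sx gx]]]] [h [y [T20 _ hI hC _]]].
have IT : `]0, T2[%classic T1 by rewrite /= in_itv /=; clra.
apply: (geo_reg hI IT); suff <- : x = h T1 by [].
have L := tends0_con (or_intror (erefl (-1 : R))) T10 _ (geo_con bP hI IT).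
apply: (tends0_uniq hS gx); apply: tends0_eq T10 _ (L _) => s sT; last first.
  by rewrite /= in_itv /=; clra.
rewrite mulN1r; apply/esym/(germ_uniq gI _ gC hC); last clra.
by apply: geo_sub hI => r /=; rewrite !in_itv /=; clra.
Qed.

Lemma saddle_f q j (T : R) : saddle q j T -> exists q' j', saddle q' j' (k * T).
Proof.
have k0 : 0 < k by case/andP: k01.
move=> [g [q' [T0 [Sq jk] gI gC [Sq' gq']]]].
have kT : 0 < k * T by rewrite mulr_gt0.
have gf : geo `]0, k * T[ (fun t => f (g (t / k))).
  apply: geo_sub (geo_f gI) => t /=; rewrite !in_itv /= => /andP[t0 tT].
  by rewrite divr_gt0//= ltr_pdivrMr// mulrC.
have tf h x : tends0 h x -> tends0 (fun t => f (h (t / k))) (f x).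
  move=> hx; have ki : 0 < k^-1 by rewrite invr_gt0.
  apply: (tends0_eq (d := 1) _ _ (tends0_comp (@f_cont x) (tends0_scale ki hx))) => // s _.
  by rewrite /= mulrC.
have [j' jk' gC'] := germ_exists bP cP ((f_Sg q).2 Sq) kT gf (tf _ _ (germ_tends Sq jk gC)).
exists (f q), j', (fun t => f (g (t / k))), (f q'); split => //.
- by split => //; exact/f_Sg.
- split; first exact/f_Sg.
  apply: (tends0_eq (d := 1) _ _ (tf _ _ gq')) => // s _.
  by congr (f (g _)); field; rewrite gt_eqF.
Qed.

Lemma no_saddle q j (T : R) : ~ saddle q j T.
Proof.
move=> sT; pose L := [set T | exists q j, saddle q j T].
suff : L = set0 by move=> L0; have : L T by [exists q, j]; rewrite L0.
apply: (finite_contracted k01).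
  apply: (sub_finite_set (B := \bigcup_(q in Sg) ((fun j => xget 0 (saddle q j)) @` `I_(prongs F q)))).
    move=> t [p [i st]]; have [g [q' [_ [Sp ip] _ _ _]]] := st.
    exists p => //; exists i => //.
    by case: xgetP => [t' _ st'|/(_ t)//]; exact: saddle_uniq st' st.
  by apply: bigcup_finite => // x _; apply: finite_image; exact: finite_II.
move=> t [p [i st]]; have [g [q' [t0 _ _ _ _]]] := st; split => //.
exact: saddle_f st.
Qed.

Lemma prong_upto q j (M : R) : Sg q -> (j < prongs F q)%N -> 0 < M ->
  exists2 g, geo `]0, M[ g & germ q j g.
Proof.
move=> Sq jk M0; have pl := prong_line bP cP Sq jk.
have [e0 _] := sec_gt0 (prong_sector (cP Sq) jk).
set e1 := e q j in e0 pl; pose c := e1 / 2.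
have c0 : 0 < c by rewrite divr_gt0.
(* The continuation starts at the regular point of parameter c, since [reach_or_hits] needs a path
   that is defined at its initial time. *)
have g0I : geo `[0, c[ (fun r => C q j (c + r, 0)).
  have := geo_affine (c := c) (or_introl (erefl 1)) pl.
  move=> H; apply: (geo_eq (g := fun t => C q j (c + 1 * t, 0))).
    by move=> t _; rewrite mul1r.
  by apply: geo_sub H => t /=; rewrite !in_itv /= /c; clra.
(* Puts the prong in front of the continued path. The overlap has length m <= c/2, so that c + m is
   still a parameter of the prong. *)
have glue (t : R) h : 0 < t -> geo `[0, t[ h ->
    (exists2 d : R, 0 < d & forall r, 0 <= r < d -> r < t -> h r = C q j (c + r, 0)) ->
    exists2 g, geo `]0, c + t[ g & germ q j g /\ forall s, c + t / 2 <= s -> g s = h (s - c).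
  move=> t0 hI [d d0 Hd].
  pose m := Num.min (d / 2) (Num.min (c / 2) (t / 2)).
  have m0 : 0 < m by rewrite !lt_min !divr_gt0.
  have m1 : m <= d / 2 by rewrite ge_min lexx.
  have m2 : m <= c / 2 by rewrite !ge_min lexx !orbT.
  have m3 : m <= t / 2 by rewrite !ge_min lexx !orbT.
  exists (fun s => if s < c + m then C q j (s, 0) else h (s - c)).
    apply: (geo_patch (a := c)); first clra.
    - by apply: geo_sub pl => s [/=]; rewrite !in_itv /= /c; rewrite /c in m2; clra.
    - have H := geo_affine (c := - c) (or_introl (erefl 1)) hI.
      apply: (geo_eq (g := fun t => h (- c + 1 * t))).
        by move=> s _; rewrite mul1r addrC.
      by apply: geo_sub H => s [/=]; rewrite !in_itv /=; clra.
    - move=> s _ sm; rewrite Hd; [congr (C q j (_, _)); ring|clra|clra].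
  split; first by exists (c + m); [clra|move=> s /andP[_ ->]].
  by move=> s st; rewrite ifF//; apply/negbTE; rewrite -leNgt; clra.
have [[h [hI [d d0 Hd]]]|[t [q' [t0 tM Sq' [h [hI hq [d d0 Hd]]]]]]] :=
    reach_or_hits bP finSg c0 g0I M0.
  have [||g gI [gC _]] := glue M h M0.
  - by apply: geo_sub hI => s /=; rewrite !in_itv /=; clra.
  - by exists d => // r rd rM; apply: Hd => //; exact: ltW.
  by exists g => //; apply: geo_sub gI => s /=; rewrite !in_itv /=; clra.
have [|g gI [gC gE]] := glue t h t0 hI; first by exists d.
exfalso; apply: (@no_saddle q j (c + t)).
exists g, q'; split => //; first clra.
split => //; apply: (tends0_eq (d := t / 2) _ _ ((tends_rev h t q').1 hq)); first clra.
by move=> s st; rewrite gE; [congr h; ring|clra].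
Qed.

Lemma prong_full q j : Sg q -> (j < prongs F q)%N -> exists2 g, geo [set t | 0 < t] g & germ q j g.
Proof.
move=> Sq jk.
have /choice[Ga HG] : forall M, exists g, 0 < M -> geo `]0, M[ g /\ germ q j g.
  move=> M; have [M0|M0] := ltP 0 M; last by exists (fun=> q).
  by have [g h1 h2] := prong_upto Sq jk M0; exists g.
have agree (s M : R) : 0 < s -> s < M -> Ga (s + 1) s = Ga M s.
  move=> s0 sM; have [h1 h2] := HG M ltac:(clra); have [h3 h4] := HG (s + 1) ltac:(clra).
  by have [h|h] := leP M (s + 1); [apply: (germ_uniq (T := M) _ h1 h4 h2)|
      apply: (germ_uniq (T := s + 1) h3 _ h4 h2)]; first
    [clra|apply: geo_sub h3|apply: geo_sub h1] => // r /=; rewrite !in_itv /=; clra.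
(* The path on ]0, s + 1[ is used at s; the extra length makes one path serve all times near s. *)
exists (fun s => Ga (s + 1) s).
  apply: geo_local => t /= t0; exists 1 => //.
  have [h1 h2] := HG (t + 2) ltac:(clra).
  apply: (geo_eq (g := Ga (t + 2))).
    by move=> s [s0]; rewrite ltr_norml => st; rewrite (agree s (t + 2))//; clra.
  by apply: geo_sub h1 => s [/= s0]; rewrite in_itv /= ltr_norml; clra.
have [h1 [d d0 Hd]] := HG 1 ltr01.
exists (Num.min d 1); first by rewrite lt_min d0 ltr01.
move=> t; rewrite lt_min => /andP[t0 /andP[td t1]].
by rewrite (agree t 1)//; apply: Hd; rewrite t0.
Qed.

End Rays.

(** * Separatrices *)

Section Leaves.
Context {R : realType} {S : surface R} (F : foliation S) (G : measured_foliation S).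
Variable Sg : set S.
Hypothesis finSg : finite_set Sg.
Local Notation isbox := (isbox F G Sg).
Local Notation isprong := (isprong F G Sg).
Variables (be : S -> R) (B : S -> R * R -> S) (bi : S -> S -> R * R).
Hypothesis bP : forall x, ~ Sg x -> isbox x (be x) (B x) (bi x).
Variables (N : S -> set S) (hl vl : S -> S -> R) (e : S -> nat -> R) (A : S -> R)
  (C : S -> nat -> R * R -> S) (ph : S -> nat -> R -> R).
Hypothesis cP : forall q, Sg q ->
  isprong q (N q) (hl q) (vl q) (prongs F q) (e q) (A q) (C q) (ph q).
Local Notation geo := (geo Sg be B).
Local Notation germ := (germ C).
Implicit Types (q x y : S) (g h : R -> S).

Let hS : hausdorff_space S := @surf_hausdorff _ S.

Hypothesis full : forall q j, Sg q -> (j < prongs F q)%N ->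
  exists2 g, geo [set t | 0 < t] g & germ q j g.

(* a separatrix of q parametrized by transverse measure, extended by q for t <= 0 *)
Definition ray q g := [/\ Sg q, forall t, t <= 0 -> g t = q, tends0 g q & geo [set t | 0 < t] g].

Lemma ray0 q g : ray q g -> g 0 = q.
Proof. by move=> [_ H _ _]; exact: H. Qed.

Lemma ray_reg q g (t : R) : ray q g -> 0 < t -> ~ Sg (g t).
Proof. by move=> [_ _ _ gI] t0; exact: geo_reg gI t0. Qed.

Lemma ray_con q g (t : R) : ray q g -> 0 <= t -> con setT g t.
Proof.
move=> [Sq g0 gq gI]; rewrite le_eqVlt => /orP[/eqP <-|t0].
  move=> U; rewrite g0// => nU; have [d d0 H] := gq U nU.
  exists d => // s _; rewrite subr0 ltr_norml => sd.
  by have [s0|s0] := leP s 0; [rewrite g0//; exact: nbhs_singleton|apply: H; clra].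
move=> U nU; have [d d0 H] := geo_con bP gI t0 nU.
exists (Num.min t d); first by rewrite lt_min t0.
by move=> s _; rewrite lt_min ltr_norml => /andP[h1 h2]; apply: H => //=; clra.
Qed.

Lemma ray_for q g (t : R) : ray q g -> 0 <= t -> {for t, continuous g}.
Proof. by move=> gr t0; apply: (for_con (I := setT) ltr01) => //; exact: ray_con gr t0. Qed.

Lemma ray_germ q g : ray q g -> exists2 j, (j < prongs F q)%N & germ q j g.
Proof.
move=> [Sq g0 gq gI]; apply: (germ_exists bP cP Sq ltr01 _ gq).
by apply: geo_sub gI => t /=; rewrite in_itv /= => /andP[].
Qed.

Lemma ray_leaf q g (t : R) : ray q g -> 0 <= t -> leaf F q (g t).
Proof.
move=> gr; rewrite le_eqVlt => /orP[/eqP <-|t0]; first by rewrite (ray0 gr); exact: leaf_refl.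
have [j jk [d d0 H]] := ray_germ gr; have [Sq _ _ gI] := gr.
have sc := prong_sector (cP Sq) jk; have [e0 A0] := sec_gt0 sc.
pose s := Num.min t (Num.min d (e q j)) / 2.
have m0 : 0 < Num.min t (Num.min d (e q j)) by rewrite !lt_min t0 d0.
have m1 : Num.min t (Num.min d (e q j)) <= t by rewrite ge_min lexx.
have m2 : Num.min t (Num.min d (e q j)) <= d by rewrite !ge_min lexx !orbT.
have m3 : Num.min t (Num.min d (e q j)) <= e q j by rewrite !ge_min lexx !orbT.
have s0 : 0 < s by rewrite /s; clra.
apply: (leaf_trans (y := g s)); last first.
  apply: (geo_leaf bP gI); first by rewrite /s; clra.
  by move=> r /andP[sr _] /=; exact: lt_le_trans sr.
rewrite H; last by rewrite /s in s0 *; clra.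
rewrite -{1}(sec_vertex sc); apply: (sec_F sc); rewrite ?normr0 ?lexx ?ltW//.
by rewrite gtr0_norm//; rewrite /s; clra.
Qed.

(** In the same direction but with u and t different, one ray passes at a positive time through the
    origin of the other; in opposite directions [g] is at the origin of [g'] at time u + t. Both
    contradict that a ray is regular at positive times. *)
Lemma ray_NS q q' g g' (u t : R) : ray q g -> ray q' g' -> 0 < u -> 0 < t -> g u = g' t ->
  u = t /\ g = g'.
Proof.
move=> gr gr' u0 t0 E; have [Sq g0 gq gI] := gr; have [Sq' g0' gq' gI'] := gr'.
have [sg sg1 H] := geo_meet bP gI gI' u0 t0 E.
have lim x y h (a : R) : ray x h -> 0 < a -> forall sg, sg = 1 \/ sg = -1 ->
    tends0 (fun r => h (a + sg * r)) (h a).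
  by move=> hr a0 s s1; apply: tends0_for => //; apply: (ray_for hr); exact: ltW.
case: sg1 => sgE; subst sg.
  have H1 s : 0 < u + s -> 0 < t + s -> g (u + s) = g' (t + s).
    by move=> us ts; rewrite H ?mul1r// => r rs; rewrite /= mul1r; clra.
  case: (ltrgtP u t) => ut.
  - exfalso; have tu : 0 < t - u by rewrite subr_gt0.
    apply: (ray_reg gr' tu); suff <- : q = g' (t - u) by [].
    apply: (tends0_uniq hS gq); apply: (tends0_eq ltr01 _ (lim _ q _ _ gr' tu 1 (or_introl erefl))).
    move=> s s1; rewrite mul1r (_ : t - u + s = t + (s - u)); last by ring.
    by rewrite -H1; [congr g; ring|clra|clra].
  - exfalso; have tu : 0 < u - t by rewrite subr_gt0.
    apply: (ray_reg gr tu); suff <- : q' = g (u - t) by [].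
    apply: (tends0_uniq hS gq'); apply: (tends0_eq ltr01 _ (lim _ q _ _ gr tu 1 (or_introl erefl))).
    move=> s s1; rewrite mul1r (_ : u - t + s = u + (s - t)); last by ring.
    by rewrite H1; [congr g'; ring|clra|clra].
  - subst t; split => //.
    have E1 s : 0 < s -> g s = g' s.
      by move=> s0; have := H1 (s - u); rewrite addrC subrK; apply.
    have qq : q = q'.
      by apply: (tends0_uniq hS gq); apply: (tends0_eq ltr01 _ gq') => s /andP[s0 _]; rewrite E1.
    by apply: funext => s; have [s0|s0] := leP s 0; [rewrite g0// g0'|exact: E1].
exfalso; have ut : 0 < u + t by rewrite addr_gt0.
apply: (ray_reg gr ut); suff <- : q' = g (u + t) by [].
apply: (tends0_uniq hS gq'); apply: (tends0_eq t0 _ (lim _ q _ _ gr ut (-1) (or_intror erefl))).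
move=> s st; rewrite (_ : u + t + -1 * s = u + (t - s)); last by ring.
rewrite H; [congr g'; ring|].
by move=> r rs /=; clra.
Qed.

Lemma ray_inj q g (s t : R) : ray q g -> 0 <= s -> 0 <= t -> g s = g t -> s = t.
Proof.
move=> gr; have [Sq _ _ _] := gr.
rewrite le_eqVlt => /orP[/eqP <-|s0]; rewrite le_eqVlt => /orP[/eqP <-|t0] //.
- by rewrite (ray0 gr) => E; case: (ray_reg gr t0); rewrite -E.
- by rewrite (ray0 gr) => E; case: (ray_reg gr s0); rewrite E.
- by case/(ray_NS gr gr s0 t0).
Qed.

Lemma germ_ray q j g : Sg q -> (j < prongs F q)%N -> geo [set t | 0 < t] g -> germ q j g ->
  ray q (fun t => if t <= 0 then q else g t).
Proof.
move=> Sq jk gI gC; split => //.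
- by move=> t ->.
- apply: (tends0_eq ltr01 _ (germ_tends cP Sq jk gC)) => s /andP[s0 _].
  by rewrite leNgt s0.
- by apply: geo_eq gI => t /= t0; rewrite leNgt t0.
Qed.

Lemma germ_ray_uniq q j g g' : ray q g -> ray q g' -> germ q j g -> germ q j g' -> g = g'.
Proof.
move=> [Sq g0 _ gI] [_ g0' _ gI'] gC gC'; apply: funext => t.
have [t0|t0] := leP t 0; first by rewrite g0// g0'.
have sub : `]0, t + 1[ `<=` [set t : R | 0 < t].
  by move=> s /=; rewrite in_itv /= => /andP[].
by apply: (germ_uniq bP (geo_sub sub gI) (geo_sub sub gI') gC gC'); clra.
Qed.

Lemma finite_rays : finite_set [set g | exists q, ray q g].
Proof.
have /choice[X HX] : forall p : S * nat, exists g, forall g', ray p.1 g' -> germ p.1 p.2 g' -> g' = g.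
  move=> p; have [[g [h1 h2]]|n] := pselect (exists g, ray p.1 g /\ germ p.1 p.2 g).
    by exists g => g' h1' h2'; exact: germ_ray_uniq h1' h1 h2' h2.
  by exists (fun=> p.1) => g' h1 h2; case: n; exists g'.
apply: (sub_finite_set (B := \bigcup_(q in Sg) ((fun j => X (q, j)) @` `I_(prongs F q)))).
  move=> g [q gr]; have [Sq _ _ _] := gr; have [j jk gC] := ray_germ gr.
  by exists q => //; exists j => //; rewrite -(HX (q, j) g).
by apply: bigcup_finite => // x _; apply: finite_image; exact: finite_II.
Qed.

Lemma ray_f (f : S -> S) (k : R) q g : continuous f -> injective f ->
  (forall x y, leaf F x y -> leaf F (f x) (f y)) -> (forall x, Sg (f x) <-> Sg x) ->
  0 < k < 1 -> (forall (a b : R) g, harc F Sg a b g ->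
    mu G (f @` (g @` `[a, b])) = (k%:E * mu G (g @` `[a, b]))%E) ->
  ray q g -> ray (f q) (fun t => f (g (t / k))).
Proof.
move=> cf jf lf Sf k01 mf [Sq g0 gq gI]; have k0 : 0 < k by case/andP: k01.
have ki : 0 < k^-1 by rewrite invr_gt0.
split; first exact/Sf.
- by move=> t t0; rewrite g0// mulr_le0_ge0// ltW.
- apply: (tends0_eq (d := 1) _ _ (tends0_comp (@cf q) (tends0_scale ki gq))) => // s _.
  by rewrite /= mulrC.
- apply: geo_sub (geo_f bP cf jf lf Sf k01 mf gI) => t /= t0.
  by rewrite divr_gt0.
Qed.

(** A ray that meets the axis of a box covers it: if it started somewhere on the axis, its origin
    would be a regular point of the box. *)
Lemma ray_plaque q g x (w w' t : R) : ray q g -> ~ Sg x -> `|w| < be x -> `|w'| < be x ->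
  0 < t -> g t = B x (w, 0) -> exists2 t', 0 < t' & g t' = B x (w', 0).
Proof.
move=> gr nx wb wb' t0 E; have [Sq g0 gq gI] := gr.
have b0 := box_gt0 (bP nx).
have b0' : `|0 : R| < be x by rewrite normr0.
have Iw : `]- be x, be x[%classic w by rewrite /= in_itv /= -ltr_norml.
have [sg sg1 H] := geo_meet bP gI (box_line bP nx b0') t0 Iw E.
pose s := sg * (w' - w).
have sE : w + sg * s = w' by rewrite /s mulrA sgn1V// mul1r addrC subrK.
move: wb wb'; rewrite !ltr_norml => /andP[w1 w2] /andP[w1' w2'].
have between r : 0 <= r <= s \/ s <= r <= 0 -> `]- be x, be x[%classic (w + sg * r).
  rewrite /= in_itv /=; move: sE; rewrite /s; case: sg1 => ->; clra.
have [ts|ts] := ltP 0 (t + s).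
  exists (t + s) => //; rewrite H ?sE// => r rs; split; last exact: between.
  by rewrite /=; clra.
exfalso; have It : `]- be x, be x[%classic (w + sg * - t) by apply: between; clra.
have nr := geo_reg (box_line bP nx b0') It.
apply: nr; suff <- : q = B x (w + sg * - t, 0) by [].
apply: (tends0_uniq hS gq).
have cl : {for w + sg * - t, continuous (fun u => B x (u, 0))}.
  apply: (@continuous_comp _ _ _ (fun u : R => (u, 0 : R)) (B x)).
    by apply: (cont_pair (f := id)); [exact: cvg_id|exact: cont_cst].
  apply: (box_cont (bP nx)); apply: sq_axis; move: It; rewrite /= in_itv /=.
  by rewrite ltr_norml.
apply: (tends0_eq t0 _ (tends0_for sg1 cl)) => r rt.
rewrite (_ : w + sg * - t + sg * r = w + sg * (r - t)); last by ring.
rewrite -H; first by congr g; ring.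
by move=> r' rr'; split; [rewrite /=; clra|apply: between; clra].
Qed.

Lemma plaque_path (a b : R) h t : (forall t, a <= t <= b -> con `[a, b] h t) ->
  (forall s t, a <= s <= b -> a <= t <= b -> leaf F (h s) (h t)) ->
  a <= t <= b -> ~ Sg (h t) -> exists2 d : R, 0 < d & forall s, a <= s <= b -> `|s - t| < d ->
    [/\ sq (be (h t)) (bi (h t) (h s)), B (h t) (bi (h t) (h s)) = h s & (bi (h t) (h s)).2 = 0].
Proof.
move=> ch lh tab n; have bx := bP n; have s0 := sq0 (box_gt0 bx).
have := box_open bx s0; rewrite (box_center bx) => /(ch t tab)[d d0 H].
exists d => // s sab sd.
have [|h1 h2] := H s _ sd; first by rewrite /= in_itv.
split => //.
have bt : bi (h t) (h t) = (0, 0) by rewrite -{2}(box_center bx) (box_K bx).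
have key u v : a <= u <= b -> a <= v <= b -> u <= v -> `|u - t| < d -> `|v - t| < d ->
    (bi (h t) (h v)).2 = (bi (h t) (h u)).2.
  move=> uab vab uv ud vd; apply: (box_pathF bx uv) => [r ruv|r ruv|r ruv].
  - apply: (con_sub (I := `[a, b])); last by apply: ch; clra.
    by move=> x /=; rewrite !in_itv /=; clra.
  - by apply: lh; clra.
  - exists (bi (h t) (h r)).
      have [||//] := H r; first by rewrite /= in_itv /=; clra.
      by move: ud vd; rewrite !ltr_norml; clra.
    have [||_ ->//] := H r; first by rewrite /= in_itv /=; clra.
    by move: ud vd; rewrite !ltr_norml; clra.
have td : `|t - t| < d by rewrite subrr normr0.
have [st|/ltW ts] := leP s t.
  by rewrite -(key s t)// bt.
by rewrite (key t s)// bt.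
Qed.

Lemma exists_ray q : Sg q -> exists g, ray q g.
Proof.
move=> Sq; have jk := prong_gt0 (cP Sq).
have [g gI gC] := full Sq jk.
by exists (fun t => if t <= 0 then q else g t); exact: germ_ray Sq jk gI gC.
Qed.

(** Level [hl] = 0 means v = 0, that is, a point on a prong; a small value of [vl] makes its
    parameter smaller than m. *)
Lemma vertex_axis q (m : R) : Sg q -> 0 < m -> \forall y \near q, N q y /\
  (hl q y = 0 -> exists g u, [/\ ray q g, 0 <= u < m & y = g u]).
Proof.
move=> Sq m0.
have [m1 m10 Hm] : exists2 m1 : R, 0 < m1 & forall j, (j < prongs F q)%N ->
    m1 < 2 * ph q j (Num.min m (e q j) / 2) ^+ 2.
  have [j jk|m1 m10 Hm] := finite_radius (P := fun j s =>
      s < 2 * ph q j (Num.min m (e q j) / 2) ^+ 2) (n := prongs F q) (t := 0).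
    have [e0 _] := sec_gt0 (prong_sector (cP Sq) jk).
    have me : 0 < Num.min m (e q j) by rewrite lt_min m0.
    have me' : Num.min m (e q j) <= e q j by rewrite ge_min lexx orbT.
    have p0 : 0 < ph q j (Num.min m (e q j) / 2).
      by apply: (sector_ph_pos cP Sq jk); rewrite ?divr_gt0//; clra.
    exists (2 * ph q j (Num.min m (e q j) / 2) ^+ 2); first by rewrite mulr_gt0// exprn_gt0.
    by move=> s; rewrite subr0 ltr_norml => /andP[].
  exists (m1 / 2); first by rewrite divr_gt0.
  by move=> j jk; apply: Hm => //; rewrite subr0 gtr0_norm ?divr_gt0//; clra.
apply: filterS (vertex_nbhs cP Sq m10) => y [Ny [vy [j [u [v [jk ue vA vu E]]]]]].
split => // hy; have sc := prong_sector (cP Sq) jk; have [e0 A0] := sec_gt0 sc.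
have v0 : v = 0.
  move/eqP: hy; rewrite E (sec_hl sc)// mulf_eq0 pnatr_eq0 /= sqrf_eq0 => /eqP //.
subst v.
have u0 : 0 <= u by case: vu => //; rewrite ltxx.
have me : 0 < Num.min m (e q j) by rewrite lt_min m0.
have me' : Num.min m (e q j) <= e q j by rewrite ge_min lexx orbT.
have mm : Num.min m (e q j) <= m by rewrite ge_min lexx.
have um : u < Num.min m (e q j) / 2.
  rewrite ltNge; apply/negP => h; move: vy; rewrite E (sec_vl sc)// ltr_norml => /andP[_ vt].
  have ue' : u < e q j by move: ue; rewrite ger0_norm.
  have h2 : ph q j (Num.min m (e q j) / 2) <= ph q j u.
    by move: h; rewrite le_eqVlt => /orP[/eqP ->//|h]; apply: ltW; apply: (sec_ph sc) => //; clra.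
  have p0 : 0 < ph q j (Num.min m (e q j) / 2).
    by apply: (sector_ph_pos cP Sq jk); rewrite ?divr_gt0//; clra.
  have h' : ph q j (Num.min m (e q j) / 2) ^+ 2 <= ph q j u ^+ 2.
    by rewrite ler_pXn2r// nnegrE ltW//; exact: lt_le_trans h2.
  have := Hm j jk; rewrite ltNge => /negP; apply; apply: ltW; apply: le_lt_trans vt.
  by rewrite ler_pM2l.
have [g gI gC] := full Sq jk; have gr := germ_ray Sq jk gI gC.
exists (fun t => if t <= 0 then q else g t), u; split => //; first by rewrite u0 /=; clra.
case: leP => uz; first by rewrite E (_ : u = 0) ?(sec_vertex sc)//; apply/eqP; rewrite eq_le uz u0.
have lC : germ q j (fun u => C q j (u, 0)) by exists 1.
rewrite E; apply/esym; apply: (germ_uniq bP _ (prong_line bP cP Sq jk) gC lC); last by rewrite uz /=; clra.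
by apply: geo_sub gI => s /=; rewrite in_itv /= => /andP[].
Qed.

Lemma vertex_path (a b : R) h t : (forall t, a <= t <= b -> con `[a, b] h t) ->
  (forall s t, a <= s <= b -> a <= t <= b -> leaf F (h s) (h t)) ->
  a <= t <= b -> Sg (h t) -> forall m : R, 0 < m ->
  exists2 d : R, 0 < d & forall s, a <= s <= b -> `|s - t| < d ->
    exists g u, [/\ ray (h t) g, 0 <= u < m & h s = g u].
Proof.
move=> ch lh tab Sq m m0.
have [d d0 H] := ch t tab _ (vertex_axis Sq m0); exists d => // s sab sd.
have Hr r : a <= r <= b -> `|r - t| < d -> N (h t) (h r).
  by move=> rab rd; have [|//] := H r _ rd; rewrite /= in_itv.
have key u v : a <= u <= b -> a <= v <= b -> u <= v -> `|u - t| < d -> `|v - t| < d ->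
    hl (h t) (h v) = hl (h t) (h u).
  move=> uab vab uv ud vd; apply: (prong_pathF (cP Sq) uv) => [r ruv|r ruv|r ruv].
  - apply: (con_sub (I := `[a, b])); last by apply: ch; clra.
    by move=> x /=; rewrite !in_itv /=; clra.
  - by apply: lh; clra.
  - by apply: Hr; [clra|move: ud vd; rewrite !ltr_norml; clra].
have td : `|t - t| < d by rewrite subrr normr0.
have [|_ K] := H s _ sd; first by rewrite /= in_itv.
apply: K; rewrite -(vertex_hl cP Sq).
by have [st|/ltW ts] := leP s t; [rewrite (key s t)|rewrite (key t s)].
Qed.

(** Being on a ray of [q] is open and closed along a path in the leaf: at regular points by
    [ray_plaque]; near a singular point the path is on rays of that point, and by [ray_NS] these are
    rays of [q] only if the point is [q]. *)
Lemma leaf_rays q y : Sg q -> leaf F q y -> exists g u, [/\ ray q g, 0 <= u & y = g u].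
Proof.
move=> Sq /leaf_connected/pcP[h [ch h0 h1 lh0]].
have lh (s t : R) : 0 <= s <= 1 -> 0 <= t <= 1 -> leaf F (h s) (h t).
  by move=> s1 t1; apply: leaf_trans (leaf_sym (lh0 s s1)) (lh0 t t1).
pose P s := exists g u, [/\ ray q g, 0 <= u & h s = g u].
suff E : `[<P 1>] = `[<P 0>].
  have P0 : P 0 by have [g gr] := exists_ray Sq; exists g, 0; rewrite h0 (ray0 gr).
  by rewrite (asboolT P0) in E; move/asboolP: E; rewrite /P h1.
apply: (locally_constant (f := fun s => `[<P s>])) => // t tab.
suff [d d0 H] : exists2 d : R, 0 < d & forall s, 0 <= s <= 1 -> `|s - t| < d -> P s <-> P t.
  by exists d => // s sab sd; apply/asbool_equiv_eq; exact: H.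
have [Sx|nx] := pselect (Sg (h t)).
  have [d d0 H] := vertex_path ch lh tab Sx ltr01; exists d => // s sab sd.
  have [g' [u' [gr' /andP[u0' _] E']]] := H s sab sd.
  split => -[g [u [gr u0 E]]].
    suff -> : P t = P 0 by exists g, 0; rewrite h0 (ray0 gr).
    suff Eq : h t = q by rewrite /P Eq h0.
    move: u0 u0'; rewrite le_eqVlt => /orP[/eqP u0|u0]; rewrite le_eqVlt => /orP[/eqP u0'|u0'].
    - by rewrite -(ray0 gr') u0' -E' E -u0 (ray0 gr).
    - by case: (ray_reg gr' u0'); rewrite -E' E -u0 (ray0 gr).
    - by case: (ray_reg gr u0); rewrite -E E' -u0' (ray0 gr').
    - have [_ gg] := ray_NS gr gr' u0 u0' (etrans (esym E) E').
      by rewrite -(ray0 gr') -gg (ray0 gr).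
  move: u0; rewrite le_eqVlt => /orP[/eqP u0|u0]; last by case: (ray_reg gr u0); rewrite -E.
  have Eq : h t = q by rewrite E -u0 (ray0 gr).
  by exists g', u'; rewrite -Eq.
have [d d0 H] := plaque_path ch lh tab nx; exists d => // s sab sd.
have [[/= w1 w2] EB w0] := H s sab sd.
have bx := bP nx; have b0 := box_gt0 bx; have z0 : `|0 : R| < be (h t) by rewrite normr0.
have Es : h s = B (h t) ((bi (h t) (h s)).1, 0) by rewrite -w0 -surjective_pairing.
have Et : h t = B (h t) (0, 0) by rewrite (box_center bx).
have regs : ~ Sg (h s) by rewrite -EB; exact: (box_reg bx).
split => -[g [u [gr u0 E]]]; move: u0; rewrite le_eqVlt => /orP[/eqP u0|u0].
- by case: regs; rewrite E -u0 (ray0 gr).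
- have [t' t0 E'] := ray_plaque gr nx w1 z0 u0 (etrans (esym E) Es).
  by exists g, t'; split => //; [exact: ltW|rewrite E' -Et].
- by case: nx; rewrite E -u0 (ray0 gr).
- have [t' t0 E'] := ray_plaque gr nx z0 w1 u0 (etrans (esym E) Et).
  by exists g, t'; split => //; [exact: ltW|rewrite E' -Es].
Qed.

(** The argument of [leaf_rays] for a single ray: once [q] is removed, the leaf has only regular
    points, where [ray_plaque] applies. *)
Lemma ray_component q g (t : R) : ray q g -> 0 < t ->
  path_component (R := R) (leaf F q `\ q) (g t) = g @` [set u | 0 < u].
Proof.
move=> gr t0; have [Sq _ _ gI] := gr.
have mem u : 0 < u -> (leaf F q `\ q) (g u).
  move=> u0; split; first by apply: (ray_leaf gr); exact: ltW.
  by move=> /= E; apply: (ray_reg gr u0); rewrite E.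
apply/seteqP; split => [y|_ [u /= u0 <-]]; last first.
  have path a b : 0 < a -> a <= b -> path_component (R := R) (leaf F q `\ q) (g a) (g b).
    move=> a0 ab; apply: pcI => // r /andP[r1 r2].
      by apply: (con_sub (I := setT)) => //; apply: (ray_con gr); rewrite ltW// (lt_le_trans a0).
    by apply: mem; exact: lt_le_trans r1.
  by have [tu|/ltW ut] := leP t u; [exact: path|apply: pc_sym; exact: path].
move=> /pcP[h [ch h0 h1 lh0]].
have lh (s r : R) : 0 <= s <= 1 -> 0 <= r <= 1 -> leaf F (h s) (h r).
  by move=> /lh0[s1 _] /lh0[r1 _]; apply: leaf_trans (leaf_sym s1) r1.
pose P s := exists2 u, 0 < u & g u = h s.
suff E : `[<P 1>] = `[<P 0>].
  have P0 : P 0 by exists t.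
  by rewrite (asboolT P0) in E; move/asboolP: E => [u u0 E]; exists u => //; rewrite E h1.
apply: (locally_constant (f := fun s => `[<P s>])) => // r tab.
have nx : ~ Sg (h r).
  have [lr nr] := lh0 r tab; have [g' [u [gr' u0 E]]] := leaf_rays Sq lr.
  move: u0; rewrite le_eqVlt => /orP[/eqP u0|u0]; last by rewrite E; exact: ray_reg gr' u0.
  by case: nr; rewrite E -u0 (ray0 gr').
have [d d0 H] := plaque_path ch lh tab nx; exists d => // s sab sd.
have [[/= w1 w2] EB w0] := H s sab sd.
have bx := bP nx; have b0 := box_gt0 bx; have z0 : `|0 : R| < be (h r) by rewrite normr0.
have Es : h s = B (h r) ((bi (h r) (h s)).1, 0) by rewrite -w0 -surjective_pairing.
have Et : h r = B (h r) (0, 0) by rewrite (box_center bx).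
apply/asbool_equiv_eq; split => -[u u0 E].
- have [t' t0' E'] := ray_plaque gr nx w1 z0 u0 (etrans E Es).
  by exists t' => //; rewrite E' -Et.
- have [t' t0' E'] := ray_plaque gr nx z0 w1 u0 (etrans E Et).
  by exists t' => //; rewrite E' -Es.
Qed.

Lemma separatrixP q L : Sg q ->
  separatrix F q L <-> exists2 g, ray q g & L = g @` [set u | 0 < u].
Proof.
move=> Sq; split => [[y [ly ny] ->]|[g gr ->]]; last first.
  exists (g 1); last by rewrite (ray_component gr ltr01).
  split; first exact: ray_leaf gr ler01.
  by move=> /= E; apply: (ray_reg gr ltr01); rewrite E.
have [g [u [gr u0 E]]] := leaf_rays Sq ly.
exists g => //; rewrite E (ray_component gr)// lt_neqAle u0 andbT.
by apply/eqP => uz; apply: ny; rewrite E -uz (ray0 gr).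
Qed.

(** After time 0 the arc avoids [q], so it stays on the ray and h = g o u. The function u is
    continuous and injective, so its image is the interval from u 0 = 0 to u 1 = t. Consequently the
    arc from q to g t in the leaf is unique. *)
Lemma ray_arc_param q g (h : R -> S) (t : R) : ray q g -> 0 < t ->
  (forall s, 0 <= s <= 1 -> con `[0, 1] h s) ->
  (forall s r, 0 <= s <= 1 -> 0 <= r <= 1 -> h s = h r -> s = r) ->
  h 0 = q -> h 1 = g t -> (forall s, 0 <= s <= 1 -> leaf F q (h s)) ->
  forall s, 0 <= s <= 1 -> exists2 u, 0 <= u <= t & h s = g u.
Proof.
move=> gr t0 ch ih h0 h1 lh0; have [Sq _ _ gI] := gr.
have lh (s r : R) : 0 <= s <= 1 -> 0 <= r <= 1 -> leaf F (h s) (h r).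
  by move=> s1 r1; apply: leaf_trans (leaf_sym (lh0 s s1)) (lh0 r r1).
have /choice[u Hu] : forall s, exists u, 0 <= s <= 1 -> h s = g u /\ 0 <= u.
  move=> s; have [sb|sb] := pselect (0 <= s <= 1); last by exists 0.
  have /andP[s0 s1] := sb; move: s0; rewrite le_eqVlt => /orP[/eqP s0|s0].
    by exists 0 => _; rewrite -s0 h0 (ray0 gr).
  have : path_component (R := R) (leaf F q `\ q) (g t) (h s).
    rewrite -h1; apply: pc_sym; apply: pcI => // r rs.
      apply: (con_sub (I := `[0, 1])); last by apply: ch; clra.
      by move=> x /=; rewrite !in_itv /=; clra.
    split; first by apply: lh0; clra.
    by move=> /= E; have := ih r 0 ltac:(clra) ltac:(clra); rewrite E h0 => /(_ erefl); clra.
  by rewrite (ray_component gr t0) => -[v /= v0 E]; exists v => _; split; [rewrite E|exact: ltW].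
have u0 : u 0 = 0.
  have [h2 h3] := Hu 0 ltac:(clra); apply: (ray_inj gr) => //.
  by rewrite -h2 h0 (ray0 gr).
have u1 : u 1 = t.
  have [h2 h3] := Hu 1 ltac:(clra); apply: (ray_inj gr) => //; first exact: ltW.
  by rewrite -h2 h1.
have cu s : 0 <= s <= 1 -> con `[0, 1] u s.
  move=> sb; apply/conP => m m0.
  have [Sx|nx] := pselect (Sg (h s)).
    have us : u s = 0.
      have [E] := Hu s sb; rewrite le_eqVlt => /orP[/eqP //|us].
      by case: (ray_reg gr us); rewrite -E.
    have [E _] := Hu s sb; rewrite us (ray0 gr) in E.
    have [d d0 H] := vertex_path ch lh sb Sx m0; exists d => // r.
    rewrite /= in_itv /= us subr0 => rb rd.
    have [g' [v [gr' /andP[v0 vm] Er]]] := H r rb rd.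
    have [Er' ur0] := Hu r rb.
    rewrite ger0_norm//; move: ur0; rewrite le_eqVlt => /orP[/eqP <- //|ur0].
    move: v0; rewrite le_eqVlt => /orP[/eqP v0|v0].
      by case: (ray_reg gr ur0); rewrite -Er' Er -v0 (ray0 gr').
    by have [-> _] := ray_NS gr gr' ur0 v0 (etrans (esym Er') Er).
  have [E] := Hu s sb; rewrite le_eqVlt => /orP[/eqP us|us].
    by case: nx; rewrite E -us (ray0 gr).
  have [d d0 H] := plaque_path ch lh sb nx.
  have bx := bP nx; have sq00 := sq0 (box_gt0 bx).
  have E0 : g (u s) = B (h s) (0, 0) by rewrite (box_center bx).
  have z0 : `|0 : R| < be (h s) by rewrite normr0 (box_gt0 bx).
  have I0 : `]- be (h s), be (h s)[%classic (0 : R) by rewrite /= in_itv /= -ltr_norml.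
  have [sg sg1 K] := geo_meet bP (box_line bP nx z0) gI I0 us (esym E0).
  pose c := Num.min m (Num.min (u s) (be (h s))).
  have c0 : 0 < c by rewrite !lt_min m0 us (box_gt0 bx).
  have cm : c <= m by rewrite ge_min lexx.
  have cus : c <= u s by rewrite /c !ge_min lexx orbT.
  have cb : c <= be (h s) by rewrite /c !ge_min lexx !orbT.
  have bh : bi (h s) (h s) = (0, 0) by rewrite -{2}(box_center bx) (box_K bx).
  have cw : {for h s, continuous (fun y => (bi (h s) y).1)}.
    apply: (@continuous_comp _ _ _ (bi (h s)) fst); last exact: cont_fst.
    by have := box_Icont bx sq00; rewrite (box_center bx).
  have nw : \forall y \near h s, `|(bi (h s) y).1| < c.
    by apply: near_norm_lt => //; rewrite bh normr0.
  have [d' d'0 H'] := ch s sb _ nw.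
  exists (Num.min d d'); first by rewrite lt_min d0.
  move=> r /= rb; rewrite lt_min => /andP[rd rd'].
  have wc := H' r rb rd'; rewrite in_itv /= in rb.
  have [_ EB w0] := H r rb rd; set w := (bi (h s) (h r)).1 in wc.
  have [Er ur0] := Hu r rb.
  have Erw : h r = B (h s) (w, 0) by rewrite -EB -w0 -surjective_pairing.
  have nsg (v : R) : `|sg * v| = `|v| by exact: norm_sgn1.
  have wlt v : 0 <= v <= w \/ w <= v <= 0 -> `|v| < c.
    by move: wc; rewrite !ltr_norml => /andP[w1 w2]; clra.
  have upos v : `|v| < c -> 0 < u s + sg * v.
    by rewrite -(nsg v) ltr_norml => /andP[h1' _]; clra.
  have EK : B (h s) (0 + w, 0) = g (u s + sg * w).
    apply: K => v vw; have vc := wlt v vw; split; last exact: upos.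
    by rewrite /= add0r in_itv /= -ltr_norml; exact: lt_le_trans cb.
  rewrite add0r -Erw Er in EK.
  rewrite (ray_inj gr ur0 (ltW (upos w wc)) EK) addrC addKr nsg.
  exact: lt_le_trans cm.
have iu s r : 0 <= s <= 1 -> 0 <= r <= 1 -> u s = u r -> s = r.
  by move=> sb rb E; apply: ih => //; rewrite (Hu s sb).1 (Hu r rb).1 E.
have im : u @` `[0, 1] = `[Num.min (u 0) (u 1), Num.max (u 0) (u 1)]%classic.
  apply: continuous_inj_image_segment; first exact: ler01.
    by apply/con_within => r; rewrite /= in_itv /=; exact: cu.
  by move=> r r'; rewrite !in_itv /=; exact: iu.
move=> s sb; exists (u s); last by have [] := Hu s sb.
have : (u @` `[0, 1]) (u s) by exists s => //; rewrite /= in_itv.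
by rewrite im u0 u1 /= in_itv /= (min_idPl (ltW t0)) (max_idPr (ltW t0)).
Qed.

Lemma seg_ray q g (t : R) : ray q g -> 0 < t -> seg F q (g t) = g @` `[0, t].
Proof.
move=> gr t0; have [Sq _ _ gI] := gr; apply/seteqP; split => [y [J [[h [eh h0 h1 JE]] JL] Jy]|].
  move: Jy; rewrite JE => -[s /uitvE sb <-].
  have [h' [/con_within ch _ hK]] := eh.
  have [|||u ut ->] := @ray_arc_param q g h t gr t0 _ _ h0 h1 _ s sb.
  - by move=> r rb; apply: ch; apply/uitvE.
  - by move=> r r' /uitvE rb /uitvE rb' E; rewrite -(hK r rb) -(hK r' rb') E.
  - by move=> r rb; apply: JL; rewrite JE; exists r => //; exact/uitvE.
  by exists u => //; rewrite /= in_itv.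
have tm s : 0 <= s <= 1 -> 0 <= 0 + t * s.
  by move=> /andP[s0 _]; rewrite add0r mulr_ge0// ltW.
move=> _ [s /= + <-]; rewrite in_itv /= => /andP[s0 st].
exists (g @` `[0, t]); last by exists s => //; rewrite /= in_itv /= s0.
split; last first.
  by move=> _ [r /= + <-]; rewrite in_itv /= => /andP[r0 _]; exact: ray_leaf gr r0.
exists (fun s => g (0 + t * s)); split.
- apply: embeds_uitv => //.
    move=> r rb; apply: (@con_compR _ _ setT _ (fun s => 0 + t * s) g) => //.
      exact: con_affine.
    by apply: (ray_con gr); exact: tm.
  move=> r r' rb rb' /(ray_inj gr (tm r rb) (tm r' rb')).
  by rewrite !add0r => /mulfI -> //; rewrite gt_eqF.
- by rewrite mulr0 addr0 (ray0 gr).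
- by rewrite mulr1 add0r.
- apply/seteqP; split => _ [r /= + <-].
    rewrite in_itv /= => /andP[r0 rt]; exists (r / t); last by rewrite add0r mulrC divfK// gt_eqF.
    by apply/uitvE/andP; split; [apply: divr_ge0 => //; exact: ltW|rewrite ler_pdivrMr// mul1r].
  move=> /uitvE /andP[r0 r1]; exists (0 + t * r) => //.
  by rewrite /= in_itv /= add0r; apply/andP; split; [apply: mulr_ge0 => //|apply: ler_piMr => //]; exact: ltW.
Qed.

End Leaves.

(** * Sliding a vertical segment along a separatrix *)

Section Reach.
Context {R : realType} {S : surface R} (F : foliation S) (G : measured_foliation S).
Variable Sg : set S.
Local Notation isbox := (isbox F G Sg).
Variables (be : S -> R) (B : S -> R * R -> S) (bi : S -> S -> R * R).
Hypothesis bP : forall x, ~ Sg x -> isbox x (be x) (B x) (bi x).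
Local Notation geo := (geo Sg be B).
Local Notation reach := (reach Sg be B).
Local Notation hits := (hits Sg be B).
Implicit Types (q x y : S) (g h : R -> S) (t T : R).

Let hS : hausdorff_space S := @surf_hausdorff _ S.

Lemma reach_le (g0 : R -> S) T t g : t <= T -> reach g0 T g -> reach g0 t g.
Proof.
move=> tT [gI [d d0 H]]; split.
  by apply: geo_sub gI => s /=; rewrite !in_itv /= => /andP[-> /= st]; exact: le_trans tT.
by exists d => // r rd rt; apply: H => //; exact: le_trans tT.
Qed.

Lemma reach_uniq (g0 : R -> S) T T' g g' : reach g0 T g -> reach g0 T' g' ->
  forall r, 0 <= r -> r <= T -> r <= T' -> g r = g' r.
Proof.
move=> H H' r r0 rT rT'; have [gI [d d0 Hd]] := reach_le rT H; have [gI' [d' d0' Hd']] := reach_le rT' H'.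
apply: (geo_uniq bP gI gI'); last by rewrite r0 lexx.
exists (Num.min d d'); first by rewrite lt_min d0.
move=> s /andP[s0 sr]; rewrite add0r lt_min => /andP[sd sd'].
by rewrite Hd ?Hd'// s0.
Qed.

Lemma hits_reach (g0 : R -> S) t q : hits g0 t q -> exists g, [/\ tends g t q, geo `[0, t[ g &
  forall T, T < t -> reach g0 T g].
Proof.
move=> [g [gI gq [d d0 H]]]; exists g; split => // T Tt; split.
  by apply: geo_sub gI => s /=; rewrite !in_itv /= => /andP[-> /= st]; exact: le_lt_trans Tt.
by exists d => // r rd rT; apply: H => //; exact: le_lt_trans Tt.
Qed.

Lemma reach_hits (g0 : R -> S) T g t q : reach g0 T g -> hits g0 t q -> Sg q -> 0 < t -> t <= T -> False.
Proof.
move=> gr /hits_reach[h [hq hI hr]] Sq t0 tT.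
have [gI _] := reach_le tT gr.
have It : `[0, t]%classic t by rewrite /= in_itv /= lexx ltW.
apply: (geo_reg gI It); suff <- : q = g t by [].
have L := tends0_con (or_intror (erefl (-1 : R))) t0 _ (geo_con bP gI It).
apply: (tends0_uniq hS ((tends_rev h t q).1 hq)); apply: tends0_eq t0 _ (L _) => s sT; last first.
  by rewrite /= in_itv /=; clra.
by rewrite mulN1r; apply: (reach_uniq gr (hr (t - s) _)); clra.
Qed.

Lemma hits_uniq (g0 : R -> S) t q q' : 0 < t -> hits g0 t q -> hits g0 t q' -> q = q'.
Proof.
move=> t0 /hits_reach[h [hq hI hr]] /hits_reach[h' [hq' hI' hr']].
apply: (tends0_uniq hS ((tends_rev h t q).1 hq)).
apply: tends0_eq t0 _ ((tends_rev h' t q').1 hq') => s st.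
by apply: (reach_uniq (hr' (t - s) _) (hr (t - s) _)); clra.
Qed.

Section Flow.
Variables (z : S) (sg0 : R).
Hypotheses (nz : ~ Sg z) (sg01 : sgn1 sg0).
Let g0 (v : R) := fun r : R => B z (sg0 * r, v).

Lemma g0_geo (v : R) : `|v| < be z -> geo `[0, be z[ (g0 v).
Proof.
move=> vb; have H := geo_affine (c := 0) sg01 (box_line bP nz vb).
apply: (geo_eq (g := fun t => B z (0 + sg0 * t, v))); first by move=> t _; rewrite add0r.
apply: geo_sub H => t /=; rewrite !in_itv /= add0r => tb.
by rewrite -ltr_norml norm_sgn1// ger0_norm; clra.
Qed.

Lemma g0_reach (v T : R) : `|v| < be z -> T < be z -> reach (g0 v) T (g0 v).
Proof.
move=> vb Tb; split; last by exists 1.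
by apply: geo_sub (g0_geo vb) => s /=; rewrite !in_itv /=; clra.
Qed.

(* near v all the horizontal lines through the vertical of z can be followed for a time
   longer than T, and do so in parallel in a common box *)
Definition flow (v T : R) := exists y (w sg d : R) (eta : R -> R), [/\ ~ Sg y, sgn1 sg, 0 < d,
  forall v', `|v' - v| < d -> {for v', continuous eta} &
  forall v', `|v' - v| < d -> exists2 g, reach (g0 v') (T + d) g &
    forall r, `|r| < d -> 0 <= T + r ->
      sq (be y) (w + sg * r, eta v') /\ g (T + r) = B y (w + sg * r, eta v')].

Lemma flow0 v : `|v| < be z -> flow v 0.
Proof.
move=> vb; have b0 := box_gt0 (bP nz).
pose d := Num.min (be z / 2) (be z - `|v|).
have d0 : 0 < d by rewrite lt_min divr_gt0//= subr_gt0.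
have d1 : d <= be z / 2 by rewrite ge_min lexx.
have d2 : d <= be z - `|v| by rewrite ge_min lexx orbT.
have vb' v' : `|v' - v| < d -> `|v'| < be z.
  move=> vd; rewrite -(subrK v v'); apply: le_lt_trans (ler_normD _ _) _.
  by rewrite -ltrBrDr; exact: lt_le_trans d2.
exists z, 0, sg0, d, id; split => //; first by move=> v' _; exact: cvg_id.
move=> v' vd; exists (g0 v').
  by apply: g0_reach; [exact: vb'|clra].
move=> r rd _; rewrite !add0r; split => //; split => /=; last exact: vb'.
by rewrite norm_sgn1//; clra.
Qed.

Lemma flow_step v t : flow v t -> exists2 d : R, 0 < d & forall s, t < s -> s < t + d -> flow v s.
Proof.
move=> [y [w [sg [d [eta [ny sg1 d0 ceta H]]]]]]; exists d => // s ts sd.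
have d0' : 0 < d - (s - t) by clra.
have dv v' : `|v' - v| < d - (s - t) -> `|v' - v| < d by clra.
exists y, (w + sg * (s - t)), sg, (d - (s - t)), eta; split => //.
  by move=> v' /dv; exact: ceta.
move=> v' /dv /H[g gr gE]; exists g; first by rewrite (_ : s + _ = t + d)//; ring.
move=> r; rewrite ltr_norml => rd r0.
have [||h1 h2] := gE (r + (s - t)).
- by rewrite ltr_norml; clra.
- clra.
have E : w + sg * (s - t) + sg * r = w + sg * (r + (s - t)) by ring.
by rewrite E (_ : s + r = t + (r + (s - t))); [split|ring].
Qed.

(** Take the box at the regular point g t and an earlier time s from which [g] is already in it. The
    change of boxes carries the parallel band at time s into this box, where all its lines run past
    t together. *)
Lemma flow_limit v t g : 0 < t -> reach (g0 v) t g ->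
  (forall s, 0 <= s -> s < t -> flow v s) -> flow v t.
Proof.
move=> t0 gr HP; have [gI _] := gr.
have It : `[0, t]%classic t by rewrite /= in_itv /= lexx ltW.
have [n [d0 [sgt [d00 sgt1 Ht]]]] := gI t It.
have bt := bP n; have bt0 := box_gt0 bt.
set x := g t in n Ht bt bt0.
pose s := t - Num.min t d0 / 2.
have m0 : 0 < Num.min t d0 by rewrite lt_min t0.
have m1 : Num.min t d0 <= t by rewrite ge_min lexx.
have m2 : Num.min t d0 <= d0 by rewrite ge_min lexx orbT.
have s0 : 0 <= s by rewrite /s; clra.
have st : s < t by rewrite /s; clra.
have sd : t - s < d0 by rewrite /s; clra.
clearbody s; clear m0 m1 m2.
have gline r : s <= r <= t -> `|r - t| < be x /\ g r = B x (sgt * (r - t), 0).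
  move=> rs; apply: Ht; first by rewrite /= in_itv /=; clra.
  by rewrite ler0_norm; clra.
have [y [w [sg [d [eta [ny sg1 d1 ceta H]]]]]] := HP s s0 st.
have v0 : `|v - v| < d by rewrite subrr normr0.
have [h hr hE] := H v v0.
have z0 : `|0 : R| < d by rewrite normr0.
have [hsq hs] := hE 0 z0 ltac:(clra).
rewrite mulr0 !addr0 in hsq hs.
have by_ := bP ny.
have sqt : sq (be x) (sgt * (s - t), 0).
  by apply: sq_axis; rewrite norm_sgn1//; have [] := gline s ltac:(clra).
have E0 : B y (w, eta v) = B x (sgt * (s - t), 0).
  rewrite -hs -(gline s ltac:(clra)).2.
  by apply: (reach_uniq hr gr); clra.
have [d2 [sg' [eta' [d20 sg1' eta0 [ceta' _] K]]]] := box_transition by_ hsq bt sqt E0.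
rewrite /= in eta0 K.
pose m := Num.min (Num.min d d2) (t - s) / 2.
have m0' : 0 < Num.min (Num.min d d2) (t - s) by rewrite !lt_min d1 d20 subr_gt0.
have m1' : Num.min (Num.min d d2) (t - s) <= d by rewrite !ge_min lexx.
have m2' : Num.min (Num.min d d2) (t - s) <= d2 by rewrite !ge_min lexx orbT.
have m3' : Num.min (Num.min d d2) (t - s) <= t - s by rewrite !ge_min lexx orbT.
have m0 : 0 < m by rewrite /m; clra.
have md : m < d by rewrite /m; clra.
have md2 : m < d2 by rewrite /m; clra.
have mt : m < t - s by rewrite /m; clra.
clearbody m; clear m0' m1' m2' m3'.
have z2 : `|0 : R| < d2 by rewrite normr0.
(* Both signs describe the direction of [g]: they are compared through the position at time s +
   m. *)
have dir : sg' * sg = sgt.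
  have md' : `|m| < d by rewrite gtr0_norm.
  have [_ h1] := hE m md' ltac:(clra).
  have [h2 h3] := gline (s + m) ltac:(clra).
  have := reach_uniq hr gr (r := s + m) ltac:(clra) ltac:(clra) ltac:(clra).
  rewrite h1 h3.
  have [|_ h4 h5] := K (sg * m) 0 _ z2; first by rewrite norm_sgn1// gtr0_norm.
  rewrite -{1}(addr0 (eta v)) h5 eta0 => E.
  have sq2 : sq (be x) (sgt * (s + m - t), 0) by apply: sq_axis; rewrite norm_sgn1.
  rewrite eta0 in h4; have := box_K bt h4; rewrite E (box_K bt sq2) => -[E1].
  have : (sg' * sg - sgt) * m = 0.
    have -> : (sg' * sg - sgt) * m = sgt * (s - t) + sg' * (sg * m) - sgt * (s + m - t) by ring.
    by rewrite E1 subrr.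
  by move/eqP; rewrite mulf_eq0 (gt_eqF m0) orbF subr_eq0 => /eqP.
pose eta2 v' := eta' (eta v' - eta v).
have cv : \forall v' \near v, `|eta v' - eta v| < d2.
  apply: (near_norm_lt (f := fun v' => eta v' - eta v)); last by rewrite subrr normr0.
  by apply: cont_sub; [exact: ceta|exact: cont_cst].
move: cv => /nbhs_ballP[r1 /= r10 Hr1].
have near_v v' : `|v' - v| < r1 -> `|eta v' - eta v| < d2.
  by move=> vr; apply: Hr1; rewrite /ball /= distrC.
pose D := Num.min (Num.min d r1) (Num.min (t - s) (be x / 2)).
have D0 : 0 < D by rewrite !lt_min d1 r10 subr_gt0 st divr_gt0.
have D1 : D <= d by rewrite /D !ge_min lexx.
have D2 : D <= r1 by rewrite /D !ge_min lexx orbT.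
have D3 : D <= t - s by rewrite /D !ge_min lexx !orbT.
have D4 : D <= be x / 2 by rewrite /D !ge_min lexx !orbT.
clearbody D.
exists x, 0, sgt, D, eta2; split => //.
  move=> v' vD; apply: (@continuous_comp _ _ _ (fun v' => eta v' - eta v) eta').
    by apply: cont_sub; [apply: ceta; exact: lt_le_trans D1|exact: cont_cst].
  by apply: ceta'; apply: near_v; exact: lt_le_trans D2.
move=> v' vD; have vd := lt_le_trans vD D1; have vr := near_v v' (lt_le_trans vD D2).
have [h' hr' hE'] := H v' vd.
have line r : `|r| <= m -> 0 <= s + r ->
    h' (s + r) = B x (sgt * (s + r - t), eta2 v') /\ `|eta2 v'| < be x.
  move=> rm r0; have [|_ h1] := hE' r _ r0; first exact: le_lt_trans md.
  have [||_ [/= _ h2] h3] := K (sg * r) (eta v' - eta v).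
  - by rewrite norm_sgn1//; exact: le_lt_trans md2.
  - exact: vr.
  split => //; rewrite h1 -[in LHS](subrK (eta v) (eta v')) (addrC (eta v' - _)) h3.
  congr (B x (_, _)); rewrite -dir; ring.
have eb : `|eta2 v'| < be x by have [||_ //] := line 0; [rewrite normr0 ltW|rewrite addr0].
clear H K HP hE E0 sqt hsq hs Ht near_v Hr1 hE' r10 D1 D2 d00 sd md2 z0 z2 vD vd vr v0 d20 d1.
(* The given path up to s + m, then the line of the box at g t; they overlap between s and s + m. *)
exists (fun r => if r < s + m then h' r else B x (sgt * (r - t), eta2 v')).
  have [hI' [d' d0' Hd']] := hr'.
  split.
    apply: (geo_patch (a := s)); first clra.
    - by apply: geo_sub hI' => r [/=]; rewrite !in_itv /=; clra.
    - have L := geo_affine (c := - (sgt * t)) sgt1 (box_line bP n eb).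
      apply: (geo_eq (g := fun r => B x (- (sgt * t) + sgt * r, eta2 v'))).
        by move=> r _; congr (B x (_, _)); ring.
      apply: geo_sub L => r [/=]; rewrite !in_itv /= => rt sr.
      rewrite (_ : - (sgt * t) + sgt * r = sgt * (r - t)); last by ring.
      rewrite -ltr_norml norm_sgn1//; have [h1 _] := gline s ltac:(clra).
      by move: h1; rewrite !ltr_norml; clra.
    - move=> r _ rs; have [||h1 _] := line (r - s); first by rewrite ger0_norm; clra.
        clra.
      by move: h1; rewrite addrC subrK.
  exists (Num.min d' m); first by rewrite lt_min d0'.
  move=> r; rewrite lt_min => /andP[r0 /andP[rd rm]] rt.
  by rewrite ifT; [apply: Hd'; clra|clra].
move=> r rD r0; rewrite add0r; split.
  by split => //=; rewrite norm_sgn1//; clra.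
have E : sgt * (t + r - t) = sgt * r by ring.
case: ifP => [h1|_]; last by rewrite E.
move: rD; rewrite ltr_norml => rD.
have [||h2 _] := line (t + r - s); first by rewrite ger0_norm; clra.
  clra.
by move: h2; rewrite -E addrC subrK => ->.
Qed.

Lemma flow_reach v T g : 0 <= T -> `|v| < be z -> reach (g0 v) T g -> flow v T.
Proof.
move=> T0 vb gr; apply: (real_ind (a := 0) (b := T) (P := flow v)) => //.
- exact: flow0.
- move=> t _ _ /flow_step[d d0 H]; exists d => // s ts sd _; exact: H.
- move=> t t0 tT H; exact: (flow_limit t0 (reach_le tT gr) H).
Qed.

Lemma flow_near v T g : 0 <= T -> `|v| < be z -> reach (g0 v) T g ->
  exists2 d : R, 0 < d & forall v', `|v' - v| < d ->
    exists2 g', reach (g0 v') (T + d) g' & leaf G (g T) (g' T).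
Proof.
move=> T0 vb gr; have [y [w [sg [d [eta [ny sg1 d0 ceta H]]]]]] := flow_reach T0 vb gr.
exists d => // v' vd; have z0 : `|0 : R| < d by rewrite normr0.
have [|h hr hE] := H v; first by rewrite subrr normr0.
have [g' gr' gE'] := H v' vd; exists g' => //.
have [h1 h2] := hE 0 z0 ltac:(clra); have [h3 h4] := gE' 0 z0 ltac:(clra).
rewrite mulr0 !addr0 in h1 h2 h3 h4.
have -> : g T = h T by apply: (reach_uniq gr hr); clra.
rewrite h2 h4.
exact: (box_G (bP ny)).
Qed.

End Flow.
End Reach.

(** * Lines close to one that runs into a singularity *)

Section Slide.
Context {R : realType} {S : surface R} (F : foliation S) (G : measured_foliation S).
Variable Sg : set S.
Hypothesis finSg : finite_set Sg.
Local Notation isbox := (isbox F G Sg).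
Local Notation isprong := (isprong F G Sg).
Variables (be : S -> R) (B : S -> R * R -> S) (bi : S -> S -> R * R).
Hypothesis bP : forall x, ~ Sg x -> isbox x (be x) (B x) (bi x).
Variables (N : S -> set S) (hl vl : S -> S -> R) (e : S -> nat -> R) (A : S -> R)
  (C : S -> nat -> R * R -> S) (ph : S -> nat -> R -> R).
Hypothesis cP : forall q, Sg q ->
  isprong q (N q) (hl q) (vl q) (prongs F q) (e q) (A q) (C q) (ph q).
Local Notation geo := (geo Sg be B).
Local Notation reach := (reach Sg be B).
Local Notation hits := (hits Sg be B).
Local Notation germ := (germ C).
Local Notation ray := (ray Sg be B).
Implicit Types (q x y : S) (g h : R -> S).

Let hS : hausdorff_space S := @surf_hausdorff _ S.

Hypothesis full : forall q j, Sg q -> (j < prongs F q)%N ->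
  exists2 g, geo [set t | 0 < t] g & germ q j g.

(** The level [vl] yields only the square of [ph], which is monotone on each side of u = 0
    separately; [ep] is the side. *)
Lemma ph_sq_mono q i (ep a b : R) : Sg q -> (i < prongs F q)%N -> sgn1 ep ->
  0 <= ep * a -> ep * a < ep * b -> `|b| < e q i -> ph q i a ^+ 2 < ph q i b ^+ 2.
Proof.
move=> Sq ik ep1; have sc := prong_sector (cP Sq) ik; have p0 := sec_ph0 sc.
have mono u u' : - e q i < u -> u <= u' -> u' < e q i -> ph q i u <= ph q i u'.
  by move=> h1; rewrite le_eqVlt => /orP[/eqP -> //|h2] h3; apply: ltW; apply: (sec_ph sc).
case: ep1 => ->; rewrite ?mul1r ?mulN1r ltr_norml => a0 ab be1.
  have h1 := mono 0 a ltac:(clra) a0 ltac:(clra); rewrite p0 in h1.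
  have h2 := sec_ph sc (u := a) (u' := b) ltac:(clra) ab ltac:(clra).
  by rewrite ltr_pXn2r// nnegrE//; clra.
have h1 := mono a 0 ltac:(clra) ltac:(clra) ltac:(clra); rewrite p0 in h1.
have h2 := sec_ph sc (u := b) (u' := a) ltac:(clra) ltac:(clra) ltac:(clra).
by rewrite -sqrrN -(sqrrN (ph q i b)) ltr_pXn2r// ?nnegrE; clra.
Qed.

Lemma ph_small q i (m : R) : Sg q -> (i < prongs F q)%N -> 0 < m ->
  exists2 d : R, 0 < d & forall t, `|t| < d -> `|t| < e q i /\ ph q i t ^+ 2 < m.
Proof.
move=> Sq ik m0; have sc := prong_sector (cP Sq) ik; have [e0 A0] := sec_gt0 sc.
have c0 : {for (0 : R), continuous (fun t : R => vl q (C q i (t, 0)))}.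
  apply: (@continuous_comp _ _ _ (fun t : R => C q i (t, 0)) (vl q)); last first.
    by rewrite (sec_vertex sc); apply: (prong_vl (cP Sq)); exact: (vertex_N cP Sq).
  apply: (@continuous_comp _ _ _ (fun u : R => (u, 0 : R)) (C q i)).
    by apply: (cont_pair (f := id)); [exact: cvg_id|exact: cont_cst].
  by apply: (sec_cont sc); [rewrite normr0|rewrite lexx ltW].
have := near_lt (a := 2 * m) c0; rewrite (sec_vertex sc) (vertex_vl cP Sq).
rewrite mulr_gt0// => /(_ isT)/nbhs_ballP[d /= d0 H].
exists (Num.min d (e q i)); first by rewrite lt_min d0.
move=> t; rewrite lt_min => /andP[td te]; split => //.
have := H t; rewrite /ball /= sub0r normrN => /(_ td).
by rewrite (sec_vl sc)// ?lexx ?ltW// ltr_pM2l.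
Qed.

Variables (z : S) (sg0 : R).
Hypotheses (nz : ~ Sg z) (sg01 : sgn1 sg0).
Let g0 (v : R) := fun r : R => B z (sg0 * r, v).

(* the line through (0, v) is, at time T, in the leaf of q *)
Definition ends (v T : R) q := (exists2 g, reach (g0 v) T g & leaf G q (g T)) \/
  (exists2 q', Sg q' /\ hits (g0 v) T q' & leaf G q q').

Lemma ends_leaf v T q q' : 0 < T -> ends v T q -> ends v T q' -> leaf G q q'.
Proof.
move=> T0 [[g gr lg]|[x [Sx hx] lx]] [[g' gr' lg']|[x' [Sx' hx'] lx']].
- apply: leaf_trans lg _; rewrite (reach_uniq bP gr gr') ?lexx ?ltW//.
  exact: leaf_sym.
- by case: (reach_hits bP gr hx' Sx' T0).
- by case: (reach_hits bP gr' hx Sx T0).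
- by apply: leaf_trans lx _; rewrite (hits_uniq bP T0 hx hx'); exact: leaf_sym.
Qed.

Section Landing.
Variables (v T s0 : R) (q : S) (j i : nat) (ep : R).
Hypotheses (Sq : Sg q) (jk : (j < prongs F q)%N) (ik : (i < prongs F q)%N) (ep1 : sgn1 ep).
Hypotheses (s00 : 0 < s0) (s0T : s0 < T) (s0e : s0 < e q j).
(** At time T - s the nearby lines have the level [vl] of the point of parameter s on the prong [j],
    along which the line at height v arrives. The admissible radius depends on s and may shrink with
    it. *)
Hypothesis lev : forall s, 0 < s -> s <= s0 -> exists2 d : R, 0 < d & forall v', `|v' - v| < d ->
  exists2 g, reach (g0 v') (T - s) g & vl q (g (T - s)) = 2 * ph q j s ^+ 2.

(** At height w = 0 only the side u > 0 is a unit speed line of this sector, and the hypotheses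
    force ep = 1 there. *)
Lemma half_line (u w : R) : 0 < ep * u -> 0 <= w <= A q -> 0 < w \/ 0 <= u ->
  geo [set r | `|r| < e q i /\ 0 < ep * r] (fun r => C q i (r, w)).
Proof.
move=> eu /andP[w0 wA] wu; have [w0'|w0'] := ltP 0 w.
  by apply: geo_sub (sector_line bP cP Sq ik w0' wA) => r [/= rE _]; rewrite in_itv /= -ltr_norml.
have wz : w = 0 by apply/eqP; rewrite eq_le w0 w0'.
have u0 : 0 <= u by case: wu => //; rewrite wz ltxx.
have epE : ep = 1.
  by move: eu; case: ep1 => -> //; rewrite mulN1r oppr_gt0 => u0'; clra.
rewrite wz; apply: geo_sub (prong_line bP cP Sq ik) => r [/=]; rewrite epE mul1r in_itv /=.
by move=> rE r0; rewrite r0 -(gtr0_norm r0).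
Qed.

(* the path enters the sector through its side ep and moves towards the centre *)
Lemma landing_inward u : `|u| < e q i -> 0 < ep * u -> ph q i u ^+ 2 = ph q j s0 ^+ 2 ->
  exists s2 d2 : R, [/\ 0 < s2, s2 < s0, s0 - s2 <= `|u| / 2, 0 < d2 &
    forall v' w s1 g, `|v' - v| < d2 -> 0 <= w <= A q -> 0 < w \/ 0 <= u -> 0 < s1 -> s1 <= s2 ->
      reach (g0 v') (T - s1) g -> g (T - s0) = C q i (u, w) ->
      forall s, s1 <= s -> s <= s0 -> s0 - s < `|u| -> g (T - s) = C q i (u - ep * (s0 - s), w)].
Proof.
have s0e' := s0e.
move=> ue eu phE.
have un : `|u| = ep * u by rewrite -(norm_sgn1 u ep1) gtr0_norm.
(* With s0 - s2 = m/2 the line stays on its side of the sector from T - s0 to T - s2, whichever way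
   it moves. *)
pose m := Num.min s0 (Num.min (e q i - `|u|) `|u|).
have m0 : 0 < m by rewrite !lt_min s00 subr_gt0 ue un.
have m1 : m <= s0 by rewrite ge_min lexx.
have m2 : m <= e q i - `|u| by rewrite /m !ge_min lexx orbT.
have m3 : m <= `|u| by rewrite /m !ge_min lexx !orbT.
pose s2 := s0 - m / 2.
have s20 : 0 < s2 by rewrite /s2; clra.
have s2s : s2 < s0 by rewrite /s2; clra.
have [d2 d20 H2] := lev s20 (ltW s2s).
exists s2, d2; split => //; first by rewrite /s2; clra.
move=> v' w s1 g vd wA wu s10 s12 gr gE.
have [gI _] := gr; have s00' := s00; have s0T' := s0T.
have I0 : `[0, T - s1]%classic (T - s0) by rewrite /= in_itv /=; clra.
have J0 : [set r | `|r| < e q i /\ 0 < ep * r] u by [].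
have [sg sg1 K] := geo_meet bP gI (half_line eu wA wu) I0 J0 gE.
have sgE : sg = ep \/ sg = - ep.
  by case: sg1 => ->; case: ep1 => ->; rewrite ?opprK; [left|right|right|left].
have epep := sgn1V ep1.
suff sgN : sg = - ep.
  move=> s ss1 ss0 su; have := K (s0 - s); rewrite sgN (_ : T - s0 + (s0 - s) = T - s); last by ring.
  rewrite (_ : u + - ep * (s0 - s) = u - ep * (s0 - s)); last by ring.
  apply => r rs; split; first by rewrite /= in_itv /=; clra.
  have r0 : 0 <= r by clra.
  have rr : r <= s0 - s by clra.
  have E : ep * (u + - ep * r) = `|u| - r.
    by transitivity (ep * u - (ep * ep) * r); [ring|rewrite epep un; ring].
  have pos : 0 < ep * (u + - ep * r) by rewrite E; clra.
  by split => //; rewrite -(norm_sgn1 _ ep1) gtr0_norm// E; clra.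
(* Moving outward would increase the level [vl] between the times T - s0 and T - s2, whereas by
   [lev] it decreases from the value at s0 to that at s2. *)
case: sgE => // sgE; exfalso.
have E r : ep * (u + ep * r) = `|u| + r.
  by transitivity (ep * u + (ep * ep) * r); [ring|rewrite epep un; ring].
have between r : 0 <= r -> r <= s0 - s2 -> `|u + ep * r| < e q i /\ 0 < ep * (u + ep * r).
  move=> r0 rs; have pos : 0 < ep * (u + ep * r) by rewrite E; clra.
  by split => //; rewrite -(norm_sgn1 _ ep1) gtr0_norm// E; rewrite /s2 in rs; clra.
have Es2 : g (T - s2) = C q i (u + ep * (s0 - s2), w).
  have := K (s0 - s2); rewrite sgE (_ : T - s0 + (s0 - s2) = T - s2); last by ring.
  apply => r rs; split; first by rewrite /= in_itv /=; clra.
  by apply: between; clra.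
have [h hr hE] := H2 v' vd.
have gh : g (T - s2) = h (T - s2) by apply: (reach_uniq bP gr hr); clra.
have sc := prong_sector (cP Sq) ik.
have [b1 b2] := between (s0 - s2) ltac:(clra) ltac:(clra).
have := hE; rewrite -gh Es2 (sec_vl sc)// => /(mulfI _) E2.
have l1 : ph q j s2 ^+ 2 < ph q j s0 ^+ 2.
  by apply: (ph_sq_mono Sq jk (or_introl erefl)); rewrite ?mul1r ?gtr0_norm//; clra.
have l2 : ph q i u ^+ 2 < ph q i (u + ep * (s0 - s2)) ^+ 2.
  by apply: (ph_sq_mono Sq ik ep1) => //; rewrite ?E; clra.
rewrite E2 ?pnatr_eq0// in l2; clra.
Qed.

(** The line has to be at u = 0 exactly at time T, that is |u| = s0. The functions [ph q i] and
    [ph q j] are not compared directly: if |u| and s0 differed, of the two expressions for [vl]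
    along the line one could be made arbitrarily small while the other is bounded below. *)
Lemma landing_point u : `|u| < e q i -> 0 < ep * u -> ph q i u ^+ 2 = ph q j s0 ^+ 2 ->
  exists2 d : R, 0 < d & forall v' w g, `|v' - v| < d -> 0 <= w <= A q -> 0 < w \/ 0 <= u ->
    reach (g0 v') (T - s0) g -> g (T - s0) = C q i (u, w) -> ends v' T q.
Proof.
have s00' := s00; have s0T' := s0T; have s0e' := s0e.
move=> ue eu phE.
have un : `|u| = ep * u by rewrite -(norm_sgn1 u ep1) gtr0_norm.
have epep := sgn1V ep1.
have u0 : 0 < `|u| by rewrite un.
have [s2 [d2 [s20 s2s s2u d20 Hin]]] := landing_inward ue eu phE.
have sc := prong_sector (cP Sq) ik.
have uE (r : R) : u - ep * r = ep * (`|u| - r).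
  by rewrite un mulrBr mulrA epep mul1r.
have lev1 s1 : 0 < s1 -> s1 <= s2 -> s0 - s1 < `|u| -> exists2 d : R, 0 < d &
    forall v' w g, `|v' - v| < d -> 0 <= w <= A q -> 0 < w \/ 0 <= u ->
    reach (g0 v') (T - s0) g -> g (T - s0) = C q i (u, w) ->
    ph q i (ep * (`|u| - (s0 - s1))) ^+ 2 = ph q j s1 ^+ 2.
  move=> s10 s12 su; have [d1 d10 H1] := lev s10 ltac:(clra).
  exists (Num.min d1 d2); first by rewrite lt_min d10.
  move=> v' w g; rewrite lt_min => /andP[vd1 vd2] wA wu gr gE.
  have [h hr hE] := H1 v' vd1.
  have gh : h (T - s0) = C q i (u, w) by rewrite -gE; apply: (reach_uniq bP hr gr); clra.
  have := Hin v' w s1 h vd2 wA wu s10 s12 hr gh s1 (lexx _) ltac:(clra) su.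
  rewrite uE => hE1; move: hE; rewrite hE1 (sec_vl sc)//.
    by move/(mulfI _); apply; rewrite pnatr_eq0.
  by rewrite norm_sgn1// gtr0_norm; clra.
(* For |u| < s0 the line comes close to u = 0 while [lev] still prescribes a level above that of s0
   - |u|; for |u| > s0 the prescribed level becomes small while the line is beyond |u| - s0. *)
case: (ltrgtP `|u| s0) => us.
- have p0 : 0 < ph q j (s0 - `|u|) ^+ 2.
    by rewrite exprn_gt0//; apply: (sector_ph_pos cP Sq jk); clra.
  have [t0 t00 Ht] := ph_small Sq ik p0.
  pose t := Num.min t0 `|u| / 2.
  have m0 : 0 < Num.min t0 `|u| by rewrite lt_min t00.
  have m1 : Num.min t0 `|u| <= t0 by rewrite ge_min lexx.
  have m2 : Num.min t0 `|u| <= `|u| by rewrite ge_min lexx orbT.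
  have tp : 0 < t by rewrite /t; clra.
  have tu : t <= `|u| / 2 by rewrite /t; clra.
  have tt0 : t < t0 by rewrite /t; clra.
  clearbody t; clear m0 m1 m2.
  have [|||d d0 H] := lev1 (s0 - `|u| + t); [clra|clra|clra|].
  exists d => // v' w g vd wA wu gr gE; exfalso.
  have := H v' w g vd wA wu gr gE; rewrite (_ : `|u| - _ = t); last by ring.
  have [|_ h1] := Ht (ep * t); first by rewrite norm_sgn1// gtr0_norm.
  move=> h2; have : ph q j (s0 - `|u|) ^+ 2 < ph q j (s0 - `|u| + t) ^+ 2.
    apply: (ph_sq_mono Sq jk (or_introl erefl)); rewrite ?mul1r; [clra|clra|].
    by rewrite (gtr0_norm (x := s0 - `|u| + t)); clra.
  clra.
- have cp : 0 < `|u| - s0 by rewrite subr_gt0.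
  have ec : `|ep * (`|u| - s0)| < e q i by rewrite norm_sgn1// gtr0_norm//; clra.
  have p0 : 0 < ph q i (ep * (`|u| - s0)) ^+ 2.
    have := @ph_sq_mono q i ep 0 (ep * (`|u| - s0)) Sq ik ep1.
    rewrite mulr0 (sec_ph0 sc) expr0n /=; apply => //.
    by rewrite mulrA epep mul1r.
  have [t0 t00 Ht] := ph_small Sq jk p0.
  pose t := Num.min t0 s2 / 2.
  have m0 : 0 < Num.min t0 s2 by rewrite lt_min t00.
  have m1 : Num.min t0 s2 <= t0 by rewrite ge_min lexx.
  have m2 : Num.min t0 s2 <= s2 by rewrite ge_min lexx orbT.
  have tp : 0 < t by rewrite /t; clra.
  have tu : t <= s2 by rewrite /t; clra.
  have tt0 : t < t0 by rewrite /t; clra.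
  clearbody t; clear m0 m1 m2.
  have [|||d d0 H] := lev1 t; [clra|clra|clra|].
  exists d => // v' w g vd wA wu gr gE; exfalso.
  have h2 := H v' w g vd wA wu gr gE.
  have [|_ h1] := Ht t; first by rewrite gtr0_norm.
  have : ph q i (ep * (`|u| - s0)) ^+ 2 < ph q i (ep * (`|u| - (s0 - t))) ^+ 2.
    apply: (ph_sq_mono Sq ik ep1); rewrite ?mulrA ?epep ?mul1r; [clra|clra|].
    by rewrite norm_sgn1// gtr0_norm; clra.
  clra.
have [d1 d10 H1] := lev s20 (ltW s2s).
exists (Num.min d1 d2); first by rewrite lt_min d10.
move=> v' w g; rewrite lt_min => /andP[vd1 vd2] wA wu gr gE.
have [h hr hE] := H1 v' vd1.
have gh : h (T - s0) = C q i (u, w) by rewrite -gE; apply: (reach_uniq bP hr gr); clra.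
have line := Hin v' w s2 h vd2 wA wu s20 (lexx _) hr gh.
have [hI [d dp Hd]] := hr.
have {}line r : T - s0 < r < T - s2 -> h r = C q i (ep * (T - r), w).
  move=> rT; have := line (T - r); rewrite (_ : T - (T - r) = r); last by ring.
  move=> ->; [|clra|clra|rewrite us; clra].
  by rewrite uE us; congr (C q i (ep * _, _)); ring.
(* [lev] provides the path only up to T - s2; the line of the sector continues it to T. *)
pose H (r : R) := if r < T - s2 then h r else C q i (ep * (T - r), w).
have germH (I : R) : exists2 d : R, 0 < d & forall r, 0 <= r < d -> r <= I -> H r = g0 v' r.
  exists (Num.min d (T - s2)); first by rewrite lt_min dp subr_gt0; clra.
  move=> r; rewrite lt_min => /andP[r0 /andP[rd rT]] rI; rewrite /H rT.
  by apply: Hd; [rewrite r0|exact: ltW].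
have m1 : sgn1 (- ep) by rewrite -mulN1r; apply: sgn1M => //; right.
have sub (I : set R) (J : set R) : (forall r, I r -> 0 <= r /\ r <= T) ->
    (forall r, I r -> T - s0 < r -> J (ep * (T - r))) ->
    geo J (fun r => C q i (r, w)) -> geo I H.
  move=> I1 IJ lJ; apply: (geo_patch (a := T - s0)); first clra.
  - by apply: geo_sub hI => r [/I1[r0 r1] r2]; rewrite /= in_itv /= r0 ltW.
  - have L := geo_affine (c := ep * T) m1 lJ.
    apply: (geo_eq (g := fun r => C q i (ep * T + - ep * r, w))).
      by move=> r _; congr (C q i (_, _)); ring.
    apply: geo_sub L => r [Ir rT]; have := IJ r Ir rT.
    by rewrite /= (_ : ep * T + - ep * r = ep * (T - r))//; ring.
  - by move=> r _; exact: line.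
(* Above the edge the line crosses u = 0 at a point of the leaf of [G] through [q]; on the edge it
   runs into [q] itself. *)
have [w0|w0] := ltP 0 w.
  left; exists H.
    split; last exact: germH.
    apply: (sub _ `]- e q i, e q i[%classic).
    - by move=> r /=; rewrite in_itv /= => /andP[].
    - move=> r /=; rewrite !in_itv /= => /andP[r0 r1] r2.
      by rewrite -ltr_norml norm_sgn1// ger0_norm; clra.
    - by apply: (sector_line bP cP Sq ik w0); case/andP: wA.
  rewrite /H ifF; last by apply/negbTE; rewrite -leNgt; clra.
  rewrite subrr mulr0 -{1}(sec_vertex sc); apply: (sec_G sc) => //.
  by rewrite normr0; have [] := sec_gt0 sc.
right; exists q; last exact: leaf_refl.
split => //; exists H; split.
- apply: (sub _ [set r | `|r| < e q i /\ 0 < ep * r]).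
  + by move=> r /=; rewrite in_itv /= => /andP[r0 r1]; split => //; exact: ltW.
  + move=> r /=; rewrite in_itv /= => /andP[r0 r1] r2.
    by rewrite norm_sgn1// ger0_norm ?mulrA ?epep ?mul1r; clra.
  + exact: half_line eu wA wu.
- apply/tends_rev; have wz : w = 0 by case/andP: wA => w1 _; apply/eqP; rewrite eq_le w1 w0.
  have epE : ep = 1.
    case: wu => [|up]; first by rewrite wz ltxx.
    by move: eu; case: ep1 => -> //; rewrite mulN1r oppr_gt0 => ?; clra.
  apply: (tends0_eq s20 _ (prong_tends cP Sq ik)) => s ss.
  rewrite /H ifF; last by apply/negbTE; rewrite -leNgt; clra.
  by rewrite wz epE; congr (C q i (_, _)); ring.
- by have [d' d0' H'] := germH T; exists d' => // r rd rT; apply: H' => //; exact: ltW.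
Qed.

(** One radius for all u: the level at time T - s0 prescribes the square of [ph q i u], and on a
    given side only one u has it. *)
Lemma landing_side : exists2 d : R, 0 < d & forall v' u w g, `|v' - v| < d ->
  `|u| < e q i -> 0 < ep * u -> 0 <= w <= A q -> 0 < w \/ 0 <= u ->
  reach (g0 v') (T - s0) g -> g (T - s0) = C q i (u, w) -> ends v' T q.
Proof.
have s00' := s00; have s0T' := s0T; have s0e' := s0e.
have sc := prong_sector (cP Sq) ik.
have [d0 d00 H0] := lev s00 (lexx _).
have lv v' u w g : `|v' - v| < d0 -> `|u| < e q i -> 0 <= w <= A q ->
    reach (g0 v') (T - s0) g -> g (T - s0) = C q i (u, w) -> ph q i u ^+ 2 = ph q j s0 ^+ 2.
  move=> vd ue wA gr gE; have [h hr hE] := H0 v' vd.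
  have gh : h (T - s0) = C q i (u, w) by rewrite -gE; apply: (reach_uniq bP hr gr); clra.
  by move: hE; rewrite gh (sec_vl sc)// => /(mulfI _); apply; rewrite pnatr_eq0.
have [[u [ue eu phE]]|nu] := pselect (exists u, [/\ `|u| < e q i, 0 < ep * u &
    ph q i u ^+ 2 = ph q j s0 ^+ 2]); last first.
  exists d0 => // v' u w g vd ue eu wA wu gr gE; exfalso; apply: nu.
  by exists u; split => //; exact: lv vd ue wA gr gE.
have [d dp H] := landing_point ue eu phE.
exists (Num.min d0 d); first by rewrite lt_min d00.
move=> v' u' w g; rewrite lt_min => /andP[vd0 vd] ue' eu' wA wu gr gE.
have phE' := lv v' u' w g vd0 ue' wA gr gE.
suff uu : u' = u by subst u'; exact: H vd wA wu gr gE.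
apply: (mulfI (sgn1_neq0 ep1)).
case: (ltrgtP (ep * u') (ep * u)) => // lt.
  by have := ph_sq_mono Sq ik ep1 (ltW eu') lt ue; rewrite phE phE' ltxx.
by have := ph_sq_mono Sq ik ep1 (ltW eu) lt ue'; rewrite phE phE' ltxx.
Qed.

End Landing.

End Slide.

(** Compactness of [a, b] in the form of a Lebesgue number, for a condition inherited by smaller
    radii. *)
Lemma uniform_itv {R : realType} (a b : R) (Q : R -> R -> Prop) : a <= b ->
  (forall v d d', Q v d -> 0 < d' -> d' <= d -> Q v d') ->
  (forall v, a <= v <= b -> exists2 d : R, 0 < d &
     forall v', a <= v' <= b -> `|v' - v| < d -> Q v' d) ->
  exists2 d : R, 0 < d & forall v, a <= v <= b -> Q v d.
Proof.
move=> ab Qm H.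
have : forall t, a <= t -> t <= b -> exists2 d : R, 0 < d & forall v, a <= v <= t -> Q v d.
  apply: real_ind => //.
  - have [d d0 Hd] := H a ltac:(clra); exists d => // v va.
    have -> : v = a by apply/eqP; rewrite eq_le; clra.
    by apply: Hd; [clra|rewrite subrr normr0].
  - move=> t at_ tb [d d0 Hd]; have [d' d'0 Hd'] := H t ltac:(clra).
    exists d' => // s ts sd sb; exists (Num.min d d'); first by rewrite lt_min d0.
    move=> v vs; have [vt|tv] := leP v t.
      by apply: Qm (Hd v ltac:(clra)) _ _; [rewrite lt_min d0|rewrite ge_min lexx].
    apply: Qm (Hd' v ltac:(clra) _) _ _; [|by rewrite lt_min d0|by rewrite ge_min lexx orbT].
    by rewrite gtr0_norm; clra.
  - move=> t at_ tb K; have [d d0 Hd] := H t ltac:(clra).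
    pose s := Num.max a (t - d / 2).
    have s1 : a <= s by rewrite le_max lexx.
    have s2 : t - d / 2 <= s by rewrite le_max lexx orbT.
    have s3 : s < t by rewrite gt_max at_ /=; clra.
    have [d' d'0 Hd'] := K s s1 s3.
    exists (Num.min d' d); first by rewrite lt_min d'0.
    move=> v vt; have [vs|sv] := leP v s.
      by apply: Qm (Hd' v ltac:(clra)) _ _; [rewrite lt_min d'0|rewrite ge_min lexx].
    apply: Qm (Hd v ltac:(clra) _) _ _; [|by rewrite lt_min d'0|by rewrite ge_min lexx orbT].
    by rewrite ltr_norml; clra.
by apply.
Qed.

Lemma finite_bound {R : realType} (a : nat -> R) k : exists2 M : R, 0 <= M &
  forall j, (j < k)%N -> a j <= M.
Proof.
elim: k => [|k [M M0 IH]]; first by exists 0.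
exists (Num.max M (a k)); first by rewrite le_max M0.
move=> j; rewrite ltnS leq_eqVlt => /orP[/eqP ->|/IH h]; first by rewrite le_max lexx orbT.
by rewrite le_max h.
Qed.

(** * Every separatrix meets a transverse leaf of a singularity *)

Section Meeting.
Context {R : realType} {S : surface R} (F : foliation S) (G : measured_foliation S).
Variable Sg : set S.
Hypothesis finSg : finite_set Sg.
Local Notation isbox := (isbox F G Sg).
Local Notation isprong := (isprong F G Sg).
Variables (be : S -> R) (B : S -> R * R -> S) (bi : S -> S -> R * R).
Hypothesis bP : forall x, ~ Sg x -> isbox x (be x) (B x) (bi x).
Variables (N : S -> set S) (hl vl : S -> S -> R) (e : S -> nat -> R) (A : S -> R)
  (C : S -> nat -> R * R -> S) (ph : S -> nat -> R -> R).
Hypothesis cP : forall q, Sg q ->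
  isprong q (N q) (hl q) (vl q) (prongs F q) (e q) (A q) (C q) (ph q).
Local Notation geo := (geo Sg be B).
Local Notation reach := (reach Sg be B).
Local Notation hits := (hits Sg be B).
Local Notation germ := (germ C).
Local Notation ray := (ray Sg be B).
Implicit Types (q x y : S) (g h : R -> S).

Let hS : hausdorff_space S := @surf_hausdorff _ S.
Let cS : compact [set: S] := @surf_compact _ S.

Hypothesis full : forall q j, Sg q -> (j < prongs F q)%N ->
  exists2 g, geo [set t | 0 < t] g & germ q j g.

Section Slide.
Variables (z : S) (sg0 : R).
Hypotheses (nz : ~ Sg z) (sg01 : sgn1 sg0).
Let g0 (v : R) := fun r : R => B z (sg0 * r, v).
Local Notation ends := (ends G Sg be B z sg0).

(** By [flow_reach], at time T - s the nearby lines are on one vertical of a box, and [vl] is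
    constant on verticals. [V] will be the set covered by the sectors of [q]. *)
Lemma level_near v T q j (V : set S) h (s : R) : `|v| < be z -> Sg q -> (j < prongs F q)%N ->
  0 < s -> s <= T -> s < e q j -> reach (g0 v) (T - s) h -> h (T - s) = C q j (s, 0) ->
  nbhs (C q j (s, 0)) (N q `&` V) -> exists2 d : R, 0 < d & forall v', `|v' - v| < d ->
    exists2 g, reach (g0 v') (T - s) g & V (g (T - s)) /\ vl q (g (T - s)) = 2 * ph q j s ^+ 2.
Proof.
move=> vb Sq jk s0 sT se hr hE nV.
have sc := prong_sector (cP Sq) jk; have [e0 A0] := sec_gt0 sc.
have sT0 : 0 <= T - s by rewrite subr_ge0.
have [y [w [sg [d [eta [ny sg1 d0 ceta H]]]]]] := flow_reach bP nz sg01 sT0 vb hr.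
have by_ := bP ny; have z0 : `|0 : R| < d by rewrite normr0.
have [|k kr kE] := H v; first by rewrite subrr normr0.
have T0' : 0 <= T - s + 0 by rewrite addr0.
have [sqv kv] := kE 0 z0 T0'; rewrite mulr0 !addr0 in sqv kv.
have hB : h (T - s) = B y (w, eta v).
  by rewrite -kv; apply: (reach_uniq bP hr kr); clra.
have cB : {for eta v, continuous (fun n => B y (w, n))}.
  apply: (@continuous_comp _ _ _ (fun n : R => (w, n)) (B y)).
    by apply: (cont_pair (g := id)); [exact: cont_cst|exact: cvg_id].
  exact: (box_cont by_).
have : nbhs (eta v) ((fun n => B y (w, n)) @^-1` (N q `&` V)).
  by apply: cB; rewrite -hB hE.
move=> /nbhs_ballP[r /= r0 Hr].
have ce : \forall v' \near v, `|eta v' - eta v| < r.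
  apply: (near_norm_lt (f := fun v' => eta v' - eta v)); last by rewrite subrr normr0.
  apply: cont_sub; last exact: cont_cst.
  by apply: ceta; rewrite subrr normr0.
move: ce => /nbhs_ballP[r1 /= r10 Hr1].
exists (Num.min d r1); first by rewrite lt_min d0.
move=> v'; rewrite lt_min => /andP[vd vr].
have ev : `|eta v' - eta v| < r by apply: Hr1; rewrite /ball /= distrC.
have [g gr gE] := H v' vd; have [sqv' gv] := gE 0 z0 T0'; rewrite mulr0 !addr0 in sqv' gv.
exists g; first by apply: reach_le gr; rewrite lerDl ltW.
have inV n : `|n - eta v| < r -> (N q `&` V) (B y (w, n)).
  by move=> nr; apply: Hr; rewrite /ball /= distrC.
rewrite gv; split; first by have [] := inV _ ev.
have [w1 w2] := sqv; have [_ w2'] := sqv'; rewrite /= in w1 w2 w2'.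
have key a b : a <= b -> `|a| < be y -> `|b| < be y -> `|a - eta v| < r -> `|b - eta v| < r ->
    vl q (B y (w, b)) = vl q (B y (w, a)).
  rewrite !ltr_norml => ab ay by' av bv.
  have sqn n : a <= n <= b -> sq (be y) (w, n) by move=> nab; split => //=; rewrite ltr_norml; clra.
  apply: (prong_pathG (cP Sq) (g := fun n => B y (w, n)) ab) => n nab.
  - apply: con_for; apply: (@continuous_comp _ _ _ (fun n : R => (w, n)) (B y)).
      by apply: (cont_pair (g := id)); [exact: cont_cst|exact: cvg_id].
    by apply: (box_cont by_); exact: sqn.
  - by apply: (box_G by_); apply: sqn; clra.
  - by have [|//] := inV n; rewrite ltr_norml; clra.
have vz : `|eta v - eta v| < r by rewrite subrr normr0.
have -> : vl q (B y (w, eta v')) = vl q (B y (w, eta v)).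
  by have [h1|/ltW h1] := leP (eta v) (eta v'); [exact: key|exact/esym/key].
by rewrite -hB hE (sec_vl sc) ?gtr0_norm// lexx ltW.
Qed.

(** At time T - s0 a nearby line is in some sector of [q], on either side: [landing_side] handles
    each of these finitely many cases. The value u = 0 is excluded since the level is positive. *)
Lemma hits_near v T q : `|v| < be z -> 0 < T -> Sg q -> hits (g0 v) T q ->
  exists2 d : R, 0 < d & forall v', `|v' - v| < d -> ends v' T q.
Proof.
move=> vb T0 Sq /hits_reach[h [hq hI hr]].
have m1 : sgn1 (-1 : R) by right.
have gI : geo `]0, T[ (fun s => h (T + -1 * s)).
  by apply: geo_sub (geo_affine (c := T) m1 hI) => s /=; rewrite !in_itv /=; clra.
have gq : tends0 (fun s => h (T + -1 * s)) q.
  by apply: (tends0_eq T0 _ ((tends_rev h T q).1 hq)) => s _; rewrite mulN1r.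
have [j jk [d1 d10 Hg]] := germ_exists bP cP Sq T0 gI gq.
pose V := [set y | exists j u v, [/\ (j < prongs F q)%N, `|u| < e q j, 0 <= v <= A q,
    0 < v \/ 0 <= u & y = C q j (u, v)]].
have nV : nbhs q (N q `&` V).
  by apply: filterS (vertex_nbhs cP Sq ltr01) => y [Ny [_ Vy]].
have [d2 d20 Hd2] := prong_tends cP Sq jk (nbhs_interior nV).
have [e0 _] := sec_gt0 (prong_sector (cP Sq) jk).
pose s0 := Num.min (Num.min d1 d2) (Num.min T (e q j)) / 2.
have m0 : 0 < Num.min (Num.min d1 d2) (Num.min T (e q j)) by rewrite !lt_min d10 d20 T0.
have l1 : Num.min (Num.min d1 d2) (Num.min T (e q j)) <= d1 by rewrite !ge_min lexx.
have l2 : Num.min (Num.min d1 d2) (Num.min T (e q j)) <= d2 by rewrite !ge_min lexx orbT.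
have l3 : Num.min (Num.min d1 d2) (Num.min T (e q j)) <= T by rewrite !ge_min lexx !orbT.
have l4 : Num.min (Num.min d1 d2) (Num.min T (e q j)) <= e q j by rewrite !ge_min lexx !orbT.
have s00 : 0 < s0 by rewrite /s0; clra.
have s1 : s0 < d1 by rewrite /s0; clra.
have s2 : s0 < d2 by rewrite /s0; clra.
have s3 : s0 < T by rewrite /s0; clra.
have s4 : s0 < e q j by rewrite /s0; clra.
clearbody s0; clear m0 l1 l2 l3 l4.
have lev0 s : 0 < s -> s <= s0 -> exists2 d : R, 0 < d & forall v', `|v' - v| < d ->
    exists2 g, reach (g0 v') (T - s) g & V (g (T - s)) /\ vl q (g (T - s)) = 2 * ph q j s ^+ 2.
  move=> sp ss; apply: (level_near (h := h) vb Sq jk sp); [clra|clra|apply: hr; clra| |].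
  - by rewrite -Hg; [rewrite mulN1r|clra].
  - by apply: Hd2; clra.
have lev s : 0 < s -> s <= s0 -> exists2 d : R, 0 < d & forall v', `|v' - v| < d ->
    exists2 g, reach (g0 v') (T - s) g & vl q (g (T - s)) = 2 * ph q j s ^+ 2.
  by move=> sp ss; have [d dp H] := lev0 s sp ss; exists d => // v' /H[g gr [_ gE]]; exists g.
have [d3 d30 H3] := lev0 s0 s00 (lexx _).
have p1 : sgn1 (1 : R) by left.
have [i ik|d4 d40 H4] := finite_radius (n := prongs F q) (t := v) (P := fun i v' =>
    forall u w g, `|u| < e q i -> 0 <= w <= A q -> 0 < w \/ 0 <= u ->
    reach (g0 v') (T - s0) g -> g (T - s0) = C q i (u, w) -> ends v' T q).
  have [da da0 Ha] := landing_side bP cP Sq jk ik p1 s00 s3 s4 lev.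
  have [db db0 Hb] := landing_side bP cP Sq jk ik m1 s00 s3 s4 lev.
  have [dc dc0 Hc] := lev s0 s00 (lexx _).
  exists (Num.min dc (Num.min da db)); first by rewrite !lt_min da0 db0 dc0.
  move=> v'; rewrite !lt_min => /andP[vc /andP[va vb']] u w g ue wA wu gr gE.
  case: (ltrgtP u 0) => u0.
  - by apply: (Hb v' u w g) => //; rewrite mulN1r oppr_gt0.
  - by apply: (Ha v' u w g) => //; rewrite mul1r.
  - exfalso; have sc := prong_sector (cP Sq) ik.
    have [k kr kE] := Hc v' vc.
    have gk : g (T - s0) = k (T - s0) by apply: (reach_uniq bP gr kr); clra.
    move: kE; rewrite -gk gE (sec_vl sc)// u0 (sec_ph0 sc) => /(mulfI _).
    rewrite pnatr_eq0 => /(_ isT)/eqP; rewrite expr0n /= eq_sym sqrf_eq0.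
    by rewrite gt_eqF//; apply: (sector_ph_pos cP Sq jk).
exists (Num.min d3 d4); first by rewrite lt_min d30.
move=> v'; rewrite lt_min => /andP[v3 v4].
have [g gr [[i [u [w [ik ue wA wu E]]]] _]] := H3 v' v3.
exact: (H4 v' v4 i ik u w g).
Qed.

Lemma ends_sub v T q q' : leaf G q q' -> ends v T q' -> ends v T q.
Proof.
move=> l [[g gr lg]|[x hx lx]]; [left; exists g => //|right; exists x => //].
  exact: leaf_trans l lg.
exact: leaf_trans l lx.
Qed.

Lemma reach_ends v T g q : 0 < T -> reach (g0 v) T g -> ends v T q <-> leaf G q (g T).
Proof.
move=> T0 gr; split => [[[g' gr' lg']|[x [Sx hx] lx]]|lg]; last by left; exists g.
  by rewrite (reach_uniq bP gr gr' (r := T)) ?lexx ?ltW.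
by case: (reach_hits bP gr hx Sx T0).
Qed.

(** Otherwise all lines between v1 and v2 could be followed up to T1, although the line at v1 ends
    then. Indeed, suppose that at a time t, before which all lines continue, some line hits a
    singularity q. The heights whose line is at time t in the leaf of [G] through q form an open and
    closed subset of [a, b], by [flow_near] and [hits_near], so v2 is one of them. *)
Lemma slide v1 v2 T1 q1 : `|v1| < be z -> `|v2| < be z -> 0 < T1 -> Sg q1 ->
  hits (g0 v1) T1 q1 -> exists T q, [/\ 0 < T, T <= T1, Sg q & ends v2 T q].
Proof.
move=> vb1 vb2 T10 Sq1 hit1; apply: contrapT => nc.
pose a := Num.min v1 v2; pose b := Num.max v1 v2.
have ab : a <= b by rewrite ge_min le_max lexx.
have v1ab : a <= v1 <= b by rewrite ge_min le_max lexx.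
have v2ab : a <= v2 <= b by rewrite ge_min le_max lexx !orbT.
have vb v : a <= v <= b -> `|v| < be z.
  rewrite ltr_norml; move: vb1 vb2; rewrite !ltr_norml /a /b => h1 h2.
  by rewrite ge_min le_max => /andP[/orP[h3|h3] /orP[h4|h4]]; clra.
have b0 := box_gt0 (bP nz).
suff H : forall t, 0 <= t -> t <= T1 -> forall v, a <= v <= b -> exists g, reach (g0 v) t g.
  have [g gr] := H T1 (ltW T10) (lexx _) v1 v1ab.
  exact: (reach_hits bP gr hit1 Sq1 T10).
apply: real_ind; first exact: ltW.
- by move=> v vab; exists (g0 v); apply: (g0_reach bP nz sg01 (vb v vab)).
- move=> t t0 tT Ht.
  have [||d d0 Hd] := @uniform_itv _ a b (fun v d => exists g, reach (g0 v) (t + d) g) ab.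
  + by move=> v d d' [g gr] _ dd; exists g; apply: reach_le gr; rewrite lerD2l.
  + move=> v vab; have [g gr] := Ht v vab.
    have [d d0 Hd] := flow_near bP nz sg01 t0 (vb v vab) gr.
    by exists d => // v' _ /Hd[g' gr' _]; exists g'.
  exists d => // s ts sd _ v vab; have [g gr] := Hd v vab; exists g.
  by apply: reach_le gr; exact: ltW.
- move=> t t0 tT Ht v vab.
  have dich w : a <= w <= b -> (exists g, reach (g0 w) t g) \/ (exists q, Sg q /\ hits (g0 w) t q).
    move=> wab; have [?|[t' [q [t'0 t't Sq hq]]]] :=
      reach_or_hits bP finSg b0 (g0_geo bP nz sg01 (vb w wab)) t0; first by left.
    right; exists q; split => //; move: t't; rewrite le_eqVlt => /orP[/eqP <- //|t't].
    have [g gr] := Ht t' (ltW t'0) t't w wab.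
    by case: (reach_hits bP gr hq Sq t'0).
  have [//|[q [Sq hq]]] := dich v vab; exfalso.
  have loc w : a <= w <= b -> exists2 d : R, 0 < d & forall w', `|w' - w| < d ->
      ends w' t q <-> ends w t q.
    move=> wab; have [[g gr]|[x [Sx hx]]] := dich w wab.
      have [d d0 Hd] := flow_near bP nz sg01 (ltW t0) (vb w wab) gr.
      exists d => // w' /Hd[g' gr' lg'].
      have gr2 : reach (g0 w') t g' by apply: reach_le gr'; rewrite lerDl ltW.
      split => [/(reach_ends _ t0 gr2) l|/(reach_ends _ t0 gr) l].
        by apply/(reach_ends _ t0 gr); exact: leaf_trans l (leaf_sym lg').
      by apply/(reach_ends _ t0 gr2); exact: leaf_trans l lg'.
    have [d d0 Hd] := hits_near (vb w wab) t0 Sx hx; exists d => // w' wd.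
    have e1 := Hd w' wd; have e2 := Hd w ltac:(rewrite subrr normr0; exact: d0).
    split => H; [apply: ends_sub e2|apply: ends_sub e1].
      exact: (ends_leaf bP t0 H e1).
    exact: (ends_leaf bP t0 H e2).
  have ev : ends v t q by right; exists q => //; exact: leaf_refl.
  have lc c d : a <= c -> c <= d -> d <= b -> `[<ends d t q>] = `[<ends c t q>].
    move=> ac cd db; apply: (locally_constant (f := fun w => `[<ends w t q>])) => // w wcd.
    have [d' d0' H] := loc w ltac:(clra); exists d' => // w' _ wd.
    by apply/asbool_equiv_eq; exact: H.
  apply: nc; exists t, q; split => //; apply/asboolP.
  have [h|/ltW h] := leP v v2; [rewrite (lc v v2)|rewrite -(lc v2 v)] => //; try clra.
    exact/asboolP.
  exact/asboolP.
Qed.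

End Slide.

Lemma ray_geo_affine q g (t sg : R) : sgn1 sg -> ray q g ->
  geo [set r | 0 < t + sg * r] (fun r => g (t + sg * r)).
Proof. by move=> sg1 [_ _ _ gI]; exact: (geo_affine sg1 gI). Qed.

(** The crossing of u = 0 may come before or after time n; having run for a time n >= e z j, the ray
    is defined at both. *)
Lemma ray_through_sector q g z j (n u v : R) : ray q g -> Sg z -> (j < prongs F z)%N ->
  `|u| < e z j -> 0 < v -> v <= A z -> e z j <= n -> g n = C z j (u, v) ->
  exists2 t, 0 < t & leaf G z (g t).
Proof.
move=> gr Sz jk ue v0 vA en E; have [Sq g0 gq gI] := gr.
have sc := prong_sector (cP Sz) jk; have [e0 A0] := sec_gt0 sc.
have n0 : 0 < n by exact: lt_le_trans en.
have line := sector_line bP cP Sz jk v0 vA.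
have Iu : `]- e z j, e z j[%classic u by rewrite /= in_itv /= -ltr_norml.
have [sg sg1 K] := geo_meet bP gI line n0 Iu E.
have sgsg := sgn1V sg1.
move: (ue); rewrite ltr_norml => /andP[u1 u2].
have nu : 0 < n + - (sg * u) by case: sg1 => ->; clra.
exists (n + - (sg * u)); first exact: nu.
rewrite K.
  rewrite (_ : u + _ = u - (sg * sg) * u); last by ring.
  rewrite sgsg mul1r subrr -{1}(sec_vertex sc); apply: (sec_G sc); first by rewrite normr0.
  by rewrite vA ltW.
move=> r; rewrite /= in_itv /=; case: sg1 => ->; clra.
Qed.

(** Shifts the time from n to the moment t when the ray crosses the vertical u = 0; n > be z keeps
    all times involved positive. *)
Lemma ray_through_box q g z (n : R) : ray q g -> ~ Sg z -> be z < n ->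
  sq (be z) (bi z (g n)) -> B z (bi z (g n)) = g n -> `|(bi z (g n)).1| < be z / 4 ->
  exists t v sg, [/\ `|t - n| < be z / 4, `|v| < be z, sgn1 sg &
    forall r, `|r| < be z / 2 -> g (t + r) = B z (sg * r, v)].
Proof.
move=> gr nz nb [u1 v1] E u4; have [Sq g0 gq gI] := gr.
have b0 := box_gt0 (bP nz); have n0 : 0 < n by clra.
set u := (bi z (g n)).1 in u1 u4; set v := (bi z (g n)).2 in v1.
have Iu : `]- be z, be z[%classic u by rewrite /= in_itv /= -ltr_norml.
have E' : g n = B z (u, v) by rewrite -[LHS]E [bi z (g n)]surjective_pairing.
have [sg sg1 K] := geo_meet bP gI (box_line bP nz v1) n0 Iu E'.
have sgsg := sgn1V sg1.
exists (n - sg * u), v, sg; split => //.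
  by rewrite addrAC subrr add0r normrN norm_sgn1.
move=> r rb; rewrite (_ : n - sg * u + r = n + (r - sg * u)); last by ring.
move: u4 rb; rewrite !ltr_norml => /andP[u2 u3] /andP[r1 r2].
rewrite K.
  congr (B z (_, _)); transitivity (u - (sg * sg) * u + sg * r); first by ring.
  by rewrite sgsg; ring.
move=> r' /= rs; rewrite in_itv /=; move: rs; case: sg1 => ->; clra.
Qed.

(** If the points g n accumulate at a singularity z, the ray is in a sector of z at a late time:
    above the edge it crosses u = 0, in the leaf of [G] through z, and on the edge [ray_NS] would
    make that time less than 1. At a regular point [slide] applies. *)
Lemma ray_meets q g : ray q g -> exists t q', [/\ 0 < t, Sg q' & leaf G q' (g t)].
Proof.
move=> gr; have [Sq g0 gq gI] := gr.
have [z cz] := seq_cluster (fun n : nat => g n%:R) cS.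
have [Sz|nz] := pselect (Sg z).
  have [M M0 HM] := finite_bound (e z) (prongs F z).
  have nU : nbhs z [set y | (hl z y = 0 -> exists g u, [/\ ray z g, 0 <= u < 1 & y = g u]) /\
      exists j u v, [/\ (j < prongs F z)%N, `|u| < e z j, 0 <= v <= A z,
        0 < v \/ 0 <= u & y = C z j (u, v)]].
    apply: filterS2 (vertex_nbhs cP Sz ltr01) (vertex_axis bP cP full Sz ltr01).
    by move=> y [_ [_ h1]] [_ h2].
  have M1 : 0 <= M + 1 by rewrite addr_ge0.
  have [n Nn [ax [j [u [v [jk ue vA vu E]]]]]] := cz _ nU (Num.bound (M + 1)).
  have nM : M + 1 < n%:R.
    by apply: lt_le_trans (archi_boundP M1) _; rewrite ler_nat.
  have n0 : (0 : R) < n%:R by clra.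
  have sc := prong_sector (cP Sz) jk.
  have [v0|v0] := ltP 0 v.
    have [||t t0 lt] := ray_through_sector gr Sz jk ue v0 _ _ E.
    - by case/andP: vA.
    - by have := HM j jk; clra.
    by exists t, z.
  exfalso; have vz : v = 0 by apply/eqP; rewrite eq_le v0; case/andP: vA.
  have [|g' [u' [gr' /andP[u0' u1'] E']]] := ax.
    by rewrite E (sec_hl sc)// vz; ring.
  move: u0'; rewrite le_eqVlt => /orP[/eqP u0'|u0'].
    by apply: (ray_reg gr n0); rewrite E' -u0' (ray0 gr').
  by have [nu _] := ray_NS bP gr gr' n0 u0' E'; clra.
have bz := bP nz; have b0 := box_gt0 bz.
have sq00 := sq0 b0.
have nU : nbhs z [set y | [/\ sq (be z) (bi z y), B z (bi z y) = y & `|(bi z y).1| < be z / 4]].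
  have N1 := box_open bz sq00; rewrite (box_center bz) in N1.
  have N2 : \forall y \near z, `|(bi z y).1| < be z / 4.
    apply: (near_norm_lt (f := fun y => (bi z y).1)).
      apply: (@continuous_comp _ _ _ (bi z) fst); last exact: cont_fst.
      by have := box_Icont bz sq00; rewrite (box_center bz).
    by rewrite -{2}(box_center bz) (box_K bz)//= normr0 divr_gt0.
  by apply: filterS2 N1 N2 => y [].
have bound (m : R) : 0 <= m -> exists n : nat, m < n%:R /\
    [/\ sq (be z) (bi z (g n%:R)), B z (bi z (g n%:R)) = g n%:R & `|(bi z (g n%:R)).1| < be z / 4].
  move=> m0; have [n Nn H] := cz _ nU (Num.bound m); exists n; split => //.
  by apply: lt_le_trans (archi_boundP m0) _; rewrite ler_nat.
have [n1 [nb1 [a1 a2 a3]]] := bound (be z) (ltW b0).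
have [t1 [v1 [sg1 [tn1 vb1 sgn1_ E1]]]] := ray_through_box gr nz nb1 a1 a2 a3.
(* The second crossing is sought after n1 + be z, so that t1 < t2. The slide lasts at most t1, so
   the ray can be followed for that long from the second crossing, even backwards. *)
have nb' : 0 <= n1%:R + be z by rewrite addr_ge0// ltW.
have [n2 [nb2 [b1 b2 b3]]] := bound _ nb'.
have [t2 [v2 [sg2 [tn2 vb2 sgn2_ E2]]]] := ray_through_box gr nz (n := n2%:R) ltac:(clra) b1 b2 b3.
have t12 : t1 < t2.
  by move: tn1 tn2; rewrite !ltr_norml; clra.
have t10 : 0 < t1 by move: tn1; rewrite ltr_norml; clra.
have m1 : sgn1 (-1 : R) by right.
(* The direction that leads back to the origin of the ray from the first crossing. At the second
   crossing the same horizontal direction may run along the ray either way; [s] tells which. *)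
pose s0 := - sg1.
have s01 : sgn1 s0 by rewrite /s0 -mulN1r; exact: sgn1M.
have h0 : hits (fun r => B z (s0 * r, v1)) t1 q.
  exists (fun r => g (t1 + -1 * r)); split.
  - by apply: geo_sub (ray_geo_affine m1 gr) => r /=; rewrite in_itv /=; clra.
  - apply/tends_rev; apply: (tends0_eq t10 _ gq) => s _; congr g; ring.
  - exists (be z / 2) => [|r /andP[r0 rb] rt]; first by rewrite divr_gt0.
    rewrite E1; first by congr (B z (_, _)); rewrite /s0; ring.
    by rewrite mulN1r normrN ger0_norm.
have [T [q' [T0 T1 Sq' ends']]] := slide nz s01 vb1 vb2 t10 Sq h0.
pose s := sg2 * s0; have s1 : sgn1 s by exact: sgn1M.
have rT : reach (fun r => B z (s0 * r, v2)) T (fun r => g (t2 + s * r)).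
  split.
    apply: geo_sub (ray_geo_affine s1 gr) => r /=; rewrite in_itv /=.
    by case: s1 => ->; clra.
  exists (be z / 2) => [|r /andP[r0 rb] rt]; first by rewrite divr_gt0.
  rewrite E2; last by rewrite norm_sgn1// ger0_norm.
  by rewrite mulrA /s mulrA (sgn1V sgn2_) mul1r.
exists (t2 + s * T), q'; split => //; first by case: s1 => ->; clra.
exact: (reach_ends q' T0 rT).1 ends'.
Qed.

End Meeting.

(** * Invariance of the constructions *)

Section Homeo.
Context {R : realType} {T : topologicalType}.

Lemma pc_image (U : topologicalType) (f : T -> U) (A : set T) x y : continuous f ->
  path_component (R := R) A x y -> path_component (R := R) (f @` A) (f x) (f y).
Proof.
move=> cf /pcP[g [cg g0 g1 Ag]]; apply/pcP; exists (f \o g); split.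
- by move=> t t01; apply: con_comp; [exact: cg|exact: cf].
- by rewrite /= g0.
- by rewrite /= g1.
- by move=> t t01; exists (g t) => //; exact: Ag.
Qed.

Lemma arc_image (U : topologicalType) (f : T -> U) (A : set T) a b : hausdorff_space U ->
  continuous f -> injective f -> is_arc (R := R) A a b -> is_arc (R := R) (f @` A) (f a) (f b).
Proof.
move=> hU cf jf [g [[h [/con_within cg _ gK]] g0 g1 ->]].
exists (f \o g); split; [|by rewrite /= g0|by rewrite /= g1|by rewrite image_comp].
apply: embeds_uitv => //.
  move=> t t01; apply: con_comp; last exact: cf.
  by apply: cg; exact/uitvE.
move=> s t s01 t01 /jf E.
by rewrite -(gK s ((uitvE s).2 s01)) E gK//; exact: (uitvE t).2 t01.
Qed.

Lemma closure_image (f : T -> T) (A : set T) x : continuous f -> closure A x ->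
  closure (f @` A) (f x).
Proof.
move=> cf cx U /cf/cx[y [Ay Uy]].
by exists (f y); split => //; exists y.
Qed.

Lemma component_image (f : T -> T) (A : set T) x y : continuous f ->
  connected_component A x y -> connected_component (f @` A) (f x) (f y).
Proof.
move=> cf [C [Cx CA cC] Cy]; exists (f @` C); last by exists y.
split; first by exists x.
  by move=> _ [z Cz <-]; exists z => //; exact: CA.
by apply: connected_continuous_connected cC _; exact: continuous_subspaceT.
Qed.

End Homeo.

(** * Homeomorphisms preserving the leaves preserve the regular points *)

Section ProngNumber.
Context {R : realType} {S : surface R}.
Variable lf : S -> set S.

(** [two_prongs] needs a point of positive level, whereas [x] has level 0 in its own chart. The
    affine map [h] re-centres the chart at a neighbouring point and gives [x] the height -1/2; the
    factor 2 makes its inverse [k] map the disc into the disc. *)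
Lemma shift_chart c x : foliated_chart lf (hlevel 2) c x -> exists c' x',
  foliated_chart lf (hlevel 2) c' x' /\ cdom c' x /\ hlevel 2 (cmap c' x) = 2 * (2^-1) ^+ 2.
Proof.
move=> fc; have [cx x0 cim Hp] := fc.
pose h (w : R * R) : R * R := (w.1 * 2, w.2 * 2 - 2^-1).
pose k (w : R * R) : R * R := (w.1 / 2, (w.2 + 2^-1) / 2).
have hk w : h (k w) = w by rewrite [RHS]surjective_pairing; congr pair; rewrite /=; field.
have kh w : k (h w) = w by rewrite [RHS]surjective_pairing; congr pair; rewrite /=; field.
have hc w : {for w, continuous h}.
  apply: cont_pair; first by apply: cont_mul; [exact: cont_fst|exact: cont_cst].
  apply: cont_sub; last exact: cont_cst.
  by apply: cont_mul; [exact: cont_snd|exact: cont_cst].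
have kc w : {for w, continuous k}.
  apply: cont_pair; first by apply: cont_mul; [exact: cont_fst|exact: cont_cst].
  apply: cont_mul; last exact: cont_cst.
  by apply: cont_add; [exact: cont_snd|exact: cont_cst].
have kd w : disc w -> disc (k w).
  by rewrite /disc /= => wd; nra.
have od : open (@disc R) by rewrite -cim; exact: cimg_open.
pose D := cdom c `&` (h \o cmap c) @^-1` disc.
have DE : (h \o cmap c) @` D = disc.
  apply/seteqP; split => [_ [y [_ dy] <-] //|w dw].
  have [h1 h2] := fc_disc fc (kd w dw).
  by exists (cinv c (k w)); rewrite /D /= h2 hk.
have oD : open D.
  rewrite openE => y [cy dy]; have c1 : {for y, continuous (h \o cmap c)}.
    by apply: continuous_comp; [exact: cmap_for|exact: hc].
  apply: filterI; first by apply: open_nbhs_nbhs; split; [exact: cdom_open|].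
  by apply: c1; apply: open_nbhs_nbhs; split.
have c1 : {within D, continuous (h \o cmap c)}.
  rewrite continuous_open_subspace// => y; rewrite inE => -[cy _].
  by apply: continuous_comp; [exact: cmap_for|exact: hc].
have oDE : open ((h \o cmap c) @` D) by rewrite DE.
have c2 : {within (h \o cmap c) @` D, continuous (cinv c \o k)}.
  rewrite continuous_open_subspace// => y; rewrite inE DE => dy.
  by apply: continuous_comp; [exact: kc|apply: (cinv_for fc); exact: kd].
have c3 y : D y -> (cinv c \o k) ((h \o cmap c) y) = y.
  by move=> [cy _]; rewrite /= kh cmapK.
pose c' := Chart oD oDE c1 c2 c3.
have d0 : disc (0 : R * R) by rewrite /disc /= expr0n /= addr0 ltr01.
have [k1 k2] := fc_disc fc (kd _ d0).
exists c', (cinv c (k 0)); split; last split.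
- split => /=.
  + by rewrite /D /= k2 hk.
  + by rewrite k2 hk.
  + exact: DE.
  + move=> y [cy dy]; apply/seteqP; split => [_ [y' py <-]|w].
      have /pcP[g [cg g0 g1 Ag]] := pc_pc py.
      rewrite -g0 -g1; apply: (pcI (g := fun t => h (cmap c (g t)))) => //; last first.
        move=> t t01; have pt := Ag t t01; have [_ [_ [ct dt]]] := pc_mem pt; split => //=.
        rewrite !hlevel2 /= g0; congr (2 * (_ * 2 - _) ^+ 2).
        apply: (fc_snd fc); apply: pc_sub pt => u [lu [cu _]]; by split.
      move=> t t01; apply: (@con_comp R _ _ `[0, 1] g (h \o cmap c) t); first exact: cg.
      apply: continuous_comp; last exact: hc.
      by apply: cmap_for; have [_ [_ []]] := pc_mem (Ag t t01).
    move=> /pcP[g [cg g0 g1 Ag]].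
    exists (cinv c (k w)); last first.
      have [dw _] := Ag 1 ltac:(rewrite lexx ler01; exact: isT).
      rewrite g1 in dw; have [_ h2] := fc_disc fc (kd w dw).
      by rewrite /= h2 hk.
    have lev t : 0 <= t <= 1 -> (g t).2 = (h (cmap c y)).2.
      move=> t01; rewrite -g0; have [t0 t1] := andP t01.
      apply: (con_sqr_constant (f := fun t => (g t).2) (c := (g 0).2 ^+ 2)) => //.
        move=> s st; apply: (con_sub (I := `[0, 1])) => [r /=|]; first by rewrite !in_itv /=; clra.
        by apply: (@con_comp R _ _ `[0, 1] g snd s); [apply: cg; clra|exact: cont_snd].
      move=> s st; have [_ /=] := Ag s ltac:(clra); rewrite !hlevel2 g0 => /mulfI; apply.
      by rewrite pnatr_eq0.
    have yE : y = cinv c (k (g 0)) by rewrite g0 kh cmapK.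
    rewrite yE -g1; apply: (pcI (g := fun t => cinv c (k (g t)))) => //.
      move=> t t01; have [dt _] := Ag t t01.
      apply: (@con_comp R _ _ `[0, 1] g (cinv c \o k) t); first exact: cg.
      by apply: continuous_comp; [exact: kc|apply: (cinv_for fc); exact: kd].
    move=> t t01; have [dt _] := Ag t t01; have [h1 h2] := fc_disc fc (kd _ dt).
    split; last by rewrite /D /= h2 hk.
    have P : model_plaque (hlevel 2) (k (g 0)) (k (g t)).
      have [t0 t1] := andP t01.
      apply: (pcI (g := fun t => k (g t)) t0) => s st.
        apply: (con_sub (I := `[0, 1])) => [r /=|]; first by rewrite !in_itv /=; clra.
        by apply: (@con_comp R _ _ `[0, 1] g k s); [apply: cg; clra|exact: kc].
      have [ds _] := Ag s ltac:(clra); split; first exact: kd.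
      by rewrite /= !hlevel2 /= (lev s)// ?lev ?lexx ?ler01//; clra.
    by have [_ []] := pc_mem (fc_leaf fc P).
- have dx : disc (h 0) by rewrite /disc /h /=; nra.
  by split => //; rewrite /= x0.
- by rewrite /= x0 hlevel2 /= mul0r sub0r sqrrN.
Qed.

Variables (f fi : S -> S).
Hypotheses (cf : continuous f) (cfi : continuous fi) (fK : cancel f fi) (fiK : cancel fi f).
Hypothesis f_lf : forall x, f @` lf x = lf (f x).

Lemma pull_chart lev c x : foliated_chart lf lev c (f x) -> exists c', foliated_chart lf lev c' x.
Proof.
move=> fc; have [cx x0 cim Hp] := fc.
pose D := f @^-1` cdom c.
have DE : (cmap c \o f) @` D = cmap c @` cdom c.
  apply/seteqP; split => [_ [y Dy <-]|_ [y cy <-]]; first by exists (f y).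
  by exists (fi y); rewrite /D /= fiK.
have oD : open D by apply: open_comp; [move=> y _; exact: cf|exact: cdom_open].
have oDE : open ((cmap c \o f) @` D) by rewrite DE; exact: cimg_open.
have c1 : {within D, continuous (cmap c \o f)}.
  rewrite continuous_open_subspace// => y; rewrite inE => Dy.
  by apply: continuous_comp; [exact: cf|exact: cmap_for].
have c2 : {within (cmap c \o f) @` D, continuous (fi \o cinv c)}.
  rewrite continuous_open_subspace// => y; rewrite inE DE cim => dy.
  by apply: continuous_comp; [exact: (cinv_for fc)|exact: cfi].
have c3 y : D y -> (fi \o cinv c) ((cmap c \o f) y) = y.
  by move=> Dy; rewrite /= cmapK.
exists (Chart oD oDE c1 c2 c3); split => //=; first by rewrite DE.
move=> y Dy; rewrite -(Hp (f y) Dy) -image_comp; congr (_ @` _).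
apply/seteqP; split => [_ [y' py <-]|y' py].
  apply: pc_sub (pc_image cf py) => _ [u [lu Du] <-]; split => //.
  by rewrite -f_lf; exists u.
exists (fi y'); last exact: fiK.
have := pc_image cfi py; rewrite fK; apply: pc_sub => _ [u [lu cu] <-].
split; last by rewrite /D /= fiK.
by move: lu; rewrite -f_lf => -[u' lu' <-]; rewrite fK.
Qed.

End ProngNumber.

(** The chart at f x is pulled back to [x] and shifted, and [two_prongs] compares it with the chart
    of [F] at [x]. The value 2 suffices, as singular points are those with another value. *)
Lemma prongs_homeo {R : realType} {S : surface R} (F : foliation S) (f fi : S -> S) x :
  continuous f -> continuous fi -> cancel f fi -> cancel fi f ->
  (forall x, f @` leaf F x = leaf F (f x)) -> prongs F (f x) = 2%N -> prongs F x = 2%N.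
Proof.
move=> cf cfi fK fiK lf E.
have [c fc] := leaf_chart F (f x); rewrite E in fc.
have [c1 fc1] := pull_chart cf cfi fK fiK lf fc.
have [c2 [x2 [fc2 [c2x lev]]]] := shift_chart fc1.
have [d fd] := leaf_chart F x.
by apply: (two_prongs (k := 2) (b := 2^-1) _ (prongs_gt0 F x) fc2 c2x fd _ lev).
Qed.

(** * Equivariance of the graphs and of the partition *)

Section Equivariance.
Context {R : realType} {S : surface R} (f : S -> S) (P : pseudo_anosov f).
Notation Fs := (stab P).
Notation Fu := (unst P).
Implicit Types (h : S -> S) (A X : set S).

Let hS : hausdorff_space S := @surf_hausdorff _ S.

(** The structure from which the graphs and the partition are built. The notion is closed under
    inversion, so that by [equivariant] each equivariance needs only one inclusion. *)
Record symmetry h hi : Prop := Symmetry {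
  sy_cont : continuous h;
  sy_conti : continuous hi;
  sy_K : cancel h hi;
  sy_iK : cancel hi h;
  sy_s : forall x y, leaf Fs x y <-> leaf Fs (h x) (h y);
  sy_u : forall x y, leaf Fu x y <-> leaf Fu (h x) (h y);
  sy_Sing : forall x, Sing P x <-> Sing P (h x);
  sy_comm : forall x, f (h x) = h (f x) }.

Lemma symmetry_inv h hi : symmetry h hi -> symmetry hi h.
Proof.
move=> sy; have [cf cfi K iK ss su sS cm] := sy; split => //.
- by move=> x y; rewrite -{1}(iK x) -{1}(iK y); exact: iff_sym (ss _ _).
- by move=> x y; rewrite -{1}(iK x) -{1}(iK y); exact: iff_sym (su _ _).
- by move=> x; rewrite -{1}(iK x); exact: iff_sym (sS _).
- by move=> x; rewrite -{2}(iK x) cm K.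
Qed.

Lemma iter_comm h hi n x : symmetry h hi -> iter n f (h x) = h (iter n f x).
Proof. by move=> sy; elim: n => //= n ->; rewrite (sy_comm sy). Qed.

Lemma equivariant (X : S -> set S) :
  (forall h hi, symmetry h hi -> forall z y, X z y -> X (h z) (h y)) ->
  forall h hi, symmetry h hi -> forall z, X (h z) = h @` X z.
Proof.
move=> H h hi sy z; apply/seteqP; split => [y Xy|_ [y Xy <-]]; last exact: (H _ _ sy).
exists (hi y); last exact: sy_iK sy y.
by have := H _ _ (symmetry_inv sy) _ _ Xy; rewrite (sy_K sy).
Qed.

Lemma mem_image h hi X y : symmetry h hi -> (h @` X) (h y) -> X y.
Proof. by move=> sy [x Xx /(can_inj (sy_K sy)) <-]. Qed.

Lemma seg_sym (F : foliation S) h hi p x y : symmetry h hi ->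
  (forall x y, leaf F x y <-> leaf F (h x) (h y)) -> seg F p x y -> seg F (h p) (h x) (h y).
Proof.
move=> sy lh [J [aJ JL] Jy]; exists (h @` J); last by exists y.
split; last by move=> _ [u /JL lu <-]; exact: (lh _ _).1 lu.
by apply: arc_image => //; [exact: sy_cont sy|exact: can_inj (sy_K sy)].
Qed.

Lemma Ju_sym h hi : symmetry h hi -> forall z y, Ju P z y -> Ju P (h z) (h y).
Proof.
move=> sy z y [q Sq sq]; exists (h q); first exact: (sy_Sing sy q).1 Sq.
by apply: (seg_sym sy) sq; exact: sy_u sy.
Qed.

Lemma calJu_sym h hi : symmetry h hi -> forall z y, calJu P z y -> calJu P (h z) (h y).
Proof.
move=> sy z y [i _ Jy]; exists i => //=.
by rewrite (iter_comm _ _ sy); exact: (Ju_sym sy).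
Qed.

Lemma stopped_sym (F : foliation S) h hi X A : symmetry h hi ->
  (forall x y, leaf F x y <-> leaf F (h x) (h y)) ->
  stopped_segments P F X A -> stopped_segments P F (h @` X) (h @` A).
Proof.
move=> sy lh [p [y [Sp Xy aA AL AX]]]; exists (h p), (h y); split.
- exact: (sy_Sing sy p).1 Sp.
- by exists y.
- by apply: arc_image => //; [exact: sy_cont sy|exact: can_inj (sy_K sy)].
- by move=> _ [u /AL lu <-]; exact: (lh _ _).1 lu.
- apply/eqP/negPn/negP => /set0P[_ [[[u Au <-] nu] /(mem_image sy) Xu]].
  have : set0 u by rewrite -AX; split => //; split => // -[] /= E; apply: nu; rewrite E; [left|right].
  by [].
Qed.

Lemma delta_s_sym h hi z A : symmetry h hi -> delta_s P z A -> delta_s P (h z) (h @` A).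
Proof.
move=> sy; rewrite /delta_s (equivariant calJu_sym sy).
by apply: (stopped_sym sy); exact: sy_s sy.
Qed.

Lemma delta_s_cup_sym h hi : symmetry h hi -> forall z y,
  (\bigcup_(I in delta_s P z) I) y -> (\bigcup_(I in delta_s P (h z)) I) (h y).
Proof. by move=> sy z y [I dI Iy]; exists (h @` I); [exact: delta_s_sym sy dI|exists y]. Qed.

Lemma delta_s_cup_image h hi z : symmetry h hi ->
  \bigcup_(I in delta_s P (h z)) I = h @` (\bigcup_(I in delta_s P z) I).
Proof. by move=> sy; exact: (equivariant delta_s_cup_sym sy). Qed.

Lemma delta_u_sym h hi z A : symmetry h hi -> delta_u P z A -> delta_u P (h z) (h @` A).
Proof.
move=> sy; rewrite /delta_u (delta_s_cup_image z sy).
by apply: (stopped_sym sy); exact: sy_u sy.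
Qed.

Variable n : nat.

Definition cut_set (z : S) := ~` (\bigcup_(I in delta_s P z) I `|`
  \bigcup_(J in iterate_image f n (delta_u P z)) J).

Lemma cut_sym h hi : symmetry h hi -> forall z y, cut_set z y -> cut_set (h z) (h y).
Proof.
move=> sy z y cy [Sy|[_ [J dJ <-] [u Ju E]]]; apply: cy.
  by left; apply: (mem_image sy); rewrite -(delta_s_cup_image z sy).
right; have si := symmetry_inv sy.
exists (iter n f @` (hi @` J)).
  exists (hi @` J) => //; have := delta_u_sym si dJ; by rewrite (sy_K sy).
exists (hi u); first by exists u.
by rewrite (iter_comm _ _ si) E (sy_K sy).
Qed.

Lemma partition_sub h hi z X : symmetry h hi -> primitive_partition P z n X ->
  primitive_partition P (h z) n (h @` X).
Proof.
have key h' hi' : symmetry h' hi' -> forall z x y, closure (connected_component (cut_set z) x) y ->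
    closure (connected_component (cut_set (h' z)) (h' x)) (h' y).
  move=> sy z' x y cl; have := closure_image (sy_cont sy) cl; apply: closureS.
  move=> _ [u cu <-]; rewrite (equivariant cut_sym sy).
  exact: component_image (sy_cont sy) cu.
move=> sy [x cx <-]; exists (h x); first exact: (cut_sym sy).
apply/seteqP; split => [y cy|_ [y cy <-]]; last exact: (key _ _ sy).
exists (hi y); last exact: sy_iK sy y.
by have := key _ _ (symmetry_inv sy) _ _ _ cy; rewrite !(sy_K sy).
Qed.

Lemma partition_sym h hi z : symmetry h hi ->
  primitive_partition P (h z) n = [set h @` X | X in primitive_partition P z n].
Proof.
move=> sy; apply/seteqP; split => [X pX|_ [X pX <-]]; last exact: partition_sub sy pX.
exists (hi @` X).
  by have := partition_sub (symmetry_inv sy) pX; rewrite (sy_K sy).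
rewrite image_comp; apply/seteqP; split => [_ [y Xy <-]|y Xy]; first by rewrite /= (sy_iK sy).
by exists y => //; exact: sy_iK sy y.
Qed.

End Equivariance.

Lemma image_iter_succ {R : realType} {S : surface R} (f fi : S -> S) (m : int) (X : set S) :
  cancel f fi -> cancel fi f -> image_iter f m (f @` X) = image_iter f (m + 1) X.
Proof.
move=> fK fiK; have inj k : injective (iter k f).
  by elim: k => // k IH x y /(can_inj fK)/IH.
case: m => [k|k].
  rewrite (_ : Posz k + 1 = Posz k.+1); last by rewrite -addn1 PoszD.
  rewrite /= image_comp; apply/seteqP; split => _ [x Xx <-]; exists x => //=.
    by rewrite -iterSr.
  by rewrite -iterSr.
(* [Negz k] stands for -(k + 1). The case m = -1 is apart because m + 1 is then no longer
   negative. *)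
case: k => [|k].
  rewrite (_ : Negz 0 + 1 = Posz 0)//=; apply/seteqP; split => [x [y Xy /(can_inj fK) <-]|x [y Xy <-]].
    by exists y.
  by exists y.
rewrite (_ : Negz k.+1 + 1 = Negz k); last first.
  by rewrite !NegzE -(addn1 k.+1) PoszD; ring.
apply/seteqP; split => [x [y Xy]|x Xx] /=.
  by move=> /(can_inj fK) E; rewrite /= -E.
by exists (f (iter k f x)).
Qed.

Lemma orbit_succ {R : realType} {S : surface R} (f fi : S -> S) (Q : set (set S)) :
  cancel f fi -> cancel fi f -> partition_orbit f [set f @` X | X in Q] = partition_orbit f Q.
Proof.
move=> fK fiK.
have E m : [set image_iter f m X | X in [set f @` X | X in Q]] = [set image_iter f (m + 1) X | X in Q].
  by rewrite image_comp; apply/seteqP; split => _ [X QX <-]; exists X => //=;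
    rewrite (image_iter_succ _ _ fK fiK).
apply/seteqP; split => _ [m _ <-]; first by exists (m + 1) => //; rewrite E.
by exists (m - 1) => //; rewrite E subrK.
Qed.

(** * Counting intersections *)

Lemma inj_near {R : realType} {T : topologicalType} (f : R -> T) (a b t m : R) :
  hausdorff_space T -> (forall t, a <= t <= b -> con `[a, b] f t) ->
  (forall s t, a <= s <= b -> a <= t <= b -> f s = f t -> s = t) -> a <= t <= b -> 0 < m ->
  exists2 U, nbhs (f t) U & forall s, a <= s <= b -> U (f s) -> `|s - t| < m.
Proof.
move=> hT cf jf tab m0; have [h [/subspace_continuousP ch hK]] := con_inj_inverse hT cf jf.
have It : (f @` `[a, b]) (f t) by exists t => //; rewrite /= in_itv.
have nb : nbhs (h (f t)) [set r : R | `|r - t| < m].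
  by rewrite hK//; apply/nbhs_ballP; exists m => //= r; rewrite /ball /= distrC.
exists [set y | (f @` `[a, b]) y -> `|h y - t| < m]; first exact: (ch _ It _ nb).
move=> s sab /= H; rewrite -(hK s sab); apply: H.
by exists s => //; rewrite /= in_itv.
Qed.

Lemma con_compact {R : realType} {T : topologicalType} (f : R -> T) (a b : R) :
  (forall t, a <= t <= b -> con `[a, b] f t) -> compact (f @` `[a, b]).
Proof.
move=> cf; apply: continuous_compact; last exact: segment_compact.
by apply/con_within => t; rewrite /= in_itv; exact: cf.
Qed.

Section FiniteMeet.
Context {R : realType} {S : surface R} (F : foliation S) (G : measured_foliation S).
Variable Sg : set S.
Hypothesis finSg : finite_set Sg.
Local Notation isbox := (isbox F G Sg).
Local Notation isprong := (isprong F G Sg).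
Variables (be : S -> R) (B : S -> R * R -> S) (bi : S -> S -> R * R).
Hypothesis bP : forall x, ~ Sg x -> isbox x (be x) (B x) (bi x).
Variables (N : S -> set S) (hl vl : S -> S -> R) (e : S -> nat -> R) (A : S -> R)
  (C : S -> nat -> R * R -> S) (ph : S -> nat -> R -> R).
Hypothesis cP : forall q, Sg q ->
  isprong q (N q) (hl q) (vl q) (prongs F q) (e q) (A q) (C q) (ph q).
Local Notation ray := (ray Sg be B).
Implicit Types (q x y : S) (g h : R -> S).

Let hS : hausdorff_space S := @surf_hausdorff _ S.
Let cS : compact [set: S] := @surf_compact _ S.

Lemma plaque_pathG (a b : R) h t : (forall t, a <= t <= b -> con `[a, b] h t) ->
  (forall s t, a <= s <= b -> a <= t <= b -> leaf G (h s) (h t)) ->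
  a <= t <= b -> ~ Sg (h t) -> exists2 d : R, 0 < d & forall s, a <= s <= b -> `|s - t| < d ->
    (bi (h t) (h s)).1 = 0.
Proof.
move=> ch lh tab n; have bx := bP n; have s0 := sq0 (box_gt0 bx).
have := box_open bx s0; rewrite (box_center bx) => /(ch t tab)[d d0 H].
exists d => // s sab sd.
have bt : bi (h t) (h t) = (0, 0) by rewrite -{2}(box_center bx) (box_K bx).
have key u v : a <= u <= b -> a <= v <= b -> u <= v -> `|u - t| < d -> `|v - t| < d ->
    (bi (h t) (h v)).1 = (bi (h t) (h u)).1.
  move=> uab vab uv ud vd; apply: (box_pathG bx uv) => [r ruv|r ruv|r ruv].
  - apply: (con_sub (I := `[a, b])); last by apply: ch; clra.
    by move=> x /=; rewrite !in_itv /=; clra.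
  - by apply: lh; clra.
  - have [||h1 h2] := H r; first by rewrite /= in_itv /=; clra.
      by move: ud vd; rewrite !ltr_norml; clra.
    by exists (bi (h t) (h r)).
have td : `|t - t| < d by rewrite subrr normr0.
have [st|/ltW ts] := leP s t.
  by rewrite -(key s t)// bt.
by rewrite (key t s)// bt.
Qed.

(** Near a regular point each arc stays in one plaque, and a horizontal and a vertical plaque meet
    once. Near a singular point z an intersection has both levels 0, hence is z, which no ray meets
    at a positive time. The vertical arc [g'] is given by its properties only, since the rays of the
    pair ([G], [F]) are built on other boxes. *)
Lemma finite_meet q q' g g' (T T' : R) : ray q g -> Sg q' -> g' 0 = q' ->
  (forall r, 0 < r -> ~ Sg (g' r)) -> (forall r, 0 <= r -> con setT g' r) ->
  (forall s r, 0 <= s -> 0 <= r -> g' s = g' r -> s = r) ->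
  (forall r, 0 <= r -> leaf G q' (g' r)) ->
  finite_set [set y | exists t r, [/\ 0 < t <= T, 0 < r <= T', y = g t & y = g' r]].
Proof.
move=> gr Sq' g0' rg' cg' ig' lg'; have [Sq g0 gq gI] := gr.
have cg t : 0 <= t <= T -> con `[0, T] g t.
  by move=> /andP[t0 _]; apply: (con_sub (I := setT)) => //; exact: (ray_con bP gr).
have ch t : 0 <= t <= T' -> con `[0, T'] g' t.
  by move=> /andP[t0 _]; apply: (con_sub (I := setT)) => //; exact: cg'.
have ig s t : 0 <= s <= T -> 0 <= t <= T -> g s = g t -> s = t.
  by move=> /andP[s0 _] /andP[t0 _]; exact: (ray_inj bP gr).
have ih s t : 0 <= s <= T' -> 0 <= t <= T' -> g' s = g' t -> s = t.
  by move=> /andP[s0 _] /andP[t0 _]; exact: ig'.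
have lg s t : 0 <= s <= T -> 0 <= t <= T -> leaf F (g s) (g t).
  move=> /andP[s0 _] /andP[t0 _]; apply: leaf_trans (leaf_sym _) (ray_leaf bP cP gr t0).
  exact: (ray_leaf bP cP gr).
have lh s t : 0 <= s <= T' -> 0 <= t <= T' -> leaf G (g' s) (g' t).
  by move=> /andP[s0 _] /andP[t0 _]; apply: leaf_trans (leaf_sym (lg' s s0)) (lg' t t0).
have away (h : R -> S) (M : R) z : (forall t, 0 <= t <= M -> con `[0, M] h t) ->
    ~ (h @` `[0, M]) z -> exists2 U, nbhs z U & forall t, 0 < t <= M -> ~ U (h t).
  move=> hc nz; exists (~` (h @` `[0, M])).
    apply: open_nbhs_nbhs; split => //; apply: closed_openC.
    by apply: compact_closed => //; exact: con_compact.
  by move=> t tM; apply; exists t => //; rewrite /= in_itv /=; clra.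
apply: finite_discrete => // z.
have [[t /= + tz]|nz] := pselect ((g @` `[0, T]) z); last first.
  have [U nU HU] := away g T z cg nz; exists U => // a b [t [r [tT _ -> _]]] _ Ut.
  by case: (HU t tT).
have [[r /= + rz]|nz] := pselect ((g' @` `[0, T']) z); last first.
  have [U nU HU] := away g' T' z ch nz; exists U => // a b [s [r [_ rT _ ->]]] _ Ur.
  by case: (HU r rT).
rewrite !in_itv /= => rT tT.
have [Sz|nz] := pselect (Sg z).
  have t0 : t = 0.
    case/andP: tT; rewrite le_eqVlt => /orP[/eqP //|t0] _.
    by case: (ray_reg gr t0); rewrite tz.
  have r0 : r = 0.
    case/andP: rT; rewrite le_eqVlt => /orP[/eqP //|r0] _.
    by case: (rg' r r0); rewrite rz.
  subst t r.
  have zq : z = q by rewrite -tz (ray0 gr).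
  have nN : nbhs z (N z).
    by apply: open_nbhs_nbhs; split; [exact: (prong_open (cP Sz))|exact: (vertex_N cP Sz)].
  have cg0 := cg 0 tT; have ch0 := ch 0 rT; rewrite /con tz in cg0; rewrite /con rz in ch0.
  have [d d0 Hd] := cg0 _ nN; have [d' d'0 Hd'] := ch0 _ nN.
  have [U1 nU1 H1] := inj_near hS cg ig tT d0.
  have [U2 nU2 H2] := inj_near hS ch ih rT d'0.
  rewrite tz in nU1; rewrite rz in nU2.
  exists (U1 `&` U2 `&` [set y | exists j u v, [/\ (j < prongs F z)%N, `|u| < e z j, 0 <= v <= A z,
    0 < v \/ 0 <= u & y = C z j (u, v)]]).
    by apply: filterI; [exact: filterI|exact: (prong_cover (cP Sz))].
  move=> y y' [t [r [/andP[t0 tT'] /andP[r0 rT'] yt yr]]] _ [[U1y U2y] [j [u [v [jk ue vA vu E]]]]].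
  exfalso; have sc := prong_sector (cP Sz) jk.
  have td : `|t - 0| < d by apply: H1; rewrite ?(ltW t0)// -yt.
  have rd : `|r - 0| < d' by apply: H2; rewrite ?(ltW r0)// -yr.
  rewrite subr0 gtr0_norm// in td; rewrite subr0 gtr0_norm// in rd.
  have hl0 : hl z y = 0.
    suff <- : hl z (g 0) = hl z y by rewrite tz (vertex_hl cP Sz).
    rewrite yt; apply/esym.
    apply: (prong_pathF (cP Sz) (ltW t0)) => s /andP[s0 st].
    - by apply: (con_sub (I := setT)) => //; exact: (ray_con bP gr).
    - by apply: (lg 0 s tT); rewrite s0; exact: le_trans st tT'.
    - apply: Hd; first by rewrite /= in_itv /= s0 (le_trans st).
      by rewrite subr0 ger0_norm//; exact: le_lt_trans td.
  have vl0 : vl z y = 0.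
    suff <- : vl z (g' 0) = vl z y by rewrite rz (vertex_vl cP Sz).
    rewrite yr; apply/esym.
    apply: (prong_pathG (cP Sz) (ltW r0)) => s /andP[s0 st].
    - by apply: (con_sub (I := setT)) => //; exact: cg'.
    - by apply: (lh 0 s rT); rewrite s0; exact: le_trans st rT'.
    - apply: Hd'; first by rewrite /= in_itv /= s0 (le_trans st).
      by rewrite subr0 ger0_norm//; exact: le_lt_trans rd.
  have v0 : v = 0.
    by move/eqP: hl0; rewrite E (sec_hl sc)// mulf_eq0 pnatr_eq0 /= sqrf_eq0 => /eqP.
  have p0 : ph z j u = 0.
    by move/eqP: vl0; rewrite E (sec_vl sc)// mulf_eq0 pnatr_eq0 /= sqrf_eq0 => /eqP.
  have u0 : 0 <= u by case: vu => //; rewrite v0 ltxx.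
  have uz : u = 0.
    move: u0; rewrite le_eqVlt => /orP[/eqP //|u0].
    have := sector_ph_pos cP Sz jk u0; rewrite p0 ltxx => H.
    by suff : false by []; apply: H; move: ue; rewrite gtr0_norm.
  by apply: (ray_reg gr t0); rewrite -yt E uz v0 (sec_vertex sc).
have bz := bP nz.
have nt : ~ Sg (g t) by rewrite tz.
have nr : ~ Sg (g' r) by rewrite rz.
have [d d0 Hd] := plaque_path bP cg lg tT nt.
have [d' d'0 Hd'] := plaque_pathG ch lh rT nr.
have [U1 nU1 H1] := inj_near hS cg ig tT d0.
have [U2 nU2 H2] := inj_near hS ch ih rT d'0.
rewrite tz in nU1 Hd; rewrite rz in nU2 Hd'.
exists (U1 `&` U2); first exact: filterI.
suff H y : (exists t r, [/\ 0 < t <= T, 0 < r <= T', y = g t & y = g' r]) -> (U1 `&` U2) y -> y = z.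
  by move=> y y' Hy Hy' Uy Uy'; rewrite (H y)// (H y').
move=> [s [s' [/andP[s0 sT] /andP[s0' sT'] ys ys']]] [Uy Uy'].
have st : 0 <= s <= T by rewrite ltW.
have st' : 0 <= s' <= T' by rewrite ltW.
have [|h1 h2 h3] := Hd s st; first by apply: H1; rewrite // -ys.
have h4 : (bi z (g' s')).1 = 0 by apply: Hd' => //; apply: H2; rewrite // -ys'.
have E : bi z (g s) = (0, 0).
  by rewrite [LHS]surjective_pairing h3; congr pair; rewrite -ys ys'.
by rewrite ys -h2 E (box_center bz).
Qed.

End FiniteMeet.

(** * Separatrices without reference to boxes *)

Section Rays.
Context {R : realType} {S : surface R} (F : foliation S) (G : measured_foliation S).
Variable Sg : set S.
Implicit Types (q x y : S) (g h : R -> S).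

(** Boxes and sectors depend on the order of the pair of foliations. This record keeps what is
    needed of the separatrices, so that those of ([F], [G]) and of ([G], [F]) can be used side by
    side. *)
Record rays (f : S -> S) (k : R) (ray : S -> (R -> S) -> Prop) : Prop := IsRays {
  rays_Sg : forall q g, ray q g -> Sg q;
  rays_0 : forall q g, ray q g -> g 0 = q;
  rays_reg : forall q g t, ray q g -> 0 < t -> ~ Sg (g t);
  rays_con : forall q g t, ray q g -> 0 <= t -> con setT g t;
  rays_inj : forall q g s t, ray q g -> 0 <= s -> 0 <= t -> g s = g t -> s = t;
  rays_leaf : forall q g t, ray q g -> 0 <= t -> leaf F q (g t);
  rays_exist : forall q, Sg q -> exists g, ray q g;
  rays_finite : finite_set [set g | exists q, ray q g];
  rays_cover : forall q y, Sg q -> leaf F q y -> exists g u, [/\ ray q g, 0 <= u & y = g u];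
  rays_separatrix : forall q L, Sg q ->
    separatrix F q L <-> exists2 g, ray q g & L = g @` [set u | 0 < u];
  rays_seg : forall q g t, ray q g -> 0 < t -> seg F q (g t) = g @` `[0, t];
  rays_map : forall q g, ray q g -> ray (f q) (fun t => f (g (t / k)));
  rays_meet : forall q g, ray q g -> exists t q', [/\ 0 < t, Sg q' & leaf G q' (g t)];
  rays_finite_meet : forall q q' g h (T T' : R), ray q g -> Sg q' -> h 0 = q' ->
    (forall r, 0 < r -> ~ Sg (h r)) -> (forall r, 0 <= r -> con setT h r) ->
    (forall s r, 0 <= s -> 0 <= r -> h s = h r -> s = r) ->
    (forall r, 0 <= r -> leaf G q' (h r)) ->
    finite_set [set y | exists t r, [/\ 0 < t <= T, 0 < r <= T', y = g t & y = h r]] }.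

Lemma exists_rays (f : S -> S) (k : R) : transverse F G -> finite_set Sg ->
  (forall x, ~ Sg x -> prongs F x = 2%N) -> continuous f -> injective f ->
  (forall x y, leaf F x y -> leaf F (f x) (f y)) -> (forall x, Sg (f x) <-> Sg x) ->
  0 < k < 1 -> (forall (a b : R) g, harc F Sg a b g ->
    mu G (f @` (g @` `[a, b])) = (k%:E * mu G (g @` `[a, b]))%E) ->
  exists ray, rays f k ray.
Proof.
move=> tr finSg regular cf jf lf Sf k01 mf.
(* Choice needs a value at every point: boxes get dummy values on [Sg], and sectors dummy values off
   it. *)
have /choice[box Hbox] : forall x, exists b : R * (R * R -> S) * (S -> R * R),
    ~ Sg x -> isbox F G Sg x b.1.1 b.1.2 b.2.
  move=> x; have [Sx|nx] := pselect (Sg x).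
    by exists (0, (fun=> x), (fun=> 0)) => /(_ Sx).
  by have [e [B [I bx]]] := exists_box tr finSg regular nx; exists (e, B, I).
have /choice[pr Hpr] : forall q, exists b : (set S) * (S -> R) * (S -> R) * (nat -> R) * R *
    (nat -> R * R -> S) * (nat -> R -> R), Sg q ->
    isprong F G Sg q b.1.1.1.1.1.1 b.1.1.1.1.1.2 b.1.1.1.1.2 (prongs F q) b.1.1.1.2 b.1.1.2 b.1.2 b.2.
  move=> q; have [Sq|nq] := pselect (Sg q); last first.
    by exists (set0, (fun=> 0), (fun=> 0), (fun=> 0), 0, (fun _ _ => q), (fun _ _ => 0)).
  have [N [hl [vl [e [A [B [ph H]]]]]]] := exists_prong tr finSg regular Sq.
  by exists (N, hl, vl, e, A, B, ph).
pose be x := (box x).1.1; pose B x := (box x).1.2; pose bi x := (box x).2.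
have bP x : ~ Sg x -> isbox F G Sg x (be x) (B x) (bi x) by exact: Hbox.
have cP q : Sg q -> isprong F G Sg q (pr q).1.1.1.1.1.1 (pr q).1.1.1.1.1.2 (pr q).1.1.1.1.2
    (prongs F q) (pr q).1.1.1.2 (pr q).1.1.2 (pr q).1.2 (pr q).2 by exact: Hpr.
have full q j : Sg q -> (j < prongs F q)%N -> exists2 g, geo Sg be B [set t | 0 < t] g &
    germ (fun q => (pr q).1.2) q j g.
  by move=> Sq jk; exact: (prong_full finSg bP cP cf jf lf Sf k01 mf Sq jk).
exists (ray Sg be B); split.
- by move=> q g [].
- by move=> q g; exact: ray0.
- by move=> q g t; exact: ray_reg.
- by move=> q g t; exact: (ray_con bP).
- by move=> q g s t; exact: (ray_inj bP).
- by move=> q g t; exact: (ray_leaf bP cP).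
- by move=> q; exact: (exists_ray cP full).
- exact: (finite_rays finSg bP cP).
- by move=> q y; exact: (leaf_rays bP cP full).
- by move=> q L; exact: (separatrixP bP cP full).
- by move=> q g t; exact: (seg_ray bP cP full).
- by move=> q g; exact: (ray_f bP cf jf lf Sf k01 mf).
- by move=> q g; exact: (ray_meets finSg bP cP full).
- by move=> q q' g h T T' gr; exact: (finite_meet bP cP T T' gr).
Qed.

End Rays.

(** * First intersection points and orbits *)

Lemma finite_min {R : realType} (A : set R) (x : R) : finite_set A -> A x ->
  exists2 m, A m & forall y, A y -> m <= y.
Proof.
move=> /finite_seqP[s ->] xs.
suff H (s' : seq R) : s' != [::] -> exists2 m, m \in s' & forall y, y \in s' -> m <= y.
  have [|m ms Hm] := H s; first by apply: contraTneq xs => ->.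
  by exists m.
elim: s' => // a s' IH _; have [->|/IH[m ms Hm]] := eqVneq s' [::].
  by exists a; rewrite ?inE// => y; rewrite inE => /eqP ->.
have [am|/ltW ma] := leP a m.
  exists a; first by rewrite inE eqxx.
  by move=> y; rewrite inE => /orP[/eqP ->//|/Hm]; exact: le_trans.
exists m; first by rewrite inE ms orbT.
by move=> y; rewrite inE => /orP[/eqP ->//|/Hm].
Qed.

Lemma exp_small {R : realType} (k c : R) : 0 < k < 1 -> 0 < c -> exists n : nat, k ^+ n < c.
Proof.
move=> /andP[k0 k1] c0; have nk : `|k| < 1 by rewrite gtr0_norm.
have /cvgrPdist_lt/(_ c c0)[N _ H] := cvg_expr nk.
exists N; have := H N (leqnn N); rewrite /= sub0r normrN ger0_norm//.
by rewrite exprn_ge0// ltW.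
Qed.

(** Moves t into the fundamental domain ]k c, c] of multiplication by k. Exponents are natural
    numbers, so t above c is multiplied, and t up to c is divided, by a least suitable power. *)
Lemma normalize {R : realType} (k t c : R) : 0 < k < 1 -> 0 < t -> 0 < c ->
  exists m : nat, k * c < k ^+ m * t <= c \/ exists t', t = k ^+ m * t' /\ k * c < t' <= c.
Proof.
move=> k01 t0 c0; have /andP[k0 k1] := k01.
have [tc|ct] := leP t c; last first.
  have ex : exists m, k ^+ m * t <= c.
    have [|m Hm] := exp_small k01 (c := c / t); first by rewrite divr_gt0.
    by exists m; rewrite -ler_pdivlMr// ltW.
  exists (ex_minn ex); left; case: ex_minnP => -[|m] Hm Hmin.
    by rewrite expr0 mul1r leNgt ct in Hm.
  rewrite Hm andbT exprS -mulrA ltr_pM2l// ltNge; apply/negP => /Hmin.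
  by rewrite ltnn.
have ex : exists m, k ^+ m * (k * c) < t.
  have [|m Hm] := exp_small k01 (c := t / (k * c)); first by rewrite divr_gt0// mulr_gt0.
  by exists m; rewrite -ltr_pdivlMr// mulr_gt0.
exists (ex_minn ex); right; case: ex_minnP => m Hm Hmin.
have km : 0 < k ^+ m by rewrite exprn_gt0.
exists (t / k ^+ m); split; first by rewrite mulrC divfK// gt_eqF.
rewrite ltr_pdivlMr// mulrC Hm /= ler_pdivrMr//.
case: m Hm Hmin km => [|m] Hm Hmin km; first by rewrite expr0 mulr1.
rewrite leNgt; apply/negP => H; have := Hmin m; rewrite ltnn => H'.
suff : false by []; apply: H'.
by rewrite mulrA -exprSr mulrC.
Qed.

Section FirstPoints.
Context {R : realType} {S : surface R} (F G : measured_foliation S).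
Variables (Sg : set S) (f fi : S -> S) (k : R) (ray ray' : S -> (R -> S) -> Prop).
Hypotheses (HF : rays F G Sg f k ray) (HG : rays G F Sg fi k ray').
Hypotheses (fK : cancel f fi) (fiK : cancel fi f) (k01 : 0 < k < 1).
Implicit Types (g h : R -> S) (q : S) (t r : R).

Definition meet g h t r := [/\ 0 < t, 0 < r & g t = h r].

(* g t = h r is a first intersection point of the separatrices g and h *)
Definition first g h t r := meet g h t r /\
  forall t' r', meet g h t' r' -> t' <= t -> r' <= r -> t' = t /\ r' = r.

Lemma finite_meeting q q' g h (T T' : R) : ray q g -> ray' q' h ->
  finite_set [set y | exists t r, [/\ 0 < t <= T, 0 < r <= T', y = g t & y = h r]].
Proof.
move=> gr hr; apply: (rays_finite_meet HF T T' gr (rays_Sg HG hr) (rays_0 HG hr)).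
- by move=> r; exact: (rays_reg HG hr).
- by move=> r; exact: (rays_con HG hr).
- by move=> s r; exact: (rays_inj HG hr).
- by move=> r; exact: (rays_leaf HG hr).
Qed.

(** It is enough to minimize the parameter on [g] among the finitely many intersections below (t,
    r), since that parameter determines the one on [h]. *)
Lemma exists_first q q' g h t r : ray q g -> ray' q' h -> meet g h t r ->
  exists t' r', first g h t' r'.
Proof.
move=> gr hr [t0 r0 E].
have finA := finite_meeting t r gr hr.
(* A left inverse of [g] on positive parameters, with value 0 off the image; it turns finitely many
   points into finitely many parameters. *)
have /choice[inv Hinv] : forall y, exists s, forall s', 0 < s' -> g s' = y -> s = s'.
  move=> y; have [[s [s0 sy]]|n] := pselect (exists s, 0 < s /\ g s = y).
    by exists s => s' s0' sy'; apply: (rays_inj HF gr (ltW s0) (ltW s0')); rewrite sy.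
  by exists 0 => s' s0' sy'; case: n; exists s'.
pose A := [set t' | 0 < t' <= t /\ exists2 r', 0 < r' <= r & g t' = h r'].
have finA' : finite_set A.
  apply: sub_finite_set (finite_image inv finA) => s [/andP[s0 st] [r' rr' sr]].
  exists (g s); last exact: Hinv.
  by exists s, r'; rewrite s0 st.
have At : A t by split; [rewrite t0 lexx|exists r; rewrite ?r0 ?lexx].
have [m [/andP[m0 mt] [r' /andP[r'0 r'r] mr]] Hm] := finite_min finA' At.
exists m, r'; split => // s s' [s0 s'0 ss'] sm s'r'.
have Es : s = m.
  apply/eqP; rewrite eq_le sm /=; apply: Hm; split; first by rewrite s0 (le_trans sm).
  by exists s' => //; rewrite s'0 (le_trans s'r').
split => //; apply: (rays_inj HG hr (ltW s'0) (ltW r'0)).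
by rewrite -mr -ss' Es.
Qed.

Lemma iter_scale (h : S -> S) g (c : R) m : (forall s, h (g s) = g (c * s)) ->
  forall s, iter m h (g s) = g (c ^+ m * s).
Proof.
move=> H; elim: m => [|m IH] s; first by rewrite expr0 mul1r.
by rewrite /= IH H mulrA exprS.
Qed.

End FirstPoints.

(** The rescaled images of g under the iterates of f are rays, and there are finitely many rays; so
    two of them coincide, and the smaller iterate can be cancelled. *)
Lemma ray_period {R : realType} {S : surface R} (F G : measured_foliation S) (Sg : set S)
    (f : S -> S) (k : R) ray q g :
  rays F G Sg f k ray -> injective f -> 0 < k -> ray q g ->
  exists2 d, (0 < d)%N & forall s, iter d f (g s) = g (k ^+ d * s).
Proof.
move=> HF jf k0 gr.
pose ph n (t : R) := iter n f (g (t / k ^+ n)).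
have phr n : ray (iter n f q) (ph n).
  elim: n => [|n IH].
    rewrite (_ : ph 0%N = g)//; apply: funext => t.
    by rewrite /ph /= expr0 divr1.
  have := rays_map HF IH; rewrite -iterS; congr ray; apply: funext => t.
  by rewrite /ph [in RHS]exprS invfM mulrA.
have ji n : injective (iter n f) by elim: n => // n IH x y /jf/IH.
have [[m [m' [mm E]]]|inj] := pselect (exists m m', (m < m')%N /\ ph m = ph m').
  exists (m' - m)%N; first by rewrite subn_gt0.
  move=> s; apply: (ji m); rewrite -iterD subnKC 1?ltnW//.
  have k' n : k ^+ n != 0 by rewrite expf_neq0// gt_eqF.
  have := f_equal (fun z => z (k ^+ m' * s)) E; rewrite /ph.
  have -> : k ^+ m' * s / k ^+ m' = s by rewrite mulrC mulKf.
  move=> <-; congr (iter _ _ (g _)).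
  by rewrite -{1}(subnKC (ltnW mm)) exprD mulrC -mulrA mulKf.
exfalso; apply: infinite_nat.
apply: (sub_finite_set (B := ph @^-1` [set g | exists q, ray q g])).
  by move=> n _; exists (iter n f q).
apply: finite_preimage (rays_finite HF) => m n _ _ E.
by case: (ltngtP m n) => // mn; case: inj; [exists m, n|exists n, m].
Qed.

(** * First intersection points up to the action of f *)

Section Orbits.
Context {R : realType} {S : surface R} (F G : measured_foliation S).
Variables (Sg : set S) (f fi : S -> S) (k : R) (ray ray' : S -> (R -> S) -> Prop).
Hypotheses (HF : rays F G Sg f k ray) (HG : rays G F Sg fi k ray').
Hypotheses (fK : cancel f fi) (fiK : cancel fi f) (k01 : 0 < k < 1).
Implicit Types (g h : R -> S) (q : S) (t r : R).

Let k0 : 0 < k. Proof. by case/andP: k01. Qed.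

Lemma common_period q q' g h : ray q g -> ray' q' h -> exists2 n, (0 < n)%N &
  (forall s, iter n f (g s) = g (k ^+ n * s)) /\ (forall s, iter n f (h s) = h (s / k ^+ n)).
Proof.
move=> gr hr.
have [d d0 Hd] := ray_period HF (can_inj fK) k0 gr.
have [d' d0' Hd'] := ray_period HG (can_inj fiK) k0 hr.
have iK n : cancel (iter n fi) (iter n f).
  by elim: n => // n IH x; rewrite (iterSr n f) iterS fiK IH.
(* [HG] is about the inverse of f, which contracts [h]; so f stretches it. *)
have Hh s : iter d' f (h s) = h (k ^- d' * s).
  have e : s = k ^+ d' * (k ^- d' * s) by rewrite mulVKf// expf_neq0// gt_eqF.
  by rewrite {1}e -Hd' iK.
(* The two separatrices may have different periods; the product serves both. *)
exists (d' * d)%N; first by rewrite muln_gt0 d0'.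
split => s.
  by rewrite iterM (iter_scale d' Hd) -exprM mulnC.
by rewrite mulnC iterM (iter_scale d Hh) mulrC exprVn -exprM mulnC.
Qed.

(** [O] will send a point to the orbit of the partition it generates. Counting the values of an
    invariant function avoids choosing representatives of orbits. *)
Variables (X : Type) (O : S -> X).
Hypothesis Of : forall z, O (f z) = O z.

Lemma finite_first q q' g h : ray q g -> ray' q' h ->
  finite_set [set O (g t) | t in [set t | exists r, first g h t r]].
Proof.
move=> gr hr.
have [[t0 [r0 [t00 r00 E0]]]|nm] := pselect (exists t r, meet g h t r); last first.
  rewrite (_ : [set t | _] = set0) ?image_set0//.
  by apply/eqP/negPn/negP => /set0P[t [r [m _]]]; apply: nm; exists t, r.
have [n n0 [ng nh]] := common_period gr hr.
set K := k ^+ n in ng nh.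
have K0 : 0 < K by rewrite exprn_gt0.
have K01 : 0 < K < 1 by rewrite K0 /= exprn_ilt1 ?ltW// -?lt0n//; case/andP: k01.
have Kn : K != 0 by rewrite gt_eqF.
have ji : injective (iter n f) by elim: (n) => // m IH x y /(can_inj fK)/IH.
have Oi m z : O (iter m f z) = O z by elim: m => // m IH; rewrite /= Of.
have up t r : meet g h t r -> meet g h (K * t) (r / K).
  by move=> [tp rp E]; split; rewrite ?mulr_gt0 ?invr_gt0// -ng E nh.
have down t r : meet g h (K * t) (r / K) -> meet g h t r.
  move=> []; rewrite pmulr_rgt0// pmulr_lgt0 ?invr_gt0// => tp rp E; split => //.
  by apply: ji; rewrite ng nh.
(* The action increases neither order relation's reversals: it is increasing in both parameters and
   permutes the intersections, so minimality is preserved. *)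
have fup t r : first g h t r -> first g h (K * t) (r / K).
  move=> [m H]; split; first exact: up.
  move=> t' r' m' tt rr.
  have [|||<- <-] := H (t' / K) (r' * K).
  - by apply: down; rewrite mulfK// mulrC divfK.
  - by rewrite ler_pdivrMr// mulrC.
  - by rewrite -ler_pdivlMr.
  by rewrite mulfK// mulrC divfK.
have fdown t r : first g h (K * t) (r / K) -> first g h t r.
  move=> [m H]; split; first exact: down.
  move=> t' r' m' tt rr; have [|||E1 E2] := H (K * t') (r' / K); first exact: up.
  - by rewrite ler_pM2l.
  - by rewrite ler_pM2r ?invr_gt0.
  by split; [apply: (mulfI Kn)|apply: (mulIf (invr_neq0 Kn))].
have fupm m t r : first g h t r -> first g h (K ^+ m * t) (r / K ^+ m).
  elim: m => [|m IH] ft; first by rewrite expr0 mul1r divr1.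
  by have := fup _ _ (IH ft); rewrite mulrA -exprS -mulrA -invfM -exprSr.
have fdownm m t r : first g h (K ^+ m * t) r -> first g h t (r * K ^+ m).
  elim: m t r => [|m IH] t r; first by rewrite expr0 mul1r mulr1.
  rewrite exprSr -mulrA => /IH H; apply: fdown.
  by move: H; rewrite mulrA mulfK.
have gm m t : O (g (K ^+ m * t)) = O (g t).
  by rewrite -(iter_scale m ng) -iterM Oi.
apply: sub_finite_set (finite_image O (finite_meeting HF HG t0 (r0 / K) gr hr)).
move=> _ [t [r ft] <-].
(* after normalizing t' by iterates of f, the intersection (K * t0, r0 / K) bounds r' *)
suff [t' [r' [ft' tt' Et]]] : exists t' r', [/\ first g h t' r', K * t0 < t' <= t0 &
    O (g t') = O (g t)].
  have [[tp rp E] H] := ft'; exists (g t') => //; exists t', r'.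
  case/andP: tt' => t1 t2; split => //; first by rewrite tp t2.
  rewrite rp /= leNgt; apply/negP => rr.
  have [E1 _] := H _ _ (up _ _ (And3 t00 r00 E0)) (ltW t1) (ltW rr).
  by rewrite E1 ltxx in t1.
have [[tp _ _] _] := ft.
have [m [H|[t' [Et H]]]] := normalize K01 tp t00.
  by exists (K ^+ m * t), (r / K ^+ m); split => //; exact: fupm.
by exists t', (r * K ^+ m); split => //; [apply: fdownm; rewrite -Et|rewrite Et gm].
Qed.

Lemma finite_all_first : finite_set [set O z | z in [set z | exists q q' g h t r,
  [/\ ray q g, ray' q' h, first g h t r & z = g t]]].
Proof.
apply: (sub_finite_set (B := \bigcup_(g in [set g | exists q, ray q g])
    \bigcup_(h in [set h | exists q, ray' q h])
      [set O (g t) | t in [set t | exists r, first g h t r]])).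
  move=> _ [z [q [q' [g [h [t [r [gr hr ft ->]]]]]]] <-].
  exists g; first by exists q.
  exists h; first by exists q'.
  by exists t => //; exists r.
apply: bigcup_finite; first exact: rays_finite HF.
move=> g [q gr]; apply: bigcup_finite; first exact: rays_finite HG.
by move=> h [q' hr]; exact: finite_first gr hr.
Qed.

Lemma exists_first_point : Sg !=set0 -> exists q q' g h t r,
  [/\ ray q g, ray' q' h & first g h t r].
Proof.
move=> [q Sq]; have [g gr] := rays_exist HF Sq.
have [t [q' [t0 Sq' l]]] := rays_meet HF gr.
have [h [u [hr u0 E]]] := rays_cover HG Sq' l.
have up : 0 < u.
  move: u0; rewrite le_eqVlt => /orP[/eqP u0|//].
  by case: (rays_reg HF gr t0); rewrite E -u0 (rays_0 HG hr).
have [t' [r' ft]] := exists_first HF HG gr hr (And3 t0 up E).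
by exists q, q', g, h, t', r'.
Qed.

End Orbits.

(** * Consequences of the pseudo-Anosov structure *)

Section PseudoAnosov.
Context {R : realType} {S : surface R} (f : S -> S) (P : pseudo_anosov f).
Notation Fs := (stab P).
Notation Fu := (unst P).
Implicit Types (x y : S).

Lemma leaf_homeo (F : foliation S) : injective f -> (forall x, f @` leaf F x = leaf F (f x)) ->
  forall x y, leaf F x y <-> leaf F (f x) (f y).
Proof.
move=> jf lf x y; rewrite -lf; split => [l|[z l /jf <- //]].
by exists y.
Qed.

Lemma leaf_homeo_inv (F : foliation S) (fi : S -> S) : cancel f fi -> cancel fi f ->
  (forall x, f @` leaf F x = leaf F (f x)) -> forall x, fi @` leaf F x = leaf F (fi x).
Proof.
move=> fK fiK lf x; apply/seteqP; split => [_ [y l <-]|y l].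
  by apply/(leaf_homeo (can_inj fK) lf); rewrite !fiK.
exists (f y); last exact: fK.
by have := (leaf_homeo (can_inj fK) lf _ _).1 l; rewrite fiK.
Qed.

(** The marked points of the torus case are invariant by definition. Otherwise invariance rests on
    [prongs_homeo], applied to f and to its inverse. *)
Lemma Sing_invariant (fi : S -> S) : continuous f -> continuous fi -> cancel f fi ->
  cancel fi f -> forall x, Sing P (f x) <-> Sing P x.
Proof.
move=> cf cfi fK fiK x.
have [E|/eqP/set0P ne] := pselect (singular Fs `|` singular Fu = set0).
  have [_ _ im _] := pa_Sing_marked E; split => [|Sx]; last by rewrite -im; exists x.
  by rewrite -{1}im => -[y Sy /(can_inj fK) <-].
rewrite (pa_Sing ne).
have key (F : foliation S) : (forall x, f @` leaf F x = leaf F (f x)) ->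
    singular F (f x) <-> singular F x.
  move=> lf; split => H E; apply: H; last exact: (prongs_homeo cf cfi fK fiK lf).
  apply: (prongs_homeo cfi cf fiK fK (leaf_homeo_inv fK fiK lf)).
  by rewrite fK.
split => -[] H; [left|right|left|right]; exact/(key _ (@pa_stab_invariant _ _ _ P))
  || exact/(key _ (@pa_unst_invariant _ _ _ P)).
Qed.

Lemma finite_Sing : finite_set (Sing P).
Proof.
have [E|/eqP/set0P ne] := pselect (singular Fs `|` singular Fu = set0).
  by have [] := pa_Sing_marked E.
rewrite (pa_Sing ne) finite_setU; split; first exact: finite_singular (pa_transverse P).
exact: finite_singular (transverse_sym (pa_transverse P)).
Qed.

Lemma Sing_neq0 : Sing P !=set0.
Proof.
have [E|/eqP/set0P ne] := pselect (singular Fs `|` singular Fu = set0).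
  by have [] := pa_Sing_marked E.
by rewrite (pa_Sing ne).
Qed.

Lemma regular_prongs x : ~ Sing P x -> prongs Fs x = 2%N /\ prongs Fu x = 2%N.
Proof.
move=> nx; have nS : ~ (singular Fs `|` singular Fu) x.
  by move=> H; apply: nx; rewrite pa_Sing//; exists x.
by split; apply: contrapT => H; apply: nS; [left|right].
Qed.

Lemma harc_transverse_set (F : foliation S) (G : measured_foliation S) (Sg : set S) a b g :
  transverse F G -> (forall x, ~ Sg x -> prongs F x = 2%N) -> harc F Sg a b g ->
  transverse_set G (g @` `[a, b]).
Proof.
move=> tr reg hg; have [ab _ _ _ _] := hg.
exists (g \o (fun r => a + (b - a) * r)), (uitv R); split => //.
- exact: (harc_transverse tr reg (harc_affine hg)).
- exact: measurable_itv.
- have := @image_affine _ _ g a b 0 1 ab ler01.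
  by rewrite mulr0 addr0 mulr1 addrC subrK.
Qed.

Lemma harc_map (F : foliation S) (Sg : set S) (h : S -> S) a b g : continuous h -> injective h ->
  (forall x y, leaf F x y -> leaf F (h x) (h y)) -> (forall x, Sg (h x) -> Sg x) ->
  harc F Sg a b g -> harc F Sg a b (h \o g).
Proof.
move=> ch jh lh Sh [ab cg ig lg rg]; split => //.
- by move=> t tab; apply: con_comp; [exact: cg|exact: ch].
- by move=> s t sab tab /jh; exact: ig.
- by move=> t tab; apply: lh; exact: lg.
- by move=> t tab /Sh; exact: rg.
Qed.

End PseudoAnosov.

Theorem corollary5 (R : realType) (S : surface R) (f : S -> S)
    (P : pseudo_anosov f) (n : nat) (hn : (compat_order P <= n)%N) :
  finite_set [set partition_orbit f Q | Q in primitive_partitions P n] /\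
  [set partition_orbit f Q | Q in primitive_partitions P n] !=set0.
Proof.
have [fi [cf cfi fK fiK]] := pa_homeo P.
have [jf jfi] := (can_inj fK, can_inj fiK).
have Sf := Sing_invariant P cf cfi fK fiK.
have Sfi x : Sing P (fi x) <-> Sing P x by rewrite -{2}(fiK x); exact: iff_sym (Sf _).
have ls := leaf_homeo jf (@pa_stab_invariant _ _ _ P).
have lu := leaf_homeo jf (@pa_unst_invariant _ _ _ P).
have lui x y : leaf (unst P) x y -> leaf (unst P) (fi x) (fi y).
  by move=> l; apply/lu; rewrite !fiK.
have l1 := pa_dilatation P; set l := dilatation P in l1.
have l0 : 0 < l by exact: lt_trans l1.
(* The common contraction factor, of f on stable arcs and of its inverse on unstable arcs. *)
have k01 : 0 < l^-1 < 1 by rewrite invr_gt0 l0 invf_lt1.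
have tr := pa_transverse P.
have regs x : ~ Sing P x -> prongs (stab P) x = 2%N by case/regular_prongs.
have regu x : ~ Sing P x -> prongs (unst P) x = 2%N by case/regular_prongs.
have [ray HF] : exists ray, rays (stab P) (unst P) (Sing P) f l^-1 ray.
  apply: (exists_rays tr (finite_Sing P) regs cf jf (fun x y => (ls x y).1) Sf k01).
  by move=> a b g hg; apply: pa_unst_scaling; exact: harc_transverse_set tr regs hg.
have [ray' HG] : exists ray', rays (unst P) (stab P) (Sing P) fi l^-1 ray'.
  apply: (exists_rays (transverse_sym tr) (finite_Sing P) regu cfi jfi lui Sfi k01).
  move=> a b g hg.
  have hg' : harc (unst P) (Sing P) a b (fi \o g).
    by apply: harc_map hg => // x /Sfi.
  (* The scaling property concerns images under f, so it is applied to the arc moved back by [fi],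
     which f brings to [g]. *)
  have := pa_stab_scaling (harc_transverse_set (transverse_sym tr) regu hg').
  have -> : f @` ((fi \o g) @` `[a, b]) = g @` `[a, b].
    rewrite image_comp; apply/seteqP; split => _ [y yab <-]; exists y => //=; by rewrite ?fiK.
  by move=> ->; rewrite image_comp muleA -EFinM mulVf ?mul1e// gt_eqF.
(* By [rays_seg] the arc ]p, z] of a separatrix is the image of ]0, t]; the condition on the two
   arcs then says that (t, r) is the only meeting pair with parameters at most t and r. *)
have firstP z : first_intersection P z <-> exists q q' g h t r,
    [/\ ray q g, ray' q' h, first g h t r & z = g t].
  split.
    move=> [nz [p [q [L [M [[Sp Sq] sL sM [Lz Mz] E]]]]]].
    have [g gr LE] := (rays_separatrix HF L Sp).1 sL.
    have [h hr ME] := (rays_separatrix HG M Sq).1 sM.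
    move: Lz Mz; rewrite LE ME => -[t /= t0 zt] [r /= r0 zr].
    exists p, q, g, h, t, r; split => //; split; first by split => //; rewrite zt.
    move=> t' r' [t0' r0' E'] tt rr.
    have : [set z] (g t').
      rewrite -E -{1}zt -zr (rays_seg HF gr t0) (rays_seg HG hr r0); split; split.
      - by exists t' => //; rewrite /= in_itv /= ltW.
      - by move=> /= Ep; apply: (rays_reg HF gr t0'); rewrite Ep.
      - by exists r' => //; rewrite /= in_itv /= ltW.
      - by move=> /= Eq; apply: (rays_reg HF gr t0'); rewrite Eq.
    move=> /= Ez; split.
      by apply: (rays_inj HF gr (ltW t0') (ltW t0)); rewrite Ez.
    by apply: (rays_inj HG hr (ltW r0') (ltW r0)); rewrite -E' Ez.
  move=> [q [q' [g [h [t [r [gr hr [[t0 r0 E] H] ->]]]]]]].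
  have Sq := rays_Sg HF gr; have Sq' := rays_Sg HG hr.
  split; first exact: (rays_reg HF gr t0).
  exists q, q', (g @` [set u | 0 < u]), (h @` [set u | 0 < u]); split => //.
  - by apply/(rays_separatrix HF _ Sq); exists g.
  - by apply/(rays_separatrix HG _ Sq'); exists h.
  - by split; [exists t|exists r].
  rewrite {2}E (rays_seg HF gr t0) (rays_seg HG hr r0); apply/seteqP; split => [y|y ->].
    move=> [[[t' /= + <-] np] [[r' /= + E'] nq]]; rewrite !in_itv /= => /andP[t1 t2] /andP[r1 r2].
    have t0' : 0 < t'.
      rewrite lt_neqAle t1 andbT; apply/eqP => tz; apply: np.
      by rewrite /= -tz (rays_0 HF gr).
    have r0' : 0 < r'.
      rewrite lt_neqAle r1 andbT; apply/eqP => rz; apply: nq.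
      by rewrite /= -E' -rz (rays_0 HG hr).
    by have [-> _] := H t' r' (And3 t0' r0' (esym E')) t2 r2.
  split; split.
  - by exists t => //; rewrite /= in_itv /= lexx ltW.
  - by move=> /= Ep; apply: (rays_reg HF gr t0); rewrite Ep.
  - by exists r => //; rewrite /= in_itv /= lexx ltW.
  - by move=> /= Eq; apply: (rays_reg HF gr t0); rewrite Eq.
have sy : symmetry P f fi by split => // x; exact: iff_sym (Sf x).
pose O z := partition_orbit f (primitive_partition P z n).
have Of z : O (f z) = O z by rewrite /O (partition_sym n z sy) (orbit_succ _ fK fiK).
have OE : [set partition_orbit f Q | Q in primitive_partitions P n] =
    [set O z | z in [set z | exists q q' g h t r,
      [/\ ray q g, ray' q' h, first g h t r & z = g t]]].
  apply/seteqP; split => [_ [_ [z /firstP Hz <-] <-]|_ [z /firstP Hz <-]]; first by exists z.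
  by exists (primitive_partition P z n) => //; exists z.
rewrite OE; split; first exact: (finite_all_first HF HG fK fiK k01 Of).
have [q [q' [g [h [t [r [gr hr ft]]]]]]] := exists_first_point HF HG (Sing_neq0 P).
by exists (O (g t)), (g t) => //; exists q, q', g, h, t, r.
Qed.
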